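(* For $p=7$ and the O'Nan group $O'N$ there is an isomorphism, with $C'=C-a^3/V$, $$H^*(BO'N)\cong DA\{1,a,a^2,b,ab,a^2b\}\oplus CA\{d,ad,a^2d,C',C'a,C'a^2\},$$ where $a=(y_1^2+y_2^2)v^2$, $b=y_1^2y_2^2v^4$, $d=(y_1y_2^3-y_1^3y_2)v$ (so $a^3/V=(y_1^2+y_2^2)^3$).
   Context: Throughout $p=7$, and $BG$ is the $7$-completed classifying space. $E=7_+^{1+2}=\langle e_1,e_2,c\mid e_1^7=e_2^7=c^7=1,[e_1,e_2]=c,\ c\text{ central}\rangle$ is the Sylow $7$-subgroup. Notation: $H^*(X)=H^*(X;\mathbb Z)/(p,\sqrt0)$, where $\sqrt0$ is the ideal of nilpotent elements. It is known that $$H^*(BE)\cong\bigl(\mathbb Z/p[y_1,y_2]/(y_1^py_2-y_1y_2^p)\oplus\mathbb Z/p\{C\}\bigr)\otimes\mathbb Z/p[v],$$ $|y_i|=2$, $|C|=2p-2$, $|v|=2p$, $Cy_i=y_i^p$, $C^2=y_1^{2p-2}+y_2^{2p-2}-y_1^{p-1}y_2^{p-1}$. Put $V=v^{p-1}$, $CA=\mathbb Z/p[C,V]$, $D_1=C^p+V$, $D_2=CV$, $DA=\mathbb Z/p[D_1,D_2]\subset CA$. $R\{x_1,\dots\}$ denotes the free $R$-module on the listed elements; $x/V$ is the unique element $z$ with $Vz=x$. $\mathrm{Out}(E)\cong GL_2(\mathbb F_7)$, where $g=\begin{pmatrix}\alpha&\beta\\\gamma&\delta\end{pmatrix}$ acts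 by $e_1\mapsto e_1^\alpha e_2^\gamma$, $e_2\mapsto e_1^\beta e_2^\delta$, and $g^*y_1=\alpha y_1+\beta y_2$, $g^*y_2=\gamma y_1+\delta y_2$, $g^*v=\det(g)v$, $g^*C=C$. The subgroups isomorphic to $(\mathbb Z/7)^2$ up to $E$-conjugacy are $A_i=\langle c,e_1e_2^i\rangle$ ($i\in\mathbb F_7$) and $A_\infty=\langle c,e_2\rangle$. $H^*(BG)$ is regarded as a subring of $H^*(BE)$ by restriction. For $G=O'N$ (sporadic simple group): $W_G(E)=N_G(E)/E\,C_G(E)=3D_8$, generated by $\mathrm{diag}(-1,1)$, $\mathrm{diag}(2,2)$, $\begin{pmatrix}0&1\\-1&0\end{pmatrix}$. The $F^{\mathrm{ec}}$-radical subgroups (those $A\cong(\mathbb Z/7)^2$ with $W_G(A)=N_G(A)/C_G(A)\supset SL_2(\mathbb F_7)$) form the two classes $\{A_0,A_\infty\}$ and $\{A_1,A_6\}$, with $W_G(A)=SL_2(\mathbb F_7):2$, the group of matrices of determinant $\pm1$; $\{A_2,A_3,A_4,A_5\}$ is a non-radical class. *)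

(* Defs.v *)
From HB Require Import structures.
From mathcomp Require Import all_boot all_order all_algebra all_fingroup.
From mathcomp Require Import all_solvable.
From mathcomp Require Import boolp generic_quotient ring.
From mathcomp Require mpoly.

Set Implicit Arguments.
Unset Strict Implicit.
Unset Printing Implicit Defensive.

Import GRing.Theory.
Local Open Scope ring_scope.
Local Open Scope quotient_scope.

Inductive ideal_gen (R : pzRingType) (S : R -> Prop) : R -> Prop :=
| IdealGen x of S x : ideal_gen S x
| Ideal0 : ideal_gen S 0
| IdealD x y of ideal_gen S x & ideal_gen S y : ideal_gen S (x + y)
| IdealMl a x of ideal_gen S x : ideal_gen S (a * x)
| IdealMr a x of ideal_gen S x : ideal_gen S (x * a).

Section QuotRing.
Variables (R : pzRingType) (S : R -> Prop).
Local Notation I := (ideal_gen S).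

Definition ideal_equiv (x y : R) : bool := `[< I (x - y) >].

Lemma ideal_genN x : I x -> I (- x).
Proof. by move=> Ix; rewrite -mulN1r; apply: IdealMl. Qed.

Lemma ideal_equiv_is_equiv : equiv_class_of ideal_equiv.
Proof.
split=> [x|x y|y x z].
- by apply/asboolP; rewrite subrr; apply: Ideal0.
- by apply/asboolP/asboolP=> /ideal_genN; rewrite opprB.
- move=> /asboolP Ixy /asboolP Iyz; apply/asboolP.
  by rewrite -[x](addrNK y) -addrA; apply: IdealD.
Qed.

Canonical ideal_equiv_equiv := EquivRelPack ideal_equiv_is_equiv.
Canonical ideal_equiv_encModRel := defaultEncModRel ideal_equiv.

Definition quotring := {eq_quot ideal_equiv}.

HB.instance Definition _ : EqQuotient R ideal_equiv quotring :=
  EqQuotient.on quotring.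
HB.instance Definition _ := Choice.on quotring.

Definition qclass (x : R) : quotring := \pi x.

Lemma qclassP x y : qclass x = qclass y <-> I (x - y).
Proof.
split=> [/eqP|Ixy]; first by rewrite /qclass piE => /asboolP.
by apply/eqP; rewrite /qclass piE; apply/asboolP.
Qed.

Lemma qclassK (z : quotring) : qclass (repr z) = z.
Proof. exact: reprK. Qed.

Lemma repr_qclass x : I (repr (qclass x) - x).
Proof. by apply/qclassP; rewrite qclassK. Qed.

Definition qopp (z : quotring) := qclass (- repr z).
Definition qadd (z w : quotring) := qclass (repr z + repr w).
Definition qmul (z w : quotring) := qclass (repr z * repr w).

Lemma qoppE x : qopp (qclass x) = qclass (- x).
Proof. by apply/qclassP; rewrite -opprD; apply/ideal_genN/repr_qclass. Qed.

Lemma qaddE x y : qadd (qclass x) (qclass y) = qclass (x + y).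
Proof.
by apply/qclassP; rewrite opprD addrACA; apply: IdealD; apply: repr_qclass.
Qed.

Lemma qmulE x y : qmul (qclass x) (qclass y) = qclass (x * y).
Proof.
apply/qclassP; set x' := repr _; set y' := repr _.
have -> : x' * y' - x * y = (x' - x) * y' + x * (y' - y).
  by rewrite mulrBl mulrBr addrA subrK.
by apply: IdealD; [apply: IdealMr|apply: IdealMl]; apply: repr_qclass.
Qed.

Fact qaddA : associative qadd.
Proof.
by move=> x y z; rewrite -[x]qclassK -[y]qclassK -[z]qclassK !qaddE addrA.
Qed.
Fact qaddC : commutative qadd.
Proof. by move=> x y; rewrite -[x]qclassK -[y]qclassK !qaddE addrC. Qed.
Fact qadd0 : left_id (qclass 0) qadd.
Proof. by move=> x; rewrite -[x]qclassK qaddE add0r. Qed.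
Fact qaddN : left_inverse (qclass 0) qopp qadd.
Proof. by move=> x; rewrite -[x]qclassK qoppE qaddE addNr. Qed.

HB.instance Definition _ :=
  GRing.isZmodule.Build quotring qaddA qaddC qadd0 qaddN.

Fact qmulA : associative qmul.
Proof.
by move=> x y z; rewrite -[x]qclassK -[y]qclassK -[z]qclassK !qmulE mulrA.
Qed.
Fact qmul1l : left_id (qclass 1) qmul.
Proof. by move=> x; rewrite -[x]qclassK qmulE mul1r. Qed.
Fact qmul1r : right_id (qclass 1) qmul.
Proof. by move=> x; rewrite -[x]qclassK qmulE mulr1. Qed.
Fact qmulDl : left_distributive qmul +%R.
Proof.
move=> x y z; rewrite -[x]qclassK -[y]qclassK -[z]qclassK.
by rewrite [X in qmul X _]qaddE !qmulE mulrDl [RHS]qaddE.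
Qed.
Fact qmulDr : right_distributive qmul +%R.
Proof.
move=> x y z; rewrite -[x]qclassK -[y]qclassK -[z]qclassK.
by rewrite [X in qmul _ X]qaddE !qmulE mulrDr [RHS]qaddE.
Qed.

HB.instance Definition _ := GRing.Zmodule_isPzRing.Build quotring
  qmulA qmul1l qmul1r qmulDl qmulDr.

Fact qclass_is_zmod_morphism : zmod_morphism qclass.
Proof. by move=> x y; rewrite -qaddE -qoppE. Qed.
HB.instance Definition _ :=
  GRing.isZmodMorphism.Build R quotring qclass qclass_is_zmod_morphism.
Fact qclass_is_monoid_morphism : monoid_morphism qclass.
Proof. by split=> // x y; rewrite -qmulE. Qed.
HB.instance Definition _ :=
  GRing.isMonoidMorphism.Build R quotring qclass qclass_is_monoid_morphism.

End QuotRing.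

Section QuotMap.
Variables (R R' : pzRingType) (S : R -> Prop) (S' : R' -> Prop) (f : R -> R').

Definition quot_map (z : quotring S) : quotring S' := qclass S' (f (repr z)).

Lemma quot_mapE :
    zmod_morphism f -> monoid_morphism f ->
    (forall x, S x -> ideal_gen S' (f x)) ->
  forall x, quot_map (qclass S x) = qclass S' (f x).
Proof.
move=> fB [_ fM] fS x; apply/qclassP; rewrite -fB.
have f0 : f 0 = 0 by have := fB 0 0; rewrite !subrr.
have fD u w : f (u + w) = f u + f w.
  have fN t : f (- t) = - f t by rewrite -[- t]sub0r fB f0 sub0r.
  by rewrite -[w in LHS]opprK fB fN opprK.
elim: (repr_qclass S x) => {x} [x /fS //||x y _ Ix _ Iy|a x _ Ix|a x _ Ix].
- by rewrite f0; apply: Ideal0.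
- by rewrite fD; apply: IdealD.
- by rewrite fM; apply: IdealMl.
- by rewrite fM; apply: IdealMr.
Qed.

Lemma quot_map_zmod_morphism :
    zmod_morphism f -> monoid_morphism f ->
    (forall x, S x -> ideal_gen S' (f x)) ->
  zmod_morphism quot_map.
Proof.
move=> fB fM fS x y; rewrite -[x]qclassK -[y]qclassK -rmorphB.
by rewrite !quot_mapE // fB rmorphB.
Qed.

Lemma quot_map_monoid_morphism :
    zmod_morphism f -> monoid_morphism f ->
    (forall x, S x -> ideal_gen S' (f x)) ->
  monoid_morphism quot_map.
Proof.
move=> fB fM fS; split=> [|x y].
  by rewrite -(rmorph1 (qclass S)) quot_mapE // fM.1 rmorph1.
rewrite -[x]qclassK -[y]qclassK -rmorphM !quot_mapE //.
by rewrite fM.2 rmorphM.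
Qed.

End QuotMap.
Arguments quot_map {R R' S S'} f z.

(* Inhomogeneous integral cochains of all degrees at once: f takes a sequence
   of n group elements to the value of the degree-n component of f.  Only the
   values at sequences of elements of D are meaningful; cochains that agree
   there differ by coboundary 0, so they have the same class. *)

Section Cochains.
Variable gT : finGroupType.
Implicit Types (f g h : seq gT -> int) (s t : seq gT) (D : {set gT}).

Definition bounded_degree f := exists N, forall s, (N < size s)%N -> f s = 0.

Definition bar_merge (i : nat) s : seq gT :=
  take i s ++ (nth 1%g s i * nth 1%g s i.+1)%g :: drop i.+2 s.

Definition cobdry f s : int :=
  if s is _ :: t then
    f t + \sum_(i < size t) (-1) ^+ i.+1 * f (bar_merge i s)
        + (-1) ^+ size s * f (take (size t) s)
  else 0.

Definition cup f g s : int :=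
  \sum_(i < (size s).+1) f (take i s) * g (drop i s).

Definition cup1 s : int := (s == [::])%:R.

Definition is_cocycle D f :=
  bounded_degree f /\ forall s, all (mem D) s -> cobdry f s = 0.

Lemma cup_nil f g : cup f g [::] = f [::] * g [::].
Proof. by rewrite /cup big_ord1. Qed.

Lemma cup_cons f g x s :
  cup f g (x :: s) = f [::] * g (x :: s) + cup (fun t => f (x :: t)) g s.
Proof. by rewrite /cup big_ord_recl. Qed.

Lemma eq_cup f f' g g' s : f =1 f' -> g =1 g' -> cup f g s = cup f' g' s.
Proof. by move=> ff gg; apply: eq_bigr => i _; rewrite ff gg. Qed.

Lemma cupDl f f' g s : cup (fun t => f t + f' t) g s = cup f g s + cup f' g s.
Proof. by rewrite /cup -big_split; apply: eq_bigr => i _; rewrite mulrDl. Qed.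
Lemma cupDr f g g' s : cup f (fun t => g t + g' t) s = cup f g s + cup f g' s.
Proof. by rewrite /cup -big_split; apply: eq_bigr => i _; rewrite mulrDr. Qed.
Lemma cupNl f g s : cup (fun t => - f t) g s = - cup f g s.
Proof. by rewrite /cup -sumrN; apply: eq_bigr => i _; rewrite mulNr. Qed.
Lemma cupZl (a : int) f g s : cup (fun t => a * f t) g s = a * cup f g s.
Proof. by rewrite /cup mulr_sumr; apply: eq_bigr => i _; rewrite mulrA. Qed.
Lemma cup0l g s : cup (fun _ => 0) g s = 0.
Proof. by rewrite /cup big1 // => i _; rewrite mul0r. Qed.

Lemma cupA f g h s : cup f (cup g h) s = cup (cup f g) h s.
Proof.
elim: s f => [|x s IHs] f; first by rewrite !cup_nil mulrA.
rewrite !cup_cons IHs cup_nil mulrDr mulrA -addrA; congr (_ + _).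
by rewrite -cupZl -cupDl; apply: eq_cup => // t; rewrite cup_cons.
Qed.

Lemma cup1l f s : cup cup1 f s = f s.
Proof.
by case: s => [|x s]; rewrite ?cup_nil ?cup_cons mul1r // cup0l addr0.
Qed.

Lemma cup1r f s : cup f cup1 s = f s.
Proof.
elim: s f => [|x s IHs] f; first by rewrite cup_nil mulr1.
by rewrite cup_cons mulr0 add0r IHs.
Qed.

Lemma cobdry_nil f : cobdry f [::] = 0.
Proof. by []. Qed.

Lemma cobdry1 f x : cobdry f [:: x] = 0.
Proof. by rewrite /cobdry big_ord0 /= addr0 expr1 mulN1r subrr. Qed.

Lemma cobdry_cons2 f x y s :
  cobdry f (x :: y :: s) = f (y :: s) - f ((x * y)%g :: s) + f (x :: s)
                           - cobdry (fun t => f (x :: t)) (y :: s).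
Proof.
rewrite /cobdry big_ord_recl /= /bar_merge /= drop0.

under eq_bigr => i _ do rewrite /bump add1n /= exprS mulN1r mulNr.
rewrite sumrN !exprS; ring.
Qed.

Lemma eq_cobdry f g : f =1 g -> cobdry f =1 cobdry g.
Proof.
move=> fg [|x s] //=; rewrite !fg; congr (_ + _ + _).
by apply: eq_bigr => i _; rewrite fg.
Qed.

Lemma cobdryD f g s : cobdry (fun t => f t + g t) s = cobdry f s + cobdry g s.
Proof.
case: s => [|x s] /=; first by rewrite addr0.
under eq_bigr => i _ do rewrite mulrDr.
by rewrite big_split /=; ring.
Qed.

Lemma cobdryZ (a : int) f s : cobdry (fun t => a * f t) s = a * cobdry f s.
Proof.
case: s => [|x s] /=; first by rewrite mulr0.
under eq_bigr => i _ do rewrite mulrCA.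
by rewrite -mulr_sumr; ring.
Qed.

Lemma cobdryN f s : cobdry (fun t => - f t) s = - cobdry f s.
Proof.
rewrite -mulN1r -cobdryZ; apply: eq_cobdry => t; exact/esym/mulN1r.
Qed.

Lemma cobdry_cup1 s : cobdry cup1 s = 0.
Proof.
have cup1_cons u t : cup1 (u :: t) = 0 by [].
case: s => [|x [|y s]] //; first exact: cobdry1.
rewrite cobdry_cons2 !cup1_cons (eq_cobdry (g := fun t => 0 * cup1 t)).
  by rewrite cobdryZ; ring.
by move=> t; rewrite mul0r.
Qed.

Lemma cobdry_cup f g s :
  cobdry (cup f g) s =
  cup (cobdry f) g s + cup (fun t => (-1) ^+ size t * f t) (cobdry g) s.
Proof.
elim: s f => [|x s IHs] f; first by rewrite !cup_nil /= mul0r mulr0 addr0.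
case: s IHs => [|y s] IHs.
  by rewrite !cobdry1 !cup_cons !cup_nil !cobdry1 /= !(mul0r, mulr0) !addr0.
set fx := fun t => f (x :: t).
have -> : cup (cobdry f) g [:: x, y & s] =
    cup (fun t => f (y :: t)) g s - cup (fun t => f ((x * y)%g :: t)) g s
    + cup fx g s - cup (cobdry fx) g (y :: s).
  rewrite !cup_cons cobdry1 !cobdry_nil !mul0r !add0r.
  rewrite (eq_cup (g' := g) _ (fun t => cobdry_cons2 f x y t)) //.
  by rewrite 3!cupDl 2!cupNl.
have -> : cup (fun t => (-1) ^+ size t * f t) (cobdry g) [:: x, y & s] =
    f [::] * cobdry g [:: x, y & s]
    - cup (fun t => (-1) ^+ size t * fx t) (cobdry g) (y :: s).
  rewrite cup_cons expr0 mul1r -cupNl; congr (_ + _).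
  by apply: eq_cup => // t /=; rewrite exprS mulN1r mulNr.
rewrite cobdry_cons2 (eq_cobdry (g := fun t =>
  f [::] * g (x :: t) + cup fx g t)); last by move=> t; rewrite cup_cons.
rewrite cobdryD cobdryZ IHs !(cup_cons f) cobdry_cons2 -/fx; ring.
Qed.

Lemma eq_cup_in D f f' g g' s : all (mem D) s ->
    (forall t, all (mem D) t -> f t = f' t) ->
    (forall t, all (mem D) t -> g t = g' t) ->
  cup f g s = cup f' g' s.
Proof.
move=> sD ff gg; apply: eq_bigr => i _.
move: sD; rewrite -{1}(cat_take_drop i s) all_cat => /andP[tD dD].
by rewrite ff ?gg.
Qed.

Fact is_cocycle_cup D f g :
  is_cocycle D f -> is_cocycle D g -> is_cocycle D (cup f g).
Proof.
move=> [[N fN] fZ] [[M gM] gZ]; split=> [|s sD].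
  exists (N + M)%N => s ltNM; rewrite /cup big1 // => i _.
  have [ltNi|leiN] := ltnP N i.
    by rewrite fN ?mul0r // size_takel // -ltnS.
  rewrite gM ?mulr0 // size_drop ltn_subRL.
  by apply: leq_ltn_trans ltNM; rewrite leq_add2r.
rewrite cobdry_cup (eq_cup_in (D := D) (f' := fun _ => 0) (g' := g)) //.
rewrite cup0l add0r.
rewrite (eq_cup_in (D := D) (f' := fun t => (-1) ^+ size t * f t)
  (g' := fun=> 0)) //.
by rewrite /cup big1 // => i _; rewrite mulr0.
Qed.

Fact is_cocycle_cup1 D : is_cocycle D cup1.
Proof.
by split=> [|s _]; [exists 0%N; case | apply: cobdry_cup1].
Qed.

Fact is_cocycle0 D : is_cocycle D (fun _ => 0).
Proof.
split=> [|s _]; first by exists 0%N.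
rewrite (eq_cobdry (g := fun t => 0 * cup1 t)) ?cobdryZ ?mul0r // => t.
by rewrite mul0r.
Qed.

Fact is_cocycleD D f g :
  is_cocycle D f -> is_cocycle D g -> is_cocycle D (fun t => f t + g t).
Proof.
move=> [[N fN] fZ] [[M gM] gZ]; split=> [|s sD]; last first.
  by rewrite cobdryD fZ ?gZ ?addr0.
exists (maxn N M) => s; rewrite gtn_max => /andP[Ns Ms].
by rewrite fN ?gM ?addr0.
Qed.

Fact is_cocycleN D f : is_cocycle D f -> is_cocycle D (fun t => - f t).
Proof.
move=> [[N fN] fZ]; split=> [|s sD]; last by rewrite cobdryN fZ ?oppr0.
by exists N => s Ns; rewrite fN ?oppr0.
Qed.

End Cochains.

Section CocycleRing.
Variables (gT : finGroupType) (D : {set gT}).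

Record cocycle := Cocycle {
  cochain_of :> seq gT -> int;
  cocycleP : is_cocycle D cochain_of
}.

Lemma cocycle_eqP (f g : cocycle) : f =1 g -> f = g.
Proof.
case: f g => [f fP] [g gP] /= /funext fg; subst g.
by congr Cocycle; apply: Prop_irrelevance.
Qed.

HB.instance Definition _ := gen_eqMixin cocycle.
HB.instance Definition _ := gen_choiceMixin cocycle.

Definition cocycle0 := Cocycle (is_cocycle0 D).
Definition cocycleN (f : cocycle) := Cocycle (is_cocycleN (cocycleP f)).
Definition cocycleD (f g : cocycle) :=
  Cocycle (is_cocycleD (cocycleP f) (cocycleP g)).

Fact cocycleDA : associative cocycleD.
Proof. by move=> f g h; apply: cocycle_eqP => s /=; rewrite addrA. Qed.
Fact cocycleDC : commutative cocycleD.
Proof. by move=> f g; apply: cocycle_eqP => s /=; rewrite addrC. Qed.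
Fact cocycle0D : left_id cocycle0 cocycleD.
Proof. by move=> f; apply: cocycle_eqP => s /=; rewrite add0r. Qed.
Fact cocycleND : left_inverse cocycle0 cocycleN cocycleD.
Proof. by move=> f; apply: cocycle_eqP => s /=; rewrite addNr. Qed.

HB.instance Definition _ :=
  GRing.isZmodule.Build cocycle cocycleDA cocycleDC cocycle0D cocycleND.

Definition cocycle1 := Cocycle (is_cocycle_cup1 D).
Definition cocycleM (f g : cocycle) :=
  Cocycle (is_cocycle_cup (cocycleP f) (cocycleP g)).

Fact cocycleMA : associative cocycleM.
Proof. by move=> f g h; apply: cocycle_eqP => s /=; rewrite cupA. Qed.
Fact cocycle1M : left_id cocycle1 cocycleM.
Proof. by move=> f; apply: cocycle_eqP => s /=; rewrite cup1l. Qed.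
Fact cocycleM1 : right_id cocycle1 cocycleM.
Proof. by move=> f; apply: cocycle_eqP => s /=; rewrite cup1r. Qed.
Fact cocycleMDl : left_distributive cocycleM +%R.
Proof. by move=> f g h; apply: cocycle_eqP => s /=; rewrite cupDl. Qed.
Fact cocycleMDr : right_distributive cocycleM +%R.
Proof. by move=> f g h; apply: cocycle_eqP => s /=; rewrite cupDr. Qed.

HB.instance Definition _ := GRing.Zmodule_isPzRing.Build cocycle
  cocycleMA cocycle1M cocycleM1 cocycleMDl cocycleMDr.

Definition coboundary (f : cocycle) :=
  exists h : seq gT -> int,
    bounded_degree h /\ forall s, all (mem D) s -> f s = cobdry h s.

(* H^*(D; Z).  Coboundaries already form an ideal of the cocycle ring. *)
Definition cohom := quotring coboundary.

HB.instance Definition _ := GRing.PzRing.on cohom.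

Definition p_or_nilpotent (p : nat) (x : cohom) :=
  x = p%:R \/ exists n, x ^+ n = 0.

(* H^*(D; Z) / (p, sqrt 0).  It only sees the p-primary part of H^*(D; Z), so it
   is the same for BD and for its p-completion. *)
Definition redcohom (p : nat) := quotring (p_or_nilpotent p).

HB.instance Definition _ p := GRing.PzRing.on (redcohom p).

Definition redclass p (f : cocycle) : redcohom p :=
  qclass _ (qclass coboundary f).

Definition is_homog p n (x : redcohom p) :=
  exists2 f : cocycle, (forall s, size s != n -> f s = 0) & x = redclass p f.

End CocycleRing.

Section Pullback.
Variables (gT hT : finGroupType) (D : {set gT}) (D' : {set hT}).
Variable phi : hT -> gT.
Hypothesis phiM : {in D' &, {morph phi : x y / (x * y)%g}}.
Hypothesis phiD : {in D', forall x, phi x \in D}.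

Lemma cobdry_map (f : seq gT -> int) s : all (mem D') s ->
  cobdry (fun t => f (map phi t)) s = cobdry f (map phi s).
Proof.
elim: s f => [|x [|y s] IHs] f //; first by rewrite [map _ _]/= !cobdry1.
move=> /andP[xD ysD]; have /andP[yD _] := ysD.
rewrite cobdry_cons2 [RHS]cobdry_cons2 [map _ (_ :: s)]/=.
rewrite [map phi ((x * y)%g :: s)]/= phiM //; congr (_ - _).
exact: (IHs (fun t => f (phi x :: t))).
Qed.

Lemma all_map_in s : all (mem D') s -> all (mem D) (map phi s).
Proof.
by move=> /allP sD; apply/allP => _ /mapP[x /sD xD ->]; apply: phiD.
Qed.

Fact is_cocycle_pull (f : cocycle D) : is_cocycle D' (fun t => f (map phi t)).
Proof.
have [[N fN] fZ] := cocycleP f; split=> [|s sD].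
  by exists N => s Ns; rewrite fN ?size_map.
by rewrite cobdry_map // fZ // all_map_in.
Qed.

Definition cocycle_pull (f : cocycle D) : cocycle D' :=
  Cocycle (is_cocycle_pull f).

Definition cohom_pull : cohom D -> cohom D' := quot_map cocycle_pull.

Definition redcohom_pull p : redcohom D p -> redcohom D' p :=
  quot_map cohom_pull.

Fact cocycle_pull_zmod_morphism : zmod_morphism cocycle_pull.
Proof. by move=> f g; apply: cocycle_eqP. Qed.

Fact cocycle_pull_monoid_morphism : monoid_morphism cocycle_pull.
Proof.
split=> [|f g]; apply: cocycle_eqP => s /=; first by case: s.
by rewrite /cup size_map; apply: eq_bigr => i _; rewrite map_take map_drop.
Qed.

Fact cocycle_pull_coboundary (f : cocycle D) :
  coboundary f -> ideal_gen (@coboundary _ D') (cocycle_pull f).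
Proof.
move=> [h [[N hN] fE]]; apply: IdealGen; exists (fun t => h (map phi t)).
split=> [|s sD]; first by exists N => s Ns; rewrite hN ?size_map.
by rewrite cobdry_map //= fE ?all_map_in.
Qed.

Lemma cohom_pull_zmod_morphism : zmod_morphism cohom_pull.
Proof.
exact: quot_map_zmod_morphism cocycle_pull_zmod_morphism
  cocycle_pull_monoid_morphism cocycle_pull_coboundary.
Qed.

Lemma cohom_pull_monoid_morphism : monoid_morphism cohom_pull.
Proof.
exact: quot_map_monoid_morphism cocycle_pull_zmod_morphism
  cocycle_pull_monoid_morphism cocycle_pull_coboundary.
Qed.

HB.instance Definition _ := GRing.isZmodMorphism.Build _ _ cohom_pull
  cohom_pull_zmod_morphism.
HB.instance Definition _ := GRing.isMonoidMorphism.Build _ _ cohom_pull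
  cohom_pull_monoid_morphism.

Fact cohom_pull_ideal p (x : cohom D) :
  p_or_nilpotent p x -> ideal_gen (@p_or_nilpotent _ D' p) (cohom_pull x).
Proof.
move=> [->|[n xn0]]; apply: IdealGen; first by left; rewrite rmorph_nat.
by right; exists n; rewrite -rmorphXn xn0 rmorph0.
Qed.

Lemma redcohom_pullE p (f : cocycle D) :
  redcohom_pull (redclass p f) = redclass p (cocycle_pull f).
Proof.
rewrite /redcohom_pull (quot_mapE cohom_pull_zmod_morphism
  cohom_pull_monoid_morphism (@cohom_pull_ideal p)).
by rewrite /cohom_pull (quot_mapE cocycle_pull_zmod_morphism
  cocycle_pull_monoid_morphism cocycle_pull_coboundary).
Qed.

Lemma redcohom_pull_zmod_morphism p : zmod_morphism (@redcohom_pull p).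
Proof.
exact: quot_map_zmod_morphism cohom_pull_zmod_morphism
  cohom_pull_monoid_morphism (@cohom_pull_ideal p).
Qed.

Lemma redcohom_pull_monoid_morphism p : monoid_morphism (@redcohom_pull p).
Proof.
exact: quot_map_monoid_morphism cohom_pull_zmod_morphism
  cohom_pull_monoid_morphism (@cohom_pull_ideal p).
Qed.

End Pullback.

Definition redcohom_res (gT : finGroupType) (D D' : {set gT})
    (sD'D : D' \subset D) (p : nat) : redcohom D p -> redcohom D' p :=
  @redcohom_pull gT gT D D' id (fun _ _ _ _ => erefl) (subsetP sD'D) p.

Fact Aut_stable (gT : finGroupType) (D : {set gT}) (s : {perm gT}) :
  s \in Aut D -> {in D, forall x, s x \in D}.
Proof. by rewrite inE => /andP[sD _] x; rewrite (perm_closed _ sD). Qed.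

Definition redcohom_aut (gT : finGroupType) (D : {set gT}) (s : {perm gT})
    (sD : s \in Aut D) (p : nat) : redcohom D p -> redcohom D p :=
  @redcohom_pull gT gT D D s (morphicP (Aut_morphic sD))
    (Aut_stable sD) p.

(* The relations together with the order present 7_+^{1+2}. *)
Record is_extraspecial_7 (gT : finGroupType) (E : {set gT}) (e1 e2 c : gT) :
    Prop := IsExtraspecial7 {
  es_gen : E = <<[set e1; e2; c]>>%g;
  es_card : #|E| = (7 ^ 3)%N;
  es_e1 : (e1 ^+ 7 = 1)%g;
  es_e2 : (e2 ^+ 7 = 1)%g;
  es_c : (c ^+ 7 = 1)%g;
  es_comm : [~ e1, e2]%g = c;
  es_central : c \in 'C(E)%g
}.

Definition mx22 (R : Type) (a b c d : R) : 'M[R]_2 :=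
  \matrix_(i, j) if i == 0 then if j == 0 then a else b
                 else if j == 0 then c else d.

(* M lies in W_G(E) = N_G(E) / E C_G(E), as a subgroup of Out(E) = GL_2(F_7):
   modulo inner automorphisms is modulo <c> on the images of e1 and e2. *)
Definition W_E (gT : finGroupType) (G E : {set gT}) (e1 e2 c : gT)
    (M : 'M['F_7]_2) : Prop :=
  exists2 x, x \in 'N_G(E)%g &
    (e1 ^ x \in e1 ^+ (M 0 0)%R * e2 ^+ (M 1 0)%R *: <[c]>)%g /\
    (e2 ^ x \in e1 ^+ (M 0 1)%R * e2 ^+ (M 1 1)%R *: <[c]>)%g.

(* The matrices, in the basis (a1, a2), of the automorphisms in
   W_G(A) = N_G(A) / C_G(A) of A = <a1, a2>, elementary abelian of rank 2. *)
Definition W_A (gT : finGroupType) (G : {set gT}) (a1 a2 : gT)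
    (M : 'M['F_7]_2) : Prop :=
  exists2 x, x \in 'N_G(<<[set a1; a2]>>)%g &
    (a1 ^ x = a1 ^+ (M 0 0)%R * a2 ^+ (M 1 0)%R)%g /\
    (a2 ^ x = a1 ^+ (M 0 1)%R * a2 ^+ (M 1 1)%R)%g.

(* A_i = <c, gen_A i>, with None for the index oo *)
Definition gen_A (gT : finGroupType) (e1 e2 : gT) (i : option 'F_7) : gT :=
  if i is Some k then (e1 * e2 ^+ k)%g else e2.

Definition sub_A (gT : finGroupType) (e1 e2 c : gT) (i : option 'F_7) :
  {set gT} := <<[set c; gen_A e1 e2 i]>>%g.

Definition ONan_classes : seq (seq (option 'F_7)) :=
  [:: [:: Some 0; None]; [:: Some 1; Some 6];
      [:: Some 2; Some 3; Some 4; Some 5]].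

Record ONan_7local (gT : finGroupType) (G E : {set gT}) (e1 e2 c : gT) :
    Prop := ONan7Local {
  on_sylow : (7.-Sylow(G) E)%g;
  on_E : is_extraspecial_7 E e1 e2 c;
  on_WE : forall M : {'GL_2['F_7]},
    W_E G E e1 e2 c (GLval M) <->
    M \in <<[set g : {'GL_2['F_7]} | GLval g \in
             [:: mx22 (-1) 0 0 1; mx22 2 0 0 2; mx22 0 1 (-1) 0]%R]>>%g;
  on_conj : forall i j : option 'F_7,
    (exists2 x, x \in G & (sub_A e1 e2 c i :^ x = sub_A e1 e2 c j)%g) <->
    has (fun cl => (i \in cl) && (j \in cl)) ONan_classes;
  on_radical : forall i, i \in [:: Some 0; None; Some 1; Some 6] ->
    forall M, W_A G c (gen_A e1 e2 i) M <-> \det M = 1 \/ \det M = -1;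
  on_nonradical : forall i, i \in [:: Some 2; Some 3; Some 4; Some 5] ->
    ~ (forall M, \det M = 1 -> W_A G c (gen_A e1 e2 i) M)
}.

(* By the classification of finite simple groups, O'N is the only simple group
   of its order. *)
Definition is_ONan (gT : finGroupType) (G : {set gT}) : Prop :=
  simple G /\ #|G| = (2 ^ 9 * 3 ^ 4 * 5 * 7 ^ 3 * 11 * 19 * 31)%N.

Import mpoly.

(* The value of P at h in a ring of characteristic p; the coefficients are
   lifted to nat, which is harmless since p = 0 in R. *)
Definition mpoly_at (p n : nat) (R : pzRingType) (h : 'I_n -> R)
    (P : {mpoly 'F_p[n]}) : R :=
  \sum_(m <- msupp P) (\prod_(i < n) h i ^+ m i) *+ (P@_m : 'F_p).

(* H^*(BE) = (F_7[y1, y2] / (y1^7 y2 - y1 y2^7) + F_7{C}) (x) F_7[v], with the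
   action of Out(E) = GL_2(F_7).  These properties determine the generators up
   to scaling y1 and y2 by a common scalar and v by another one. *)
Record is_HE_presentation (gT : finGroupType) (E : {set gT}) (e1 e2 : gT)
    (y1 y2 C v : redcohom E 7) : Prop := IsHEPresentation {
  he_deg : [/\ is_homog 2%N y1, is_homog 2%N y2, is_homog 12%N C & is_homog 14%N v];
  he_comm : forall x y : redcohom E 7, x * y = y * x;
  he_rel : y1 ^+ 7 * y2 = y1 * y2 ^+ 7;
  he_Cy1 : C * y1 = y1 ^+ 7;
  he_Cy2 : C * y2 = y2 ^+ 7;
  he_C2 : C ^+ 2 = y1 ^+ 12 + y2 ^+ 12 - y1 ^+ 6 * y2 ^+ 6;
  he_span : forall x, exists (P : {mpoly 'F_7[3]}) (Q : {mpoly 'F_7[1]}),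
    x = mpoly_at (tnth [tuple y1; y2; v]) P + C * mpoly_at (fun=> v) Q;
  he_free : forall (P : {mpoly 'F_7[3]}) (Q : {mpoly 'F_7[1]}),
    mpoly_at (tnth [tuple y1; y2; v]) P + C * mpoly_at (fun=> v) Q = 0 ->
    Q = 0 /\
    exists K, P = K * ('X_0 ^+ 7 * 'X_1 - 'X_0 * 'X_1 ^+ 7);
  he_aut : forall (s : {perm gT}) (sE : s \in Aut E) (M : 'M['F_7]_2),
    s e1 = (e1 ^+ (M 0 0)%R * e2 ^+ (M 1 0)%R)%g ->
    s e2 = (e1 ^+ (M 0 1)%R * e2 ^+ (M 1 1)%R)%g ->
    [/\ redcohom_aut sE y1 = y1 *+ M 0 0 + y2 *+ M 0 1,
        redcohom_aut sE y2 = y1 *+ M 1 0 + y2 *+ M 1 1,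
        redcohom_aut sE v = v *+ (\det M : 'F_7)
      & redcohom_aut sE C = C]
}.

(* The element of DA{x_0,...,x_5} + CA{z_0,...,z_5} with coefficients u.1 k in
   DA = F_7[D1, D2] and u.2 k in CA = F_7[C, V] *)
Definition DA_CA_comb (R : pzRingType) (D1 D2 C V : R) (x z : seq R)
    (u : {ffun 'I_6 -> {mpoly 'F_7[2]}} * {ffun 'I_6 -> {mpoly 'F_7[2]}}) : R :=
  \sum_(k < 6) mpoly_at (tnth [tuple D1; D2]) (u.1 k) * x`_k +
  \sum_(k < 6) mpoly_at (tnth [tuple C; V]) (u.2 k) * z`_k.

(* Main.v *)
Require Import Defs.
From HB Require Import structures.
From mathcomp Require Import all_boot all_order all_algebra all_fingroup.
From mathcomp Require Import all_solvable mpoly.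
From mathcomp Require Import boolp generic_quotient zify ring lra.

(* Transfer identifies [H^*(BG)] with the classes of [H^*(BE)] that are stable
   under fusion in [G].  By Quillen-Venkov, a class of [H^*(BE)] is determined,
   modulo 7 and nilpotents, by its restrictions to the eight groups [A_m]; each
   of these is [r (y, u^7 - y^6 u)] for a polynomial [r] in [y] and [v].  Stability
   amounts to equivariance under [W_G(E)] together with invariance under matrices
   of determinant [+-1] at the radical [A_m], where Dickson's argument leaves only
   the polynomials in [y^42 + v^6] and [(y v)^2]; at the other [A_m] a Frattini
   argument shows that nothing more is required.  A class is then expanded by
   removing its values at [A_0], at [A_1] and at [A_2] in turn, and the leading
   monomials show that the expansion is unique. *)

Set Implicit Arguments.
Unset Strict Implicit.
Unset Printing Implicit Defensive.

Import GRing.Theory.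
Local Open Scope ring_scope.

(** The statement is about integral bar cochains and gives [H^*(BE)] only through a presentation, so
    the topology has to come from explicit homotopies. Most of them are instances of one
    construction, the straightening of cochains on an action groupoid: it yields Shapiro's lemma,
    triviality of inner automorphisms, the double coset formula modulo 7 and divisibility by
    Bockstein classes. The presentation does not say how its generators restrict to the [A_m]. This
    is recovered from degrees, inner automorphisms and [Out(E)], up to two non-zero scalars [al] and
    [la] that are carried along. The relation [y1^7 y2 = y1 y2^7] is what makes the [A_m] detect: it
    says that the product of the Bocksteins of the eight characters with kernels [A_m] vanishes. The
    generators of the theorem are adapted to three points [(s, t)] of the projective line over
    [F_7]: [b] vanishes at [A_0] but not at [A_1], while [d] and [C'] vanish at both but not at
    [A_2]. At the first two points [s^2 + t^2] is 1 and 2, elements of cube 1, whence the cube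
    subtracted in [C']. *)

Arguments cobdry {gT} f s : simpl never.

(** * Coboundaries and degree weights of integral cochains *)

Section CochainCalculus.
Variable gT : finGroupType.
Implicit Types (f g h : seq gT -> int) (s t : seq gT) (D : {group gT}).

(** Stated for bare functions, so that primitives can be moved between subgroups and along maps
    before a cocycle is formed. *)
Definition cob D f :=
  exists h, bounded_degree h /\ forall s, all (mem D) s -> f s = cobdry h s.

(** Reweighting by degree. The weights that occur are signs and projections onto one degree or one
    parity. *)
Definition wt (w : nat -> int) f s := w (size s) * f s.

Definition comp n := wt (fun m => (m == n)%:R).
Lemma cobdry0 s : cobdry (fun _ : seq gT => 0) s = 0.
Proof.
rewrite (eq_cobdry (g := fun t => 0 * cup1 t)) ?cobdryZ ?mul0r // => t.
by rewrite mul0r.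
Qed.

Lemma cobdryB f g s : cobdry (fun t => f t - g t) s = cobdry f s - cobdry g s.
Proof. by rewrite cobdryD cobdryN. Qed.

Lemma eq_cobdry_in D f g s : (forall t, all (mem D) t -> f t = g t) ->
  all (mem D) s -> cobdry f s = cobdry g s.
Proof.
elim: s f g => [|x [|y s] IHs] f g fg //; first by rewrite !cobdry1.
case/andP=> xD ysD; have /andP[yD sD] := ysD.
have xyD : all (mem D) ((x * y)%g :: s) by apply/andP; split=> //; exact: groupM.
have xsD : all (mem D) (x :: s) by apply/andP.
rewrite !cobdry_cons2 !fg //.
by congr (_ - _); apply: IHs => // t tD; apply: fg; apply/andP.
Qed.

Lemma eq_cobdry_size f g s : (forall t, (size t).+1 = size s -> f t = g t) ->
  cobdry f s = cobdry g s.
Proof.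
elim: s f g => [|x [|y s] IHs] f g fg //; first by rewrite !cobdry1.
rewrite !cobdry_cons2 !fg //; congr (_ - _).
by apply: IHs => // t ts; apply: fg; rewrite /= ts.
Qed.

Lemma cobdry_sum (I : finType) (P : pred I) (F : I -> seq gT -> int) s :
  cobdry (fun t => \sum_(i | P i) F i t) s = \sum_(i | P i) cobdry (F i) s.
Proof.
elim: s F => [|x [|y s] IHs] F; first by rewrite big1.
  by rewrite cobdry1 big1 // => i _; rewrite cobdry1.
rewrite cobdry_cons2 (IHs (fun i t => F i (x :: t))) -!sumrB -big_split -sumrB.
by apply: eq_bigr => i _; rewrite cobdry_cons2.
Qed.

(** [cobdry f s] evaluates [f] only on sequences one shorter than [s]; at the empty sequence both
    sides vanish. *)
Lemma cobdry_wt w f s : cobdry (wt w f) s = w (size s).-1 * cobdry f s.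
Proof.
rewrite -cobdryZ; apply: eq_cobdry_size => t ts; rewrite /wt.
by rewrite -ts.
Qed.

Lemma bounded0 : bounded_degree (fun _ : seq gT => 0).
Proof. by exists 0%N. Qed.

Lemma boundedD f g : bounded_degree f -> bounded_degree g ->
  bounded_degree (fun s => f s + g s).
Proof.
move=> [N fN] [M gM]; exists (maxn N M) => s.
by rewrite gtn_max => /andP[Ns Ms]; rewrite fN ?gM ?addr0.
Qed.

Lemma bounded_wt w f : bounded_degree f -> bounded_degree (wt w f).
Proof. by move=> [N fN]; exists N => s Ns; rewrite /wt fN ?mulr0. Qed.

Lemma bounded_sum (I : finType) (P : pred I) (F : I -> seq gT -> int) :
  (forall i, P i -> bounded_degree (F i)) ->
  bounded_degree (fun s => \sum_(i | P i) F i s).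
Proof.
move=> FB; suff [N HN] : exists N, forall i s, P i -> (N < size s)%N -> F i s = 0.
  by exists N => s Ns; rewrite big1 // => i Pi; rewrite HN.
have /choice[N HN] : forall i, exists N, P i -> forall s, (N < size s)%N -> F i s = 0.
  move=> i; case: (boolP (P i)) => [/FB[N FN]|/negP nP]; first by exists N.
  by exists 0%N => Pi; case: nP.
exists (\max_i N i) => i s Pi Ns; apply: HN => //.
exact: leq_ltn_trans (leq_bigmax i) Ns.
Qed.

Lemma bounded_cup f g : bounded_degree f -> bounded_degree g ->
  bounded_degree (cup f g).
Proof.
move=> [N fN] [M gM]; exists (N + M)%N => s ltNM; rewrite /cup big1 // => i _.
have [ltNi|leiN] := ltnP N i.
  by rewrite fN ?mul0r // size_takel // -ltnS.
rewrite gM ?mulr0 // size_drop ltn_subRL.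
by apply: leq_ltn_trans ltNM; rewrite leq_add2r.
Qed.

Lemma cob0 D : cob D (fun _ => 0).
Proof. by exists (fun _ => 0); split=> [|s _]; [exact: bounded0|rewrite cobdry0]. Qed.

Lemma cobD D f g : cob D f -> cob D g -> cob D (fun s => f s + g s).
Proof.
move=> [h [hB fE]] [k [kB gE]]; exists (fun s => h s + k s).
by split=> [|s sD]; [exact: boundedD|rewrite cobdryD fE ?gE].
Qed.

Lemma eq_cob D f g : (forall s, all (mem D) s -> f s = g s) -> cob D f -> cob D g.
Proof. by move=> fg [h [hB fE]]; exists h; split=> // s sD; rewrite -fg // fE. Qed.

Lemma cob_wt D w f : cob D f -> cob D (wt w f).
Proof.
move=> [h [hB fE]]; exists (wt (fun n => w n.+1) h).
split=> [|s sD]; first exact: bounded_wt.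
by rewrite cobdry_wt /wt fE //; case: s {sD} => //=; rewrite !mulr0.
Qed.

Lemma cocycle_wt D w f : is_cocycle D f -> is_cocycle D (wt w f).
Proof.
move=> [fB fZ]; split=> [|s sD]; first exact: bounded_wt.
by rewrite cobdry_wt fZ ?mulr0.
Qed.

Lemma cup0r f s : cup f (fun _ => 0) s = 0.
Proof. by rewrite /cup big1 // => i _; rewrite mulr0. Qed.

(** The sign in the Leibniz rule is absorbed into the left factor, which remains a cocycle. *)
Lemma cup_cobr D f g : is_cocycle D f -> cob D g -> cob D (cup f g).
Proof.
move=> fC [h [hB gE]]; set f' := wt (fun n => (-1) ^+ n) f.
have f'C : is_cocycle D f' by apply: cocycle_wt.
exists (cup f' h); split=> [|s sD]; first by apply: bounded_cup => //; case: f'C.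
rewrite cobdry_cup (@eq_cup_in _ D (cobdry f') (fun _ => 0) h h) //; last first.
  by move=> t tD; case: f'C => _ ->.
rewrite cup0l add0r; apply: (@eq_cup_in _ D) => // t tD.
by rewrite /f' /wt mulrA -exprMn mulrNN mulr1 expr1n mul1r.
Qed.

Lemma cup_cobl D f g : is_cocycle D g -> cob D f -> cob D (cup f g).
Proof.
move=> [gB gZ] [h [hB fE]]; exists (cup h g); split; first exact: bounded_cup.
move=> s sD; rewrite cobdry_cup.
rewrite (@eq_cup_in _ D (fun t => (-1) ^+ size t * h t) (fun t => (-1) ^+ size t * h t) _ (fun _ => 0) s sD) //.
rewrite cup0r addr0; exact: (@eq_cup_in _ D).
Qed.

End CochainCalculus.

(** * Cohomology classes of cocycles *)

Section Classes.
Variables (gT : finGroupType) (D : {group gT}).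
Implicit Types f g : cocycle D.

Definition cls f : cohom D := qclass _ f.

Lemma cls_surj (x : cohom D) : exists f, x = cls f.
Proof. by exists (repr x); rewrite /cls qclassK. Qed.

(** Coboundaries already form an ideal, so equality of classes always comes with an explicit
    primitive. *)
Lemma ideal_cob f : ideal_gen (@coboundary _ D) f -> cob D f.
Proof.
elim=> {f} [f //||f g _ IHf _ IHg|f g _ IHg|f g _ IHg].
- exact: cob0.
- exact: cobD.
- exact: cup_cobr (cocycleP f) IHg.
- exact: cup_cobl (cocycleP f) IHg.
Qed.

Lemma clsP f g : cls f = cls g <-> cob D (fun s => f s - g s).
Proof.
rewrite /cls qclassP; split=> [/ideal_cob|fg]; first by apply: eq_cob.
exact: IdealGen.
Qed.

Lemma cls0P f : cls f = 0 <-> cob D f.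
Proof.
have -> : (0 : cohom D) = cls 0 by rewrite /cls rmorph0.
rewrite clsP; split; apply: eq_cob => s _ /=; by rewrite subr0.
Qed.

Lemma cls0 : cls 0 = 0.
Proof. exact: rmorph0. Qed.
Lemma cls1 : cls 1 = 1.
Proof. exact: rmorph1. Qed.
Lemma clsD f g : cls (f + g) = cls f + cls g.
Proof. exact: rmorphD. Qed.
Lemma clsN f : cls (- f) = - cls f.
Proof. exact: rmorphN. Qed.
Lemma clsM f g : cls (f * g) = cls f * cls g.
Proof. exact: rmorphM. Qed.
Lemma clsX f n : cls (f ^+ n) = cls f ^+ n.
Proof. exact: rmorphXn. Qed.
Lemma cls_nat n : cls n%:R = n%:R.
Proof. exact: rmorph_nat. Qed.

Definition wtc w f : cocycle D := Cocycle (cocycle_wt w (cocycleP f)).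

Lemma cls_wt w f g : cls f = cls g -> cls (wtc w f) = cls (wtc w g).
Proof.
rewrite !clsP => /(cob_wt w); apply: eq_cob => s _ /=.
by rewrite /wt mulrBr.
Qed.

Lemma cls_eq f g : (forall s, all (mem D) s -> f s = g s) -> cls f = cls g.
Proof.
move=> fg; rewrite clsP; apply: eq_cob (cob0 D) => s sD.
by rewrite fg ?subrr.
Qed.

Lemma cocycle_natE n s : (n%:R : cocycle D) s = n%:R * cup1 s.
Proof. by elim: n => [|n IHn]; rewrite ?mul0r // -[n.+1]addn1 !natrD mulrDl mul1r -IHn. Qed.

Lemma cocycle_mulrnE f n s : (f *+ n) s = f s *+ n.
Proof. by elim: n => [|n IHn]; rewrite ?mulr0n // !mulrS -IHn. Qed.

Lemma cocycle_sumE (I : Type) (r : seq I) (P : pred I) (F : I -> cocycle D) s :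
  (\sum_(i <- r | P i) F i) s = \sum_(i <- r | P i) F i s.
Proof.
by elim/big_rec2: _ => // i x y _ <-.
Qed.

Lemma cocycle_nil f g : (f * g) [::] = f [::] * g [::].
Proof. exact: cup_nil. Qed.

Lemma cocycleX_nil f n : (f ^+ n) [::] = f [::] ^+ n.
Proof. by elim: n => [|n IHn]; rewrite ?expr0 // !exprS cocycle_nil IHn. Qed.

(** Coboundaries vanish on the empty sequence, so the value in degree 0 is an invariant of the
    class. *)
Lemma cls_nil f g : cls f = cls g -> f [::] = g [::].
Proof. by rewrite clsP => -[h [_ /(_ [::] isT)]] /= /eqP; rewrite subr_eq0 => /eqP. Qed.

(* Summing the cocycle identity over the first variable contracts [#|D| f]. *)
Lemma card_kills f : f [::] = 0 -> cls f *+ #|D| = 0.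
Proof.
move=> f0; have -> : cls f *+ #|D| = cls (f *+ #|D|) by rewrite /cls rmorphMn.
rewrite cls0P; exists (fun s => \sum_(x in D) f (x :: s)); split.
  have [[N fN] _] := cocycleP f; exists N => s Ns.
  by rewrite big1 // => x _; rewrite fN // ltnS ltnW.
case=> [|y s] /=; rewrite cocycle_mulrnE; first by rewrite f0 mul0rn.
case/andP=> yD sD; have [_ fZ] := cocycleP f.
have E x : x \in D -> cobdry (fun t => f (x :: t)) (y :: s) =
    f (y :: s) - f ((x * y)%g :: s) + f (x :: s).
  move=> xD; have := fZ [:: x, y & s]; rewrite cobdry_cons2 => /(_ _)/eqP.
  rewrite subr_eq0 eq_sym => H; apply/eqP/H.
  by apply/andP; split=> //; apply/andP.
rewrite -[LHS]sumr_const.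
transitivity (\sum_(x in D) cobdry (fun t => f (x :: t)) (y :: s)); last first.
  by rewrite cobdry_sum.
rewrite (eq_bigr _ E) big_split sumrB /=.
suff -> : \sum_(x in D) f ((x * y)%g :: s) = \sum_(x in D) f (x :: s).
  by rewrite subrK.
rewrite [RHS](reindex_inj (mulIg y)) /=; apply: eq_bigl => x.
by rewrite groupMr.
Qed.

End Classes.

(* Cochains with coefficients in the functions on a right [D]-set [X] (only the
   points satisfying the invariant predicate [P] matter); [X]-cochains are the
   cochains of the action groupoid. *)
Section ActionCochains.
Variables (gT : finGroupType) (D : {group gT}) (X : Type) (act : X -> gT -> X).
Variable P : X -> Prop.
Hypothesis act1 : forall x, act x 1%g = x.
Hypothesis actM : forall x, {in D &, forall g h, act x (g * h)%g = act (act x g) h}.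
Hypothesis actP : forall x g, P x -> g \in D -> P (act x g).
Implicit Types (F : X -> seq gT -> int) (f : seq gT -> int).

Definition cobX F x s : int :=
  if s is g :: t then cobdry (F x) s + (F (act x g) t - F x t) else 0.

Definition boundedX F := exists N, forall x s, (N < size s)%N -> F x s = 0.

Definition cobX_on F G :=
  forall x s, P x -> all (mem D) s -> F x s = cobX G x s.

Lemma cobX_cons2 F x g h t :
  cobX F x (g :: h :: t) = F (act x g) (h :: t) - F x ((g * h)%g :: t)
     + F x (g :: t) - cobdry (fun t => F x (g :: t)) (h :: t).
Proof. rewrite /cobX cobdry_cons2; ring. Qed.

Lemma cobX1 F x g : cobX F x [:: g] = F (act x g) [::] - F x [::].
Proof. by rewrite /cobX cobdry1 add0r. Qed.

Lemma cobX_const f x s : cobX (fun _ => f) x s = cobdry f s.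
Proof. by case: s => [|g t] //; rewrite /cobX subrr addr0. Qed.

Lemma cobXD F G x s : cobX (fun x s => F x s + G x s) x s = cobX F x s + cobX G x s.
Proof. case: s => [|g t] //; rewrite /cobX cobdryD; ring. Qed.

Lemma cobXB F G x s : cobX (fun x s => F x s - G x s) x s = cobX F x s - cobX G x s.
Proof. case: s => [|g t] //; rewrite /cobX cobdryB; ring. Qed.

Lemma cobX_wt w F x s : cobX (fun x => wt w (F x)) x s = w (size s).-1 * cobX F x s.
Proof. case: s => [|g t]; rewrite /cobX ?mulr0 // cobdry_wt /wt /=; ring. Qed.

Lemma boundedX_const f : bounded_degree f -> boundedX (fun _ => f).
Proof. by move=> [N fN]; exists N => _. Qed.

Lemma boundedXD F G : boundedX F -> boundedX G -> boundedX (fun x s => F x s + G x s).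
Proof.
move=> [N FN] [M GM]; exists (maxn N M) => x s.
by rewrite gtn_max => /andP[Ns Ms]; rewrite FN ?GM ?addr0.
Qed.

Lemma boundedXN F : boundedX F -> boundedX (fun x s => - F x s).
Proof. by move=> [N FN]; exists N => x s Ns; rewrite FN ?oppr0. Qed.

Lemma boundedX_at F x : boundedX F -> bounded_degree (F x).
Proof. by move=> [N FN]; exists N => s; apply: FN. Qed.

Lemma boundedX_act F (c : X -> X) : boundedX F -> boundedX (fun x => F (c x)).
Proof. by move=> [N FN]; exists N => x s; apply: FN. Qed.

Section Straighten.
Variable eta : X -> gT.
Hypothesis etaD : forall x, P x -> eta x \in D.

(** The arrow from [x] to [act x g] transported, by means of [eta], to an arrow between the base
    points of its ends. *)
Definition shift_arrow x g := (eta x * g * (eta (act x g))^-1)%g.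

Fixpoint pm x s : seq gT :=
  if s is g :: t then shift_arrow x g :: pm (act x g) t else [::].

(** Prism operator of the natural transformation [eta]: an alternating sum over the place at which a
    path changes from transported to original arrows, with [eta] inserted there. *)
Fixpoint Kp f x s : int :=
  if s is g :: t then
    f [:: eta x, g & t] - Kp (fun u => f (shift_arrow x g :: u)) (act x g) t
  else f [:: eta x].

Lemma Kp_cons f x g t : Kp f x (g :: t) =
  f [:: eta x, g & t] - Kp (fun u => f (shift_arrow x g :: u)) (act x g) t.
Proof. by []. Qed.

Let base x := act x (eta x)^-1%g.

Lemma size_pm x s : size (pm x s) = size s.
Proof. by elim: s x => //= g t IHt x; rewrite IHt. Qed.

Lemma shift_arrowD x g : P x -> g \in D -> shift_arrow x g \in D.
Proof. by move=> Px gD; rewrite /shift_arrow !groupM ?groupV ?etaD //; apply: actP. Qed.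

Lemma shift_arrowM x g h : P x -> g \in D -> h \in D ->
  shift_arrow x (g * h)%g = (shift_arrow x g * shift_arrow (act x g) h)%g.
Proof. by move=> Px gD hD; rewrite /shift_arrow actM // !mulgA mulgKV. Qed.

Lemma pm_in (H : {set gT}) x s : {in D, forall g, forall x, P x -> shift_arrow x g \in H} ->
  P x -> all (mem D) s -> all (mem H) (pm x s).
Proof.
move=> phiH; elim: s x => [|g t IHt] x Px //= /andP[gD tD].
apply/andP; split; first exact: phiH.
by apply: IHt => //; apply: actP.
Qed.

Lemma eq_Kp f f' x s : (forall t, size t = (size s).+1 -> f t = f' t) ->
  Kp f x s = Kp f' x s.
Proof.
elim: s f f' x => [|g t IHt] f f' x ff /=; first by rewrite ff.
by rewrite ff //; congr (_ - _); apply: IHt => u us; rewrite ff //= us.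
Qed.

Lemma Kp_eq0 f x s : (forall t, all (mem D) t -> f t = 0) ->
  P x -> all (mem D) s -> Kp f x s = 0.
Proof.
elim: s f x => [|g t IHt] f x f0 Px /=.
  by move=> _; apply: f0; apply/andP; split=> //; apply: etaD.
case/andP=> gD tD; rewrite f0; last by apply/and3P; split=> //; apply: etaD.
rewrite IHt ?subr0 //; last exact: actP.
by move=> u uD; apply: f0; apply/andP; split=> //; apply: shift_arrowD.
Qed.

Lemma KpD f f' x s : Kp (fun t => f t + f' t) x s = Kp f x s + Kp f' x s.
Proof. elim: s f f' x => [|g t IHt] f f' x //=; rewrite IHt; ring. Qed.

Lemma KpN f x s : Kp (fun t => - f t) x s = - Kp f x s.
Proof. elim: s f x => [|g t IHt] f x //=; rewrite IHt; ring. Qed.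

Lemma KpB f f' x s : Kp (fun t => f t - f' t) x s = Kp f x s - Kp f' x s.
Proof. by rewrite KpD KpN. Qed.

Lemma Kp_bounded f N x s : (forall t, (N < size t)%N -> f t = 0) -> (N < size s)%N ->
  Kp f x s = 0.
Proof.
move=> fN Ns; rewrite (@eq_Kp _ (fun _ => 0)); last first.
  by move=> t ts; rewrite fN // ts ltnW.
by elim: s {Ns} x => [|g t IHt] x //=; rewrite IHt subr0.
Qed.

(** Rests on [shift_arrow x g * eta (act x g) = eta x * g]. Through [head] and [behead] the face
    that multiplies the first two arrows becomes an operation on functions. *)
Lemma Kp_mul f x g h s : P x -> g \in D -> h \in D ->
  Kp (fun u => f ((shift_arrow x g * head 1%g u)%g :: behead u)) (act x g) (h :: s) =
  f [:: (eta x * g)%g, h & s] - Kp (fun u => f (shift_arrow x (g * h)%g :: u)) (act x (g * h)%g) s.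
Proof.
move=> Px gD hD /=; rewrite -shift_arrowM // actM //.
by rewrite /shift_arrow mulgKV.
Qed.

(** The faces of the prism adjacent to the inserted [eta] cancel in pairs, which leaves its two
    ends. *)
Lemma Kp_homotopy f x s : P x -> all (mem D) s ->
  cobX (Kp f) x s + Kp (cobdry f) x s = f s - f (pm x s).
Proof.
elim: s f x => [|g [|h t] IHs] f x Px.
- by move=> _; rewrite /= cobdry1; ring.
- case/andP=> gD _; rewrite cobX1 /= !cobdry_cons2 !cobdry1 /shift_arrow mulgKV; ring.
case/andP=> gD htD; have /andP[hD tD] := htD.
have Pg : P (act x g) by apply: actP.
set phi := shift_arrow x g; set f' := fun u => f (phi :: u).
have E1 : Kp (fun u => cobdry f (phi :: u)) (act x g) (h :: t) =
    Kp f (act x g) (h :: t)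
    - (f [:: (eta x * g)%g, h & t] - Kp (fun u => f (shift_arrow x (g * h)%g :: u)) (act x (g * h)%g) t)
    + (f' (h :: t) - Kp f' (act (act x g) h) t) - Kp (cobdry f') (act x g) (h :: t).
  rewrite -Kp_mul //.
  rewrite (_ : f' (h :: t) - _ = Kp (fun u => f' (behead u)) (act x g) (h :: t)) //.
  rewrite -KpB -KpD -KpB; apply: eq_Kp; case=> [|a u] // _.
  by rewrite cobdry_cons2.
have E2 : cobdry (fun t => Kp f x (g :: t)) (h :: t) =
    cobdry (fun u => f [:: eta x, g & u]) (h :: t)
    - (f' (h :: t) - f' (pm (act x g) (h :: t)) - Kp (cobdry f') (act x g) (h :: t)
      - Kp f' (act (act x g) h) t + Kp f' (act x g) t).
  rewrite cobdryB; congr (_ - _); rewrite -IHs // /cobX.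
  by rewrite /f' /phi; ring.
rewrite cobX_cons2 E2 (Kp_cons (cobdry f)) E1 !Kp_cons -/phi -/f'.
rewrite (cobdry_cons2 f) [cobdry (fun t0 => f (eta x :: t0)) _]cobdry_cons2.
by rewrite /f' /phi /=; ring.
Qed.

(** [Kp_homotopy] treats the cochain at one base point as fixed; the additional terms arise because
    the base point itself moves along the first arrow. *)
Lemma straighten F x s : P x -> all (mem D) s ->
  cobX (fun x => Kp (F (base x)) x) x s + Kp (cobX F (base x)) x s =
  F x s - F (base x) (pm x s).
Proof.
case: s => [|g t] Px.
  move=> _; rewrite {1}/cobX /= cobdry1 /base -actM ?groupV ?etaD //.
  by rewrite mulVg act1; ring.
case/andP=> gD tD; have gtD : all (mem D) (g :: t) by apply/andP.
have := Kp_homotopy (F (base x)) Px gtD; rewrite /cobX.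
set A := cobdry _ _; set B := Kp (cobdry _) _ _ => E.
have bg : base (act x g) = act (base x) (shift_arrow x g).
  have Pg : P (act x g) by apply: actP.
  have [ex eg] := (etaD Px, etaD Pg).
  rewrite /base /shift_arrow !actM ?groupM ?groupV //.
  by rewrite -(actM _ (groupVr ex) ex) mulVg act1.
have be : act (base x) (eta x) = x.
  by rewrite /base -actM ?groupV ?etaD // mulVg act1.
have -> : Kp (cobX F (base x)) x (g :: t) = B + (F x (g :: t) - F (base x) (g :: t)
    - (Kp (F (base (act x g))) (act x g) t - Kp (F (base x)) (act x g) t)).
  rewrite /B -KpB /= be bg /=.
  set U := Kp (fun u => cobdry _ _ + _) _ _.
  have -> : U = Kp (fun u => cobdry (F (base x)) (shift_arrow x g :: u)) (act x g) t
     + Kp (fun u => F (act (base x) (shift_arrow x g)) u - F (base x) u) (act x g) t.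
    by rewrite -KpD.
  ring.
rewrite -/B in E; move: E; rewrite -/A => E.
rewrite [LHS](_ : _ = (A + (Kp (F (base x)) (act x g) t - Kp (F (base x)) x t)) + B
  + (F x (g :: t) - F (base x) (g :: t))); last ring.
rewrite E; ring.
Qed.

Lemma cobX_pm f x s : P x -> all (mem D) s ->
  cobX (fun x s => f (pm x s)) x s = cobdry f (pm x s).
Proof.
elim: s f x => [|g [|h t] IHs] f x Px.
- by [].
- by rewrite cobX1 /= cobdry1 subrr.
case/andP=> gD htD; have /andP[hD tD] := htD.
have Pg : P (act x g) by apply: actP.
rewrite cobX_cons2.
have := IHs (fun u => f (shift_arrow x g :: u)) _ Pg htD; rewrite /cobX => E.
rewrite /= cobdry_cons2.
rewrite -[shift_arrow _ h :: pm _ t]/(pm (act x g) (h :: t)) -E.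
by rewrite /= shift_arrowM // actM //; ring.
Qed.

Lemma straighten_cocycle F : boundedX F ->
    (forall x s, P x -> all (mem D) s -> cobX F x s = 0) -> (forall x, P x -> P (base x)) ->
  exists K, boundedX K /\
    cobX_on (fun x s => F x s - F (base x) (pm x s)) K.
Proof.
move=> [N FN] FZ Pb; exists (fun x => Kp (F (base x)) x); split.
  by exists N => x s Ns; apply: Kp_bounded Ns => t; apply: FN.
move=> x s Px sD; rewrite -straighten // [X in _ + X]Kp_eq0 ?addr0 //.
by move=> t tD; apply: FZ => //; apply: Pb.
Qed.

End Straighten.

(** With all base points equal to [x0], transported paths lie in the stabiliser, hence in [H]. So
    [F] is homotopic to the pullback of [F x0] along [pm], and a primitive on [H] pulls back to one
    over all points. *)
Lemma shapiro (H : {group gT}) (x0 : X) (eta : X -> gT) F :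
    (forall x, P x -> eta x \in D) -> P x0 ->
    (forall x, P x -> act x (eta x)^-1%g = x0) ->
    {in D, forall g, act x0 g = x0 -> g \in H} ->
    boundedX F -> (forall x s, P x -> all (mem D) s -> cobX F x s = 0) ->
    cob H (F x0) ->
  exists K, boundedX K /\ cobX_on F K.
Proof.
move=> etaD Px0 eta0 stabH FB FZ [h [[M hM] hE]].
have [|K [KB KE]] := straighten_cocycle etaD FB FZ.
  by move=> x Px; rewrite eta0.
have phiH : {in D, forall g, forall x, P x -> shift_arrow eta x g \in H}.
  move=> g gD x Px; have Pg : P (act x g) by apply: actP.
  apply: stabH; first by rewrite !groupM ?groupV ?etaD.
  have xE : act x0 (eta x) = x.
    by rewrite -(eta0 x Px) -actM ?groupV ?etaD // mulVg act1.
  by rewrite /shift_arrow !actM ?groupM ?groupV ?etaD // xE eta0.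
exists (fun x s => K x s + h (pm eta x s)); split.
  apply: boundedXD => //; exists M => x s Ms; rewrite hM //.
  by rewrite size_pm.
move=> x s Px sD; rewrite cobXD -KE // cobX_pm // -hE; last first.
  exact: (pm_in _ _ sD).
by rewrite eta0 // subrK.
Qed.

End ActionCochains.

(** * Summation over invariant sets, and inner automorphisms *)

Section SumCochains.
Variables (gT : finGroupType) (D : {group gT}) (X : finType) (act : X -> gT -> X).
Variable A : {set X}.
Hypothesis act1 : forall x, act x 1%g = x.
Hypothesis actM : forall x, {in D &, forall g h, act x (g * h)%g = act (act x g) h}.
Hypothesis actA : forall x g, x \in A -> g \in D -> act x g \in A.

Lemma sum_act (R : nmodType) (F : X -> R) g : g \in D ->
  \sum_(x in A) F (act x g) = \sum_(x in A) F x.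
Proof.
move=> gD; rewrite [RHS](reindex (act^~ g)) /=; last first.
  exists (act^~ g^-1%g) => x _; rewrite -actM ?groupV ?mulgV ?mulVg ?act1 //.
apply: eq_bigl => x; apply/idP/idP => [xA|/actA H]; first exact: actA.
by have := H _ (groupVr gD); rewrite -actM ?groupV // mulgV act1.
Qed.

(** The action terms [F (act x g) t - F x t] cancel in the sum over an invariant set. *)
Lemma sum_cobX (F : X -> seq gT -> int) s : all (mem D) s ->
  \sum_(x in A) cobX act F x s = cobdry (fun s => \sum_(x in A) F x s) s.
Proof.
case: s => [|g t]; first by rewrite big1.
case/andP=> gD _; rewrite /cobX big_split cobdry_sum /= sumrB.
by rewrite (sum_act (fun x => F x t)) // subrr addr0.
Qed.

Lemma cob_sumX F K : boundedX K -> cobX_on D act (fun x => x \in A) F K ->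
  cob D (fun s => \sum_(x in A) F x s).
Proof.
move=> KB FK; exists (fun s => \sum_(x in A) K x s); split.
  by apply: bounded_sum => x _; apply: boundedX_at.
by move=> s sD; rewrite -sum_cobX //; apply: eq_bigr => x xA; apply: FK.
Qed.

End SumCochains.

Section InnerConjugation.
Variables (gT : finGroupType) (D : {group gT}).

(** Straightening over a one-point set with [eta = u^-1]: transporting an arrow is conjugation by
    [u]. *)
Lemma conj_cob (f : cocycle D) u : u \in D ->
  cob D (fun s => f s - f (map (conjg^~ u) s)).
Proof.
move=> uD; pose act (x : unit) (g : gT) := x.
have [fB fZ] := cocycleP f.
have actM x : {in D &, forall g h, act x (g * h)%g = act (act x g) h} by [].
have etaD x : True -> (fun _ : unit => u^-1%g) x \in D by rewrite groupV.
have [] := @straighten_cocycle _ D _ act (fun _ => True) _ actM _ _ etaD (fun _ => f) => //.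
- exact: boundedX_const.
- by move=> x s _ sD; rewrite cobX_const fZ.
move=> K [KB KE]; exists (K tt); split; first exact: boundedX_at.
move=> s sD; have := KE tt s I sD; rewrite /cobX.
have -> : pm act (fun _ => u^-1%g) tt s = map (conjg^~ u) s.
  elim: s {sD} => //= g t ->; congr (_ :: _).
  by rewrite /shift_arrow invgK conjgE mulgA.
by case: s {sD} => [|g t] ->; rewrite // subrr addr0.
Qed.

End InnerConjugation.

(* Reversing the arrows of the bar construction is homotopic to the identity;
   since it exchanges the two factors of a cup product, cohomology is graded
   commutative. *)
Section Reversal.
Variable gT : finGroupType.
Implicit Types (f g : seq gT -> int) (s t : seq gT) (D : {group gT}).

(** This is [(-1)^(n(n+1)/2)], the sign of the permutation reversing the vertices of an
    [n]-simplex. *)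
Fixpoint eps n : int := if n is m.+1 then (-1) ^+ m.+1 * eps m else 1.

Definition revinv s := rev (map (@invg gT) s).
Definition prodl s := foldr (@mulg gT) 1%g s.
Definition revc f s := eps (size s) * f (revinv s).

Lemma epsD p q : eps (p + q) = eps p * eps q * (-1) ^+ (p * q).
Proof.
elim: p => [|p IHp]; first by rewrite mul1r mulr1.
rewrite addSn /= IHp mulSn -addSn !exprD; ring.
Qed.

Lemma size_revinv s : size (revinv s) = size s.
Proof. by rewrite size_rev size_map. Qed.

Lemma revinv_cons x s : revinv (x :: s) = rcons (revinv s) x^-1%g.
Proof. by rewrite /revinv /= rev_cons. Qed.

Lemma revinv_rcons s x : revinv (rcons s x) = x^-1%g :: revinv s.
Proof. by rewrite /revinv map_rcons rev_rcons. Qed.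

Lemma revinv_in D s : all (mem D) s -> all (mem D) (revinv s).
Proof.
elim: s => // x s IHs /andP[xD sD]; rewrite revinv_cons all_rcons IHs // andbT.
exact: groupVr.
Qed.

Lemma prodl_cat s t : prodl (s ++ t) = (prodl s * prodl t)%g.
Proof. by elim: s => [|x s IHs] /=; rewrite ?mul1g // IHs mulgA. Qed.

Lemma cobdry_rcons2 f s x y :
  cobdry f (rcons (rcons s x) y) = cobdry (fun t => f (rcons t y)) (rcons s x)
   + (-1) ^+ (size s).+1 * (f (rcons s (x * y)%g) - f (rcons s y) - f (rcons s x)).
Proof.
elim: s f => [|z s IHs] f.
  by rewrite /= cobdry1 cobdry_cons2 cobdry1; ring.
case: s IHs => [|w s] IHs.
  by rewrite /= !cobdry_cons2 !cobdry1 /=; ring.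
have := IHs (fun t => f (z :: t)); rewrite /= (cobdry_cons2 f) => ->.
rewrite [in RHS]cobdry_cons2 /= !exprS; ring.
Qed.

Lemma cobdry_revinv f s :
  cobdry (fun t => f (revinv t)) s = (-1) ^+ size s * cobdry f (revinv s).
Proof.
elim: s f => [|x [|y s] IHs] f; first by rewrite mulr0.
  by rewrite !cobdry1 mulr0.
rewrite cobdry_cons2.
have -> : cobdry (fun t => f (revinv (x :: t))) (y :: s) =
    (-1) ^+ size (y :: s) * cobdry (fun t => f (rcons t x^-1%g)) (revinv (y :: s)).
  rewrite -(IHs (fun t => f (rcons t x^-1%g))).
  by apply: eq_cobdry => t; rewrite revinv_cons.
rewrite !revinv_cons cobdry_rcons2 -!revinv_cons.
rewrite !revinv_cons invMg size_revinv /= !exprS.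
set e := (-1) ^+ size s; have ee : e * e = 1.
  by rewrite /e -exprMn mulrNN mulr1 expr1n.
set A := f (rcons _ (_ * _)%g); set B := f (rcons _ _); set C' := f (rcons (revinv s) x^-1%g).
rewrite mulrDr [X in _ = _ + X](_ : _ = (e * e) * (B - A + C')); last ring.
rewrite ee; ring.
Qed.

Lemma prodl_merge i s : (i.+1 < size s)%N -> prodl (bar_merge i s) = prodl s.
Proof.
move=> lis; rewrite /bar_merge -[in RHS](cat_take_drop i s) !prodl_cat.
rewrite (drop_nth 1%g (ltnW lis)) (drop_nth 1%g lis) /=.
by rewrite !mulgA.
Qed.

(** Inner faces preserve the product of the whole sequence; only the two outer faces change it. *)
Lemma cobdry_prodl (F : gT -> seq gT -> int) x t :
  let s := x :: t in let u := take (size t) s in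
  cobdry (fun t => F (prodl t) t) s = cobdry (F (prodl s)) s
   + (F (prodl t) t - F (prodl s) t) + (-1) ^+ size s * (F (prodl u) u - F (prodl s) u).
Proof.
move=> s u; rewrite {1 2}/cobdry /s -/s -/u.
rewrite (eq_bigr (fun i : 'I_(size t) => (-1) ^+ i.+1 * F (prodl s) (bar_merge i s))).
  ring.
by move=> i _; rewrite prodl_merge // /= ltnS.
Qed.

Definition revT f s := - eps (size s) * f (prodl s :: revinv s).

(** Prism operator between identity and reversal. Its terms evaluate [f] at an initial segment of
    [s], followed by the product of the remaining arrows and by these arrows reversed and
    inverted. *)
Fixpoint revP f s : int :=
  revT f s - (if s is x :: t then revP (fun u => f (x :: u)) t else 0).

Lemma revP_cons f x t :
  revP f (x :: t) = revT f (x :: t) - revP (fun u => f (x :: u)) t.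
Proof. by []. Qed.

Lemma revP_lin f f' (a : int) s :
  revP (fun t => f t + a * f' t) s = revP f s + a * revP f' s.
Proof. elim: s f f' => [|x s IHs] f f'; rewrite /= /revT ?IHs; ring. Qed.

Lemma eq_revP f f' s : (forall t, size t = (size s).+1 -> f t = f' t) ->
  revP f s = revP f' s.
Proof.
elim: s f f' => [|x s IHs] f f' ff /=; rewrite /revT ff //= ?size_revinv //.
by congr (_ - _); apply: IHs => t ts; rewrite ff //= ts.
Qed.

Lemma revP_bounded f N s : (forall t, (N < size t)%N -> f t = 0) -> (N < size s)%N ->
  revP f s = 0.
Proof.
move=> fN Ns; rewrite (@eq_revP _ (fun t => 0 + 0 * 0)); last first.
  by move=> t ts; rewrite fN ?mul0r ?addr0 // ts ltnW.
rewrite (revP_lin (fun=> 0) (fun=> 0)) mul0r addr0.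
by elim: s {Ns} => [|g t IHt]; rewrite /= /revT ?IHt !mulr0 subr0.
Qed.

Lemma revP_homotopy f s : cobdry (revP f) s + revP (cobdry f) s = f s - revc f s.
Proof.
elim: s f => [|g [|h t] IHs] f.
- by rewrite /= /revT /revc /= cobdry1; ring.
- rewrite cobdry1 /= /revT /= /revc /= !cobdry_cons2 !cobdry1 !mulg1 !mulgV; ring.
rewrite cobdry_cons2 (revP_cons (cobdry f)); set s := g :: h :: t.
set fg := fun u => f (g :: u).
have E2 : cobdry (fun t => revP f (g :: t)) (h :: t) =
   cobdry (fun u => revT f (g :: u)) (h :: t) - cobdry (revP fg) (h :: t).
  exact: cobdryB.
have E1 : revP (fun u => cobdry f (g :: u)) (h :: t) =
   revP f (h :: t) - revP (fun u => f ((g * head 1%g u)%g :: behead u)) (h :: t)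
   + revP (fun u => fg (behead u)) (h :: t) - revP (cobdry fg) (h :: t).
  rewrite -[X in X - _ + _]mul1r -mulN1r -[revP f _]mul1r.
  transitivity (revP (fun u => (f u + (-1) * f ((g * head 1%g u)%g :: behead u)
     + 1 * fg (behead u)) + (-1) * cobdry fg u) (h :: t)).
    by apply: eq_revP; case=> [|a u] // _; rewrite cobdry_cons2 /fg /=; ring.
  by rewrite !revP_lin; ring.
have IH := IHs fg.
have dT : cobdry (revT f) s = revT f (h :: t) - revT f ((g * h)%g :: t) + revT f (g :: t)
    - cobdry (fun u => revT f (g :: u)) (h :: t) by rewrite cobdry_cons2.
(* The part of the identity not covered by induction. It is obtained by splitting off the last
   arrow, whose inverse begins the reversed sequence. *)
have key : revT (cobdry f) s + cobdry (revT f) s - revT f (h :: t)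
   - eps (size t).+1 * f (prodl s :: revinv (h :: t)) + eps (size s) * f (revinv s) = 0.
  pose u := take (size (h :: t)) s; pose l := last g (h :: t).
  have sE : s = rcons u l.
    rewrite /u /s (lastI g (h :: t)) -/l -cats1.
    by rewrite take_size_cat ?size_belast // cats1.
  pose F (p : gT) (w : seq gT) : int := wt (fun n => - eps n) (fun v => f (p :: revinv v)) w.
  have su : size u = (size t).+1 by rewrite size_takel //= leqnSn.
  have pu : prodl u = (prodl s * l^-1)%g.
    by rewrite sE -cats1 prodl_cat /= mulg1 mulgK.
  have ru : revinv s = l^-1%g :: revinv u by rewrite [in LHS]sE revinv_rcons.
  have dT' : cobdry (revT f) s = _ := cobdry_prodl F g (h :: t).
  rewrite dT' -/s -/u cobdry_wt (cobdry_revinv (fun v => f (prodl s :: v))).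
  rewrite /revT ru cobdry_cons2 -ru -pu /F /wt su /=.
  ring.
have Ih : revP f (h :: t) = revT f (h :: t) - revP (fun u => f (h :: u)) t by [].
have Igh : revP f ((g * h)%g :: t) = revT f ((g * h)%g :: t) -
    revP (fun u => f ((g * h)%g :: u)) t by [].
have Ig : revP f (g :: t) = revT f (g :: t) - revP fg t by [].
have Im : revP (fun u => f ((g * head 1%g u)%g :: behead u)) (h :: t) =
    - eps (size t).+1 * f (prodl s :: revinv (h :: t)) - revP (fun u => f ((g * h)%g :: u)) t.
  by [].
have Ib : revP (fun u => fg (behead u)) (h :: t) =
    - eps (size t).+1 * fg (revinv (h :: t)) - revP fg t by [].
move: IH key dT; rewrite {}E2 {}E1 {}Im {}Ib {}Ih {}Igh {}Ig /revc.
rewrite [size (h :: t)]/=.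
have -> : fg (h :: t) = f s by [].
have -> : fg (revinv (h :: t)) = f (g :: revinv (h :: t)) by [].
by move=> IH key dT; lra.
Qed.

Lemma revc_cocycle D f : is_cocycle D f -> is_cocycle D (revc f).
Proof.
move=> [[N fN] fZ]; split; first by exists N => s Ns; rewrite /revc fN ?mulr0 ?size_revinv.
move=> s sD; rewrite (cobdry_wt eps (fun t => f (revinv t))) cobdry_revinv.
by rewrite fZ ?mulr0 // revinv_in.
Qed.

Lemma prodl_in D s : all (mem D) s -> prodl s \in D.
Proof. by elim: s => [|x s IHs] //= /andP[xD /IHs]; apply: groupM. Qed.

Lemma revP_eq0 D f s : (forall t, all (mem D) t -> f t = 0) -> all (mem D) s ->
  revP f s = 0.
Proof.
elim: s f => [|x s IHs] f f0 sD; rewrite /= /revT f0 ?mulr0 ?subr0 ?sub0r //=.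
- by rewrite andbT.
- rewrite IHs ?oppr0 //; last by case/andP: sD.
  by move=> t tD; apply: f0; case/andP: sD => xD _; apply/andP.
- apply/andP; split; last exact: (revinv_in sD).
  exact: (prodl_in sD).
Qed.

Lemma revc_homotopic D f : is_cocycle D f -> cob D (fun s => f s - revc f s).
Proof.
move=> [[N fN] fZ]; exists (revP f); split; first by exists N => s; apply: revP_bounded.
by move=> s sD; rewrite -revP_homotopy [X in _ + X](revP_eq0 fZ) ?addr0.
Qed.

(** The hypothesis makes the sign of the exchange a constant [a], as happens for factors of definite
    parity. *)
Lemma revc_cup (a : int) f g s :
    (forall u v, (-1) ^+ (size u * size v) * (f u * g v) = a * (f u * g v)) ->
  revc (cup f g) s = a * cup (revc g) (revc f) s.
Proof.
move=> sgn; rewrite /revc /cup size_revinv !mulr_sumr (reindex_inj rev_ord_inj) /=.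
apply: eq_bigr => i _; rewrite subSS size_drop (size_takel (leq_ord i)).
have -> : take (size s - i) (revinv s) = revinv (drop i s).
  rewrite /revinv take_rev size_map subKn ?leq_ord // map_drop //.
have -> : drop (size s - i) (revinv s) = revinv (take i s).
  by rewrite /revinv drop_rev size_map subKn ?leq_ord // map_take.
rewrite -{1}(subnKC (leq_ord i)) epsD.
have := sgn (revinv (drop i s)) (revinv (take i s)).
rewrite !size_revinv size_drop (size_takel (leq_ord i)) => E.
rewrite [RHS](_ : _ = eps i * eps (size s - i) * (a * (f (revinv (drop i s)) * g (revinv (take i s))))).
  rewrite -E (mulnC i); ring.
ring.
Qed.

End Reversal.

(** * Even and odd classes, and graded commutativity *)

Section GradedCommutativity.
Variables (gT : finGroupType) (D : {group gT}).
Implicit Types (f g : cocycle D) (x y : cohom D).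

Lemma cls_comm (b : bool) f g :
    (forall u v, (-1) ^+ (size u * size v) * (f u * g v) = (-1) ^+ b * (f u * g v)) ->
  cls f * cls g = (-1) ^+ b * (cls g * cls f).
Proof.
move=> sgn; pose r h := Cocycle (revc_cocycle (cocycleP h)) : cocycle D.
have rE h : cls (r h) = cls h.
  by apply/esym/clsP; apply: revc_homotopic; apply: cocycleP.
rewrite -clsM -rE -(rE g) -(rE f) -clsM.
have -> : (-1) ^+ b * cls (r g * r f) = cls ((-1) ^+ b * (r g * r f)).
  by case: (b); rewrite ?expr1 ?expr0 ?mulN1r ?mul1r ?clsN.
apply: cls_eq => s _.
transitivity ((-1) ^+ b * (r g * r f) s); first by apply: revc_cup.
case: b {sgn}; last by rewrite !expr0 !mul1r.
by rewrite [nat_of_bool _]/= !expr1 !mulN1r.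
Qed.

Definition is_even x := exists2 f, x = cls f & forall s, odd (size s) -> f s = 0.
Definition is_odd x := exists2 f, x = cls f & forall s, ~~ odd (size s) -> f s = 0.

Lemma even_odd_dec x : exists e o, [/\ is_even e, is_odd o & x = e + o].
Proof.
have [f ->] := cls_surj x.
exists (cls (wtc (fun m => (~~ odd m)%:R) f)), (cls (wtc (fun m => (odd m)%:R) f)).
split; last 1 first.
- rewrite -clsD; apply: cls_eq => s _ /=; rewrite /wt.
  by case: (odd _); rewrite ?mul0r ?mul1r ?add0r ?addr0.
- by eexists; first by []; move=> s /= so; rewrite /wt so mul0r.
- by eexists; first by []; move=> s /= /negPf so; rewrite /wt so mul0r.
Qed.

Lemma even_comm x y : is_even x -> x * y = y * x.
Proof.
case=> f -> f0; have [g ->] := cls_surj y.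
rewrite (@cls_comm false f g) ?mul1r // => u v.
case: (boolP (odd (size u))) => [/f0->|/negPf uo]; first by rewrite !(mul0r, mulr0).
by rewrite -signr_odd oddM uo.
Qed.

Lemma odd_anticomm x y : is_odd x -> is_odd y -> x * y = - (y * x).
Proof.
case=> f -> f0 [g -> g0].
rewrite (@cls_comm true f g) ?mulN1r // => u v.
case: (boolP (odd (size u))) => [uo|/f0->]; last by rewrite !(mul0r, mulr0).
case: (boolP (odd (size v))) => [vo|/g0->]; last by rewrite !(mul0r, mulr0).
by rewrite -signr_odd oddM uo vo.
Qed.

Lemma is_evenD x y : is_even x -> is_even y -> is_even (x + y).
Proof.
case=> f -> f0 [g -> g0]; exists (f + g); first by rewrite clsD.
by move=> s so /=; rewrite f0 ?g0.
Qed.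

Lemma is_evenN x : is_even x -> is_even (- x).
Proof.
case=> f -> f0; exists (- f); first by rewrite clsN.
by move=> s so /=; rewrite f0 ?oppr0.
Qed.

Lemma is_oddD x y : is_odd x -> is_odd y -> is_odd (x + y).
Proof.
case=> f -> f0 [g -> g0]; exists (f + g); first by rewrite clsD.
by move=> s so /=; rewrite f0 ?g0.
Qed.

Lemma cup_parity (f g : seq gT -> int) (a b : bool) s :
    (forall s, odd (size s) != a -> f s = 0) ->
    (forall s, odd (size s) != b -> g s = 0) ->
  odd (size s) != a (+) b -> cup f g s = 0.
Proof.
move=> fa gb sab; rewrite /cup big1 // => i _.
have [ta|/fa->] := eqVneq (odd (size (take i s))) a; last by rewrite mul0r.
rewrite gb ?mulr0 //; apply: contraNneq sab => <-; rewrite -ta -oddD.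
by rewrite -size_cat cat_take_drop.
Qed.

Lemma is_evenM x y : is_even x -> is_even y -> is_even (x * y).
Proof.
case=> f -> f0 [g -> g0]; exists (f * g); first by rewrite clsM.
move=> s so; apply: (@cup_parity _ _ false false) => [t|t|]; rewrite /= ?so //.
  by move=> tt; apply: f0; case: odd tt.
by move=> tt; apply: g0; case: odd tt.
Qed.

Lemma odd_oddM x y : is_odd x -> is_odd y -> is_even (x * y).
Proof.
case=> f -> f0 [g -> g0]; exists (f * g); first by rewrite clsM.
move=> s so; apply: (@cup_parity _ _ true true) => [t|t|]; rewrite /= ?so //.
  by move=> tt; apply: f0; case: odd tt.
by move=> tt; apply: g0; case: odd tt.
Qed.

Lemma even_oddM x y : is_even x -> is_odd y -> is_odd (x * y).
Proof.
case=> f -> f0 [g -> g0]; exists (f * g); first by rewrite clsM.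
move=> s so; apply: (@cup_parity _ _ false true) => [t|t|]; rewrite /= ?(negPf so) //.
  by move=> tt; apply: f0; case: odd tt.
by move=> tt; apply: g0; case: odd tt.
Qed.

Lemma even_nat n : is_even n%:R.
Proof.
exists n%:R; first by rewrite cls_nat.
by case=> // a s _; rewrite cocycle_natE mulr0.
Qed.

Lemma is_evenX x n : is_even x -> is_even (x ^+ n).
Proof.
move=> xe; elim: n => [|n IHn]; first exact: (even_nat 1).
by rewrite exprS; apply: is_evenM.
Qed.

(** Projection onto the even degrees is well defined on classes. *)
Lemma even_odd_eq0 x y : is_even x -> is_odd y -> x + y = 0 -> x = 0 /\ y = 0.
Proof.
case=> f -> f0 [g -> g0] fg0; suff f00 : cls f = 0 by rewrite f00 add0r in fg0.
have E : cls (f + g) = cls 0 by rewrite clsD fg0 cls0.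
have := cls_wt (fun m => (~~ odd m)%:R) E.
rewrite (_ : cls (wtc _ 0) = 0); last first.
  rewrite -cls0.
  by apply: cls_eq => s _ /=; rewrite /wt mulr0.
move=> <-; apply: cls_eq => s _ /=; rewrite /wt.
case: (boolP (odd _)) => so /=; first by rewrite f0 ?mul0r.
by rewrite g0 // addr0 mul1r.
Qed.

Lemma odd_sqr x : is_odd x -> x ^+ 2 *+ 2 = 0.
Proof.
move=> xo; rewrite expr2 mulr2n; apply/eqP.
by rewrite addr_eq0; apply/eqP; exact: odd_anticomm.
Qed.

End GradedCommutativity.

(** * Integral cohomology modulo 7 and nilpotents *)

Section Reduction.
Variables (gT : finGroupType) (D : {group gT}).
Implicit Types (f g : cocycle D) (x y e o a w : cohom D).

Definition div7 x := exists w, x = w *+ 7.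

Lemma div7D x y : div7 x -> div7 y -> div7 (x + y).
Proof. by move=> [w ->] [w' ->]; exists (w + w'); rewrite mulrnDl. Qed.
Lemma div7Ml a x : div7 x -> div7 (a * x).
Proof. by move=> [w ->]; exists (a * w); rewrite mulrnAr. Qed.
Lemma div7Mr a x : div7 x -> div7 (x * a).
Proof. by move=> [w ->]; exists (w * a); rewrite mulrnAl. Qed.
Lemma div70 : div7 0. Proof. by exists 0; rewrite mul0rn. Qed.
Lemma div7N x : div7 x -> div7 (- x).
Proof. by move=> [w ->]; exists (- w); rewrite mulNrn. Qed.

(** As [2 o^2 = 0], one has [o^2 = 7 o^2]. *)
Lemma odd_sqr_div7 o : is_odd o -> div7 (o * o).
Proof.
move=> oo; exists (o ^+ 2); rewrite -expr2 (mulrnDr _ 6 1) mulr1n.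
by rewrite (mulrnA _ 2 3) odd_sqr // mul0rn add0r.
Qed.

Definition even_pn e := is_even e /\ exists k, div7 (e ^+ k).

Lemma even_pnD e1 e2 : even_pn e1 -> even_pn e2 -> even_pn (e1 + e2).
Proof.
move=> [ev1 [k1 d1]] [ev2 [k2 d2]]; split; first exact: is_evenD.
exists (k1 + k2)%N; rewrite exprDn_comm; last exact: even_comm.
elim/big_ind: _ => [|x y|i _]; [exact: div70|exact: div7D|].
suff [w ->] : div7 (e1 ^+ (k1 + k2 - i) * e2 ^+ i).
  by rewrite -mulrnA mulnC mulrnA; exists (w *+ 'C(k1 + k2, i)).
have [lei|lti] := leqP k2 i.
  by apply: div7Ml; rewrite -(subnKC lei) exprD; apply: div7Mr.
apply: div7Mr; rewrite -[(_ - _)%N](@subnKC k1) ?exprD; first exact: div7Mr.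
by rewrite -addnBA ?leq_addr // ltnW.
Qed.

Lemma even_pnM a e : is_even a -> even_pn e -> even_pn (a * e).
Proof.
move=> ae [ev [k d]]; split; first exact: is_evenM.
by exists k; rewrite exprMn_comm; [apply: div7Ml|apply: even_comm].
Qed.

Lemma odd_odd_pn o o' : is_odd o -> is_odd o' -> even_pn (o * o').
Proof.
move=> oo oo'; split; first exact: odd_oddM.
exists 2%N; rewrite expr2 -!mulrA; apply: div7Ml.
rewrite mulrA (odd_anticomm oo' oo) mulNr -mulrA; apply: div7N.
by apply: div7Ml; apply: odd_sqr_div7.
Qed.

(** An explicit description of the kernel of the reduction, in place of the ideal generated by 7 and
    the nilpotents; [redq0P] identifies the two. *)
Definition pnil x := exists e o, [/\ x = e + o, even_pn e & is_odd o].

(** Even classes are central and the square of an odd class vanishes modulo 7, so only the terms at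
    most linear in [o] survive. *)
Lemma expr_even_odd e o n : is_even e -> is_odd o ->
  exists a w, is_even a /\ (e + o) ^+ n = e ^+ n + a * o + w *+ 7.
Proof.
move=> ev od; elim: n => [|n [a [w [av E]]]].
  exists 0, 0; split; first exact: (even_nat _ 0).
  by rewrite !expr0 mul0r mul0rn !addr0.
have [u uE] : div7 (a * (o * o)) by apply/div7Ml/odd_sqr_div7.
exists (a * e + e ^+ n), (w * (e + o) + u); split.
  by apply: is_evenD; [apply: is_evenM|apply: is_evenX].
rewrite exprSr E mulrDl [w *+ 7 * _]mulrnAl [(w * _ + u) *+ 7]mulrnDl.
move: (w * (e + o) *+ 7) => W.
rewrite mulrDl !mulrDr -exprSr -[a * o * e]mulrA -(even_comm o ev) mulrA.
rewrite -[a * o * o]mulrA uE; move: (u *+ 7) => U.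
rewrite !mulrDl -!addrA; congr (_ + _); rewrite addrCA.
by congr (_ + (_ + _)); rewrite addrC.
Qed.

Local Notation redq := (qclass (@p_or_nilpotent _ D 7)).

Lemma redq7 : (7 : redcohom D 7) = 0.
Proof.
rewrite -(rmorph_nat redq) -(rmorph0 redq); apply/qclassP; rewrite subr0.
by apply: IdealGen; left.
Qed.

Lemma red_mulrn7 (z : redcohom D 7) : z *+ 7 = 0.
Proof. by rewrite -mulr_natr redq7 mulr0. Qed.

Lemma redq_div7 x : div7 x -> redq x = 0.
Proof. by case=> w ->; rewrite rmorphMn /= red_mulrn7. Qed.

Lemma redq_nil x n : x ^+ n = 0 -> redq x = 0.
Proof.
move=> xn; rewrite -(rmorph0 redq); apply/qclassP; rewrite subr0.
by apply: IdealGen; right; exists n.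
Qed.

Lemma red_cancel m (z : redcohom D 7) : coprime m 7 -> z *+ m = 0 -> z = 0.
Proof.
case: (posnP m) => [->|m0] // /coprimeP - /(_ m0)[[u t] /= E zm].
have E' : (u * m = t * 7 + 1)%N by lia.
have := congr1 (fun k => z *+ k) E'; rewrite /= mulnC mulrnA zm mul0rn mulrnDr.
by rewrite mulnC mulrnA red_mulrn7 mul0rn add0r.
Qed.

Lemma redq_odd o : is_odd o -> redq o = 0.
Proof.
(* Modulo 7 the factor 8 is 1, while [(8 o)^2 = 64 o^2] vanishes because [2 o^2 = 0]. *)
move=> od; have : redq (o *+ 8) = 0.
  apply: (@redq_nil _ 2); rewrite expr2 mulrnAl mulrnAr -mulrnA -expr2.
  by rewrite (mulrnA _ 2 32) odd_sqr // mul0rn.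
by rewrite rmorphMn (mulrnDr _ 7 1) red_mulrn7 add0r.
Qed.

(** Divisibility of a power by 7 does not yet give nilpotency. The degree-0 part is an integer
    divisible by 7 and is removed. After multiplication by the prime-to-7 part of [#|D|], a high
    power is a multiple of [#|D|], hence zero by [card_kills]; the factor prime to 7 is then
    cancelled. *)
Lemma redq_even_pn e : even_pn e -> redq e = 0.
Proof.
case=> ev [k [w E]]; have [f Ef _] := ev.
case: k E => [|k] E.
  by rewrite -[e]mul1r -(expr0 e); apply/redq_div7/div7Mr; exists w.
have [g Eg] := cls_surj w.
have /cls_nil : cls (f ^+ k.+1) = cls (g *+ 7) by rewrite clsX -Ef E Eg /cls rmorphMn.
rewrite cocycleX_nil cocycle_mulrnE => Ec.
have [c Ec'] : exists c : int, f [::] = c * 7.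
  have d7 : (7 %| (f [::])%R ^+ k.+1)%Z.
    by rewrite Ec -[g _ *+ 7]mulr_natr dvdz_mull.
  move: d7; rewrite dvdzE abszX Euclid_dvdX // => /andP[d7 _].
  by apply/dvdzP; rewrite dvdzE.
pose f' := f - (c%:~R : cocycle D) *+ 7.
have zE (z : int) s : (z%:~R : cocycle D) s = z * cup1 s.
  case: z => m; first by rewrite -[X in X * cup1 s]natz; apply: cocycle_natE.
  by rewrite NegzE mulrNz -pmulrn -natz mulNr -(cocycle_natE D).
have f'0 : f' [::] = 0.
  rewrite /f' [LHS]/= cocycle_mulrnE zE Ec' /cup1 eqxx mulr1.
  by ring.
have redf' : redq (cls f') = redq e.
  rewrite Ef clsD clsN rmorphD rmorphN /= [redq (cls (_ *+ 7))]redq_div7 ?subr0 //.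
  by exists (cls c%:~R); rewrite /cls rmorphMn.
have evf' : is_even (cls f').
  rewrite clsD -Ef; apply: is_evenD => //; rewrite clsN; apply: is_evenN.
  exists (c%:~R *+ 7) => // -[|x s] // so; by rewrite cocycle_mulrnE zE /cup1 mulr0 mul0rn.
have [w' [E' w'0]] : exists w' : cocycle D, cls f' ^+ k.+1 = cls w' *+ 7 /\ w' [::] = 0.
  have [u Eu] : div7 (cls f' ^+ k.+1).
    have -> : cls f' = e - (cls c%:~R) *+ 7 by rewrite Ef clsD clsN /cls rmorphMn.
    rewrite exprBn_comm; last exact: even_comm.
    elim/big_ind: _ => [|x y|i _]; [exact: div70|exact: div7D|].
    case: (posnP i) => [->|i0].
      by exists w; rewrite bin0 mulr1n expr0 mul1r mulr1 subn0 E.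
    have [v ->] : div7 ((-1) ^+ i * e ^+ (k.+1 - i) * (cls c%:~R *+ 7) ^+ i).
      apply: div7Ml; rewrite -(prednK i0) exprS; apply: div7Mr.
      by exists (cls c%:~R).
    by exists (v *+ 'C(k.+1, i)); rewrite -!mulrnA mulnC.
  have [w' Ew'] := cls_surj u; exists w'; split; first by rewrite -Ew'.
  have /cls_nil : cls (f' ^+ k.+1) = cls (w' *+ 7) by rewrite clsX Eu Ew' /cls rmorphMn.
  rewrite cocycleX_nil f'0 expr0n cocycle_mulrnE => /esym/eqP.
  by rewrite Num.Theory.mulrn_eq0 /= => /eqP.
rewrite -redf'.
(* The successor keeps [a] positive, so that [w' ^+ a] still vanishes in degree 0 when 7 does not
   divide [#|D|]. *)
pose a := (logn 7 #|D|).+1; pose m := (#|D|`_7^')%N.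
have cm : coprime m 7 by rewrite coprime_sym prime_coprime // -p'natE // part_pnat.
apply: (red_cancel cm); rewrite -rmorphMn; apply: (@redq_nil _ (k.+1 * a)).
have -> : (cls f' *+ m) ^+ (k.+1 * a) = (cls (w' ^+ a) *+ 7 ^ a) *+ m ^ (k.+1 * a).
  by rewrite exprMn_n exprM E' exprMn_n -clsX.
have w'a0 : (w' ^+ a) [::] = 0 by rewrite cocycleX_nil w'0 expr0n.
have dv : (#|D| %| 7 ^ a * m ^ (k.+1 * a))%N.
  rewrite -[X in (X %| _)%N](partnC 7%N (cardG_gt0 D)) dvdn_mul //.
    by rewrite p_part dvdn_exp2l.
  by rewrite -[X in (X %| _)%N]expn1 dvdn_exp2l // muln_gt0.
by case/dvdnP: dv => q q7; rewrite -mulrnA q7 mulnC mulrnA card_kills // mul0rn.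
Qed.

Lemma redq_pnil x : pnil x -> redq x = 0.
Proof. by case=> e [o [-> ep od]]; rewrite rmorphD /= redq_even_pn // redq_odd // addr0. Qed.

Lemma div7_even x y : is_even x -> is_odd y -> div7 (x + y) -> div7 x.
Proof.
move=> xe yo [w E]; have [e [o [ee oo wE]]] := even_odd_dec w.
suff [/eqP] : x - e *+ 7 = 0 /\ y - o *+ 7 = 0 by rewrite subr_eq0 => /eqP ->; exists e.
apply: even_odd_eq0.
- apply: is_evenD => //; apply: is_evenN; rewrite -mulr_natr.
  by apply: is_evenM => //; apply: even_nat.
- have oN : is_odd (- (o *+ 7)).
    rewrite -mulNrn -mulr_natl; apply: even_oddM; first exact: even_nat.
    by rewrite -mulN1r; apply: even_oddM => //; apply/is_evenN/(even_nat _ 1).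
  exact: is_oddD.
- by rewrite addrACA E wE mulrnDl -opprD subrr.
Qed.

(** By [expr_even_odd] the even part of [x^n] is [e^n] modulo 7, so a power of [e] is divisible by 7
    as soon as a power of that even part is. *)
Lemma pnil_of_expr x n : pnil (x ^+ n) -> pnil x.
Proof.
have [e [o [ev od ->]]] := even_odd_dec x.
have [a [w [av ->]]] := expr_even_odd n ev od.
case=> e' [o' [E [ev' [k dk]] od']].
have d7 : div7 (e ^+ n - e').
  have od'' : is_odd (a * o - o').
    apply: is_oddD; first exact: even_oddM.
    by rewrite -mulN1r; apply: even_oddM => //; apply/is_evenN/(even_nat _ 1).
  apply: (div7_even _ od''); first by apply: is_evenD; [apply: is_evenX|apply: is_evenN].
  exists (- w); rewrite addrACA -opprD -E mulNrn.
  by rewrite opprD addrA subrr add0r.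
exists e, o; split=> //; split=> //; exists (n * k)%N.
have [u Eu] := d7; have -> : e ^+ (n * k) = (e' + u *+ 7) ^+ k.
  by rewrite exprM -Eu addrC subrK.
rewrite exprDn_comm; last exact: even_comm.
elim/big_ind: _ => [|y z|i _]; [exact: div70|exact: div7D|].
case: (posnP i) => [->|i0].
  by rewrite bin0 mulr1n expr0 mulr1 subn0.
have [v ->] : div7 (e' ^+ (k - i) * (u *+ 7) ^+ i).
  apply: div7Ml; rewrite -(prednK i0) exprS; apply: div7Mr; by exists u.
by exists (v *+ 'C(k, i)); rewrite -!mulrnA mulnC.
Qed.

Lemma even_pn0 : even_pn 0.
Proof. by split; [exact: (even_nat _ 0)|exists 1%N; exact: div70]. Qed.

Lemma is_odd0 : is_odd (0 : cohom D).
Proof. by exists 0; rewrite ?cls0. Qed.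

Lemma pnilD x y : pnil x -> pnil y -> pnil (x + y).
Proof.
move=> [e [o [-> ep od]]] [e' [o' [-> ep' od']]]; exists (e + e'), (o + o').
by split; [rewrite addrACA|exact: even_pnD|exact: is_oddD].
Qed.

Lemma pnil_even e : even_pn e -> pnil e.
Proof. by exists e, 0; rewrite addr0; split=> //; exact: is_odd0. Qed.

Lemma pnil_odd o : is_odd o -> pnil o.
Proof. by exists 0, o; rewrite add0r; split=> //; exact: even_pn0. Qed.

Lemma pnilMl a x : pnil x -> pnil (a * x).
Proof.
move=> [e [o [-> ep od]]]; have [ea [oa [eav oad ->]]] := even_odd_dec a.
rewrite mulrDl !mulrDr; have [ev _] := ep.
apply: pnilD; apply: pnilD.
- by apply/pnil_even/even_pnM.
- by apply/pnil_odd/even_oddM.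
- by rewrite -(even_comm _ ev); apply/pnil_odd/even_oddM.
- by apply/pnil_even/odd_odd_pn.
Qed.

Lemma pnilMr a x : pnil x -> pnil (x * a).
Proof.
move=> px; have [e [o [xE ep od]]] := px; have [ev _] := ep.
rewrite xE mulrDl; apply: pnilD; first by rewrite even_comm //; apply/pnilMl/pnil_even.
have [ea [oa [eav oad ->]]] := even_odd_dec a; rewrite mulrDr; apply: pnilD.
  by rewrite -(even_comm _ eav); apply/pnilMl/pnil_odd.
by apply/pnil_even/odd_odd_pn.
Qed.

Lemma redq0P x : redq x = 0 <-> pnil x.
Proof.
split; last exact: redq_pnil.
move/eqP; rewrite -(rmorph0 redq) => /eqP/qclassP; rewrite subr0.
elim=> {x} [x [->|[n xn]]||x y _ px _ py|a x _ px|a x _ px].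
- apply: pnil_even; split; first exact: even_nat.
  by exists 1%N, 1; rewrite expr1.
- by apply: (@pnil_of_expr _ n); rewrite xn; apply/pnil_even/even_pn0.
- exact/pnil_even/even_pn0.
- exact: pnilD.
- exact: pnilMl.
- exact: pnilMr.
Qed.

Lemma red_surj (z : redcohom D 7) : exists x, z = redq x.
Proof. by exists (repr z); rewrite qclassK. Qed.

Lemma red_reduced (z : redcohom D 7) n : z ^+ n = 0 -> z = 0.
Proof.
have [x ->] := red_surj z; rewrite -rmorphXn => /redq0P/pnil_of_expr.
by move/redq_pnil.
Qed.

Lemma red_even_rep (z : redcohom D 7) :
  exists2 f : cocycle D, z = redclass 7 f & forall s, odd (size s) -> f s = 0.
Proof.
have [x ->] := red_surj z; have [e [o [[f Ef f0] od ->]]] := even_odd_dec x.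
by exists f => //; rewrite rmorphD /= (redq_odd od) addr0 Ef.
Qed.

Lemma red_comm (z t : redcohom D 7) : z * t = t * z.
Proof.
have [f -> f0] := red_even_rep z; have [g -> _] := red_even_rep t.
have fe : is_even (cls f) by exists f.
transitivity (redq (cls f * cls g)); first by rewrite rmorphM.
by rewrite (even_comm _ fe) rmorphM.
Qed.

(** Turns vanishing in the reduced ring into a single divisibility in integral cohomology, to which
    cochain arguments apply. *)
Lemma redclass0P f : (forall s, odd (size s) -> f s = 0) ->
  redclass 7 f = 0 <-> exists k, div7 (cls f ^+ k).
Proof.
move=> f0; have ef : is_even (cls f) by exists f.
split=> [/redq0P [e [o [E ep od]]]|dk]; last by apply: redq_even_pn.
have [ee [k dk]] := ep; exists k; suff -> : cls f = e by [].
have [/eqP] : cls f - e = 0 /\ - o = 0; last by rewrite subr_eq0 => /eqP.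
apply: even_odd_eq0; first by apply: is_evenD => //; apply: is_evenN.
  by rewrite -mulN1r; apply: even_oddM => //; apply/is_evenN/(even_nat _ 1).
by rewrite -addrA -opprD -E subrr.
Qed.

End Reduction.

(** * Cup products over an action groupoid *)

Section TwistedCup.
Variables (gT : finGroupType) (D : {group gT}) (X : Type) (act : X -> gT -> X).
Variable P : X -> Prop.
Hypothesis actM : forall x, {in D &, forall g h, act x (g * h)%g = act (act x g) h}.
Hypothesis actP : forall x g, P x -> g \in D -> P (act x g).
Implicit Types (A B : X -> seq gT -> int) (f : seq gT -> int).

(** The second factor is evaluated at the point reached after the first has consumed its arrows. *)
Fixpoint cupP f B x s : int :=
  f [::] * B x s + (if s is g :: t then cupP (fun u => f (g :: u)) B (act x g) t else 0).

Lemma cupP_cons f B x g t : cupP f B x (g :: t) =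
  f [::] * B x (g :: t) + cupP (fun u => f (g :: u)) B (act x g) t.
Proof. by []. Qed.

Lemma eq_cupP f f' B x s : f =1 f' -> cupP f B x s = cupP f' B x s.
Proof.
elim: s f f' x => [|g t IHt] f f' x ff /=; rewrite ff //.
by congr (_ + _); apply: IHt => u.
Qed.

Lemma cupPD f f' B x s : cupP (fun t => f t + f' t) B x s = cupP f B x s + cupP f' B x s.
Proof. elim: s f f' x => [|g t IHt] f f' x /=; rewrite ?IHt; ring. Qed.

Lemma cupPN f B x s : cupP (fun t => - f t) B x s = - cupP f B x s.
Proof. elim: s f x => [|g t IHt] f x /=; rewrite ?IHt; ring. Qed.

Lemma cupPB f f' B x s : cupP (fun t => f t - f' t) B x s = cupP f B x s - cupP f' B x s.
Proof. by rewrite cupPD cupPN. Qed.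

Lemma eq_cupP_in f f' B B' x s : P x -> all (mem D) s ->
    (forall t, all (mem D) t -> f t = f' t) ->
    (forall y t, P y -> all (mem D) t -> B y t = B' y t) ->
  cupP f B x s = cupP f' B' x s.
Proof.
move=> Px sD ff BB; elim: s f f' x Px sD ff => [|g t IHt] f f' x Px /=.
  by move=> _ ff; rewrite ff ?BB.
case/andP=> gD tD ff; rewrite ff ?BB //; last by apply/andP.
congr (_ + _); apply: IHt => //; first exact: actP.
by move=> u uD; apply: ff; apply/andP.
Qed.

Lemma cupP0l B x s : cupP (fun _ => 0) B x s = 0.
Proof. by elim: s x => [|g t IHt] x /=; rewrite ?IHt mul0r ?addr0. Qed.

Lemma cupP0r f x s : cupP f (fun _ _ => 0) x s = 0.
Proof. by elim: s f x => [|g t IHt] f x /=; rewrite ?IHt mulr0 ?addr0. Qed.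

Lemma cupP_const f (b : seq gT -> int) x s : cupP f (fun _ => b) x s = cup f b s.
Proof.
elim: s f x => [|g t IHt] f x /=; first by rewrite cup_nil addr0.
by rewrite cup_cons IHt.
Qed.

Lemma cupP_bounded f B N M x s : (forall t, (N < size t)%N -> f t = 0) ->
  (forall x t, (M < size t)%N -> B x t = 0) -> (N + M < size s)%N -> cupP f B x s = 0.
Proof.
move=> fN BM; elim: s f N x fN => [|g t IHt] f N x fN //= Ns.
rewrite BM ?mulr0 ?add0r; last by apply: leq_ltn_trans Ns; rewrite leq_addl.
case: N fN Ns => [|N] fN Ns.
  rewrite (@eq_cupP _ (fun _ => 0)) ?cupP0l // => u; exact: fN.
by apply: (IHt _ N) => // u uN; apply: fN.
Qed.

Let sgn : nat -> int := fun n => (-1) ^+ n.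

Lemma cobX_cupP f B x s : all (mem D) s ->
  cobX act (cupP f B) x s = cupP (cobdry f) B x s + cupP (wt sgn f) (cobX act B) x s.
Proof.
elim: s f x => [|g [|h t] IHs] f x.
- by rewrite /= cobdry_nil mul0r mulr0.
- by move=> _; rewrite /cobX /= !cobdry1 /wt /sgn /=; ring.
case/andP=> gD htD; have /andP[hD tD] : all (mem D) (h :: t) by [].
have := IHs (fun u => f (g :: u)) (act x g) htD.
set fg := fun u => f (g :: u) => IH.
have -> : cupP (wt sgn f) (cobX act B) x [:: g, h & t] =
    f [::] * cobX act B x [:: g, h & t] - cupP (wt sgn fg) (cobX act B) (act x g) (h :: t).
  rewrite cupP_cons -cupPN; congr (_ + _); first by rewrite /wt /sgn mul1r.
  by apply: eq_cupP => u; rewrite /wt /sgn /= exprS mulN1r mulNr.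
have -> : cupP (cobdry f) B x [:: g, h & t] =
    cupP (fun u => f (h :: u)) B (act (act x g) h) t
    - cupP (fun u => f ((g * h)%g :: u)) B (act (act x g) h) t
    + cupP fg B (act (act x g) h) t - cupP (cobdry fg) B (act x g) (h :: t).
  rewrite !cupP_cons !cobdry_nil !cobdry1 !mul0r !add0r -cupPB -cupPD -cupPB.
  by apply: eq_cupP => u; rewrite cobdry_cons2.
rewrite cobX_cons2 !(cupP_cons f).
have -> : cobdry (fun t => cupP f B x (g :: t)) (h :: t) =
   f [::] * cobdry (fun t => B x (g :: t)) (h :: t) + cobdry (cupP fg B (act x g)) (h :: t).
  by rewrite -cobdryZ -cobdryD.
rewrite [cobX act B x _]cobX_cons2 actM //.
move: IH; rewrite {1}/cobX -/fg; set c := cobdry (cupP fg _ _) _ => IH.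
move: IH; set q := cupP (cobdry fg) _ _ _; set r := cupP (wt sgn fg) _ _ _ => IH.
have -> : c = q + r - cupP fg B (act (act x g) h) t + cupP fg B (act x g) t.
  by rewrite -IH; ring.
ring.
Qed.

Definition cupX A B x s := cupP (A x) B x s.

Lemma cobX_cupX A B x s : all (mem D) s ->
  cobX act (cupX A B) x s =
  cupX (cobX act A) B x s + cupX (fun x => wt sgn (A x)) (cobX act B) x s.
Proof.
case: s => [|g t] sD; first by rewrite /= /cupX /= mul0r mulr0.
have := cobX_cupP (A x) B x sD; rewrite {1}/cobX => E.
rewrite {1}/cobX /cupX [cupP (cobX act A x) _ _ _]/= mul0r add0r.
have -> : cupP (fun u => cobX act A x (g :: u)) B (act x g) t =
    cupP (cobdry (A x)) B x (g :: t)
    + (cupP (A (act x g)) B (act x g) t - cupP (A x) B (act x g) t).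
  by rewrite cupP_cons cobdry_nil mul0r add0r -cupPB -cupPD.
move: E; set c := cobdry _ _ => E.
have -> : c = cupP (cobdry (A x)) B x (g :: t) + cupP (wt sgn (A x)) (cobX act B) x (g :: t)
  - (cupP (A x) B (act x g) t - cupP (A x) B x t) by rewrite -E; ring.
ring.
Qed.

Lemma boundedX_cupX A B : boundedX A -> boundedX B -> boundedX (cupX A B).
Proof.
move=> [N AN] [M BM]; exists (N + M)%N => x s.
by apply: cupP_bounded => // t; apply: AN.
Qed.

End TwistedCup.

(** * Bockstein classes of characters, and divisibility by them *)

Section Carry.
Implicit Types x a b : 'F_7.

(** The 2-cocycle of [Z] as an extension of [Z/7] by [7 Z]; its pullback along a character
    represents the Bockstein. *)
Definition carry x a : int := ((x + a)%N %/ 7)%N.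
Definition wrap x : int := (x == -1)%:R.

Lemma F7_addE x a : (x + a)%R = ((x + a)%N %% 7)%N :> nat.
Proof. by []. Qed.

Lemma F7_lt x : (x < 7)%N.
Proof. exact: (ltn_ord x). Qed.

Lemma carryE x a : 7 * carry x a = (x : nat)%:Z + (a : nat)%:Z - ((x + a)%R : nat)%:Z.
Proof. rewrite F7_addE /carry; lia. Qed.

Lemma carry_cocycle x a b :
  carry (x + a) b - carry x (a + b) + carry x a = carry a b.
Proof.
apply: (@mulfI int 7) => //; rewrite mulrDr mulrBr !carryE (addrA x); ring.
Qed.

Lemma wrapE x : ((x + 1)%R : nat)%:Z = (x : nat)%:Z + 1 - 7 * wrap x.
Proof.
suff: [forall x : 'F_7, ((x + 1)%R : nat)%:Z == (x : nat)%:Z + 1 - 7 * wrap x].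
  by move/forallP/(_ x)/eqP.
by apply/forallP; case=> -[|[|[|[|[|[|[|]]]]]]].
Qed.

(** Moving [x] by one step changes the carry by a coboundary over [Z/7], which allows summation by
    parts against [wrap]. *)
Lemma carry_shift x a : carry (x + 1) a - carry x a = wrap (x + a) - wrap x.
Proof.
apply: (@mulfI int 7) => //; rewrite !mulrBr !carryE (addrAC x 1) !wrapE; ring.
Qed.

Lemma carry00 : carry 0 0 = 0. Proof. by []. Qed.

End Carry.

Section Bockstein.
Variables (gT : finGroupType) (D : {group gT}) (chi : gT -> 'F_7).
Hypothesis chiM : {in D &, forall g h, chi (g * h)%g = chi g + chi h}.

Definition bock_cochain (s : seq gT) : int :=
  if s is [:: g; h] then carry (chi g) (chi h) else 0.

Fact bock_cocycle : is_cocycle D bock_cochain.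
Proof.
split; first by exists 2%N; do 3!case=> [|? ] //.
move=> s sD; have [s3|s3] := eqVneq (size s) 3%N; last first.
  rewrite (@eq_cobdry_size _ _ (fun _ => 0)) ?cobdry0 // => t ts.
  by case: t ts => [|? [|? [|? ?]]] //= ts; rewrite -ts eqxx in s3.
case: s s3 sD => [|a [|b [|c [|? ?]]]] // _ /and4P[aD bD cD _].
rewrite !cobdry_cons2 !cobdry1 /= !chiM // -(carry_cocycle (chi a) (chi b)); ring.
Qed.

Definition bock : cocycle D := Cocycle bock_cocycle.

Lemma cup_bock f g h s : cup bock_cochain f [:: g, h & s] = carry (chi g) (chi h) * f s.
Proof.
rewrite !cup_cons /= !mul0r !add0r /cup big_ord_recl take0 drop0 /=.
by rewrite big1 ?addr0 // => i _; case: s i => [|a s] [i ?] //=; rewrite mul0r.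
Qed.

Lemma cup_bock1 f g : cup bock_cochain f [:: g] = 0.
Proof. by rewrite cup_cons cup_nil /= !mul0r. Qed.

Lemma bock_killed7 : cls bock *+ 7 = 0.
Proof.
have -> : cls bock *+ 7 = cls (bock *+ 7) by rewrite /cls rmorphMn.
rewrite cls0P; exists (fun s => if s is [:: g] then (chi g : nat)%:Z else 0); split.
  by exists 1%N; do 2!case=> [|?] //.
move=> s sD; rewrite cocycle_mulrnE.
have [s2|s2] := eqVneq (size s) 2%N; last first.
  rewrite (@eq_cobdry_size _ _ (fun _ => 0)) ?cobdry0 => [|t ts].
    by case: s s2 {sD} => [|? [|? [|? ?]]] //= _; rewrite mul0rn.
  by case: t ts => [|? [|? ?]] //= ts; rewrite -ts eqxx in s2.
case: s s2 sD => [|a [|b [|c ?]]] // _ /and3P[aD bD _].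
rewrite cobdry_cons2 cobdry1 chiM // -mulr_natl.
rewrite [LHS](_ : _ = 7 * carry (chi a) (chi b)) // carryE; ring.
Qed.

Let act (x : 'F_7) (g : gT) := x + chi g.

Let chi1 : chi 1%g = 0.
Proof. by apply: (@addrI _ (chi 1%g)); rewrite -chiM // mulg1 addr0. Qed.

Let chiV g : g \in D -> chi g^-1%g = - chi g.
Proof.
move=> gD; apply/eqP; rewrite -subr_eq0 opprK -chiM ?groupV // mulVg.
by rewrite chi1.
Qed.

Let act1 x : act x 1%g = x. Proof. by rewrite /act chi1 addr0. Qed.
Let actM x : {in D &, forall g h, act x (g * h)%g = act (act x g) h}.
Proof. by move=> g h gD hD; rewrite /act chiM // addrA. Qed.

Lemma sum_F7_shift (R : nmodType) (F : 'F_7 -> R) a : \sum_x F (x + a) = \sum_x F x.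
Proof. by rewrite [RHS](reindex_inj (addIr a)). Qed.

Let sum_cobX7 (F : 'F_7 -> seq gT -> int) s : all (mem D) s ->
  \sum_x cobX act F x s = cobdry (fun s => \sum_x F x s) s.
Proof.
move=> sD; have := @sum_cobX _ D 'F_7 act [set: 'F_7] act1 actM _ F s sD.
rewrite (eq_bigl xpredT) => [|x]; last by rewrite inE.
move=> -> //; apply: eq_cobdry => t; by apply: eq_bigl => x; rewrite inE.
Qed.

(* Quillen-Venkov: summation by parts over the coset space [Z/7] of the kernel
   turns a trivialisation of [f] over that space, together with a
   trivialisation of its variation, into a multiple of the Bockstein. *)
Lemma bock_transgression (f : cocycle D) F K : boundedX F -> boundedX K ->
    (forall x s, all (mem D) s -> cobX act F x s = f s) ->
    (forall x s, all (mem D) s -> F (x + 1) s - F x s = cobX act K x s) ->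
  exists w, cls f = cls bock * cls w.
Proof.
move=> FB KB FE KE.
have wC : is_cocycle D (fun s => \sum_x K x s).
  split=> [|s sD]; first by apply: bounded_sum => x _; apply: boundedX_at.
  rewrite -sum_cobX7 // (eq_bigr (fun x => F (x + 1) s - F x s)); last first.
    by move=> x _; rewrite KE.
  by rewrite sumrB (sum_F7_shift (fun x => F x s)) subrr.
(* [carry] is a 1-cochain of the action groupoid whose coboundary is the Bockstein. [W] is its
   product with a translate of [K]; the shift by -1 comes from summation by parts. *)
pose W x s : int := if s is g :: t then carry x (chi g) * K (x + chi g - 1) t else 0.
have WB : boundedX W.
  have [N KN] := KB; exists N.+1 => x [|g t] //= Nt.
  by rewrite KN ?mulr0.
exists (Cocycle wC); rewrite -clsM clsP.
exists (fun s => \sum_x (wrap x * F x s - W x s)); split.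
  apply: bounded_sum => x _; apply: (@boundedX_at _ _ (fun x s => wrap x * F x s - W x s) x).
  apply: boundedXD; last exact: boundedXN.
  by have [N FN] := FB; exists N => y s Ns; rewrite FN ?mulr0.
move=> s sD; rewrite [LHS]/= -/(bock_cochain).
rewrite (eq_cobdry (g := fun s => (\sum_x wrap x * F x s) - \sum_x W x s)); last first.
  by move=> t; rewrite sumrB.
rewrite cobdryB -!sum_cobX7 //.
have sum_wrap : \sum_x wrap x = 1.
  by rewrite (bigD1 (-1)) //= /wrap eqxx big1 ?addr0 // => x /negPf->.
(* Summation by parts in [x]: [carry_shift] supplies the differences of [wrap]. *)
have E1 g t : all (mem D) (g :: t) -> \sum_x cobX act (fun x s => wrap x * F x s) x (g :: t)
    = f (g :: t) + \sum_x carry x (chi g) * - cobX act K (x + chi g - 1) t.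
  move=> gtD; have /andP[gD tD] := gtD.
  have -> : f (g :: t) = \sum_x wrap x * cobX act F x (g :: t).
    rewrite (eq_bigr (fun x => wrap x * f (g :: t))) => [|x _]; last by rewrite FE.
    by rewrite -mulr_suml sum_wrap mul1r.
  have -> : \sum_x carry x (chi g) * - cobX act K (x + chi g - 1) t =
      \sum_x (wrap (x + chi g) - wrap x) * F (x + chi g) t.
    transitivity (\sum_x (carry x (chi g) * F (x + chi g - 1) t - carry x (chi g) * F (x + chi g) t)).
      apply: eq_bigr => x _; rewrite -KE // -addrA addNr addr0; ring.
    rewrite sumrB -(sum_F7_shift (fun x => carry x (chi g) * F (x + chi g - 1) t) 1) -sumrB.
    apply: eq_bigr => x _; rewrite addrAC addrK -carry_shift; ring.
  rewrite -big_split; apply: eq_bigr => x _; rewrite /cobX cobdryZ /act /=; ring.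
case: s sD => [|g [|h t]] sD.
- rewrite !big1 // subr0 cup_nil mul0r subr0.
  by rewrite -(FE 0 [::] isT).
- by rewrite E1 // cup_bock1 subr0 !big1 ?addr0 ?subr0 // => x _;
    rewrite /cobX ?oppr0 ?mulr0 // cobdry1.
have /andP[gD htD] := sD; have /andP[hD tD] : all (mem D) (h :: t) by [].
rewrite E1 // cup_bock.
have -> : \sum_x cobX act W x [:: g, h & t] =
    carry (chi g) (chi h) * (\sum_x K x t)
    - \sum_x carry x (chi g) * cobX act K (x + chi g - 1) (h :: t).
  rewrite -(sum_F7_shift (fun x => K x t) (chi g + chi h - 1)) mulr_sumr -sumrB.
  apply: eq_bigr => x _; rewrite cobX_cons2 /W /= -(carry_cocycle x (chi g) (chi h)) cobdryZ /act.
  have e1 : x + (chi g + chi h - 1) = x + chi g + chi h - 1 by rewrite !addrA.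
  have e2 : x + (chi g + chi h) = x + chi g + chi h by rewrite addrA.
  have e3 : x + chi g - 1 + chi h = x + chi g + chi h - 1 by rewrite addrAC.
  rewrite chiM // e1 /cobX e3 ?e2.
  move: (K (x + chi g + chi h - 1) t) (K (x + chi g - 1) t) => k k'.
  move: (cobdry _ _) => c; move: (carry _ _) (carry _ _) (carry _ _) => u v w; ring.
rewrite [X in _ + X - _](eq_bigr (fun x => - (carry x (chi g) * cobX act K (x + chi g - 1) (h :: t)))).
  by rewrite sumrN; ring.
by move=> x _; rewrite mulrN.
Qed.

Section Kernel.
Variables (H : {group gT}) (t : gT).
Hypothesis HD : H \subset D.
Hypothesis chiH : {in H, forall g, chi g = 0}.
Hypothesis kerH : {in D, forall g, chi g = 0 -> g \in H}.
Hypothesis tD : t \in D.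
Hypothesis chit : chi t = 1.

Let chiX n : chi (t ^+ n)%g = n%:R.
Proof.
elim: n => [|n IHn]; first by rewrite expg0 chi1.
by rewrite expgS chiM ?groupX // IHn chit -natr1 addrC.
Qed.

Lemma shapiro_kernel F : boundedX F ->
    (forall x s, all (mem D) s -> cobX act F x s = 0) -> cob H (F 0) ->
  exists K, boundedX K /\ forall x s, all (mem D) s -> F x s = cobX act K x s.
Proof.
move=> FB FZ F0; pose eta (x : 'F_7) := (t ^+ (x : nat))%g.
have chieta x : chi (eta x) = x by rewrite /eta chiX natr_Zp.
have [] := @shapiro _ D _ act (fun _ => True) act1 actM _ H 0 eta F => //.
- by move=> x _; rewrite groupX.
- by move=> x _; rewrite /act chiV ?groupX // chieta subrr.
- by move=> g gD; rewrite /act add0r; apply: kerH.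
- by move=> x s _; apply: FZ.
by move=> K [KB KE]; exists K; split=> // x s; apply: KE.
Qed.

Let restr0 F s : all (mem H) s -> cobX act F 0 s = cobdry (F 0) s.
Proof.
by case: s => [|g s] //= /andP[gH _]; rewrite /act (chiH gH) addr0 subrr addr0.
Qed.

(** Shapiro's lemma for [f], viewed as a cochain constant in [x]. *)
Lemma kernel_coboundary (f : cocycle D) : cob H f ->
  exists F, boundedX F /\ forall x s, all (mem D) s -> cobX act F x s = f s.
Proof.
move=> fH; have [fB fZ] := cocycleP f.
have [||K [KB KE]] := @shapiro_kernel (fun _ => f) _ _ fH.
- exact: boundedX_const.
- by move=> x s sD; rewrite cobX_const fZ.
by exists K; split=> // x s sD; rewrite -KE.
Qed.

Lemma cobX_shift F x s : cobX act (fun x => F (x + 1)) x s = cobX act F (x + 1) s.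
Proof. by case: s => [|g s] //; rewrite /cobX /act (addrAC x 1). Qed.

(** The variation [De] of the primitive [F] is a cocycle over [Z/7], perhaps not a coboundary.
    Multiplication by [f], the coboundary of [F], repairs this, since [De f] is up to sign the
    coboundary of [De F]. Hence the square. *)
Lemma bock_dvd_sqr (f : cocycle D) : cob H f ->
  exists w, cls f ^+ 2 = cls bock * cls w.
Proof.
move=> fH; have [F [FB FE]] := kernel_coboundary fH; have [fB fZ] := cocycleP f.
pose sgn : nat -> int := fun n => (-1) ^+ n.
pose De x s := F (x + 1) s - F x s.
have DeB : boundedX De.
  by apply: boundedXD; [apply: boundedX_act FB|apply: boundedXN].
have DeZ x s : all (mem D) s -> cobX act De x s = 0.
  by move=> sD; rewrite cobXB cobX_shift !FE ?subrr.
pose F2 x s := cup (F x) f s; pose K := cupX act (fun x => wt sgn (De x)) F.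
have actP (x : 'F_7) g : True -> g \in D -> True by [].
have F2E x s : F2 x s = cupX act F (fun _ => f) x s by rewrite /cupX cupP_const.
rewrite expr2 -clsM; apply: (@bock_transgression (f * f) F2 K).
- have [N FN] := FB; have [M fM] := fB; exists (N + M)%N => x s Ns.
  by rewrite F2E; apply: cupP_bounded Ns => // t' ?; apply: FN.
- apply: boundedX_cupX => //; have [N DN] := DeB; exists N => x s Ns.
  by rewrite /wt DN ?mulr0.
- move=> x s sD.
  have -> : cobX act F2 x s = cobX act (cupX act F (fun _ => f)) x s.
    case: s sD => [|g s] // _; rewrite /cobX !F2E; congr (_ + _).
    by apply: eq_cobdry => u; rewrite F2E.
  rewrite (cobX_cupX actM) // /cupX.
  rewrite (@eq_cupP_in _ D _ act (fun _ => True) actP _ f _ (fun _ => f)) //; last first.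
    by move=> u uD; rewrite FE.
  rewrite (@eq_cupP_in _ D _ act (fun _ => True) actP (wt _ _) (wt sgn (F x)) _ (fun _ _ => 0)) //.
    by rewrite cupP0r addr0 cupP_const.
  by move=> y u _ uD; rewrite cobX_const fZ.
- move=> x s sD; rewrite (cobX_cupX actM) // /cupX.
  rewrite (@eq_cupP_in _ D _ act (fun _ => True) actP _ (fun _ => 0) _ F) //; last first.
    by move=> u uD; rewrite cobX_wt DeZ ?mulr0.
  rewrite cupP0l add0r.
  rewrite (@eq_cupP_in _ D _ act (fun _ => True) actP _ (De x) _ (fun _ => f)) //.
  - by rewrite cupP_const /F2 /De cupDl cupNl.
  - by move=> u _; rewrite /wt mulrA -exprMn mulrNN mulr1 expr1n mul1r.
  - by move=> y u _ uD; rewrite FE.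
Qed.

(** For homogeneous [f] the class of the variation lies in degree [n - 1] of the kernel, where
    cohomology vanishes by hypothesis; so [f] itself, and not only its square, is divisible. *)
Lemma bock_dvd (f : cocycle D) n : (0 < n)%N -> cob H f ->
    (forall s, size s != n -> f s = 0) ->
    (forall z : cocycle H, (forall s, size s != n.-1 -> z s = 0) -> cob H z) ->
  exists w, cls f = cls bock * cls w.
Proof.
move=> n0 fH fn Hn; have [F0 [FB0 FE0]] := kernel_coboundary fH.
(* The primitive may have components in other degrees; only the one of degree [n - 1] is kept, so
   that the hypothesis on [H] applies. *)
pose F x := comp n.-1 (F0 x).
have FB : boundedX F by have [N FN] := FB0; exists N => x s Ns; rewrite /F /comp /wt FN ?mulr0.
have FE x s : all (mem D) s -> cobX act F x s = f s.
  move=> sD; rewrite cobX_wt FE0 //.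
  case: (posnP (size s)) => [/size0nil->|s0].
    by rewrite fn ?mulr0 // eq_sym -lt0n.
  have [E|sn] := eqVneq (size s) n; first by rewrite E eqxx mul1r.
  rewrite fn // mulr0 //.
pose De x s := F (x + 1) s - F x s.
have DeB : boundedX De.
  by apply: boundedXD; [apply: boundedX_act FB|apply: boundedXN].
have DeZ x s : all (mem D) s -> cobX act De x s = 0.
  by move=> sD; rewrite cobXB cobX_shift !FE ?subrr.
have De0C : is_cocycle H (De 0).
  split=> [|s sH]; first exact: boundedX_at.
  rewrite -restr0 // DeZ //.
  by apply/allP => x /(allP sH) xH; apply: (subsetP HD).
have [|K [KB KE]] := shapiro_kernel DeB DeZ.
  apply: (Hn (Cocycle De0C)) => s /negPf sn /=.
  by rewrite /De /F /comp /wt sn !mul0r subrr.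
exact: (@bock_transgression f F K).
Qed.

Hypothesis pr : gT -> gT.
Hypothesis prM : {in D &, {morph pr : g h / (g * h)%g}}.
Hypothesis prH : {in D, forall g, pr g \in H}.
Hypothesis pr_id : {in H, forall g, pr g = g}.

Let HsubD s : all (mem H) s -> all (mem D) s.
Proof. by move=> sH; apply/allP => x /(allP sH) xH; apply: (subsetP HD). Qed.

Let pull f : is_cocycle H f -> is_cocycle D (fun s => f (map pr s)).
Proof. by move=> fC; apply: (is_cocycle_pull prM prH (Cocycle fC)). Qed.

Let map_pr_id s : all (mem H) s -> map pr s = s.
Proof. by elim: s => //= g s IHs /andP[gH sH]; rewrite IHs // pr_id. Qed.

(* When the kernel is a retract the Bockstein is a non-zero-divisor modulo 7:
   its annihilator is the image of the transfer from the kernel. *)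
Lemma bock_regular (z : cocycle D) : cls bock * cls z = 0 -> div7 (cls z).
Proof.
rewrite -clsM cls0P => -[w [wB wE]]; have [zB zZ] := cocycleP z.
pose W x s : int := if s is g :: t then carry x (chi g) * z t else 0.
have WB : boundedX W.
  by have [N zN] := zB; exists N.+1 => x [|g s] //= Ns; rewrite zN ?mulr0.
have cobW x s : all (mem D) s -> cobX act W x s = (bock * z) s.
  case: s => [|g [|h s]] sD; first by rewrite [RHS]/= cup_nil mul0r.
    by rewrite [RHS]/= cup_bock1 cobX1 subrr.
  have /andP[gD hsD] := sD; have /andP[hD _] : all (mem D) (h :: s) by [].
  rewrite cobX_cons2 [RHS]/= cup_bock /W cobdryZ zZ // /act chiM //.
  rewrite -(carry_cocycle x (chi g) (chi h)); ring.
have wH : is_cocycle H w.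
  split=> // s sH; rewrite -wE ?HsubD // -(cobW 0) ?HsubD // restr0 //.
  rewrite (@eq_cobdry_in _ H _ (fun _ => 0)) ?cobdry0 //.
  by case=> [|g u] //= /andP[gH _]; rewrite (chiH gH) carry00 mul0r.
(* [W] and [w] are two primitives of the product, one over [Z/7] and one over [D]. Adding the
   pullback of [w] along the retraction makes their difference trivial on the kernel. *)
have [|||F [FB FE]] := @shapiro_kernel (fun x s => W x s - w s + w (map pr s)).
- apply: boundedXD; first by apply: boundedXD => //; apply: boundedX_const; rewrite -/(bounded_degree _);
    have [N wN] := wB; exists N => s Ns; rewrite wN ?oppr0.
  by have [N wN] := wB; exists N => x s Ns; rewrite wN ?size_map.
- move=> x s sD; have [_ wpZ] := pull wH.
  rewrite cobXD cobXB !cobX_const cobW // wpZ // -wE // addr0.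
  by rewrite subrr.
- apply: eq_cob (cob0 H) => -[|g s] sH; first by rewrite /W sub0r addNr.
  have /andP[gH _] := sH.
  by rewrite /W (chiH gH) carry00 mul0r sub0r map_pr_id // addNr.
(* A cocycle over [Z/7] whose sum over [x] is [z], because the terms in [F] cancel. *)
pose Psi x s := wrap x * z s - (F (x + 1) s - F x s).
have PsiB : boundedX Psi.
  apply: boundedXD; last by apply: boundedXN; apply: boundedXD;
    [apply: boundedX_act FB|apply: boundedXN].
  by have [N zN] := zB; exists N => x s Ns; rewrite zN ?mulr0.
have PsiZ x s : all (mem D) s -> cobX act Psi x s = 0.
  move=> sD; rewrite cobXB cobXB cobX_shift -!FE //.
  case: s sD => [|g s] sD; first by rewrite /W /=; ring.
  have /andP[gD sD'] := sD; have [_ zZ'] := cocycleP z.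
  rewrite /cobX cobdryZ zZ' // mulr0 add0r /W /act -mulrBl -carry_shift; ring.
have PsiH : is_cocycle H (Psi 0).
  split=> [|s sH]; first exact: boundedX_at.
  by rewrite -restr0 // PsiZ // HsubD.
have NC := pull PsiH.
(* Through the retraction each of the seven values of [Psi] is compared with the pullback of
   [Psi 0]; their sum is therefore 7 times a class. *)
have [|||F2 [FB2 FE2]] := @shapiro_kernel (fun x s => Psi x s - Psi 0 (map pr s)).
- apply: boundedXD => //; apply: boundedXN; apply: boundedX_const.
  by case: NC.
- by move=> x s sD; rewrite cobXB PsiZ // cobX_const; case: NC => _ ->; rewrite ?subrr.
- by apply: eq_cob (cob0 H) => s sH; rewrite map_pr_id // subrr.
exists (cls (Cocycle NC)).
have -> : cls (Cocycle NC) *+ 7 = cls ((Cocycle NC : cocycle D) *+ 7) by rewrite /cls rmorphMn.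
rewrite clsP; exists (fun s => \sum_x F2 x s); split.
  by apply: bounded_sum => x _; apply: boundedX_at.
move=> s sD; rewrite -sum_cobX7 // -(eq_bigr _ (fun x _ => FE2 x s sD)).
rewrite cocycle_mulrnE sumrB sumr_const card_ord; congr (_ - _).
rewrite sumrB sumrB (sum_F7_shift (fun x => F x s)) subrr subr0 -mulr_suml.
have -> : \sum_x wrap x = 1.
  by rewrite (bigD1 (-1)) //= /wrap eqxx big1 ?addr0 // => x /negPf->.
by rewrite mul1r.
Qed.

End Kernel.

End Bockstein.

(** * Rings of characteristic 7 and the reduced cohomology ring *)

Section Char7.
Variables (R : comNzRingType) (R7 : 7%:R = 0 :> R).

(** The equation [7 = 0] is an argument, so that the ring morphism structure can be attached to the
    map. *)
Definition of7 of 7%:R = 0 :> R := fun c : 'F_7 => (c : nat)%:R : R.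

Lemma natr_mod7 n : (n %% 7)%:R = n%:R :> R.
Proof. by rewrite [in RHS](divn_eq n 7) natrD natrM R7 mulr0 add0r. Qed.

Fact of7_zmod : zmod_morphism (of7 R7).
Proof.
have of7D x y : of7 R7 (x + y) = of7 R7 x + of7 R7 y.
  by rewrite /of7 F7_addE natr_mod7 natrD.
by move=> x y; apply/eqP; rewrite eq_sym subr_eq -of7D subrK.
Qed.

Fact of7_monoid : monoid_morphism (of7 R7).
Proof. by split=> // x y; rewrite /of7 -natrM -[RHS]natr_mod7. Qed.

HB.instance Definition _ := GRing.isZmodMorphism.Build _ _ (of7 R7) of7_zmod.
HB.instance Definition _ := GRing.isMonoidMorphism.Build _ _ (of7 R7) of7_monoid.

Definition ev1 (u : R) : {rmorphism {poly 'F_7} -> R} :=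
  horner_morph (fun c => mulrC u (of7 R7 c)).

(** The inner variable goes to [u] and the outer one to [y]: [{poly {poly 'F_7}}] serves as
    [F_7[u, y]], expanded in powers of [y]. *)
Definition ev2 (u y : R) : {rmorphism {poly {poly 'F_7}} -> R} :=
  horner_morph (fun p => mulrC y (ev1 u p)).

Lemma ev1X u : ev1 u 'X = u. Proof. exact: horner_morphX. Qed.
Lemma ev1C u c : ev1 u c%:P = of7 R7 c. Proof. exact: horner_morphC. Qed.
Lemma ev2X u y : ev2 u y 'X = y. Proof. exact: horner_morphX. Qed.
Lemma ev2C u y p : ev2 u y p%:P = ev1 u p. Proof. exact: horner_morphC. Qed.

Lemma mpoly_atE n (h : 'I_n -> R) (P : {mpoly 'F_7[n]}) :
  mpoly_at h P = mmap (of7 R7) h P.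
Proof. by rewrite /mmap; apply: eq_bigr => m _; rewrite -mulr_natl. Qed.
End Char7.

Section ReducedRing.
Variables (gT : finGroupType) (D : {group gT}).

(** An alias that carries the commutative and non-trivial ring structures; both are theorems about
    groups and not part of the quotient construction. *)
Definition rcoh : Type := redcohom D 7.
HB.instance Definition _ := GRing.PzRing.on rcoh.

Fact rcoh_comm : commutative (@GRing.mul rcoh). Proof. exact: red_comm. Qed.

(** If a power of [n] is 7 times a class, then 7 divides it already in degree 0. *)
Lemma redclass1_eq0 n : redclass 7 (n%:R : cocycle D) = 0 -> (7 %| n)%N.
Proof.
move/redclass0P => [].
  by case=> // x s _; rewrite cocycle_natE mulr0.
move=> k [w]; have [g ->] := cls_surj w => E.
have /cls_nil : cls ((n%:R : cocycle D) ^+ k) = cls (g *+ 7) by rewrite clsX E /cls rmorphMn.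
rewrite cocycleX_nil cocycle_natE mulr1 natz cocycle_mulrnE => /(congr1 absz).
rewrite abszX absz_nat -mulr_natr abszM => E7.
have : (7 %| n ^ k)%N by rewrite E7 dvdn_mull.
by rewrite Euclid_dvdX // => /andP[].
Qed.

Fact rcoh_nz : (1 : rcoh) != 0.
Proof.
apply/eqP => r10; have : redclass 7 (1%:R : cocycle D) = 0 by rewrite /redclass !rmorph1.
by move/redclass1_eq0.
Qed.

HB.instance Definition _ := GRing.PzSemiRing_isNonZero.Build rcoh rcoh_nz.
HB.instance Definition _ := GRing.PzSemiRing_hasCommutativeMul.Build rcoh rcoh_comm.

Fact rcoh7 : (7%:R : rcoh) = 0. Proof. exact: redq7. Qed.

End ReducedRing.

Section Char7Morph.
Variables (R S : comNzRingType) (R7 : 7%:R = 0 :> R) (S7 : 7%:R = 0 :> S).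
Variable f : {rmorphism R -> S}.

Lemma rmorph_of7 c : f (of7 R7 c) = of7 S7 c.
Proof. exact: rmorph_nat. Qed.

Lemma rmorph_ev1 u p : f (ev1 R7 u p) = ev1 S7 (f u) p.
Proof.
elim/poly_ind: p => [|p c IHp]; first by rewrite !rmorph0.
by rewrite !rmorphD !rmorphM /= !ev1X !ev1C IHp rmorph_of7.
Qed.

Lemma rmorph_ev2 u y p : f (ev2 R7 u y p) = ev2 S7 (f u) (f y) p.
Proof.
elim/poly_ind: p => [|p c IHp]; first by rewrite !rmorph0.
by rewrite !rmorphD !rmorphM /= !ev2X !ev2C IHp rmorph_ev1.
Qed.

End Char7Morph.

Section PullbackMorphism.
Variables (gT hT : finGroupType) (D : {group gT}) (D' : {group hT}) (phi : hT -> gT).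
Hypothesis phiM : {in D' &, {morph phi : x y / (x * y)%g}}.
Hypothesis phiD : {in D', forall x, phi x \in D}.

Definition rpull : rcoh D -> rcoh D' := @redcohom_pull _ _ _ _ _ phiM phiD 7.
HB.instance Definition _ := GRing.isZmodMorphism.Build _ _ rpull
  (@redcohom_pull_zmod_morphism _ _ _ _ _ phiM phiD 7).
HB.instance Definition _ := GRing.isMonoidMorphism.Build _ _ rpull
  (@redcohom_pull_monoid_morphism _ _ _ _ _ phiM phiD 7).

Lemma rpullE f : rpull (redclass 7 f) = redclass 7 (cocycle_pull phiM phiD f).
Proof. exact: redcohom_pullE. Qed.
End PullbackMorphism.

Section RedclassMorphism.
Variables (gT : finGroupType) (D : {group gT}).
Implicit Types f g : cocycle D.
Definition rcl f : rcoh D := redclass 7 f.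
Fact rcl_zmod : zmod_morphism rcl.
Proof. by move=> f g; rewrite /rcl /redclass !rmorphB. Qed.
Fact rcl_monoid : monoid_morphism rcl.
Proof. by split=> [|f g]; rewrite /rcl /redclass ?rmorph1 // !rmorphM. Qed.
HB.instance Definition _ := GRing.isZmodMorphism.Build _ _ rcl rcl_zmod.
HB.instance Definition _ := GRing.isMonoidMorphism.Build _ _ rcl rcl_monoid.

Lemma rcl_cls f g : cls f = cls g -> rcl f = rcl g.
Proof. by rewrite /rcl /redclass /cls => ->. Qed.
End RedclassMorphism.

(** A character of [D] onto [F_7] with kernel [H], and an element [t] whose powers represent the
    cosets of [H]. *)
Record char7 (gT : finGroupType) (D H : {group gT}) (chi : gT -> 'F_7) (t : gT) : Prop :=
  Char7 {
    char7M : {in D &, forall g h, chi (g * h)%g = chi g + chi h};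
    char7_sub : H \subset D;
    char7_0 : {in H, forall g, chi g = 0};
    char7_ker : {in D, forall g, chi g = 0 -> g \in H};
    char7_t : t \in D;
    char7_1 : chi t = 1
  }.

Section Restriction.
Variables (gT : finGroupType) (D H : {group gT}).
Hypothesis HD : H \subset D.

Fact cocycle_sub f : is_cocycle D f -> is_cocycle H f.
Proof.
move=> [fB fZ]; split=> // s sH; apply: fZ.
by apply/allP => x /(allP sH) xH; apply: (subsetP HD).
Qed.

Definition resc (f : cocycle D) : cocycle H := Cocycle (cocycle_sub (cocycleP f)).

Definition rres : rcoh D -> rcoh H :=
  @rpull gT gT D H id (fun _ _ _ _ => erefl) (subsetP HD).
HB.instance Definition _ := GRing.RMorphism.on rres.

Lemma rresE f : rres (rcl f) = rcl (resc f).
Proof.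
rewrite /rres /rcl rpullE; congr redclass; apply: cocycle_eqP => s /=.
by rewrite map_id.
Qed.
End Restriction.

Lemma cocycle_mulrzE (gT : finGroupType) (D : {group gT}) (f : cocycle D) (m : int) s :
  (f *~ m) s = f s *~ m.
Proof. by case: m => m; rewrite ?NegzE ?mulrNz /= cocycle_mulrnE. Qed.

Lemma clsMz (gT : finGroupType) (D : {group gT}) (f : cocycle D) (m : int) :
  cls (f *~ m) = cls f *~ m.
Proof. exact: raddfMz. Qed.

Section Homogeneous.
Variables (gT : finGroupType) (D : {group gT}).
Implicit Types f w : cocycle D.

Definition hdeg n f := forall s, size s != n -> f s = 0.

Lemma homog_comp n f : hdeg n (wtc (fun m => (m == n)%:R) f).
Proof. by move=> s /negPf sn /=; rewrite /wt sn mul0r. Qed.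

Lemma homog_id n f : hdeg n f -> f = wtc (fun m => (m == n)%:R) f.
Proof.
move=> fn; apply: cocycle_eqP => s /=; rewrite /wt.
by have [_|/fn->] := eqVneq (size s) n; rewrite ?mul1r ?mulr0.
Qed.

Lemma homog0_nat f : hdeg 0 f -> exists m : int, cls f = m%:~R.
Proof.
move=> f0; exists (f [::]).
rewrite -cls1 -clsMz; apply: cls_eq => s _; rewrite cocycle_mulrzE.
case: s => [|x s]; first by rewrite -mulrzr mul1r intz.
by rewrite f0 // mul0rz.
Qed.

Lemma sum_comp f : exists N, f = \sum_(n < N) wtc (fun m => (m == n)%:R) f.
Proof.
have [[N fN] _] := cocycleP f; exists N.+1; apply: cocycle_eqP => s.
rewrite cocycle_sumE /=; have [Ns|sN] := ltnP N (size s).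
  by rewrite fN // big1 // => i _; rewrite /wt fN ?mulr0.
rewrite (bigD1 (Ordinal (sN : (size s < N.+1)%N))) //= /wt eqxx mul1r.
rewrite big1 ?addr0 // => i /negPf ne; rewrite eq_sym.
by rewrite (_ : (val i == size s) = false) ?mul0r //; apply: contraFF ne => /eqP E; apply/eqP/val_inj.
Qed.

Lemma homog_bock (H : {group gT}) chi t (cd : char7 D H chi t) f w n :
    hdeg n.+2 f -> cls f = cls (bock (char7M cd)) * cls w ->
  exists2 w', hdeg n w' & cls f = cls (bock (char7M cd)) * cls w'.
Proof.
move=> fn E; exists (wtc (fun m => (m == n)%:R) w); first exact: homog_comp.
rewrite [in LHS](homog_id fn) -clsM.
have -> : bock (char7M cd) * wtc (fun m => (m == n)%:R) w =
    wtc (fun m => (m == n.+2)%:R) (bock (char7M cd) * w).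
  apply: cocycle_eqP => -[|g [|h s]] /=; rewrite /wt ?cup_nil ?cup_bock1 ?cup_bock /=.
  - by rewrite !mul0r.
  - by rewrite mulr0.
  - by rewrite !eqSS mulrCA.
by apply: cls_wt; rewrite clsM.
Qed.

Lemma cob_trivial f : (forall x, x \in D -> x = 1%g) -> f [::] = 0 -> cob D f.
Proof.
move=> D1 f0; rewrite -cls0P -(card_kills f0) (_ : #|D| = 1%N) //.
apply/eqP; rewrite -trivg_card1; apply/eqP/trivgP/subsetP => x /D1->.
exact: set11.
Qed.
End Homogeneous.

(** * Cohomology of [Z/7] and [(Z/7)^2] *)

Section CyclicCohomology.
Variables (gT : finGroupType) (D : {group gT}) (chi : gT -> 'F_7) (t : gT).
Hypothesis cd : char7 D 1%G chi t.
Let u := bock (char7M cd).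
Implicit Types f w : cocycle D.

Let triv x : x \in (1%G : {group gT}) -> x = 1%g. Proof. by move=> /set1gP. Qed.

Let dvd (f : cocycle D) n : hdeg n.+2 f -> exists2 w, hdeg n w & cls f = cls u * cls w.
Proof.
move=> fn; have [cM cS c0 cK ct c1] := cd.
have [||w E] := @bock_dvd _ D chi (char7M cd) _ t cS c0 cK ct c1 f n.+2 isT _ fn.
- apply: (cob_trivial (f := resc cS f) triv); exact: fn.
- by move=> z zn; apply: cob_trivial triv _; apply: zn.
exact: homog_bock fn E.
Qed.

(** Divisibility by [u] reduces to degree 1, where [#|D|] times the cocycle is a coboundary and
    coboundaries are zero. *)
Lemma cyclic_odd n f : odd n -> hdeg n f -> cls f = 0.
Proof.
elim/ltn_ind: n f => -[|[|n]] IH f //= no fn; last first.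
  have [w wn ->] := dvd fn; rewrite (IH n _ w) ?mulr0 //.
  by move: no; rewrite negbK.
have f0 : f [::] = 0 by apply: fn.
have D0 : (#|D|%:R : int) != 0 by rewrite Num.Theory.pnatr_eq0 -lt0n cardG_gt0.
rewrite cls0P; apply: eq_cob (cob0 D) => s sD.
have [s1|/fn-> //] := eqVneq (size s) 1%N.
have : cls (f *+ #|D|) = 0 by rewrite /cls rmorphMn; apply: card_kills.
rewrite cls0P => -[h [_ hE]]; have := hE s sD; rewrite cocycle_mulrnE.
case: s s1 sD {hE} => [|x [|? ?]] // _ _; rewrite cobdry1 -mulr_natr => /eqP.
by rewrite mulf_eq0 (negPf D0) orbF => /eqP.
Qed.

Lemma cyclic_even n f : hdeg n.*2 f -> exists m : int, cls f = cls u ^+ n *~ m.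
Proof.
elim: n f => [|n IHn] f fn; first by have [m ->] := homog0_nat fn; exists m; rewrite expr0.
have [w wn ->] := dvd fn; have [m ->] := IHn w wn.
by exists m; rewrite mulrzAr exprS.
Qed.

End CyclicCohomology.

Section Rank2Cohomology.
Variables (gT : finGroupType) (D H : {group gT}) (chi chi2 : gT -> 'F_7) (t t2 : gT).
Hypothesis cd : char7 D H chi t.
Hypothesis cd2 : char7 H 1%G chi2 t2.
Hypothesis chi2M : {in D &, forall g h, chi2 (g * h)%g = chi2 g + chi2 h}.
Let y := bock (char7M cd).
Let u := bock chi2M.
Implicit Types f w : cocycle D.

(** After subtraction of the multiple of [u^(n+1)] seen on [H], the remainder dies there and is
    divisible by [y]; the obstruction lies in an odd degree of the cyclic group [H]. *)
Lemma rank2_even n f : hdeg n.*2 f ->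
  exists m : nat -> int, cls f = \sum_(k < n.+1) cls y ^+ k * cls u ^+ (n - k) *~ m k.
Proof.
have [cM cS c0 cK ct c1] := cd.
elim: n f => [|n IHn] f fn.
  have [m ->] := homog0_nat fn; exists (fun _ => m).
  by rewrite big_ord1 !expr0 mul1r.
have fn' : hdeg n.+1.*2 (resc cS f) by move=> s /fn.
have [m] := cyclic_even cd2 fn'.
have -> : cls (bock (char7M cd2)) = cls (resc cS u) by congr cls; apply: cocycle_eqP.
have resX k (g : cocycle D) : resc cS g ^+ k = resc cS (g ^+ k).
    elim: k => [|k IHk]; first exact: cocycle_eqP.
    by rewrite !exprS IHk; apply: cocycle_eqP.
rewrite -clsX resX -clsMz.
rewrite clsP => fH; pose f' := f - u ^+ n.+1 *~ m.
pose f'' := wtc (fun k => (k == n.+1.*2)%:R) f'.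
have un : hdeg n.+1.*2 (u ^+ n.+1).
  elim: (n.+1) => [|k IHk]; first by case=> // a s _; rewrite expr0 [LHS]/= /cup1.
  rewrite exprS => -[|g [|h s]] sk; first by rewrite [LHS]/= cup_nil mul0r.
    exact: cup_bock1.
  by rewrite [LHS]/= cup_bock IHk ?mulr0.
have [|||w E] := @bock_dvd _ D chi (char7M cd) _ t cS c0 cK ct c1 f'' n.+1.*2 isT.
- apply: cob_wt; apply: eq_cob fH => s _.
  by rewrite [RHS]/= /f' /= !cocycle_mulrzE.
- exact: homog_comp.
- move=> z zn; rewrite -cls0P; apply: (cyclic_odd cd2 (n := n.*2.+1)) => //=.
  by rewrite odd_double.
have f''E : cls f'' = cls f'.
  rewrite /f'' -homog_id // => s sn.
  by rewrite [LHS]/= fn // sub0r cocycle_mulrzE un // mul0rz oppr0.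
have [w' w'n E'] := homog_bock (homog_comp _) E.
have [m' Em'] := IHn w' w'n.
exists (fun k => if k is j.+1 then m' j else m).
have -> : cls f = cls f' + cls (u ^+ n.+1 *~ m) by rewrite -clsD subrK.
rewrite -f''E E' Em' mulr_sumr [RHS]big_ord_recl addrC; congr (_ + _).
  by rewrite expr0 mul1r subn0 clsMz clsX.
by apply: eq_bigr => k _; rewrite mulrzAr mulrA -exprS.
Qed.

End Rank2Cohomology.

Section Regularity.
Variables (gT : finGroupType) (D H : {group gT}) (chi : gT -> 'F_7) (t : gT).
Hypothesis cd : char7 D H chi t.
Variable pr : gT -> gT.
Hypothesis prM : {in D &, {morph pr : g h / (g * h)%g}}.
Hypothesis prH : {in D, forall g, pr g \in H}.
Hypothesis pr_id : {in H, forall g, pr g = g}.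
Hypothesis killed : forall n (f : cocycle D), (0 < n)%N -> hdeg n.*2 f -> cls f *+ 7 = 0.
Let y := bock (char7M cd).

Lemma even_killed7 (f : cocycle D) :
  (forall s, odd (size s) -> f s = 0) -> f [::] = 0 -> cls f *+ 7 = 0.
Proof.
move=> fo f0; have [N ->] := sum_comp f.
rewrite /cls rmorph_sum -sumrMnl big1 // => i _.
have [io|ie] := boolP (odd i).
  rewrite -/(cls _) (_ : wtc _ f = 0) ?cls0 ?mul0rn //; apply: cocycle_eqP => s /=.
  rewrite /wt; have [si|_] := eqVneq; last by rewrite mul0r.
  by rewrite fo ?mulr0 // si.
case: (posnP i) => [i0|i0].
  rewrite -/(cls _) (_ : wtc _ f = 0) ?cls0 ?mul0rn //; apply: cocycle_eqP => s /=.
  rewrite /wt i0; case: eqVneq => [/size0nil->|_]; last by rewrite mul0r.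
  by rewrite f0 mulr0.
apply: (killed (n := i./2)); first by case: (nat_of_ord i) ie i0 => [|[|?]].
have -> : i./2.*2 = i by rewrite -[RHS]odd_double_half (negPf ie).
exact: homog_comp.
Qed.

Lemma div7_pos_even (f : cocycle D) :
  (forall s, odd (size s) -> f s = 0) -> f [::] = 0 -> div7 (cls f) -> cls f = 0.
Proof.
move=> fo f0 [w E]; have [e [o [[g Eg go] od wE]]] := even_odd_dec w.
have fE : cls f = cls g *+ 7.
  have [/eqP] : cls f - cls g *+ 7 = 0 /\ - o *+ 7 = 0; last by rewrite subr_eq0 => /eqP.
  apply: even_odd_eq0.
  - exists (f - g *+ 7); first by rewrite clsD clsN /cls rmorphMn.
    by move=> s so; rewrite [LHS]/= cocycle_mulrnE fo // go // mul0rn subrr.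
  - rewrite -mulr_natl; apply: even_oddM; first exact: even_nat.
    by rewrite -mulN1r; apply: even_oddM => //; apply/is_evenN/(even_nat _ 1).
  - by rewrite E wE Eg mulrnDl mulNrn -addrA -opprD subrr.
have g0 : g [::] = 0.
  have /cls_nil : cls f = cls (g *+ 7) by rewrite fE /cls rmorphMn.
  rewrite f0 cocycle_mulrnE => /esym/eqP.
  by rewrite Num.Theory.mulrn_eq0 => /eqP.
by rewrite fE even_killed7.
Qed.

(** In positive even degrees divisibility by 7 means vanishing. So the factors [y] of a product
    [y^j f^k] divisible by 7 can be cancelled one at a time with [bock_regular], until [f^k] itself
    is divisible by 7. *)
Lemma red_bock_regular (x : rcoh D) : rcl y * x = 0 -> x = 0.
Proof.
have [cM cS c0 cK ct c1] := cd.
have [f -> fo] := red_even_rep x; rewrite -/(rcl f) -rmorphM => H0.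
have yfo s : odd (size s) -> (y * f) s = 0.
  move=> so; apply: (@cup_parity _ _ _ false false) => [v vo|v vo|]; last by rewrite so.
    by case: v vo => [|? [|? [|? ?]]].
  by apply: fo; case: odd vo.
have [k] := (redclass0P yfo).1 H0.
have ye : is_even (cls y) by exists y => //; case=> [|? [|? [|? ?]]].
rewrite clsM exprMn_comm; last exact: even_comm.
have evX j : exists2 g : cocycle D, cls g = cls y ^+ j * cls f ^+ k &
    (forall s, odd (size s) -> g s = 0) /\ ((0 < j)%N -> g [::] = 0).
  have fXo : is_even (cls (f ^+ k)).
    by rewrite clsX; apply: is_evenX; exists f.
  have go : is_even (cls y ^+ j * cls f ^+ k).
    by apply: is_evenM; [apply: is_evenX|rewrite -clsX].
  have [g Eg go'] := go; exists g => //; split=> // j0.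
  have /cls_nil -> : cls g = cls (y ^+ j * f ^+ k) by rewrite clsM !clsX.
  by rewrite cocycle_nil cocycleX_nil expr0n (gtn_eqF j0) mul0r.
suff: forall j, div7 (cls y ^+ j * cls f ^+ k) -> div7 (cls f ^+ k).
  move=> Hs Hd; apply: (@red_reduced _ _ _ k); rewrite -[LHS]/(rcl f ^+ k) -rmorphXn.
  by apply: redq_div7; rewrite -/(cls _) clsX; apply: Hs Hd.
elim=> [|j IHj]; first by rewrite mul1r.
have [g Eg [go g0]] := evX j.+1; rewrite -Eg => /(div7_pos_even go (g0 isT)).
rewrite Eg exprS -mulrA => yz; apply: IHj.
have [g' Eg' _] := evX j; rewrite -Eg' in yz *.
exact: (bock_regular cS c0 cK ct c1 prM prH pr_id) yz.
Qed.
End Regularity.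

Section ElementaryAbelian.

Local Notation A0T := ('F_7 * 'F_7)%type.

(** The fixed model of [(Z/7)^2] to which all the [A_m] are pulled back. *)
Definition A0 : {group A0T} := [set: A0T]%G.
Definition A0ker : {group A0T} := setX_group 1%G [set: 'F_7]%G.

Lemma A0fstM : {in A0 &, forall g h : A0T, (g * h)%g.1 = g.1 + h.1}. Proof. by []. Qed.
Lemma A0sndM : {in A0 &, forall g h : A0T, (g * h)%g.2 = g.2 + h.2}. Proof. by []. Qed.

Lemma A0kerE g : (g \in A0ker) = (g.1 == 0).
Proof. by rewrite inE inE in_setT andbT. Qed.

Lemma A0cd : char7 A0 A0ker fst ((1, 0) : A0T).
Proof.
split=> //; first exact: subsetT.
- by move=> g; rewrite A0kerE => /eqP.
- by move=> g _ /= g0; rewrite A0kerE g0.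
- by rewrite inE.
Qed.

Lemma A0cd2 : char7 A0ker 1%G snd ((0, 1) : A0T).
Proof.
split=> //; first exact: sub1G.
- by move=> g /set1gP->.
- move=> [i j]; rewrite A0kerE => /eqP /= -> ->; exact: set11.
- by rewrite A0kerE.
Qed.

Definition A0y : rcoh A0 := rcl (bock A0fstM).
Definition A0u : rcoh A0 := rcl (bock A0sndM).
Definition A0ev : {rmorphism {poly {poly 'F_7}} -> rcoh A0} := ev2 (rcoh7 A0) A0u A0y.

End ElementaryAbelian.

Lemma mulrz_kill (V : zmodType) (a : V) (m : int) k : a *+ k = 0 -> a *~ m *+ k = 0.
Proof. by move=> ak; rewrite pmulrn -mulrzA mulrC mulrzA -pmulrn ak mul0rz. Qed.

Lemma A0killed n (f : cocycle A0) : (0 < n)%N -> hdeg n.*2 f -> cls f *+ 7 = 0.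
Proof.
move=> n0 fn; have [m ->] := rank2_even A0cd A0cd2 A0sndM fn.
rewrite -sumrMnl big1 // => -[[|k] /= kn] _; apply: mulrz_kill.
  by rewrite mul1r subn0 -(prednK n0) exprS -mulrnAl bock_killed7 mul0r.
by rewrite exprS -mulrA -mulrnAl bock_killed7 mul0r.
Qed.

Lemma A0ker_killed n (f : cocycle A0ker) : (0 < n)%N -> hdeg n.*2 f -> cls f *+ 7 = 0.
Proof.
move=> n0 fn; have [m ->] := cyclic_even A0cd2 fn; apply: mulrz_kill.
by rewrite -(prednK n0) exprS -mulrnAl bock_killed7 mul0r.
Qed.

Lemma of7_inj (gT : finGroupType) (D : {group gT}) c : of7 (rcoh7 D) c = 0 -> c = 0.
Proof.
move=> c0; have : (7 %| c)%N.
  by apply: (@redclass1_eq0 _ D); rewrite -[LHS]/(rcl _) rmorph_nat.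
by case: (posnP c) => [c00 _|c1 /(dvdn_leq c1)]; [apply: val_inj|rewrite leqNgt F7_lt].
Qed.

(** The constant term survives restriction to the trivial subgroup, where the Bockstein dies; what
    remains is a multiple of the Bockstein, a non-zero-divisor. *)
Lemma A0ker_indep p : ev1 (rcoh7 A0ker) (rcl (bock (char7M A0cd2))) p = 0 -> p = 0.
Proof.
elim/poly_ind: p => // p c IHp; rewrite rmorphD rmorphM /= ev1X ev1C => E.
have c0 : c = 0.
  apply: (@of7_inj _ 1%G).
  have := congr1 (rres (sub1G A0ker)) E; rewrite rmorphD rmorphM rmorph0 /= rresE.
  rewrite (_ : rcl (resc _ _) = 0) ?mulr0 ?add0r; last first.
    rewrite -(rmorph0 (@rcl _ 1%G)); apply: rcl_cls; rewrite cls0 cls0P.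
    by apply: cob_trivial => // x /set1gP.
  rewrite (rmorph_of7 _ (rcoh7 _)); exact.
move: E; rewrite c0 rmorph0 !addr0 mulrC => E; rewrite IHp ?mul0r //.
have := @red_bock_regular _ A0ker 1%G snd _ A0cd2 (fun _ => 1%g) _ _ _ A0ker_killed _ E.
apply=> [x y _ _|x _|x /set1gP->] //; by rewrite ?mulg1.
Qed.

Lemma A0yE : A0y = rcl (bock (char7M A0cd)).
Proof. by congr rcl; apply: cocycle_eqP. Qed.

(** The same descent one rank higher, with the kernel of [fst] in place of the trivial group. *)
Lemma A0ev_eq0 P : A0ev P = 0 -> P = 0.
Proof.
elim/poly_ind: P => // P c IHP.
rewrite rmorphD rmorphM /= [A0ev 'X]ev2X [A0ev c%:P]ev2C => E.
have [cM cS _ _ _ _] := A0cd.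
have c0 : c = 0.
  apply: A0ker_indep.
  have := congr1 (rres cS) E; rewrite rmorphD rmorphM rmorph0 /= [rres cS A0y]rresE.
  rewrite (_ : rcl (resc _ _) = 0) ?mulr0 ?add0r; last first.
    rewrite -(rmorph0 (@rcl _ A0ker)); apply: rcl_cls; rewrite cls0 cls0P.
    apply: eq_cob (cob0 _) => -[|g [|h [|? ?]]] //= /and3P[gH hH _].
    by rewrite (char7_0 A0cd gH) (char7_0 A0cd hH) carry00.
  rewrite (rmorph_ev1 _ (rcoh7 _)) /= [rres cS A0u]rresE => <-; congr (ev1 _ (rcl _) _).
  exact: cocycle_eqP.
move: E; rewrite c0 rmorph0 !addr0 mulrC => E; rewrite IHP ?mul0r //.
have := @red_bock_regular _ A0 A0ker fst _ A0cd (fun x => (0, x.2)) _ _ _ A0killed (A0ev P).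
apply=> [x y _ _|x _|x|] //; last by rewrite -A0yE.
- by congr (_, _); apply: val_inj.
- by rewrite A0kerE.
- by rewrite A0kerE; case: x => i j /= /eqP->.
Qed.

Lemma A0ev_inj : injective A0ev.
Proof.
move=> P Q E; apply/eqP; rewrite -subr_eq0; apply/eqP/A0ev_eq0.
by rewrite rmorphB /= E subrr.
Qed.

(* The degree-[2n] part of the reduced cohomology of [(Z/7)^2]. *)
Definition hform n (c : nat -> 'F_7) : {poly {poly 'F_7}} :=
  \sum_(k < n.+1) (c k *: 'X ^+ (n - k))%:P * 'X ^+ k.

Lemma A0ev_monomial (c : 'F_7) i j :
  A0ev ((c *: 'X ^+ j)%:P * 'X ^+ i) = (A0u ^+ j * A0y ^+ i) * of7 (rcoh7 A0) c.
Proof.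
have eX : A0ev 'X = A0y by apply: ev2X.
have eC p : A0ev p%:P = ev1 (rcoh7 A0) A0u p by apply: ev2C.
rewrite rmorphM rmorphXn eX eC -mul_polyC rmorphM rmorphXn ev1X ev1C; by rewrite [RHS]mulrC mulrA.
Qed.

Lemma A0_homog n (f : cocycle A0) : hdeg n.*2 f -> exists c, rcl f = A0ev (hform n c).
Proof.
move=> fn; have [m E] := rank2_even A0cd A0cd2 A0sndM fn.
exists (fun k => (m k)%:~R).
rewrite (rcl_cls (g := \sum_(k < n.+1) (bock (char7M A0cd)) ^+ k * (bock A0sndM) ^+ (n - k) *~ m k)).
  rewrite !rmorph_sum; apply: eq_bigr => k _.
  have rz (g : cocycle A0) (z : int) : rcl (g *~ z) = rcl g *~ z by apply: raddfMz.
  by rewrite A0ev_monomial /= rz rmorphM !rmorphXn /= -A0yE rmorph_int mulrzr mulrC.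
by rewrite E /cls rmorph_sum; apply: eq_bigr => k _;
  rewrite -[RHS]/(cls _) clsMz clsM !clsX.
Qed.

(** * Sums over orbits of an elementary abelian group *)

Section OrbitSum.
Variables (gT : finGroupType) (D : {group gT}) (X : finType) (act : X -> gT -> X).
Hypothesis act1 : forall x, act x 1%g = x.
Hypothesis actM : forall x, {in D &, forall g h, act x (g * h)%g = act (act x g) h}.
Hypothesis abelD : (7.-abelem D)%g.
Variable F : X -> seq gT -> int.
Hypothesis FB : boundedX F.
Hypothesis FZ : forall x s, all (mem D) s -> cobX act F x s = 0.

Let stab x0 := [set g in D | act x0 g == x0].

Fact stab_group x0 : group_set (stab x0).
Proof.
apply/group_setP; split=> [|g h]; first by rewrite inE group1 act1 eqxx.
rewrite !inE => /andP[gD /eqP gx] /andP[hD /eqP hx].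
by rewrite groupM // actM // gx hx eqxx.
Qed.

(* On a non-trivial orbit the stabiliser has a complement, which acts simply
   transitively and identifies all the summands. *)
Lemma orbit_class x0 (O := [set act x0 g | g in D]) (h : cocycle D) :
    (forall s, h s = \sum_(x in O) F x s) -> (1 < #|O|)%N ->
  div7 (cls h) /\ (7 %| #|O|)%N.
Proof.
move=> hE O1; pose K := Group (stab_group x0).
have abD : abelian D by case/and3P: abelD.
have KD : K \subset D by apply/subsetP => g; rewrite inE => /andP[].
have fixK g : g \in K -> act x0 g = x0 by rewrite inE => /andP[_ /eqP].
have [L dpr] := abelem_split_dprod abelD KD.
have [_ KL _ tiKL] := dprodP dpr.
have cKL : (L \in [complements to K in D])%g.
  by apply/complP; split.
have LD : L \subset D by rewrite -KL mulG_subr.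
have lM : {in D &, {morph remgr K L : g g' / (g * g')%g}}.
  by apply: (remgrM cKL); rewrite -(sub_abelian_normal _ abD).
have kl g : g \in D -> (divgr K L g * remgr K L g)%g = g by move=> _; rewrite -divgr_eq.
have kK g : g \in D -> divgr K L g \in K by move=> gD; rewrite mem_divgr ?KL.
have lL g : g \in D -> remgr K L g \in L by move=> gD; rewrite mem_remgr ?KL.
have lDm g : g \in D -> remgr K L g \in D by move=> /lL; apply: subsetP.
have kD g : g \in D -> divgr K L g \in D by move=> /kK; apply: subsetP.
have actl g : g \in D -> act x0 (remgr K L g) = act x0 g.
  by move=> gD; rewrite -[in RHS](kl g gD) (actM _ (kD g gD) (lDm g gD)) (fixK _ (kK g gD)).
pose P x := x \in O.
have actP x g : P x -> g \in D -> P (act x g).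
  by move=> /imsetP[g' g'D ->] gD; rewrite -actM //; apply: imset_f; rewrite groupM.
pose w x := odflt 1%g [pick g in D | act x0 g == x].
have wP x : P x -> w x \in D /\ act x0 (w x) = x.
  move=> /imsetP[g gD xE]; rewrite /w; case: pickP => [g' /andP[? /eqP]//|/(_ g)].
  by rewrite gD xE eqxx.
(* Representatives are taken in the complement [L], so that transporting arrows is the projection
   onto the stabiliser, the same map at every point. *)
pose eta x := remgr K L (w x).
have etaD x : P x -> eta x \in D by move=> /wP[wD _]; rewrite lDm.
have etaX x : P x -> act x0 (eta x) = x by move=> /wP[wD wE]; rewrite actl.
have baseE x : P x -> act x (eta x)^-1%g = x0.
  by move=> Px; rewrite -{1}(etaX x Px) -actM ?groupV ?etaD // mulgV act1.
have eta_shift x g : P x -> g \in D -> eta (act x g) = (eta x * remgr K L g)%g.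
  move=> Px gD; have Pg := actP x g Px gD; have [eD egD] := (etaD _ Px, etaD _ Pg).
  have etaL z : P z -> eta z \in L by move=> /wP[wD _]; apply: lL.
  have eE : eta x = remgr K L (eta x) by rewrite (remgr_id tiKL) ?etaL.
  have egE : eta (act x g) = remgr K L (eta (act x g)) by rewrite (remgr_id tiKL) ?etaL.
  rewrite [in RHS]eE -lM // egE.
  have kin : (eta (act x g) * (eta x * g)^-1)%g \in K.
    have exg : (eta x * g)%g \in D by rewrite groupM.
    have xg : act x0 (eta x * g)%g = act x g by rewrite actM // etaX.
    rewrite inE groupM ?groupV //= actM ?groupV // etaX // -xg.
    by rewrite -actM ?groupV // mulgV act1.
  have -> : eta (act x g) = ((eta (act x g) * (eta x * g)^-1) * (eta x * g))%g by rewrite mulgKV.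
  by rewrite (remgrMl _ _ kin).
have pmE x s : P x -> all (mem D) s -> pm act eta x s = map (divgr K L) s.
  elim: s x => //= g s IHs x Px /andP[gD sD]; rewrite IHs //; last exact: actP.
  congr (_ :: _); rewrite /shift_arrow eta_shift // invMg mulgA /divgr.
  rewrite -(mulgA (eta x)) (centsP abD _ (etaD x Px)) ?mulgK //.
  by rewrite groupM ?groupV ?lDm.
have [||T [TB TE]] := @straighten_cocycle _ D X act P act1 actM actP eta etaD F FB.
- by move=> x s _; apply: FZ.
- by move=> x Px; rewrite baseE // -(act1 x0); apply: imset_f; rewrite group1.
have cO : #|O| = #|L|.
  have -> : O = [set act x0 l | l in L].
    apply/setP => x; apply/imsetP/imsetP => -[g gD ->].
      by exists (remgr K L g); [apply: lL|rewrite actl].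
    by exists g => //; apply: (subsetP LD).
  apply: card_in_imset => l l' lLl l'L E.
  have [lD l'D] := (subsetP LD _ lLl, subsetP LD _ l'L).
  apply/eqP; rewrite eq_mulgV1; apply/eqP/set1gP; rewrite -tiKL inE.
  rewrite [X in _ && X]groupM ?groupV // andbT inE groupM ?groupV //=.
  by rewrite actM ?groupV // E -actM ?groupV // mulgV act1.
have d7 : (7 %| #|O|)%N.
  have /p_natP[n E] : (7.-nat #|L|)%N by apply: (pgroupS LD); case/and3P: abelD.
  by move: O1; rewrite cO E; case: n {E} => // n _; rewrite expnS dvdn_mulr.
split=> //.
have FK : is_cocycle K (F x0).
  split=> [|s sK]; first exact: boundedX_at.
  rewrite -(FZ x0 (s := s)); last by apply/allP => g /(allP sK); apply: (subsetP KD).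
  by case: s sK => [|g s] //= /andP[gK _]; rewrite fixK // subrr addr0.
have kM : {in D &, {morph divgr K L : g h / (g * h)%g}}.
  move=> g g' gD g'D; rewrite /divgr lM // invMg mulgA -!mulgA; congr (_ * _)%g.
  by rewrite mulgA (centsP abD) ?groupM ?groupV ?lDm.
have wC := is_cocycle_pull kM kK (Cocycle FK).
exists (cls (Cocycle wC) *+ (#|O| %/ 7)); rewrite -mulrnA divnK //.
have -> : cls (Cocycle wC) *+ #|O| = cls ((Cocycle wC : cocycle D) *+ #|O|) by rewrite /cls rmorphMn.
rewrite clsP; apply: eq_cob (cob_sumX act1 actM actP TB TE) => s sD.
rewrite hE cocycle_mulrnE -sumr_const -sumrB; apply: eq_bigr => x Px.
by rewrite pmE // baseE.
Qed.

End OrbitSum.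

Section OrbitSumTotal.
Variables (gT : finGroupType) (D : {group gT}) (X : finType) (act : X -> gT -> X).
Hypothesis act1 : forall x, act x 1%g = x.
Hypothesis actM : forall x, {in D &, forall g h, act x (g * h)%g = act (act x g) h}.
Hypothesis abelD : (7.-abelem D)%g.
Variable F : X -> seq gT -> int.
Hypothesis FB : boundedX F.
Hypothesis FZ : forall x s, all (mem D) s -> cobX act F x s = 0.

(** A non-trivial orbit has a sum divisible by 7 and a length divisible by 7, so it counts for zero
    on both sides; each fixed point contributes [z]. *)
Lemma orbit_sum (z : rcoh D) (A : {set X}) :
    (forall x g, x \in A -> g \in D -> act x g \in A) ->
    (forall x (h : cocycle D), x \in A -> (forall g, g \in D -> act x g = x) ->
      (forall s, h s = F x s) -> rcl h = z) ->
  forall h : cocycle D, (forall s, h s = \sum_(x in A) F x s) -> rcl h = z *+ #|A|.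
Proof.
elim: {A}_.+1 {-2}A (ltnSn #|A|) => // n IHn A An actA Az h hE.
case: (set_0Vmem A) => [A0|[x0 x0A]].
  rewrite A0 cards0 mulr0n -(rmorph0 (@rcl _ D)); congr rcl; apply: cocycle_eqP => s.
  by rewrite hE A0 big_set0.
pose O := [set act x0 g | g in D].
have x0O : x0 \in O by rewrite -[x0]act1; apply: imset_f; rewrite group1.
have OA : O \subset A by apply/subsetP => _ /imsetP[g gD ->]; apply: actA.
have actO x g : x \in O -> g \in D -> act x g \in O.
  by move=> /imsetP[g' g'D ->] gD; rewrite -actM //; apply: imset_f; rewrite groupM.
have sumC (B : {set X}) : (forall x g, x \in B -> g \in D -> act x g \in B) ->
    is_cocycle D (fun s => \sum_(x in B) F x s).
  move=> actB; split; first by apply: bounded_sum => x _; apply: boundedX_at.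
  by move=> s sD; rewrite -(sum_cobX act1 actM actB) // big1 // => x _; apply: FZ.
have actAO x g : x \in A :\: O -> g \in D -> act x g \in A :\: O.
  rewrite !inE => /andP[xO xA] gD; rewrite actA // andbT.
  apply: contra xO => /actO - /(_ g^-1%g); rewrite groupV => /(_ gD).
  by rewrite -actM ?groupV // mulgV act1.
pose hO := Cocycle (sumC O actO); pose hA := Cocycle (sumC _ actAO).
have -> : h = hO + hA.
  by apply: cocycle_eqP => s /=; rewrite hE (big_setID O) /= (setIidPr OA).
rewrite rmorphD -(setID A O) (setIidPr OA) cardsU (_ : O :&: (A :\: O) = set0); last first.
  by apply/setP => x; rewrite !inE; case: (x \in O); rewrite ?andbF.
rewrite cards0 subn0 mulrnDr; congr (_ + _); last first.
  apply: IHn => //.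
    rewrite -ltnS (leq_trans _ An) // ltnS -[X in (_ < X)%N](cardsID O A) (setIidPr OA).
    by rewrite -[X in (X < _)%N]add0n ltn_add2r card_gt0; apply/set0Pn; exists x0.
  by move=> x h' /setDP[xA _]; apply: Az.
have [O1|O1] := ltnP 1 #|O|.
  have [d7 /dvdnP[q ->]] := orbit_class act1 actM abelD FB FZ (h := hO) (fun s => erefl) O1.
  by rewrite mulnC mulrnA red_mulrn7 mul0rn; apply: redq_div7 d7.
have O0 : O = [set x0].
  by apply/eqP; rewrite eq_sym eqEcard sub1set x0O cards1.
rewrite O0 cards1 mulr1n; apply: (Az x0) => // [g gD|s].
  by have := actO _ _ x0O gD; rewrite O0 => /set1P.
by rewrite /= O0 big_set1.
Qed.

End OrbitSumTotal.

(** * Transfer and restriction to a Sylow subgroup *)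

Section Transfer.
Variables (gT : finGroupType) (G E : {group gT}).
Hypothesis EG : E \subset G.
Local Notation rp := (@fingroup.repr gT).
Implicit Types f : cocycle E.

Let act (x : {set gT}) (g : gT) : {set gT} := (x :* g)%g.
Let act1 x : act x 1%g = x. Proof. exact: rcoset1. Qed.
Let actM x (g h : gT) : act x (g * h)%g = act (act x g) h. Proof. exact: rcosetM. Qed.

Let P (x : {set gT}) := x \in rcosets E G.
Let actP x (g : gT) : P x -> g \in G -> P (act x g).
Proof.
by move=> /rcosetsP[h hG ->] gG; apply/rcosetsP; exists (h * g)%g; rewrite ?groupM ?rcosetM.
Qed.

Lemma rcoset_reprE x : x \in rcosets E G -> rp x \in G /\ x = (E :* rp x)%g.
Proof.
move=> /rcosetsP[h hG ->]; have /rcosetP[e eE ->] := mem_repr_rcoset E h.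
split; first by rewrite groupM // (subsetP EG).
by rewrite rcosetM (rcoset_id eE).
Qed.

Let phiE : {in G, forall g, forall x, P x -> shift_arrow act rp x g \in E}.
Proof.
move=> g gG x Px; have [_ xE] := rcoset_reprE Px.
have [_ xgE] := rcoset_reprE (actP Px gG).
rewrite /shift_arrow -mem_rcoset -xgE /act.
by rewrite mem_rcoset mulgK {2}xE rcoset_refl.
Qed.

Definition tr_cochain f s := \sum_(x in rcosets E G) f (pm act rp x s).

Let pmE x s : P x -> all (mem G) s -> all (mem E) (pm act rp x s).
Proof. by move=> Px sG; apply: (pm_in actP phiE). Qed.

Let reprG x : P x -> rp x \in G. Proof. by move=> /rcoset_reprE[]. Qed.

Let actM' x : {in G &, forall g h, act x (g * h)%g = act (act x g) h}.
Proof. by move=> g h _ _. Qed.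

Let sum_pm (f' : seq gT -> int) s : all (mem G) s ->
  \sum_(x in rcosets E G) cobdry f' (pm act rp x s) =
  cobdry (fun s => \sum_(x in rcosets E G) f' (pm act rp x s)) s.
Proof.
move=> sG; rewrite -(sum_cobX act1 actM' actP (fun x s => f' (pm act rp x s)) sG).
by apply: eq_bigr => x Px; rewrite (cobX_pm actM' actP rp) //; apply: reprG.
Qed.

Fact tr_cocycle f : is_cocycle G (tr_cochain f).
Proof.
have [[N fN] fZ] := cocycleP f; split.
  by exists N => s Ns; rewrite /tr_cochain big1 // => x _; rewrite fN ?size_pm.
by move=> s sG; have := sum_pm f sG; rewrite big1 => [<-|x Px] //; rewrite fZ ?pmE.
Qed.

Definition transfer f : cocycle G := Cocycle (tr_cocycle f).

Lemma transfer_cls (f g : cocycle E) : cls f = cls g -> cls (transfer f) = cls (transfer g).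
Proof.
rewrite !clsP => -[h [[N hN] hE]].
exists (fun s => \sum_(x in rcosets E G) h (pm act rp x s)); split.
  by exists N => s Ns; rewrite big1 // => x _; rewrite hN ?size_pm.
move=> s sG; rewrite -(sum_pm h sG) /= /tr_cochain -sumrB; apply: eq_bigr => x Px.
by rewrite -hE ?pmE.
Qed.

Lemma transferMn f n : transfer (f *+ n) = transfer f *+ n.
Proof.
apply: cocycle_eqP => s; rewrite cocycle_mulrnE /= /tr_cochain -sumrMnl.
by apply: eq_bigr => x _; rewrite cocycle_mulrnE.
Qed.

(** Straightening compares the transported [f] with [f] itself at every coset; the sum of these
    homotopies gives one copy of [f] per coset. *)
Lemma transfer_res (f : cocycle G) : cls (transfer (resc EG f)) = cls f *+ #|G : E|%g.
Proof.
apply/esym; rewrite /cls -rmorphMn -/(cls _) -/(cls _) clsP.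
have [fB fZ] := cocycleP f.
have [||K [KB KE]] := @straighten_cocycle _ G _ act P act1 actM' actP _ reprG
    (fun _ => f) (boundedX_const _ fB).
- by move=> x s _ sG; rewrite cobX_const fZ.
- move=> x Px; apply: actP => //; rewrite groupV; exact: reprG.
apply: eq_cob (cob_sumX act1 actM' actP KB KE) => s sG.
by rewrite sumrB sumr_const cocycle_mulrnE.
Qed.

(* Only the cosets fixed by an elementary abelian subgroup contribute modulo 7
   to the restriction of a transfer to it (Mackey). *)
Lemma transfer_abelem (hT : finGroupType) (A : {group hT}) (phi : hT -> gT)
    (phiM : {in A &, {morph phi : x y / (x * y)%g}}) (phiG : {in A, forall x, phi x \in G})
    (f : cocycle E) (z : rcoh A) : (7.-abelem A)%g ->
    (forall g, g \in G ->
      forall (pM : {in A &, {morph (fun x => phi x ^ g)%g : x y / (x * y)%g}})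
             (pE : {in A, forall x, (phi x ^ g)%g \in E}),
      rpull pM pE (rcl f) = z) ->
  rpull phiM phiG (rcl (transfer f)) = z *+ #|G : E|%g.
Proof.
move=> abA fixz; pose actA (x : {set gT}) a := act x (phi a).
(* The action is defined on all subsets of [gT]; extension by zero makes [F] a cocycle at every
   point. *)
pose F (x : {set gT}) s := if x \in rcosets E G then f (pm act rp x (map phi s)) else 0.
have phi1 : phi 1%g = 1%g.
  by apply: (mulgI (phi 1%g)); rewrite -phiM ?group1 // mulg1 mulg1.
have actA1 x : actA x 1%g = x by rewrite /actA phi1 act1.
have actAM x : {in A &, forall a b, actA x (a * b)%g = actA (actA x a) b}.
  by move=> a b aA bA; rewrite /actA phiM // actM.
have actAP x a : x \in rcosets E G -> a \in A -> actA x a \in rcosets E G.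
  by move=> Px aA; apply: actP => //; apply: phiG.
have [[N fN] fZ] := cocycleP f.
have mapG s : all (mem A) s -> all (mem G) (map phi s).
  exact: (@all_map_in _ _ G A phi phiG).
have FB : boundedX F.
  by exists N => x s Ns; rewrite /F; case: ifP => // _; rewrite fN // size_pm size_map.
have FZ x s : all (mem A) s -> cobX actA F x s = 0.
  move=> sA; case: (boolP (x \in rcosets E G)) => [Px|nPx].
    transitivity (cobX act (fun x s => f (pm act rp x s)) x (map phi s)).
      case: s sA => [|a s] // sA; have /andP[aA _] := sA.
      rewrite /cobX /= -[phi a :: _]/(map phi (a :: s)) -(cobdry_map phiM) //.
      by rewrite /F Px actAP.
    by rewrite (cobX_pm actM' actP rp) ?fZ ?pmE ?mapG //; apply: reprG.
  case: s sA => [|a s] // /andP[aA _].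
  have nPa : actA x a \notin rcosets E G.
    apply: contra nPx => /actAP - /(_ a^-1%g); rewrite groupV => /(_ aA).
    by rewrite -actAM ?groupV // mulgV actA1.
  rewrite /cobX /F (negPf nPa) (negPf nPx) subrr addr0.
  exact: cobdry0.
rewrite rpullE -/(rcl _) /indexg.
apply: (orbit_sum actA1 actAM abA FB FZ actAP) => [x h Px fixx hE|s]; last first.
  by rewrite /= /tr_cochain; apply: eq_bigr => x Px; rewrite /F Px.
have [rG xE] := rcoset_reprE Px.
have shE a : a \in A -> shift_arrow act rp x (phi a) = (phi a ^ (rp x)^-1)%g.
  by move=> /fixx xa; rewrite /shift_arrow [act x _]xa conjgE invgK mulgA.
have pM : {in A &, {morph (fun a => phi a ^ (rp x)^-1)%g : a b / (a * b)%g}}.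
  by move=> a b aA bA; rewrite phiM // conjMg.
have pE : {in A, forall a, (phi a ^ (rp x)^-1)%g \in E}.
  by move=> a aA; rewrite -shE //; apply: phiE => //; apply: phiG.
rewrite -(fixz _ (groupVr rG) pM pE) rpullE -/(rcl _).
apply: rcl_cls; apply: cls_eq => s sA; rewrite hE /F Px /=; congr (f _).
elim: s sA => //= a s IHs /andP[aA sA]; rewrite shE //.
by rewrite [act x _](fixx a aA) IHs.
Qed.

End Transfer.

Section RestrictionToSylow.
Variables (gT : finGroupType) (G E : {group gT}).
Hypothesis EG : E \subset G.
Hypothesis idx : coprime #|G : E|%g 7.

(** If a power of the restriction is divisible by 7, so is its transfer, which is the index times
    the same power of the class. *)
Lemma rres_inj : injective (rres EG).
Proof.
suff inj0 x : rres EG x = 0 -> x = 0.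
  by move=> x y xy; apply/eqP; rewrite -subr_eq0; apply/eqP/inj0; rewrite rmorphB /= xy subrr.
have [f -> fo] := red_even_rep x; rewrite -/(rcl f) rresE => /(redclass0P (f := resc EG f) fo)[k [w E0]].
have [g Eg] := cls_surj w.
have resX n : resc EG f ^+ n = resc EG (f ^+ n).
  elim: n => [|n IHn]; first exact: cocycle_eqP.
  by rewrite !exprS IHn; apply: cocycle_eqP.
have E1 : cls (resc EG (f ^+ k)) = cls (g *+ 7).
  by rewrite -resX clsX E0 Eg /cls rmorphMn.
have := transfer_cls EG E1; rewrite transfer_res transferMn => E2.
apply: (@red_reduced _ _ _ k); rewrite -[LHS]/(rcl f ^+ k) -rmorphXn.
apply: (red_cancel idx); rewrite -rmorphMn /=.
rewrite -[LHS]/(qclass _ (cls (f ^+ k *+ _))).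
have -> : cls (f ^+ k *+ #|G : E|%g) = cls (f ^+ k) *+ #|G : E|%g by rewrite /cls rmorphMn.
rewrite E2; apply: redq_div7; exists (cls (transfer EG g)).
by rewrite /cls rmorphMn.
Qed.
End RestrictionToSylow.

Lemma F7_mulrn (x i : 'F_7) : x *+ i = x * i.
Proof. by rewrite -mulr_natr natr_Zp. Qed.

(** * The group [7_+^{1+2}]: normal forms and automorphisms *)

Section HeisenbergRelations.
Variables (gT : finGroupType).

Lemma expg_F7D (x : gT) (i j : 'F_7) : (x ^+ 7 = 1)%g -> (x ^+ (i + j)%R = x ^+ i * x ^+ j)%g.
Proof. by move=> x7; rewrite F7_addE expg_mod // expgD. Qed.

Lemma expg_F7M (x : gT) (i j : 'F_7) : (x ^+ 7 = 1)%g -> (x ^+ (i * j)%R = (x ^+ i) ^+ j)%g.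
Proof. by move=> x7; rewrite -expgM -[RHS](expg_mod _ x7). Qed.

Lemma expg_F7N (x : gT) (i : 'F_7) : (x ^+ 7 = 1)%g -> (x ^+ (- i)%R = (x ^+ i)^-1)%g.
Proof.
by move=> x7; apply/eqP; rewrite eq_sym eq_invg_mul -expg_F7D // subrr.
Qed.

Record heis_rel (e1 e2 c : gT) : Prop := HeisRel {
  heis_e1 : (e1 ^+ 7 = 1)%g;
  heis_e2 : (e2 ^+ 7 = 1)%g;
  heis_c : (c ^+ 7 = 1)%g;
  heis_comm : [~ e1, e2]%g = c;
  heis_c1 : commute e1 c;
  heis_c2 : commute e2 c
}.

Definition nf (e1 e2 c : gT) (i j k : 'F_7) := (e1 ^+ i * e2 ^+ j * c ^+ k)%g.

Section Relations.
Variables e1 e2 c : gT.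
Hypothesis hr : heis_rel e1 e2 c.
Local Notation nf := (nf e1 e2 c).

Lemma nf_commX (i j : 'F_7) : (e2 ^+ j * e1 ^+ i = e1 ^+ i * e2 ^+ j * c ^+ (- (j * i))%R)%g.
Proof.
have [_ _ c7 cm c1 c2] := hr.
have E : (e1 ^+ i * e2 ^+ j = e2 ^+ j * e1 ^+ i * c ^+ (j * i)%R)%g.
  rewrite [LHS]commgC; congr (_ * _)%g; rewrite commXXg ?cm // expg_F7M // -expgM.
  by rewrite mulnC.
by rewrite E expg_F7N // mulgK.
Qed.

Lemma nfM i j k i' j' k' :
  (nf i j k * nf i' j' k' = nf (i + i') (j + j') (k + k' - j * i'))%g.
Proof.
have [e17 e27 c7 cm c1 c2] := hr.
have key (A B Z A' B' Z' W : gT) : commute Z A' -> commute Z B' -> commute W B' ->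
    commute W (Z * Z')%g -> (B * A' = A' * B * W)%g ->
    (A * B * Z * (A' * B' * Z') = A * A' * (B * B') * (Z * Z' * W))%g.
  move=> ZA ZB WB WZ BA.
  have -> : (A * B * Z * (A' * B' * Z') = A * B * (Z * (A' * B')) * Z')%g by rewrite !mulgA.
  rewrite (commuteM ZA ZB) -WZ.
  have -> : (A * B * (A' * B' * Z) * Z' = A * (B * A') * (B' * (Z * Z')))%g by rewrite !mulgA.
  rewrite BA.
  have -> : (A * (A' * B * W) * (B' * (Z * Z')) = A * A' * B * (W * B') * (Z * Z'))%g.
    by rewrite !mulgA.
  by rewrite WB !mulgA.
rewrite /nf !expg_F7D //; apply: key; last exact: nf_commX.
- by apply: commuteX2; apply/esym/c1.
- by apply: commuteX2; apply/esym/c2.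
- by apply: commuteX2; apply/esym/c2.
- by apply: commuteM; apply: commuteX2.
Qed.

Lemma nf100 : nf 1 0 0 = e1. Proof. by rewrite /nf expg1 !expg0 !mulg1. Qed.
Lemma nf010 : nf 0 1 0 = e2. Proof. by rewrite /nf expg1 !expg0 mulg1 mul1g. Qed.
Lemma nf001 : nf 0 0 1 = c. Proof. by rewrite /nf expg1 !expg0 !mul1g. Qed.
Lemma nf000 : nf 0 0 0 = 1%g. Proof. by rewrite /nf !expg0 !mul1g. Qed.

End Relations.
End HeisenbergRelations.

Section Extraspecial.
Variables (gT : finGroupType) (E : {group gT}) (e1 e2 c : gT).
Hypothesis hE : is_extraspecial_7 E e1 e2 c.
Local Notation nfE := (nf e1 e2 c).

Lemma es_mem : [/\ e1 \in E, e2 \in E & c \in E].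
Proof.
rewrite (es_gen hE); split; apply: mem_gen; rewrite !inE eqxx ?orbT //.
Qed.

Lemma es_heis : heis_rel e1 e2 c.
Proof.
have [e1E e2E cE] := es_mem; have cC := es_central hE.
split; [exact: es_e1 hE|exact: es_e2 hE|exact: es_c hE|exact: es_comm hE|..].
  exact: (esym (centP cC _ e1E)).
exact: (esym (centP cC _ e2E)).
Qed.

Local Notation F73 := ('F_7 * 'F_7 * 'F_7)%type.
Let nfp (p : F73) := nfE p.1.1 p.1.2 p.2.

Lemma es_nf_in i j k : nfE i j k \in E.
Proof. by have [e1E e2E cE] := es_mem; rewrite /nf !groupM ?groupX. Qed.

Lemma es_nfP x : x \in E -> exists p, x = nfp p.
Proof.
pose N := [set nfp p | p : F73].
have gN : group_set N.
  apply/group_setP; split.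
    by apply/imsetP; exists (0, 0, 0) => //; rewrite /nfp nf000.
  move=> _ _ /imsetP[p _ ->] /imsetP[q _ ->]; rewrite /nfp (nfM es_heis).
  by apply/imsetP; exists (p.1.1 + q.1.1, p.1.2 + q.1.2, p.2 + q.2 - p.1.2 * q.1.1).
have EN : E \subset Group gN.
  rewrite (es_gen hE) gen_subG; apply/subsetP => y; rewrite !inE -orbA.
  case/or3P => /eqP->; apply/imsetP.
  - by exists (1, 0, 0) => //; rewrite /nfp nf100.
  - by exists (0, 1, 0) => //; rewrite /nfp nf010.
  - by exists (0, 0, 1) => //; rewrite /nfp nf001.
by move=> /(subsetP EN)/imsetP[p _ ->]; exists p.
Qed.

(** By counting: [nfp] maps [F_7^3] onto a group of order [7^3]. *)
Let nfp_inj : injective nfp.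
Proof.
have EE : [set nfp p | p : F73] = E.
  apply/setP => x; apply/imsetP/idP => [[p _ ->]|/es_nfP[p ->]]; first exact: es_nf_in.
  by exists p.
have /imset_injP inj : #|[set nfp p | p in [set: F73]]| == #|[set: F73]|.
  rewrite cardsT !card_prod card_Fp // (_ : [set nfp p | p in [set: F73]] = E) ?(es_card hE) //.
  by rewrite -EE; apply/setP => x; apply/imsetP/imsetP => -[p _ ->]; exists p.
by move=> p q pq; apply: inj; rewrite ?inE.
Qed.

Definition es_co (x : gT) : F73 := odflt (0, 0, 0) [pick p | nfp p == x].

Lemma es_coK i j k : es_co (nfE i j k) = (i, j, k).
Proof.
rewrite /es_co; case: pickP => [p /eqP pE|/(_ (i, j, k))]; last by rewrite eqxx.
exact: (@nfp_inj p (i, j, k)).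
Qed.

Lemma es_co_e1 : es_co e1 = (1, 0, 0).
Proof. by rewrite -[X in es_co X](nf100 e1 e2 c) es_coK. Qed.
Lemma es_co_e2 : es_co e2 = (0, 1, 0).
Proof. by rewrite -[X in es_co X](nf010 e1 e2 c) es_coK. Qed.
Lemma es_co_c : es_co c = (0, 0, 1).
Proof. by rewrite -[X in es_co X](nf001 e1 e2 c) es_coK. Qed.

Lemma es_nfK x : x \in E -> nfE (es_co x).1.1 (es_co x).1.2 (es_co x).2 = x.
Proof. by move=> /es_nfP[[[i j] k] ->]; rewrite /nfp es_coK. Qed.

Definition es_pi1 x := (es_co x).1.1.
Definition es_pi2 x := (es_co x).1.2.

Lemma es_pi1M : {in E &, forall g h, es_pi1 (g * h)%g = es_pi1 g + es_pi1 h}.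
Proof.
move=> g h /es_nfP[p ->] /es_nfP[q ->].
by rewrite /es_pi1 (nfM es_heis) !es_coK.
Qed.

Lemma es_pi2M : {in E &, forall g h, es_pi2 (g * h)%g = es_pi2 g + es_pi2 h}.
Proof.
move=> g h /es_nfP[p ->] /es_nfP[q ->].
by rewrite /es_pi2 (nfM es_heis) !es_coK.
Qed.

Lemma es_pi1E i j k : es_pi1 (nfE i j k) = i. Proof. by rewrite /es_pi1 es_coK. Qed.
Lemma es_pi2E i j k : es_pi2 (nfE i j k) = j. Proof. by rewrite /es_pi2 es_coK. Qed.

Definition es_hom (e1' e2' c' : gT) x := nf e1' e2' c' (es_co x).1.1 (es_co x).1.2 (es_co x).2.

Lemma es_homM e1' e2' c' : heis_rel e1' e2' c' ->
  {in E &, {morph es_hom e1' e2' c' : x y / (x * y)%g}}.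
Proof.
move=> hr x y /es_nfP[p ->] /es_nfP[q ->].
by rewrite /es_hom /nfp (nfM es_heis) !es_coK (nfM hr).
Qed.

Section Lift.
Variable M : 'M['F_7]_2.
Let f1 := (e1 ^+ (M 0 0)%R * e2 ^+ (M 1 0)%R)%g.
Let f2 := (e1 ^+ (M 0 1)%R * e2 ^+ (M 1 1)%R)%g.
Let D := \det M.
Let fc := (c ^+ (D : 'F_7))%g.

Let f1E : f1 = nfE (M 0 0) (M 1 0) 0. Proof. by rewrite /nf expg0 mulg1. Qed.
Let f2E : f2 = nfE (M 0 1) (M 1 1) 0. Proof. by rewrite /nf expg0 mulg1. Qed.

Lemma det_mx22 : D = M 0 0 * M 1 1 - M 0 1 * M 1 0.
Proof.
rewrite /D (expand_det_row _ 0) !big_ord_recl big_ord0 /cofactor !det_mx11 !mxE /=.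
rewrite expr0 expr1 mul1r mulN1r addr0 mulrN.
by congr (M _ _ * M _ _ - M _ _ * M _ _); apply: val_inj.
Qed.

(** The commutator enters [(xy)^7] with exponent ['C(7, 2) = 21], a multiple of 7. *)
Lemma es_exp7 x : x \in E -> (x ^+ 7 = 1)%g.
Proof.
move=> xE; have [p ->] := es_nfP xE.
have [e17 e27 c7 cm c1 c2] := es_heis.
have X (i j k : 'F_7) : commute (e1 ^+ i * e2 ^+ j)%g (c ^+ k)%g.
  apply: commute_sym; apply: commuteM; apply: commuteX2; exact: commute_sym.
rewrite /nfp /nf (expgMn _ (X _ _ _)) -!expgM mulnC expgM c7 expg1n mulg1.
have cm' : ([~ e2 ^+ p.1.2, e1 ^+ p.1.1] = (c ^+ (p.1.1 * p.1.2))^-1)%g.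
  by rewrite -invg_comm commXXg cm.
rewrite expMg_Rmul; last 2 first.
- by rewrite cm'; apply: commuteV; apply: commuteX2.
- by rewrite cm'; apply: commuteV; apply: commuteX2.
rewrite cm' -!expgM ![(_ * 7)%N]mulnC !expgM e17 e27 !expg1n !mul1g.
have b21 : (p.1.1 * p.1.2 * 'C(7, 2) = 7 * (p.1.1 * p.1.2 * 3))%N.
  by rewrite (_ : 'C(7, 2) = 21) //; lia.
by rewrite expgVn -!expgM b21 expgM c7 expg1n invg1.
Qed.

(** Elements of [E] have exponent 7 and central commutators, and the commutator is the determinant
    of the images in [F_7^2]. *)
Lemma heis_lift : heis_rel f1 f2 fc.
Proof.
have [e1E e2E cE] := es_mem.
have f1I : f1 \in E by rewrite groupM ?groupX.
have f2I : f2 \in E by rewrite groupM ?groupX.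
have cC x : x \in E -> commute x fc.
  by move=> xE; apply: commuteX; apply/esym/(centP (es_central hE)).
split; rewrite ?es_exp7 ?groupX //; try exact: cC.
apply: (mulgI (f2 * f1)%g); rewrite -commgC f1E f2E.
have -> : fc = nfE 0 0 D by rewrite /nf !expg0 !mul1g.
rewrite !(nfM es_heis); congr (nf _ _ _ _ _ _); rewrite ?det_mx22; ring.
Qed.

Hypothesis D0 : D != 0.

Let hom := es_hom f1 f2 fc.

Let homE x : x \in E -> hom x \in E.
Proof.
have [e1E e2E cE] := es_mem.
by move=> _; rewrite /hom /es_hom /nf !groupM ?groupX ?groupM ?groupX.
Qed.

Let hom_inj : {in E &, injective hom}.
Proof.
have hM := es_homM heis_lift.
suff ker : forall x, x \in E -> hom x = 1%g -> x = 1%g.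
  move=> x y xE yE xy; apply/eqP; rewrite eq_mulgV1; apply/eqP/ker; rewrite ?groupM ?groupV //.
  have h1 : hom 1%g = 1%g.
    by apply: (mulgI (hom 1%g)); rewrite -hM ?group1 // !mulg1.
  rewrite /hom hM ?groupV // -[es_hom _ _ _ x]/(hom x) xy -hM ?groupV // mulgV.
  exact: h1.
move=> x /es_nfP[[[i j] k] ->]; rewrite /hom /es_hom /nfp es_coK /= => E1.
have pX (pi : gT -> 'F_7) w n : {in E &, forall g h, pi (g * h)%g = pi g + pi h} ->
    w \in E -> pi (w ^+ n)%g = pi w *+ n.
  move=> pM wE; elim: n => [|n IHn]; last by rewrite expgS pM ?groupX // IHn mulrS.
  by apply: (@addrI _ (pi 1%g)); rewrite -pM ?group1 // mulg1 addr0.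
have f1I : f1 \in E by rewrite f1E es_nf_in.
have f2I : f2 \in E by rewrite f2E es_nf_in.
have fcI : fc \in E by have [_ _ cE] := es_mem; rewrite groupX.
have fcE : fc = nfE 0 0 D by rewrite /nf !expg0 !mul1g.
have [A B C] : [/\ (f1 ^+ i)%g \in E, (f2 ^+ j)%g \in E & (fc ^+ k)%g \in E].
  by split; apply: groupX.
have p1 : es_pi1 (nf f1 f2 fc i j k) = M 0 0 * i + M 0 1 * j.
  rewrite /nf (es_pi1M (groupM A B) C) (es_pi1M A B)
    (pX _ _ i es_pi1M f1I) (pX _ _ j es_pi1M f2I) (pX _ _ k es_pi1M fcI).
  by rewrite fcE f1E f2E !es_pi1E mul0rn addr0 !F7_mulrn.
have p2 : es_pi2 (nf f1 f2 fc i j k) = M 1 0 * i + M 1 1 * j.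
  rewrite /nf (es_pi2M (groupM A B) C) (es_pi2M A B)
    (pX _ _ i es_pi2M f1I) (pX _ _ j es_pi2M f2I) (pX _ _ k es_pi2M fcI).
  by rewrite fcE f1E f2E !es_pi2E mul0rn addr0 !F7_mulrn.
have e0 : es_co 1%g = (0, 0, 0) by rewrite -(nf000 e1 e2 c) es_coK.
move: p1 p2; rewrite E1 /es_pi1 /es_pi2 e0 /= => p1 p2.
have Di : D * i = 0.
  rewrite det_mx22 [LHS](_ : _ = M 1 1 * (M 0 0 * i + M 0 1 * j) - M 0 1 * (M 1 0 * i + M 1 1 * j)); last ring.
  by rewrite -p1 -p2; ring.
have Dj : D * j = 0.
  rewrite det_mx22 [LHS](_ : _ = M 0 0 * (M 1 0 * i + M 1 1 * j) - M 1 0 * (M 0 0 * i + M 0 1 * j)); last ring.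
  by rewrite -p1 -p2; ring.
have i0 : i = 0 by apply/eqP; move/eqP: Di; rewrite mulf_eq0 (negPf D0).
have j0 : j = 0 by apply/eqP; move/eqP: Dj; rewrite mulf_eq0 (negPf D0).
have c7 := es_c hE.
move: E1; rewrite i0 j0 /nf !expg0 !mul1g -expg_F7M // => E1.
have /(congr1 es_co) : nfE 0 0 (D * k) = 1%g by rewrite /nf !expg0 !mul1g.
rewrite e0 es_coK => /(congr1 snd) /= /eqP; rewrite mulf_eq0 (negPf D0) /= => /eqP ->.
by rewrite expg0.
Qed.

Lemma aut_lift : exists s : {perm gT}, s \in Aut E /\
  [/\ s e1 = f1, s e2 = f2 & s c = fc].
Proof.
have im : hom @: E \subset E by apply/subsetP => _ /imsetP[x xE ->]; apply: homE.
have pE := perm_inE hom_inj im; have [e1E e2E cE] := es_mem.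
exists (perm_in hom_inj im); split.
  rewrite inE perm_in_on; apply/morphicP => x y xE yE.
  by rewrite !pE ?groupM // /hom (es_homM heis_lift).
rewrite !pE // /hom /es_hom es_co_e1 es_co_e2 es_co_c /=.
by rewrite nf100 nf010 nf001.
Qed.
End Lift.
End Extraspecial.

(** * Functoriality of pullbacks and linear substitutions *)

Section RpullComposition.
Variables (gT hT kT : finGroupType) (D : {group gT}) (D' : {group hT}) (D'' : {group kT}).
Variables (psi : hT -> gT) (phi : kT -> hT) (chi : kT -> gT).
Hypothesis psiM : {in D' &, {morph psi : x y / (x * y)%g}}.
Hypothesis psiD : {in D', forall x, psi x \in D}.
Hypothesis phiM : {in D'' &, {morph phi : x y / (x * y)%g}}.
Hypothesis phiD : {in D'', forall x, phi x \in D'}.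
Hypothesis chiM : {in D'' &, {morph chi : x y / (x * y)%g}}.
Hypothesis chiD : {in D'', forall x, chi x \in D}.

Lemma rpull_comp x : {in D'', forall g, chi g = psi (phi g)} ->
  rpull chiM chiD x = rpull phiM phiD (rpull psiM psiD x).
Proof.
move=> chiE; have [f -> _] := red_even_rep x.
rewrite [rpull psiM psiD _]rpullE [rpull phiM phiD _]rpullE [LHS]rpullE.
rewrite -!/(rcl _); apply: rcl_cls; apply: cls_eq => s sD /=.
have -> // : map chi s = map psi (map phi s).
by rewrite -map_comp; apply/eq_in_map => g /(allP sD) gD; apply: chiE.
Qed.
End RpullComposition.

Section RpullExt.
Variables (gT hT : finGroupType) (D : {group gT}) (D' : {group hT}) (phi psi : hT -> gT).
Hypothesis phiM : {in D' &, {morph phi : x y / (x * y)%g}}.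
Hypothesis phiD : {in D', forall x, phi x \in D}.
Hypothesis psiM : {in D' &, {morph psi : x y / (x * y)%g}}.
Hypothesis psiD : {in D', forall x, psi x \in D}.

Lemma eq_rpull x : {in D', phi =1 psi} -> rpull phiM phiD x = rpull psiM psiD x.
Proof.
move=> E; have [f -> _] := red_even_rep x.
rewrite -/(rcl f) !rpullE -!/(rcl _); apply: rcl_cls; apply: cls_eq => s sD /=.
have -> // : map phi s = map psi s.
by apply/eq_in_map => g /(allP sD) gD; apply: E.
Qed.

Lemma rpull_inner x u : u \in D -> {in D', forall g, psi g = (phi g ^ u)%g} ->
  rpull psiM psiD x = rpull phiM phiD x.
Proof.
move=> uD E; have [f -> _] := red_even_rep x.
rewrite -/(rcl f) !rpullE -!/(rcl _); apply/esym; apply: rcl_cls; rewrite clsP.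
have [h [[N hN] hE]] := conj_cob f uD.
exists (fun s => h (map phi s)); split; first by exists N => s Ns; rewrite hN ?size_map.
move=> s sD; rewrite (cobdry_map phiM) // -hE ?(all_map_in phiD) //=; congr (_ - f _).
by rewrite -map_comp; apply/eq_in_map => g /(allP sD) gD; apply: E.
Qed.
End RpullExt.

Section BocksteinLinear.
Variables (gT : finGroupType) (D : {group gT}).

Lemma bock_lin (chi chi1 chi2 : gT -> 'F_7)
    (cM : {in D &, forall g h, chi (g * h)%g = chi g + chi h})
    (cM1 : {in D &, forall g h, chi1 (g * h)%g = chi1 g + chi1 h})
    (cM2 : {in D &, forall g h, chi2 (g * h)%g = chi2 g + chi2 h}) (i j : 'F_7) :
  {in D, forall g, chi g = i * chi1 g + j * chi2 g} ->
  rcl (bock cM) = rcl (bock cM1) *+ i + rcl (bock cM2) *+ j.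
Proof.
move=> E; rewrite -!rmorphMn -rmorphD; apply/esym; apply: rcl_cls; rewrite clsP.
(* [q] measures how far the integer lifts are from satisfying the linear relation; its coboundary
   accounts for the difference of the carries. *)
pose q g := ((i * chi1 g + j * chi2 g)%N %/ 7)%N.
exists (fun s => if s is [:: g] then (q g)%:Z else 0); split.
  by exists 1%N; do 2!case=> [|?] //.
move=> s sD; rewrite [LHS]/= !cocycle_mulrnE.
have [s2|s2] := eqVneq (size s) 2%N; last first.
  rewrite (@eq_cobdry_size _ _ (fun _ => 0)) ?cobdry0 => [|u us].
    by case: s s2 {sD} => [|? [|? [|? ?]]] //= _; rewrite !mul0rn.
  by case: u us => [|? [|? ?]] //= us; rewrite -us eqxx in s2.
case: s s2 sD => [|a [|b [|? ?]]] // _ /and3P[aD bD _].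
rewrite cobdry_cons2 cobdry1 /=; apply: (@mulfI int 7) => //.
have Eq g : g \in D -> 7 * (q g)%:Z =
    (i : nat)%:Z * (chi1 g : nat)%:Z + (j : nat)%:Z * (chi2 g : nat)%:Z - (chi g : nat)%:Z.
  move=> gD; have -> : (chi g : nat) = ((i * chi1 g + j * chi2 g)%N %% 7)%N.
    by rewrite E // /= modnDml modnDmr.
  rewrite /q -!PoszM -PoszD; lia.
have abD : (a * b)%g \in D by rewrite groupM.
have mn (x : int) (n : nat) : x *+ n = n%:Z * x by rewrite -mulr_natl natz.
rewrite !mn !mulrDr !mulrN !Eq //.
have c1 := carryE (chi1 a) (chi1 b); have c2 := carryE (chi2 a) (chi2 b).
have c0 := carryE (chi a) (chi b).
rewrite [7 * (_ * _)]mulrCA c1 [7 * (_ * _)]mulrCA c2 c0 !cM // !cM1 // !cM2 //; ring.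
Qed.

Lemma rpull_bock (hT : finGroupType) (D' : {group hT}) (phi : hT -> gT)
    (phiM : {in D' &, {morph phi : x y / (x * y)%g}})
    (phiD : {in D', forall x, phi x \in D}) (chi : gT -> 'F_7)
    (cM : {in D &, forall g h, chi (g * h)%g = chi g + chi h})
    (cM' : {in D' &, forall g h, chi (phi (g * h)%g) = chi (phi g) + chi (phi h)}) :
  rpull phiM phiD (rcl (bock cM)) = rcl (bock (chi := chi \o phi) cM').
Proof.
by rewrite rpullE -/(rcl _); congr rcl; apply: cocycle_eqP => -[|? [|? [|? ?]]].
Qed.

End BocksteinLinear.

Section CommutingPairs.
Variable gT : finGroupType.
Local Notation A0T := ('F_7 * 'F_7)%type.

Record cpair (D : {set gT}) (a b : gT) : Prop := CPair {
  cp_a : a \in D; cp_b : b \in D; cp_c : commute a b;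
  cp_a7 : (a ^+ 7 = 1)%g; cp_b7 : (b ^+ 7 = 1)%g
}.

Definition phi2 (a b : gT) (p : A0T) := (a ^+ p.1 * b ^+ p.2)%g.

Variables (D : {group gT}) (a b : gT).
Hypothesis cp : cpair D a b.

Fact phi2M : {in A0 &, {morph phi2 a b : x y / (x * y)%g}}.
Proof.
move=> p q _ _; rewrite /phi2 /= !expg_F7D ?(cp_a7 cp) ?(cp_b7 cp) //.
rewrite -!mulgA; congr (_ * _)%g; rewrite !mulgA; congr (_ * _)%g.
exact: (commuteX2 _ _ (cp_c cp)).
Qed.

Fact phi2D : {in A0, forall x, phi2 a b x \in D}.
Proof. by move=> p _; rewrite groupM ?groupX ?(cp_a cp) ?(cp_b cp). Qed.

Definition sig : rcoh D -> rcoh A0 := rpull phi2M phi2D.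
HB.instance Definition _ := GRing.RMorphism.on sig.
End CommutingPairs.

Section LinearSubstitution.
Local Notation BT := {poly {poly 'F_7}}.

Fact BT7 : (7%:R : BT) = 0.
Proof.
have F7 : (7%:R : 'F_7) = 0 by apply: val_inj.
by rewrite -[7%:R](rmorph_nat (@polyC _)) -(rmorph_nat (@polyC 'F_7)) F7 !rmorph0.
Qed.

Definition BU : BT := 'X%:P.
Definition BY : BT := 'X.

(** Induced by replacing the pair [(a, b)] with [(a^i b^k, a^j b^l)]. The dual coordinates transform
    by the transposed matrix: [y] goes to [i y + j u] and [u] to [k y + l u]. *)
Definition lsub (i k j l : 'F_7) : {rmorphism BT -> BT} :=
  ev2 BT7 (BY *+ k + BU *+ l) (BY *+ i + BU *+ j).

Variables (gT : finGroupType) (D : {group gT}) (a b a' b' : gT).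
Hypotheses (cp : cpair D a b) (cp' : cpair D a' b').

Lemma A0evY : A0ev BY = A0y. Proof. exact: ev2X. Qed.
Lemma A0evU : A0ev BU = A0u. Proof. by rewrite /BU [LHS]ev2C ev1X. Qed.

Lemma sig_lin (i k j l : 'F_7) x P :
    (a' = a ^+ i * b ^+ k)%g -> (b' = a ^+ j * b ^+ l)%g ->
  sig cp x = A0ev P -> sig cp' x = A0ev (lsub i k j l P).
Proof.
move=> a'E b'E xP.
pose L (p : 'F_7 * 'F_7) := (p.1 * i + p.2 * j, p.1 * k + p.2 * l).
have LM : {in A0 &, {morph L : p q / (p * q)%g}}.
  by move=> p q _ _; rewrite /L /=; congr (_, _); rewrite !mulrDl addrACA.
have LD : {in A0, forall p, L p \in A0} by move=> p _; rewrite inE.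
have [aD bD ab a7 b7] := cp.
have -> : sig cp' x = rpull LM LD (sig cp x).
  apply: rpull_comp => p _; rewrite /phi2 a'E b'E /L /=.
  have cX (m n : nat) : commute (a ^+ m)%g (b ^+ n)%g by apply: commuteX2.
  have eX (g : gT) (m n : 'F_7) : (g ^+ 7 = 1)%g ->
      (g ^+ (p.1 * m + p.2 * n)%R = (g ^+ m) ^+ p.1 * (g ^+ n) ^+ p.2)%g.
    by move=> g7; rewrite expg_F7D // (mulrC p.1) (mulrC p.2) !expg_F7M.
  rewrite !eX // (expgMn _ (cX i k)) (expgMn _ (cX j l)).
  rewrite -!mulgA; congr (_ * _)%g; rewrite !mulgA; congr (_ * _)%g.
  by rewrite -!expgM cX.
transitivity (ev2 (rcoh7 A0) (rpull LM LD A0u) (rpull LM LD A0y) P).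
  by rewrite xP; apply: rmorph_ev2.
transitivity (ev2 (rcoh7 A0) (A0ev (BY *+ k + BU *+ l)) (A0ev (BY *+ i + BU *+ j)) P); last first.
  exact/esym/rmorph_ev2.
have fM g h : g \in A0 -> h \in A0 -> (L (g * h)%g).1 = (L g).1 + (L h).1 by move=> gA hA; rewrite LM.
have sM g h : g \in A0 -> h \in A0 -> (L (g * h)%g).2 = (L g).2 + (L h).2 by move=> gA hA; rewrite LM.
have -> : rpull LM LD A0u = A0ev (BY *+ k + BU *+ l).
  rewrite rmorphD !rmorphMn A0evY A0evU (rpull_bock LM LD A0sndM sM).
  by apply: bock_lin => p _; rewrite /L /= mulrC [p.2 * _]mulrC.
have -> : rpull LM LD A0y = A0ev (BY *+ i + BU *+ j).
  rewrite rmorphD !rmorphMn A0evY A0evU (rpull_bock LM LD A0fstM fM).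
  by apply: bock_lin => p _; rewrite /L /= mulrC [p.2 * _]mulrC.
by [].
Qed.
End LinearSubstitution.

(** * Detection of reduced classes of [E] on the subgroups [A_m] *)

Section Detection.
Variables (gT : finGroupType) (E : {group gT}) (e1 e2 c : gT).
Hypothesis hE : is_extraspecial_7 E e1 e2 c.
Local Notation pi1 := (es_pi1 e1 e2 c).
Local Notation pi2 := (es_pi2 e1 e2 c).
Local Notation gen := (gen_A e1 e2).

Definition es_B1 : rcoh E := rcl (bock (es_pi1M hE)).
Definition es_B2 : rcoh E := rcl (bock (es_pi2M hE)).

(* [H^2(E; Z)] is [Hom(E, Q/Z)]. *)
Lemma es_H2 (f : cocycle E) : hdeg 2 f ->
  exists i j : 'F_7, rcl f = es_B1 *+ i + es_B2 *+ j.
Proof.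
move=> f2; have [e1E e2E cE] := es_mem hE.
have f0 : f [::] = 0 by apply: f2.
have := card_kills f0; rewrite (es_card hE) => fk.
have {fk} : cls (f *+ 7 ^ 3) = 0 by rewrite /cls rmorphMn.
have m343 (w : int) : w *+ (7 ^ 3)%N = 343 * w by rewrite -[LHS]mulr_natl (_ : (7 ^ 3)%N = 343%N).
rewrite cls0P => -[h0 [_ hE0]]; pose h x := h0 [:: x].
(* Modulo 343, the order of [E], the function [h] is a homomorphism: it is the character of [E] that
   corresponds to [f]. *)
have hM x y : x \in E -> y \in E -> h (x * y)%g = h x + h y - 343 * f [:: x; y].
  move=> xE yE; have xyD : all (mem E) [:: x; y] by apply/and3P.
  have := hE0 _ xyD.
  by rewrite cocycle_mulrnE m343 cobdry_cons2 cobdry1 /h => ->; ring.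
have hX x n : x \in E -> exists q, h (x ^+ n)%g = n%:Z * h x + 343 * q.
  move=> xE; elim: n => [|n [q IHn]].
    exists (f [:: 1%g; 1%g]); rewrite expg0 mul0r add0r.
    by have := hM 1%g 1%g (group1 E) (group1 E); rewrite mulg1 => E0; lra.
  rewrite expgS; exists (q - f [:: x; (x ^+ n)%g]); rewrite hM ?groupX // IHn intS; ring.
have h1 : exists q, h 1%g = 343 * q.
  by have [q] := hX 1%g 0%N (group1 E); rewrite expg0 => ->; exists q; rewrite mul0r add0r.
(* As [x^7 = 1], the integer [7 h(x)] is divisible by 343. *)
have h49 x : x \in E -> exists q, h x = 49 * q.
  move=> xE; have [q] := hX x 7%N xE; rewrite (es_exp7 hE xE).
  by have [q' ->] := h1 => E0; exists (q' - q); lra.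
(* [c] is a commutator, so the character vanishes on it. *)
have hc : exists q, h c = 343 * q.
  have E0 : (e1 * e2 = e2 * e1 * c)%g by rewrite -(es_comm hE) -commgC.
  have := congr1 h E0; rewrite !hM ?groupM // => E1.
  by exists (f [:: e2; e1] + f [:: (e2 * e1)%g; c] - f [:: e1; e2]); lra.
have [u1 hu1] := h49 _ e1E; have [u2 hu2] := h49 _ e2E.
have red (u : int) : exists2 i : 'F_7, exists q, u = (i : nat)%:Z + 7 * q & True.
  have lt7 : (`|(u %% 7)%Z| < 7)%N by lia.
  exists (Ordinal lt7) => //; exists (u %/ 7)%Z => /=; lia.
have [i [q1 Ei] _] := red u1; have [j [q2 Ej] _] := red u2.
have hx x : x \in E -> exists q,
    h x = 49 * ((i : nat)%:Z * (pi1 x : nat)%:Z + (j : nat)%:Z * (pi2 x : nat)%:Z) + 343 * q.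
  move=> xE; have [[[a b] k] ->] := es_nfP hE xE; rewrite (es_pi1E hE) (es_pi2E hE).
  have A : (e1 ^+ a)%g \in E by rewrite groupX.
  have B : (e2 ^+ b)%g \in E by rewrite groupX.
  have C : (c ^+ k)%g \in E by rewrite groupX.
  rewrite /nf /= (hM _ _ (groupM A B) C) (hM _ _ A B).
  have [r1 ->] := hX _ a e1E; have [r2 ->] := hX _ b e2E; have [r3 ->] := hX _ k cE.
  have [qc ->] := hc; rewrite hu1 hu2 Ei Ej.
  exists (q1 * (a : nat)%:Z + q2 * (b : nat)%:Z + r1 + r2 + r3 + (k : nat)%:Z * qc
    - f [:: (e1 ^+ a)%g; (e2 ^+ b)%g] - f [:: (e1 ^+ a * e2 ^+ b)%g; (c ^+ k)%g]).
  ring.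
have /choice[kk kkE] : forall x, exists q, x \in E ->
    h x = 49 * ((i : nat)%:Z * (pi1 x : nat)%:Z + (j : nat)%:Z * (pi2 x : nat)%:Z) + 343 * q.
  move=> x; case: (boolP (x \in E)) => [/hx[q E0]|nE]; first by exists q.
  by exists 0.
exists i, j; rewrite -!rmorphMn -rmorphD; apply: rcl_cls; rewrite clsP.
exists (fun s => if s is [:: g] then kk g else 0); split.
  by exists 1%N; do 2!case=> [|?] //.
move=> s sD; rewrite [LHS]/= !cocycle_mulrnE.
have [s2|s2] := eqVneq (size s) 2%N; last first.
  rewrite (@eq_cobdry_size _ _ (fun _ => 0)) ?cobdry0 => [|u us].
    by rewrite f2 //; case: s s2 {sD} => [|? [|? [|? ?]]] //= _; rewrite !mul0rn; ring.
  by case: u us => [|? [|? ?]] //= us; rewrite -us eqxx in s2.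
case: s s2 sD => [|x [|y [|? ?]]] // _ /and3P[xE yE _].
rewrite cobdry_cons2 cobdry1 /=; apply: (@mulfI int 343) => //.
have mn (w : int) (n : nat) : w *+ n = n%:Z * w by rewrite -mulr_natl natz.
have := hM x y xE yE; rewrite (kkE _ xE) (kkE _ yE) (kkE _ (groupM xE yE)) => E0.
have c1 := carryE (pi1 x) (pi1 y); have c2 := carryE (pi2 x) (pi2 y).
rewrite -(es_pi1M hE xE yE) in c1; rewrite -(es_pi2M hE xE yE) in c2.
rewrite !mn.
have E1 : 343 * f [:: x; y] = 49 * ((i : nat)%:Z * (7 * carry (pi1 x) (pi1 y))
   + (j : nat)%:Z * (7 * carry (pi2 x) (pi2 y))) + 343 * (kk x + kk y - kk (x * y)%g).
  by rewrite c1 c2; rewrite -[343 * f _](subKr (49 * ((i : nat)%:Z * (pi1 x : nat)%:Z + (j : nat)%:Z * (pi2 x : nat)%:Z) + 343 * kk x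
     + (49 * ((i : nat)%:Z * (pi1 y : nat)%:Z + (j : nat)%:Z * (pi2 y : nat)%:Z) + 343 * kk y))) -E0; ring.
rewrite mulrBr E1; ring.
Qed.

(** [es_chi m] is a character with kernel [A_m]; [es_lam m] is the coordinate on [A_m] along the
    generator [gen m]. *)
Definition es_chi (m : option 'F_7) x : 'F_7 :=
  if m is Some k then pi2 x - k * pi1 x else pi1 x.
Definition es_lam (m : option 'F_7) x : 'F_7 := if m is Some k then pi1 x else pi2 x.

Lemma es_chiM m : {in E &, forall g h, es_chi m (g * h)%g = es_chi m g + es_chi m h}.
Proof.
move=> g h gE hE'; case: m => [k|] /=; last exact: es_pi1M hE _ _ gE hE'.
rewrite (es_pi1M hE) // (es_pi2M hE) //; ring.
Qed.

Lemma es_lamM m : {in E &, forall g h, es_lam m (g * h)%g = es_lam m g + es_lam m h}.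
Proof. by case: m => [k|]; [exact: es_pi1M hE|exact: es_pi2M hE]. Qed.

Lemma es_genE m : gen m = nf e1 e2 c (if m is Some _ then 1 else 0) (if m is Some k then k else 1) 0.
Proof. by case: m => [k|]; rewrite /nf expg0 mulg1 ?expg1 ?expg0 ?mul1g. Qed.

Lemma es_cp m : cpair E (gen m) c.
Proof.
have [_ _ cE] := es_mem hE.
have gE : gen m \in E by rewrite es_genE es_nf_in.
split=> //; try exact: es_exp7 hE _ _.
exact/esym/(centP (es_central hE)).
Qed.

Fact es_ker_group m : group_set [set x in E | es_chi m x == 0].
Proof.
have chi1 : es_chi m 1%g = 0.
  by apply: (@addrI _ (es_chi m 1%g)); rewrite -es_chiM ?group1 // mulg1 addr0.
apply/group_setP; split; first by rewrite inE group1 chi1 /=.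
move=> g h; rewrite !inE => /andP[gE /eqP g0] /andP[hE' /eqP h0].
by rewrite groupM // es_chiM // g0 h0 addr0 eqxx.
Qed.
Definition es_ker m := Group (es_ker_group m).

Let fX (pi : gT -> 'F_7) x n : {in E &, forall g h, pi (g * h)%g = pi g + pi h} ->
  x \in E -> pi (x ^+ n)%g = pi x *+ n.
Proof.
move=> pM xE; elim: n => [|n IHn]; last by rewrite expgS pM ?groupX // IHn mulrS.
by apply: (@addrI _ (pi 1%g)); rewrite -pM ?group1 // mulg1 addr0.
Qed.

Let val_gen m : (es_chi m (gen m) = 0) * (es_lam m (gen m) = 1).
Proof. by case: m => [k|]; rewrite es_genE /= (es_pi1E hE) (es_pi2E hE) ?mulr1 ?subrr. Qed.
Let val_c m : (es_chi m c = 0) * (es_lam m c = 0).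
Proof.
rewrite -(nf001 e1 e2 c); case: m => [k|] /=; rewrite (es_pi1E hE) (es_pi2E hE) //.
by rewrite mulr0 subr0.
Qed.

Lemma es_char7 m : char7 E (es_ker m) (es_chi m) (gen (if m is Some _ then None else Some 0)).
Proof.
split; first exact: es_chiM.
- by apply/subsetP => x; rewrite inE => /andP[].
- by move=> g; rewrite inE => /andP[_ /eqP].
- by move=> g gE g0; rewrite inE gE g0 /=.
- by rewrite es_genE es_nf_in.
- by case: m => [k|]; rewrite es_genE /= (es_pi1E hE) ?(es_pi2E hE) ?mulr0 ?subr0.
Qed.

Local Notation phi m := (phi2 (gen m) c).

Lemma es_phi_ker m p : phi m p \in es_ker m.
Proof.
have [aE cE _ _ _] := es_cp m.
rewrite inE groupM ?groupX //= es_chiM ?groupX // !(fX _ (@es_chiM m)) //.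
by rewrite val_gen val_c !mul0rn addr0.
Qed.

Lemma es_phi_surj m x : x \in es_ker m -> exists p, x = phi m p.
Proof.
have [aE cE cac _ c7] := es_cp m; rewrite inE => /andP[xE /eqP x0].
pose y := ((gen m ^+ es_lam m x)^-1 * x)%g.
have aX : (gen m ^+ es_lam m x)%g \in E by rewrite groupX.
have yE : y \in E by rewrite groupM ?groupV.
have xy : x = ((gen m ^+ es_lam m x) * y)%g by rewrite mulKVg.
have ly : es_lam m y = 0.
  have := congr1 (es_lam m) xy; rewrite es_lamM // (fX _ (@es_lamM m)) // val_gen.
  by rewrite natr_Zp => /eqP; rewrite eq_sym addrC -subr_eq0 addrK => /eqP.
have cy : es_chi m y = 0.
  have := congr1 (es_chi m) xy; rewrite es_chiM // (fX _ (@es_chiM m)) // val_gen.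
  by rewrite x0 mul0rn add0r.
have [p1 p2] : pi1 y = 0 /\ pi2 y = 0.
  move: ly cy; case: (m) => [k|] /= ->; last by move=> ->.
  by rewrite mulr0 subr0.
move: p1 p2; have [[[i j] k] yE'] := es_nfP hE yE.
rewrite yE' (es_pi1E hE) (es_pi2E hE) /= => i0 j0.
exists (es_lam m x, k); rewrite /phi2 /= [LHS]xy yE' /nf i0 j0 !expg0 !mul1g //.
Qed.

Lemma es_phi_inj m : injective (phi m).
Proof.
have [aE cE cac _ c7] := es_cp m.
move=> [i k] [i' k'] pq.
have ii : i = i'.
  have := congr1 (es_lam m) pq; rewrite /phi2 /= !es_lamM ?groupX //.
  by rewrite !(fX _ (@es_lamM m)) // val_gen val_c !mul0rn !addr0 !natr_Zp.
move: pq; rewrite ii /phi2 /= => /mulgI E0.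
have : nf e1 e2 c 0 0 k = nf e1 e2 c 0 0 k' by rewrite /nf !expg0 !mul1g.
by move/(congr1 (@es_co gT e1 e2 c)); rewrite !(es_coK hE) => /(congr1 snd) /= ->.
Qed.

Definition es_sig m : rcoh E -> rcoh A0 := sig (es_cp m).

(* Transport along the isomorphism [(Z/7)^2 -> A_m]. *)
Lemma es_ker_cob m (f : cocycle E) :
  cob A0 (cocycle_pull (phi2M (es_cp m)) (phi2D (es_cp m)) f) -> cob (es_ker m) f.
Proof.
move=> fC; pose psi x : 'F_7 * 'F_7 := odflt (0, 0) [pick p | phi m p == x].
have phiK p : psi (phi m p) = p.
  rewrite /psi; case: pickP => [q /eqP/es_phi_inj //|/(_ p)]; by rewrite eqxx.
have psiK x : x \in es_ker m -> phi m (psi x) = x by move=> /es_phi_surj[p ->]; rewrite phiK.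
have psiM : {in es_ker m &, {morph psi : x y / (x * y)%g}}.
  move=> x y /es_phi_surj[p ->] /es_phi_surj[q ->].
  by rewrite -(phi2M (es_cp m)) ?phiK // inE.
have psiD : {in es_ker m, forall x, psi x \in A0} by move=> x _; rewrite inE.
have [h [[N hN] hE']] := fC.
exists (fun s => h (map psi s)); split; first by exists N => s Ns; rewrite hN ?size_map.
move=> s sD; rewrite (cobdry_map psiM) // -hE' ?(all_map_in psiD) //=; congr (f _).
rewrite -map_comp -[LHS]map_id; apply/eq_in_map => x /(allP sD) xD /=.
by rewrite psiK.
Qed.

Hypothesis es_rel : es_B1 ^+ 7 * es_B2 = es_B1 * es_B2 ^+ 7.

Lemma prod_F7 (R : comNzRingType) (x y : R) : 7%:R = 0 :> R ->
  \prod_(k : 'F_7) (x - y *+ k) = x ^+ 7 - x * y ^+ 6.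
Proof.
move=> R7; rewrite 7!big_ord_recl big_ord0 /= /bump /=.
(* The displayed multiple of 7 is the exact difference between the two polynomials over the
   integers. *)
have -> : x ^+ 7 - x * y ^+ 6 = \prod_(i < 7) (x - y *+ i)
   + 7%:R * (3 * x ^+ 6 * y - 25 * x ^+ 5 * y ^+ 2 + 105 * x ^+ 4 * y ^+ 3
      - 232 * x ^+ 3 * y ^+ 4 + 252 * x ^+ 2 * y ^+ 5 - 103 * x * y ^+ 6).
  by rewrite 7!big_ord_recl big_ord0 /= /bump /=; ring.
rewrite R7 mul0r addr0 7!big_ord_recl big_ord0 /= /bump /=.
by [].
Qed.

(** The eight characters represent the points of the projective line over [F_7], so the product is,
    up to sign, the relation [B1^7 B2 - B1 B2^7]. *)
Lemma es_prod_bock : \prod_m rcl (bock (es_chiM m)) = 0.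
Proof.
have optE (F : option 'F_7 -> rcoh E) : \prod_m F m = F None * \prod_k F (Some k).
  rewrite (bigD1 None) //=; congr (_ * _).
  rewrite (reindex_omap Some id) => [|[k|]] //=; apply: eq_bigl => k.
  by rewrite ?eqxx.
rewrite optE (_ : rcl _ = es_B1); last by congr rcl; apply: cocycle_eqP.
rewrite (eq_bigr (fun k : 'F_7 => es_B2 - es_B1 *+ k)) => [|k _]; last first.
  rewrite (bock_lin (es_chiM (Some k)) (es_pi2M hE) (es_pi1M hE) (i := 1) (j := - k)).
    rewrite mulr1n; congr (_ + _).
    rewrite -[LHS]mulr_natr -[es_B1 *+ k]mulr_natr -mulrN; congr (_ * _).
    exact: (rmorphN (of7 (rcoh7 E)) k).
  by move=> g _ /=; rewrite mul1r mulNr.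
rewrite (prod_F7 _ _ (rcoh7 E)) mulrBr [es_B2 * _]mulrC [es_B1 * (_ * es_B2)]mulrA -exprS.
by rewrite es_rel subrr.
Qed.

(** A class that vanishes on [A_m] has a power divisible by the Bockstein of [es_chi m]. The product
    of these powers over all [m] is a multiple of a zero product, so the class is nilpotent. *)
Lemma es_detection x : (forall m, es_sig m x = 0) -> x = 0.
Proof.
have [f -> fo] := red_even_rep x; rewrite -/(rcl f) => sig0.
have pullP m (g : cocycle E) : es_sig m (rcl g) =
   rcl (cocycle_pull (phi2M (es_cp m)) (phi2D (es_cp m)) g) by apply: rpullE.
pose P m (g : cocycle E) := cocycle_pull (phi2M (es_cp m)) (phi2D (es_cp m)) g.
have Po m (g : cocycle E) : (forall s, odd (size s) -> g s = 0) ->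
    forall s, odd (size s) -> P m g s = 0.
  by move=> go s so; apply: go; rewrite size_map.
(* The degree-0 part is a multiple of 7 and is removed: divisibility by 7 on [A_m] then becomes
   vanishing, as in all positive even degrees. *)
have [f' [ff' f'o f'0]] : exists f' : cocycle E, [/\ rcl f = rcl f',
    forall s, odd (size s) -> f' s = 0 & f' [::] = 0].
  have := sig0 None; rewrite pullP => /(redclass0P (Po None f fo))[k [w Ew]].
  have [g Eg] := cls_surj w.
  have /cls_nil : cls (P None f ^+ k) = cls (g *+ 7) by rewrite clsX Ew Eg /cls rmorphMn.
  rewrite cocycleX_nil cocycle_mulrnE /= => Ec.
  have [q Eq] : exists q : int, f [::] = 7 * q.
    have d7 : (7 %| (f [::])%R ^+ k)%Z by rewrite Ec -[g _ *+ 7]mulr_natr dvdz_mull.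
    move: d7; rewrite dvdzE abszX Euclid_dvdX // => /andP[d7 _].
    have /dvdzP[q ->] : (7 %| f [::])%Z by rewrite dvdzE.
    by exists q; rewrite mulrC.
  exists (f - (1 *~ q) *+ 7); split.
  - by rewrite rmorphB /= rmorphMn /= (red_mulrn7 (D := E)) subr0.
  - case=> // y s so; rewrite [LHS]/= fo // cocycle_mulrnE cocycle_mulrzE.
    by rewrite [cochain_of _ _](_ : _ = 0) // mul0rz mul0rn subr0.
  - rewrite [LHS]/= cocycle_mulrnE cocycle_mulrzE Eq [cochain_of _ _](_ : _ = 1) //.
    by rewrite -mulrzr mul1r intz; ring.
have /choice[nm /choice[wm Hm]] m : exists n w, rcl f' ^+ n = rcl (bock (es_chiM m)) * rcl w.
  have := sig0 m; rewrite ff' pullP => /(redclass0P (Po m f' f'o))[k [w Ew]].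
  pose F := f' ^+ k.+1.
  have PF : P m F = P m f' ^+ k.+1.
    rewrite /F; elim: (k.+1) => [|j IHj]; first by apply: cocycle_eqP => -[].
    rewrite !exprS -IHj.
    exact: (cocycle_pull_monoid_morphism (phi2M (es_cp m)) (phi2D (es_cp m))).2.
  have Fo s : odd (size s) -> F s = 0.
    rewrite /F; elim: (k.+1) s => [|j IHj] s so.
      by rewrite expr0 [LHS]/= /cup1; case: s so.
    rewrite exprS; apply: (@cup_parity _ _ _ false false) => [v vo|v vo|]; last by rewrite so.
      by apply: f'o; case: odd vo.
    by apply: IHj; case: odd vo.
  have F0 : F [::] = 0 by rewrite cocycleX_nil f'0 expr0n.
  have PF0 : cls (P m F) = 0.
    apply: (div7_pos_even A0killed); [exact: Po|by []|].
    by rewrite PF clsX exprS Ew; apply: div7Ml; exists w.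
  have Hk : cob (es_ker m) F by apply: es_ker_cob; rewrite -cls0P.
  have [cM cS c0 cK ct c1] := es_char7 m.
  have [W EW] := bock_dvd_sqr (es_chiM m) cK ct c1 Hk.
  exists (k.+1 * 2)%N, W; rewrite exprM -!rmorphXn -rmorphM; apply: rcl_cls.
  by rewrite clsX clsM EW.
apply: (@red_reduced _ _ _ (\sum_m nm m)).
rewrite -[LHS]/((rcl f : rcoh E) ^+ _) ff' -prodrXr (eq_bigr _ (fun m _ => Hm m)).
by rewrite big_split /= es_prod_bock mul0r.
Qed.
End Detection.

(** * Binary forms invariant under a shear and semi-invariant under a torus *)

Section Char7Identities.
Variables (R : comNzRingType) (R7 : 7%:R = 0 :> R).

Lemma frob7 (a b : R) : (a + b) ^+ 7 = a ^+ 7 + b ^+ 7.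
Proof.
transitivity (a ^+ 7 + b ^+ 7 + 7%:R * (a ^+ 6 * b + 3 * a ^+ 5 * b ^+ 2
  + 5 * a ^+ 4 * b ^+ 3 + 5 * a ^+ 3 * b ^+ 4 + 3 * a ^+ 2 * b ^+ 5 + a * b ^+ 6)); first by ring.
by rewrite R7 mul0r addr0.
Qed.

Lemma frob7B (a b : R) : (a - b) ^+ 7 = a ^+ 7 - b ^+ 7.
Proof. by rewrite frob7 -[in (- b) ^+ 7]mulN1r exprMn -signr_odd expr1 mulN1r. Qed.

Lemma F7_pow7 (i : 'F_7) : i ^+ 7 = i.
Proof.
have /forallP/(_ i)/eqP // : [forall i : 'F_7, i ^+ 7 == i].
by apply/forallP; case=> -[|[|[|[|[|[|[|]]]]]]].
Qed.

Lemma of7_pow7 i : of7 R7 i ^+ 7 = of7 R7 i.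
Proof. by rewrite -rmorphXn F7_pow7. Qed.

Lemma mulrn_of7 (x : R) (i : 'F_7) : x *+ i = of7 R7 i * x.
Proof. by rewrite -[LHS]mulr_natl. Qed.
End Char7Identities.

Section BTscalars.
Local Notation BT := {poly {poly 'F_7}}.
Definition BK : 'F_7 -> BT := of7 BT7.
HB.instance Definition _ := GRing.RMorphism.on BK.

Lemma BKE (i : 'F_7) : BK i = i%:P%:P.
Proof.
by rewrite /BK /of7 -(rmorph_nat (@polyC _)) -(rmorph_nat (@polyC 'F_7)) natr_Zp.
Qed.

Lemma BK0 : BK 0 = 0. Proof. exact: rmorph0. Qed.
Lemma BK1 : BK 1 = 1. Proof. exact: rmorph1. Qed.
Lemma BKM x y : BK (x * y) = BK x * BK y. Proof. exact: rmorphM. Qed.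
Lemma BKX x n : BK (x ^+ n) = BK x ^+ n. Proof. exact: rmorphXn. Qed.
Lemma BKN x : BK (- x) = - BK x. Proof. exact: rmorphN. Qed.

Lemma BK_eq0 i : (BK i == 0) = (i == 0).
Proof. by rewrite BKE !polyC_eq0. Qed.

Lemma hformE n c : hform n c = \sum_(k < n.+1) BK (c k) * BU ^+ (n - k) * BY ^+ k.
Proof.
apply: eq_bigr => k _; rewrite BKE /BU /BY -mul_polyC rmorphM rmorphXn /=.
by [].
Qed.

Lemma hform_inj n c c' : hform n c = hform n c' -> forall k, (k <= n)%N -> c k = c' k.
Proof.
move=> E k kn; have coefh (d : nat -> 'F_7) : (hform n d)`_k`_(n - k) = d k.
  rewrite /hform coef_sum (bigD1 (Ordinal (kn : (k < n.+1)%N))) //= coefCM coefXn eqxx mulr1.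
  rewrite big1 ?addr0 => [|i ne]; first by rewrite coefZ coefXn eqxx mulr1.
  rewrite coefCM coefXn [k == i]eq_sym (_ : (val i == k) = false) ?mulr0 //.
  by apply: contra_neqF ne => /eqP E0; apply: val_inj.
by rewrite -coefh E coefh.
Qed.

Lemma lsubK i k j l x : lsub i k j l (BK x) = BK x.
Proof. exact: rmorph_of7. Qed.
Lemma lsubY i k j l : lsub i k j l BY = BK i * BY + BK j * BU.
Proof. by rewrite [LHS]ev2X !(mulrn_of7 BT7). Qed.
Lemma lsubU i k j l : lsub i k j l BU = BK k * BY + BK l * BU.
Proof. by rewrite [LHS]ev2C ev1X !(mulrn_of7 BT7). Qed.

Opaque BU BY BK.

Lemma lsubY10 k l : lsub 1 k 0 l BY = BY.
Proof.
suff comb (R : nzRingType) (a b x y : R) : x = 1 -> y = 0 -> x * a + y * b = a.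
  by rewrite lsubY; apply: comb; [apply: BK1|apply: BK0].
by move=> -> ->; rewrite mul1r mul0r addr0.
Qed.

Lemma lsubU0 i j l : lsub i 0 j l BU = BK l * BU.
Proof.
suff comb (R : nzRingType) (a b x y : R) : x = 0 -> x * a + y * b = y * b.
  by rewrite lsubU; apply: comb; apply: BK0.
by move=> ->; rewrite mul0r add0r.
Qed.

Lemma lsubU00 i j : lsub i 0 j 0 BU = 0.
Proof. by rewrite lsubU0 BK0; apply: mul0r. Qed.

Lemma lsubU11 i j : lsub i 1 j 1 BU = BY + BU.
Proof.
suff comb (R : nzRingType) (a b x : R) : x = 1 -> x * a + x * b = a + b.
  by rewrite lsubU; apply: comb; apply: BK1.
by move=> ->; rewrite !mul1r.
Qed.

Lemma lsubM i k j l x y : lsub i k j l (x * y) = lsub i k j l x * lsub i k j l y.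
Proof. exact: rmorphM. Qed.
Lemma lsubD i k j l x y : lsub i k j l (x + y) = lsub i k j l x + lsub i k j l y.
Proof. exact: rmorphD. Qed.
Lemma lsubB i k j l x y : lsub i k j l (x - y) = lsub i k j l x - lsub i k j l y.
Proof. exact: rmorphB. Qed.
Lemma lsubX i k j l x n : lsub i k j l (x ^+ n) = lsub i k j l x ^+ n.
Proof. exact: rmorphXn. Qed.

Lemma lsub_hform n c (e : 'F_7) :
  lsub 1 0 0 e (hform n c) = hform n (fun k => e ^+ (n - k) * c k).
Proof.
rewrite !hformE rmorph_sum; apply: eq_bigr => k _.
rewrite !lsubM !lsubX lsubK lsubY10 lsubU0.
by rewrite exprMn BKM BKX; ring.
Qed.

Lemma scale_hform n c (e : 'F_7) : BK e * hform n c = hform n (fun k => e * c k).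
Proof.
rewrite !hformE mulr_sumr; apply: eq_bigr => k _.
by rewrite rmorphM !mulrA.
Qed.

Lemma BYU_coef (x : 'F_7) n : BK x * BY ^+ n = 0 -> x = 0.
Proof.
move/eqP; rewrite mulf_eq0 expf_eq0 polyX_eq0 andbF orbF BK_eq0.
by move/eqP.
Qed.

(** The product of the forms [u + k y] over [k] in [F_7]; up to a scalar, [v] restricts to it. *)
Definition Bv0 : BT := BU ^+ 7 - BY ^+ 6 * BU.

Lemma shiftE : (lsub 1 1 0 1 BY = BY) * (lsub 1 1 0 1 BU = BY + BU).
Proof. by rewrite lsubY10 lsubU11. Qed.

Lemma shift_form (x y : 'F_7) m n : lsub 1 1 0 1 (BK x * BU ^+ m + BK y * BY ^+ n) =
  BK x * (BY + BU) ^+ m + BK y * BY ^+ n.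
Proof. by rewrite lsubD !lsubM !lsubX !lsubK !shiftE. Qed.

Lemma shift_form' (x y : 'F_7) m n : lsub 1 1 0 1 (BK x * BU ^+ m + BK y * (BY ^+ n * BU)) =
  BK x * (BY + BU) ^+ m + BK y * (BY ^+ n * (BY + BU)).
Proof. by rewrite lsubD !lsubM !lsubX !lsubK !shiftE. Qed.

Lemma kill_form n : lsub 1 0 0 0 ((BY + BU) ^+ n - BU ^+ n) = BY ^+ n - 0 ^+ n.
Proof.
by rewrite lsubB !lsubX lsubD lsubY10 lsubU00 addr0.
Qed.

Lemma linear_form_inv c : lsub 1 1 0 1 (hform 1 c) = hform 1 c ->
  hform 1 c = BK (c 1) * BY.
Proof.
have -> : hform 1 c = BK (c 0) * BU ^+ 1 + BK (c 1) * BY ^+ 1.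
  by rewrite hformE 2!big_ord_recl big_ord0 /bump /= !expr0 !expr1 !mulr1 addr0.
rewrite shift_form !expr1 => E.
have /(@BYU_coef _ 1) -> : BK (c 0) * BY ^+ 1 = 0.
  rewrite expr1; apply: (addIr (BK (c 0) * BU + BK (c 1) * BY)).
  by rewrite add0r -[RHS]E; ring.
by rewrite BK0 mul0r add0r.
Qed.

Lemma linear_form_weight c : lsub 1 0 0 3 (hform 1 c) = BK 3 * hform 1 c -> c 1%N = 0.
Proof.
rewrite lsub_hform scale_hform => /hform_inj/(_ 1%N isT); rewrite expr0 mul1r => E.
have : (3 - 1) * c 1%N = 0 by rewrite mulrBl mul1r -E subrr.
by move/eqP; rewrite mulf_eq0 => /orP[//|/eqP].
Qed.

Lemma weight_zero (x : 'F_7) a b : (3 ^+ a - 3 ^+ b : 'F_7) != 0 ->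
  3 ^+ a * x = 3 ^+ b * x -> x = 0.
Proof.
move=> ab /eqP; rewrite -subr_eq0 -mulrBl mulf_eq0 (negPf ab) /=.
by move/eqP.
Qed.

(** 3 generates the units of [F_7], so invariance under [u] to [3 u] leaves only [u^6] and [y^6];
    the shear excludes [u^6]. *)
Lemma sextic_form_inv c : lsub 1 0 0 3 (hform 6 c) = hform 6 c ->
  lsub 1 1 0 1 (hform 6 c) = hform 6 c -> hform 6 c = BK (c 6) * BY ^+ 6.
Proof.
move=> E; have w k : (0 < k < 6)%N -> c k = 0.
  move=> /andP[k0 k6]; move: E; rewrite lsub_hform => /hform_inj/(_ k (ltnW k6)) E.
  apply: (@weight_zero _ (6 - k) 0); last by rewrite expr0 mul1r.
  by case: k k0 k6 {E} => [|[|[|[|[|[|]]]]]].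
have -> : hform 6 c = BK (c 0) * BU ^+ 6 + BK (c 6) * BY ^+ 6.
  rewrite hformE 7!big_ord_recl big_ord0 /bump /=.
  rewrite (w 1%N) // (w 2%N) // (w 3%N) // (w 4%N) // (w 5%N) // !BK0 !mul0r.
  by rewrite !expr0 !mulr1 !add0r addr0.
rewrite shift_form => E2.
have : BK (c 0) * ((BY + BU) ^+ 6 - BU ^+ 6) = 0.
  by rewrite mulrBr; apply/eqP; rewrite subr_eq0; apply/eqP/(addIr _ E2).
move/eqP; rewrite mulf_eq0 BK_eq0 => /orP[/eqP->|]; first by rewrite BK0 mul0r add0r.
have : lsub 1 0 0 0 ((BY + BU) ^+ 6 - BU ^+ 6) = BY ^+ 6.
  by rewrite kill_form expr0n subr0.
move=> E3 /eqP E4; move: E3; rewrite E4 rmorph0 => /esym/eqP.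
by rewrite expf_eq0 polyX_eq0.
Qed.

(** Weight 1 leaves [u^7] and [y^6 u]; by additivity of the Frobenius, shear invariance makes their
    coefficients opposite. *)
Lemma septic_form_inv c : lsub 1 0 0 3 (hform 7 c) = BK 3 * hform 7 c ->
  lsub 1 1 0 1 (hform 7 c) = hform 7 c -> hform 7 c = BK (c 0) * Bv0.
Proof.
rewrite scale_hform => E; have w k : (k <= 7)%N -> (k != 0) && (k != 6) -> c k = 0.
  move=> k7 kn; move: E; rewrite lsub_hform => /hform_inj/(_ k k7) E.
  apply: (@weight_zero _ (7 - k) 1); last by rewrite expr1.
  by case: k k7 kn {E} => [|[|[|[|[|[|[|[|]]]]]]]].
have -> : hform 7 c = BK (c 0) * BU ^+ 7 + BK (c 6) * (BY ^+ 6 * BU).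
  rewrite hformE 8!big_ord_recl big_ord0 /bump /=.
  rewrite (w 1%N) // (w 2%N) // (w 3%N) // (w 4%N) // (w 5%N) // (w 7%N) // !BK0 !mul0r.
  rewrite !expr0 !mulr1.
  by rewrite !add0r !addr0 expr1; ring.
rewrite shift_form' (frob7 BT7) => E2.
have E3 : BK (c 0 + c 6) * BY ^+ 7 = 0.
  rewrite rmorphD; apply: (addIr (BK (c 0) * BU ^+ 7 + BK (c 6) * (BY ^+ 6 * BU))).
  by rewrite add0r -[RHS]E2; ring.
have c6 : c 6 = - c 0 by apply/eqP; rewrite -addr_eq0 addrC; apply/eqP/(BYU_coef E3).
by rewrite c6 BKN /Bv0; ring.
Qed.
End BTscalars.

Lemma meval_F7_rel n (w : 'I_n -> 'F_7) (a b : 'I_n) :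
  ('X_a ^+ 7 * 'X_b - 'X_a * 'X_b ^+ 7 : {mpoly 'F_7[n]}).@[w] = 0.
Proof.
suff H k : ('X_a ^+ k * 'X_b - 'X_a * 'X_b ^+ k : {mpoly 'F_7[n]}).@[w] =
    w a ^+ k * w b - w a * w b ^+ k.
  by rewrite (H 7%N) !F7_pow7 subrr.
by rewrite mevalB !mevalM !rmorphXn /= !mevalXU.
Qed.

Lemma mpoly_at_lin (gT : finGroupType) (D : {group gT}) n (h : 'I_n -> rcoh D) (i j : 'F_7) (a b : 'I_n) :
  mpoly_at h (i *: 'X_a + j *: 'X_b) = of7 (rcoh7 D) i * h a + of7 (rcoh7 D) j * h b :> rcoh D.
Proof. by rewrite (mpoly_atE (rcoh7 D)) mmapD !mmapZ !mmapX !mmap1U. Qed.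

Lemma mpoly_at_X (gT : finGroupType) (D : {group gT}) n (h : 'I_n -> rcoh D) (a : 'I_n) :
  mpoly_at h ('X_a : {mpoly 'F_7[n]}) = h a :> rcoh D.
Proof. by rewrite (mpoly_atE (rcoh7 D)) mmapX mmap1U. Qed.

Lemma meval_lin n (w : 'I_n -> 'F_7) (i j : 'F_7) (a b : 'I_n) :
  (i *: 'X_a + j *: 'X_b : {mpoly 'F_7[n]}).@[w] = i * w a + j * w b.
Proof. by rewrite mevalD !mevalZ !mevalXU. Qed.

(** * Restrictions of the generators [y1], [y2], [C], [v] *)

Section Generators.
Variables (gT : finGroupType) (E : {group gT}) (e1 e2 c : gT).
Hypothesis hE : is_extraspecial_7 E e1 e2 c.
Variables y1 y2 C v : rcoh E.
Hypothesis hP : @is_HE_presentation gT E e1 e2 y1 y2 C v.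

Local Notation o := (of7 (rcoh7 E)).
Local Notation ev3 := (mpoly_at (tnth [tuple y1; y2; v])).

(** The relation between [y1] and [y2] vanishes at every point over [F_7], so evaluation at points
    tests independence. *)
Lemma he_point (P : {mpoly 'F_7[3]}) (w : 'I_3 -> 'F_7) : ev3 P = 0 :> rcoh E -> P.@[w] = 0.
Proof.
move=> P0; have : ev3 P + C * mpoly_at (fun=> v) (0 : {mpoly 'F_7[1]}) = 0 :> rcoh E.
  by rewrite P0 add0r {1}/mpoly_at msupp0 big_nil mulr0.
move=> /(he_free hP)[_ [K ->]].
by rewrite [LHS](mevalM w K) [X in _ * X](meval_F7_rel w) mulr0.
Qed.

Lemma he_linear_free (i j : 'F_7) : o i * y1 + o j * y2 = 0 -> i = 0 /\ j = 0.
Proof.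
move=> E0.
have P0 : ev3 (i *: 'X_0 + j *: 'X_1) = 0 :> rcoh E.
  by rewrite -[RHS]E0; exact: (mpoly_at_lin (tnth [tuple y1; y2; v])).
have := he_point (fun k => (k == 0)%:R) P0; have := he_point (fun k => (k == 1)%:R) P0.
rewrite [X in X = 0 -> _](meval_lin _ i j 0 1) [X in _ -> X = 0 -> _](meval_lin _ i j 0 1).
by rewrite !mulr0 !mulr1 add0r addr0.
Qed.

Lemma he_v_neq0 : v != 0.
Proof.
apply/eqP => v0.
pose i2 : 'I_3 := Ordinal (isT : (2 < 3)%N).
have P0 : ev3 ('X_i2 : {mpoly 'F_7[3]}) = 0 :> rcoh E.
  by rewrite -[RHS]v0; exact: (mpoly_at_X (tnth [tuple y1; y2; v])).
by have := he_point (fun k => 1) P0; rewrite [X in X = 0 -> _]mevalXU => /eqP.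
Qed.

(** In degree 2 the [y_i] are an invertible linear change of the Bocksteins; the relation is a Moore
    determinant, which such a change multiplies by its determinant. *)
Lemma he_es_rel : es_B1 hE ^+ 7 * es_B2 hE = es_B1 hE * es_B2 hE ^+ 7.
Proof.
have H2 x : @is_homog gT E 7 2 x -> exists i j, x = o i * es_B1 hE + o j * es_B2 hE.
  move=> [f f2 ->]; have [i [j E0]] := es_H2 hE f2.
  by exists i, j; rewrite -/(rcl f) E0 !(mulrn_of7 (rcoh7 E)).
have [h1 h2 _ _] := he_deg hP.
have [i [j Ey1]] := H2 _ h1; have [k [l Ey2]] := H2 _ h2.
have rel : y1 ^+ 7 * y2 = y1 * y2 ^+ 7 := he_rel hP.
set B1 := es_B1 hE in Ey1 Ey2 *; set B2 := es_B2 hE in Ey1 Ey2 *.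
pose d := i * l - j * k.
have d0 : d != 0.
  apply/eqP => d0.
  have e1' : o l * y1 + o (- j) * y2 = 0.
    rewrite rmorphN /= Ey1 Ey2 [LHS](_ : _ = (o i * o l - o j * o k) * B1); last ring.
    by rewrite -!(rmorphM o) -(rmorphB o) -/d d0 rmorph0 mul0r.
  have e2' : o (- k) * y1 + o i * y2 = 0.
    rewrite rmorphN /= Ey1 Ey2 [LHS](_ : _ = (o i * o l - o j * o k) * B2); last ring.
    by rewrite -!(rmorphM o) -(rmorphB o) -/d d0 rmorph0 mul0r.
  have [l0 /eqP] := he_linear_free e1'; rewrite oppr_eq0 => /eqP j0.
  have [/eqP] := he_linear_free e2'; rewrite oppr_eq0 => /eqP k0 i0.
  have y10 : y1 = 0 by rewrite Ey1 i0 j0 rmorph0 !mul0r addr0.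
  have : o 1 * y1 + o 0 * y2 = 0 by rewrite y10 rmorph0 mulr0 mul0r addr0.
  by move=> /he_linear_free[/eqP].
have : o d * (B1 ^+ 7 * B2 - B1 * B2 ^+ 7) = 0.
  have e7 a b : (o a * B1 + o b * B2) ^+ 7 = o a * B1 ^+ 7 + o b * B2 ^+ 7.
    by rewrite (frob7 (rcoh7 E)) !exprMn !of7_pow7.
  move: rel; rewrite Ey1 Ey2 !e7 => /eqP; rewrite -subr_eq0 => /eqP rel.
  by rewrite rmorphB !rmorphM /= -[RHS]rel; ring.
move=> /(congr1 (fun z => o d^-1 * z)); rewrite mulr0 mulrA -(rmorphM o) mulVf // rmorph1 mul1r.
by move/eqP; rewrite subr_eq0 => /eqP.
Qed.

Lemma sig_homog n (x : rcoh E) a b (cp : cpair E a b) : @is_homog gT E 7 n.*2 x ->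
  exists d, sig cp x = A0ev (hform n d).
Proof.
move=> [f fn ->]; have [d E0] := A0_homog (n := n)
    (f := cocycle_pull (phi2M cp) (phi2D cp) f) (fun s sn => fn (map _ s) (etrans (congr1 (fun k => k != _) (size_map _ _)) sn)).
by exists d; rewrite -E0; apply: rpullE.
Qed.

Fact cp1 : cpair E e1 c.
Proof. by have := es_cp hE (Some 0); rewrite /= expg0 mulg1. Qed.

(** Conjugation by [e2] sends [e1] to [e1 c] and fixes [c]. *)
Lemma sig_inner_shift x P : sig cp1 x = A0ev P -> lsub 1 1 0 1 P = P.
Proof.
move=> xP; have [e1E e2E cE] := es_mem hE; have [_ _ ec e17 c7] := cp1.
have cp' : cpair E (e1 ^+ (1 : 'F_7)%R * c ^+ (1 : 'F_7)%R)%g (e1 ^+ (0 : 'F_7)%R * c ^+ (1 : 'F_7)%R)%g.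
  rewrite /= expg0 mul1g !expg1; split=> //; first exact: groupM.
    by apply: commute_sym; apply: commuteM => //; apply: commute_sym.
  by apply: (es_exp7 hE); rewrite groupM.
apply: A0ev_inj; rewrite -(sig_lin cp' erefl erefl xP) -xP.
apply: (@rpull_inner _ _ E A0 _ _ (phi2M cp1) (phi2D cp1) (phi2M cp') (phi2D cp') x e2 e2E) => p _; rewrite /phi2 conjMg !conjXg conjg_mulR (es_comm hE).
rewrite [(c ^ e2)%g](_ : _ = c) /= ?expg0 ?mul1g ?expg1 //.
by rewrite conjgE (centP (es_central hE) _ e2E) mulKg.
Qed.

Section Aut.
Variable M : 'M['F_7]_2.
Hypothesis M0 : \det M != 0.

Lemma sig_aut : exists cp' : cpair E (e1 ^+ (M 0 0)%R * e2 ^+ (M 1 0)%R)%g (c ^+ (\det M : 'F_7))%g,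
  [/\ sig cp' y1 = sig cp1 (y1 *+ M 0 0 + y2 *+ M 0 1),
      sig cp' y2 = sig cp1 (y1 *+ M 1 0 + y2 *+ M 1 1),
      sig cp' v = sig cp1 (v *+ (\det M : 'F_7)) & sig cp' C = sig cp1 C].
Proof.
have [s [sE [s1 s2 sc]]] := aut_lift hE M0; have [e1E e2E cE] := es_mem hE.
have sM := morphicP (Aut_morphic sE); have sI := Aut_stable sE.
have [_ _ ec e17 c7] := cp1.
have s11 : s 1%g = 1%g by apply: (mulgI (s 1%g)); rewrite -sM ?group1 // !mulg1.
have sX x n : x \in E -> s (x ^+ n)%g = (s x ^+ n)%g.
  by move=> xE; elim: n => [|n IHn]; rewrite ?expg0 // !expgS sM ?groupX // IHn.
have cp' : cpair E (s e1) (s c).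
  split; rewrite ?sI -?sX ?e17 ?c7 //.
  by rewrite /commute -!sM // ec.
have [h1 h2 h3 h4] := he_aut hP sE s1 s2.
have sg x : sig cp' x = sig cp1 (redcohom_aut sE x).
  apply: rpull_comp => p _; rewrite /phi2 sM ?groupX // !sX //.
move: cp' sg; rewrite s1 sc => cp' sg; exists cp'.
by split; rewrite sg ?h1 ?h2 ?h3 ?h4.
Qed.
End Aut.

Lemma det_mx22E (a b d e : 'F_7) : \det (mx22 a b d e) = a * e - b * d.
Proof. by rewrite det_mx22 !mxE. Qed.

(** Fixes [e1] and raises [c] to the power 3, a generator of the units of [F_7]. *)
Let D3 : 'M['F_7]_2 := mx22 1 0 0 3.

Lemma sig_weight x P (e : 'F_7) : sig cp1 x = A0ev P ->
    (forall cp' : cpair E (e1 ^+ (D3 0 0)%R * e2 ^+ (D3 1 0)%R)%g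
        (c ^+ (\det D3 : 'F_7)%R)%g,
      sig cp' x = sig cp1 (x *+ e)) ->
    (exists cp' : cpair E (e1 ^+ (D3 0 0)%R * e2 ^+ (D3 1 0)%R)%g
        (c ^+ (\det D3 : 'F_7)%R)%g, True) ->
  lsub 1 0 0 3 P = BK e * P.
Proof.
move=> xP H [cp' _]; have := H cp'.
rewrite (sig_lin (i := 1) (k := 0) (j := 0) (l := 3) cp' _ _ xP).
- have -> : sig cp1 (x *+ e) = sig cp1 x *+ e := rmorphMn (sig cp1) e x.
  by rewrite xP -(rmorphMn A0ev) => /A0ev_inj ->; rewrite (mulrn_of7 BT7).
- by rewrite /D3 !mxE /= !expg0.
- by rewrite /D3 det_mx22E mul1r mul0r subr0 expg0 mul1g.
Qed.

(** [al] and [la] are the scalars that the presentation leaves open; [C] has none, being normalised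
    by [C y1 = y1^7]. *)
Definition he_val (al la : 'F_7) : Prop :=
  [/\ al != 0, la != 0 & forall m, let s := if m is Some _ then 1 else 0 in
      let t := if m is Some k then k else 1 in
    [/\ es_sig hE m y1 = A0ev (BK (s * al) * BY),
        es_sig hE m y2 = A0ev (BK (t * al) * BY),
        es_sig hE m v = A0ev (BK la * Bv0)
      & es_sig hE m C = A0ev (BY ^+ 6)]].

(** On [A_0] the degree, shear invariance and the weight under [D3] leave one coefficient for each
    of [y1], [C], [v] and none for [y2]; automorphisms carry the result to the other [A_m].
    Detection shows that [al] and [la] are non-zero. *)
Lemma he_values : exists al la, he_val al la.
Proof.
have [d1 d2 dC dv] := he_deg hP.
have [p1 E1] := sig_homog (n := 1) cp1 d1; have [p2 E2] := sig_homog (n := 1) cp1 d2.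
have [pC EC] := sig_homog (n := 6) cp1 dC; have [pv Ev] := sig_homog (n := 7) cp1 dv.
have M0 : \det D3 != 0 by rewrite /D3 det_mx22E.
have [cp3 [_ w2 wv wC]] := sig_aut M0.
have irr a b (cp cp' : cpair E a b) x : sig cp x = sig cp' x by congr sig; apply: Prop_irrelevance.
have ex3 : exists cp' : cpair E (e1 ^+ (D3 0 0)%R * e2 ^+ (D3 1 0)%R)%g
        (c ^+ (\det D3 : 'F_7)%R)%g, True by exists cp3.
have P1 := linear_form_inv (sig_inner_shift E1).
have P2 := linear_form_inv (sig_inner_shift E2).
have p20 : p2 1%N = 0.
  apply: linear_form_weight; apply: (sig_weight E2) ex3 => cp'.
  by rewrite (irr _ _ cp' cp3) w2 /D3 !mxE /= mulr0n add0r.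
have PC : hform 6 pC = BK (pC 6) * BY ^+ 6.
  apply: sextic_form_inv (sig_inner_shift EC).
  rewrite -[RHS]mul1r -BK1; apply: (sig_weight EC) ex3 => cp'.
  by rewrite (irr _ _ cp' cp3) wC.
have Pv : hform 7 pv = BK (pv 0) * Bv0.
  apply: septic_form_inv (sig_inner_shift Ev); apply: (sig_weight Ev) ex3 => cp'.
  by rewrite (irr _ _ cp' cp3) wv /D3 det_mx22E mul1r mul0r subr0.
pose al := p1 1%N; pose la := pv 0%N; pose ka := pC 6.
have vals m : let s := if m is Some _ then 1 else 0 in
      let t := if m is Some k then k else 1 in
    [/\ es_sig hE m y1 = A0ev (BK (s * al) * BY),
        es_sig hE m y2 = A0ev (BK (t * al) * BY),
        es_sig hE m v = A0ev (BK la * Bv0)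
      & es_sig hE m C = A0ev (BK ka * BY ^+ 6)].
  (* An automorphism of determinant 1, hence fixing [c], that takes [e1] to the generator of
     [A_m]. *)
  move=> s t; pose M : 'M['F_7]_2 := if m is Some k then mx22 1 0 k 1 else mx22 0 (-1) 1 0.
  have dM : \det M = 1.
    by rewrite /M; case: (m) => [k|]; rewrite det_mx22E ?mul1r ?mul0r ?subr0 // mulr1 sub0r opprK.
  have M1 : \det M != 0 by rewrite dM.
  have [cpM [v1 v2 vv vC]] := sig_aut M1.
  have aE : (e1 ^+ (M 0 0)%R * e2 ^+ (M 1 0)%R)%g = gen_A e1 e2 m.
    by rewrite /M; case: (m) => [k|]; rewrite !mxE /= ?expg1 ?expg0 ?mul1g.
  have cE : (c ^+ (\det M : 'F_7))%g = c by rewrite dM expg1.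
  have Ms : M 0 0 = s /\ M 1 0 = t by rewrite /M /s /t; case: (m) => [k|]; rewrite !mxE.
  have sgE x : es_sig hE m x = sig cpM x.
    move: cpM {v1 v2 vv vC}; rewrite aE cE => cpM; exact: irr.
  rewrite !sgE v1 v2 vv vC dM mulr1n Ev Pv EC PC; have [-> ->] := Ms.
  rewrite !rmorphD !rmorphMn /= E1 E2 P1 P2 p20 -!(rmorphMn A0ev) -!(rmorphD A0ev).
  by split=> //; congr (A0ev _); rewrite !(mulrn_of7 BT7) BK0 mul0r mulr0 addr0 mulrA -BKM.
have det := es_detection he_es_rel.
have al0 : al != 0.
  apply/eqP => al0; have y10 : y1 = 0.
    by apply: det => m; have [-> _ _ _] := vals m; rewrite al0 mulr0 BK0 mul0r rmorph0.
  have : o 1 * y1 + o 0 * y2 = 0 by rewrite y10 rmorph0 mulr0 mul0r addr0.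
  by move=> /he_linear_free[/eqP].
have la0 : la != 0.
  apply/eqP => la0; have /eqP := he_v_neq0; apply.
  by apply: det => m; have [_ _ -> _] := vals m; rewrite la0 BK0 mul0r rmorph0.
have ka1 : ka = 1.
  have [v1 _ _ vC] := vals (Some 0).
  have h : (C : rcoh E) * y1 = y1 ^+ 7 := he_Cy1 hP.
  have E7 : es_sig hE (Some 0) C * es_sig hE (Some 0) y1 = es_sig hE (Some 0) y1 ^+ 7.
    by rewrite -[LHS](rmorphM (es_sig hE (Some 0))) h [LHS](rmorphXn (es_sig hE (Some 0))).
  move: E7; rewrite v1 vC -[X in X = _ -> _](rmorphM A0ev) -[X in _ = X -> _](rmorphXn A0ev) => /A0ev_inj.
  rewrite mul1r exprMn -BKX F7_pow7 => E0.
  have /BYU_coef/eqP : BK ((ka - 1) * al) * BY ^+ 7 = 0.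
    rewrite mulrBl mul1r [BK _](rmorphB BK) mulrBl -[X in _ - X = _]E0 [X in X * _ - _]BKM; ring.
  by rewrite mulf_eq0 (negPf al0) orbF subr_eq0 => /eqP.
exists al, la; split=> // m; have := vals m; rewrite ka1 => -[-> -> -> ->].
by split=> //; rewrite BK1 mul1r.
Qed.
End Generators.

(** * Coefficients and substitutions in two variables *)

Section Bivariate.
Local Notation BT := {poly {poly 'F_7}}.

Transparent BU BY BK.

Lemma coef_BK_mul (x : 'F_7) (p : BT) k j : (BK x * p)`_k`_j = x * p`_k`_j.
Proof. by rewrite BKE coefCM coefCM. Qed.

Lemma coefYM (p : BT) k : (BY * p)`_k = if k is k'.+1 then p`_k' else 0.
Proof. by rewrite /BY coefXM; case: k. Qed.

Lemma coefUM (p : BT) k j : (BU * p)`_k`_j = if j is j'.+1 then p`_k`_j' else 0.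
Proof. by rewrite /BU coefCM coefXM; case: j. Qed.

Lemma coef_YU (x : 'F_7) a b k j :
  (BK x * BY ^+ a * BU ^+ b)`_k`_j = x *+ ((k == a) && (j == b)).
Proof.
rewrite -mulrA coef_BK_mul /BU -rmorphXn /= coefMC /BY coefXn.
by case: (k == a); rewrite ?mul1r ?mul0r ?coef0 ?coefXn ?mulr_natr //= mulr0.
Qed.

Lemma BT_expand (x : BT) :
  x = \sum_(k < size x) \sum_(j < size x`_k) BK x`_k`_j * BY ^+ k * BU ^+ j.
Proof.
rewrite -[LHS]coefK poly_def; apply: eq_bigr => k _.
rewrite -[in LHS](coefK x`_k) poly_def -mul_polyC rmorph_sum mulr_suml.
apply: eq_bigr => j _; rewrite -mul_polyC rmorphM rmorphXn /= BKE.
by rewrite /BU /BY; ring.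
Qed.

Lemma coef0_ev2 u y p : (ev2 BT7 u (BY * y) p)`_0 = p`_0 \Po u`_0.
Proof.
elim/poly_ind: p => [|p c _]; first by rewrite rmorph0 !coef0 comp_poly0.
rewrite rmorphD rmorphM /= ev2X ev2C mulrC -mulrA coefD coefYM add0r coefD coefMX add0r coefC /=.
elim/poly_ind: c => [|q d IHq]; first by rewrite rmorph0 coef0 comp_poly0.
rewrite rmorphD rmorphM /= ev1X ev1C coefD coefM big_ord_recl big_ord0 addr0 subn0 IHq.
by rewrite comp_polyD comp_polyM comp_polyX comp_polyC -/BK BKE coefC.
Qed.

(** Setting the outer variable to 0 turns the lowest coefficient into its composite with a
    non-constant polynomial, so it vanishes and a factor can be cancelled. *)
Lemma ev2_inj (u y : BT) : (1 < size (u`_0)%R)%N -> y != 0 -> injective (ev2 BT7 u (BY * y)).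
Proof.
move=> u0 y0; apply: raddf_inj; elim/poly_ind=> [//|p c IHp] pc0.
have c0 : c = 0.
  have := congr1 (fun z : BT => z`_0) pc0; rewrite coef0_ev2 coef0 coefD coefMX coefC add0r => /eqP.
  by rewrite comp_poly_eq0 // => /eqP.
move: pc0; rewrite c0 polyC0 addr0 => /eqP; rewrite [X in X == _]rmorphM /= ev2X mulf_eq0 mulf_eq0 (negPf y0) orbF polyX_eq0 orbF.
by move=> /eqP/IHp ->; rewrite mul0r.
Qed.

Lemma lsub_diag_coef i l (x : BT) k j : (lsub i 0 0 l x)`_k`_j = i ^+ k * l ^+ j * x`_k`_j.
Proof.
have L (p : BT) : lsub i 0 0 l (BY * p) = BK i * (BY * lsub i 0 0 l p).
  by rewrite [LHS](rmorphM (lsub i 0 0 l)) [X in X * _]lsubY BK0 mul0r addr0 mulrA.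
have LU (p : BT) : lsub i 0 0 l (BU * p) = BK l * (BU * lsub i 0 0 l p).
  by rewrite [LHS](rmorphM (lsub i 0 0 l)) [X in X * _]lsubU BK0 mul0r add0r mulrA.
have C (q : {poly 'F_7}) k' j' : (lsub i 0 0 l q%:P)`_k'`_j' = (q`_j' * l ^+ j') *+ (k' == 0%N).
  elim/poly_ind: q j' => [|q d IHq] j'; first by rewrite !rmorph0 !coef0 mul0r mul0rn.
  have -> : (q * 'X + d%:P)%:P = BU * q%:P + BK d by rewrite BKE rmorphD rmorphM mulrC.
  rewrite [lsub i 0 0 l _](rmorphD (lsub i 0 0 l)) lsubK LU !coefD coef_BK_mul coefUM coefMX BKE !coefC.
  case: j' => [|j']; rewrite /= ?IHq.
    by case: (k' == 0%N); rewrite !coefC /= ?mulr0 ?add0r ?expr0 ?mulr1.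
  by case: (k' == 0%N); rewrite !coefC /= ?mulr0 ?addr0 ?expr0 // exprS !mulr1n; ring.
elim/poly_ind: x k j => [|p c IHp] k j; first by rewrite rmorph0 !coef0 mulr0.
have -> : p * 'X + c%:P = BY * p + c%:P by rewrite mulrC.
rewrite [lsub i 0 0 l _](rmorphD (lsub i 0 0 l)) (L p) !coefD coef_BK_mul !coefYM C coefC.
case: k => [|k] /=; first by rewrite coef0 mulr0 !add0r expr0 mul1r mulr1n mulrC.
by rewrite mulr0n IHp coef0 !addr0 exprS !mulrA.
Qed.

Opaque BU BY BK.

Lemma BT_ext (R : nzRingType) (f g : {rmorphism BT -> R}) :
  f BU = g BU -> f BY = g BY -> f =1 g.
Proof.
move=> fU fY x; rewrite (BT_expand x) !rmorph_sum; apply: eq_bigr => k _.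
rewrite !rmorph_sum; apply: eq_bigr => j _.
by rewrite !rmorphM !rmorphXn /= fU fY BKE -(natr_Zp x`_k`_j) !rmorph_nat.
Qed.
End Bivariate.

Lemma BKB x y : BK (x - y) = BK x - BK y.
Proof. exact: rmorphB. Qed.

Lemma BKD x y : BK (x + y) = BK x + BK y.
Proof. exact: rmorphD. Qed.

(** * Dickson invariants for matrices of determinant 1 and -1 *)

Section Dickson.
Local Notation BT := {poly {poly 'F_7}}.
Variables al la : 'F_7.
Hypotheses (al0 : al != 0) (la0 : la != 0).

(** Here [BU] stands for [v] in the source and for [u] in the target: a polynomial in [y] and [v] is
    sent to its expression in the cohomology of [A_m]. *)
Definition Phi : {rmorphism BT -> BT} := ev2 BT7 (BK la * Bv0) (BY * BK al).

Lemma PhiY : Phi BY = BY * BK al.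
Proof. exact: ev2X. Qed.

Lemma PhiU : Phi BU = BK la * Bv0.
Proof. by rewrite [LHS]ev2C ev1X. Qed.

Lemma PhiK x : Phi (BK x) = BK x.
Proof. exact: rmorph_of7. Qed.

Lemma F7_pow6 (i : 'F_7) : i != 0 -> i ^+ 6 = 1.
Proof. by move=> i0; apply: (mulfI i0); rewrite -exprS F7_pow7 mulr1. Qed.

Transparent BU BY BK.
Lemma Bv0_coef0 : (Bv0 : BT)`_0 = 'X^7.
Proof.
by rewrite /Bv0 coefB [BY ^+ 6]exprS -[BY * _ * _]mulrA coefYM subr0 /BU -(rmorphXn (@polyC _)) coefC.
Qed.

Lemma BY_neq0 : BY != 0.
Proof. by rewrite /BY polyX_eq0. Qed.

Lemma BU_neq0 : BU != 0.
Proof. by rewrite /BU polyC_eq0 polyX_eq0. Qed.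

Lemma map_BU : map_poly (horner_eval 0) BU = 0.
Proof. by rewrite /BU map_polyC /= /horner_eval hornerX. Qed.

Lemma map_BY : map_poly (horner_eval 0) BY = 'X.
Proof. by rewrite /BY map_polyX. Qed.

Lemma coef0_BU : (BU : BT)`_0 = 'X.
Proof. by rewrite /BU coefC. Qed.
Opaque BU BY BK.

Lemma coef_BK_mul' x (p : BT) k : (BK x * p)`_k = x *: p`_k.
Proof. by apply/polyP => j; rewrite coef_BK_mul coefZ. Qed.

Lemma coef0_BKM x (p : BT) : (BK x * p)`_0 = x *: p`_0.
Proof. by apply/polyP => j; rewrite coef_BK_mul coefZ. Qed.

Lemma Phi_coef0 p : (Phi p)`_0 = p`_0 \Po (la *: 'X^7).
Proof. by rewrite [LHS]coef0_ev2 coef0_BKM Bv0_coef0. Qed.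

Lemma Phi_inj : injective Phi.
Proof.
apply: ev2_inj; last by rewrite BK_eq0.
by rewrite coef0_BKM Bv0_coef0 size_scale // size_polyXn.
Qed.

Lemma frob7_lin (R : comNzRingType) (R7 : 7%:R = 0 :> R) (i j : 'F_7) (x y : R) n :
  (of7 R7 i * x + of7 R7 j * y) ^+ (7 ^ n) = of7 R7 i * x ^+ (7 ^ n) + of7 R7 j * y ^+ (7 ^ n).
Proof.
elim: n => [|n IHn]; first by rewrite !expr1.
by rewrite expnSr !exprM IHn frob7 // !exprMn !of7_pow7.
Qed.

(** A Moore determinant: since taking [7^n]-th powers is linear over [F_7], any linear substitution
    multiplies it by its determinant. *)
Lemma lsub_moore i k j l n :
  lsub i k j l (BY * BU ^+ (7 ^ n) - BY ^+ (7 ^ n) * BU) =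
  BK (i * l - j * k) * (BY * BU ^+ (7 ^ n) - BY ^+ (7 ^ n) * BU).
Proof.
rewrite lsubB !lsubM !lsubX lsubY lsubU !(frob7_lin BT7) -!/(BK _).
have -> : BK (i * l - j * k) = BK i * BK l - BK j * BK k.
  by rewrite BKB !BKM.
ring.
Qed.

Lemma YBv0 : BY * Bv0 = BY * BU ^+ (7 ^ 1) - BY ^+ (7 ^ 1) * BU.
Proof. by rewrite /Bv0 expn1; ring. Qed.

Lemma lsub_YBv0 i k j l : lsub i k j l (BY * Bv0) = BK (i * l - j * k) * (BY * Bv0).
Proof. by rewrite YBv0 lsub_moore. Qed.

Lemma lsub_Bv0 i k l : i != 0 -> lsub i k 0 l Bv0 = BK l * Bv0.
Proof.
move=> i0; apply: (mulfI BY_neq0); apply: (mulfI (x := BK i)); first by rewrite BK_eq0.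
have := lsub_YBv0 i k 0 l; rewrite lsubM lsubY BK0 mul0r addr0 mul0r subr0 BKM => E.
by rewrite mulrA E; ring.
Qed.

(** Substitutions preserving the line of [y] act diagonally on polynomials in [y] and [v]; the shear
    part [k] disappears. *)
Lemma lsub_Phi i k l x : i != 0 -> lsub i k 0 l (Phi x) = Phi (lsub i 0 0 l x).
Proof.
move=> i0; apply: (@BT_ext _ (lsub i k 0 l \o Phi) (Phi \o lsub i 0 0 l)).
  change (lsub i k 0 l (Phi BU) = Phi (lsub i 0 0 l BU)).
  rewrite PhiU lsubM lsubK lsub_Bv0 // lsubU BK0 mul0r add0r [RHS](rmorphM Phi).
  by rewrite [X in _ = X * _]PhiK PhiU mulrCA.
change (lsub i k 0 l (Phi BY) = Phi (lsub i 0 0 l BY)).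
rewrite PhiY lsubM lsubK !lsubY BK0 mul0r addr0 [RHS](rmorphM Phi).
by rewrite [X in _ = X * _]PhiK PhiY mulrA.
Qed.

Definition BD1 : BT := BY ^+ 42 + BU ^+ 6.
Definition Bq2 : BT := (BY * BU) ^+ 2.

(** A Dickson invariant as a quotient of Moore determinants: multiplied by the one with [n = 1] it
    gives the one with [n = 2]. *)
Lemma lsub_BD1 i k j l : (i * l - j * k) != 0 ->
  lsub i k j l (BY ^+ 42 + Bv0 ^+ 6) = BY ^+ 42 + Bv0 ^+ 6.
Proof.
move=> d0; have E : BY * Bv0 * (BY ^+ 42 + Bv0 ^+ 6) = BY * BU ^+ (7 ^ 2) - BY ^+ (7 ^ 2) * BU.
  have -> : BY * Bv0 * (BY ^+ 42 + Bv0 ^+ 6) = BY ^+ 43 * Bv0 + BY * Bv0 ^+ 7 by ring.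
  rewrite /Bv0 (frob7B BT7); have -> : (7 ^ 2 = 49)%N by []; ring.
have vn0 : BY * Bv0 != 0.
  rewrite mulf_neq0 ?BY_neq0 //; apply/eqP => /(congr1 (fun z : BT => z`_0)).
  by rewrite [RHS]coef0 Bv0_coef0 => /eqP; rewrite -size_poly_eq0 size_polyXn.
have /(congr1 (lsub i k j l)) := E; rewrite lsubM lsub_YBv0 lsub_moore -E => E2.
apply: (mulfI vn0); apply: (mulfI (x := BK (i * l - j * k))); first by rewrite BK_eq0.
by rewrite mulrA E2.
Qed.

Lemma Phi_BD1 : Phi BD1 = BY ^+ 42 + Bv0 ^+ 6.
Proof.
have e42 : 42%N = (6 * 7)%N by [].
rewrite /BD1 rmorphD !rmorphXn /= PhiY PhiU !exprMn -!BKX (F7_pow6 la0) e42 !exprM (F7_pow6 al0).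
by rewrite expr1n BK1 mulr1 mul1r.
Qed.

Lemma Phi_Bq2 : Phi Bq2 = BK ((al * la) ^+ 2) * (BY * Bv0) ^+ 2.
Proof. by rewrite /Bq2 rmorphXn rmorphM /= PhiY PhiU BKX BKM; ring. Qed.

Definition det1 (i k j l : 'F_7) := (i * l - j * k) ^+ 2 = 1.
Definition inv_det1 (x : BT) := forall i k j l, det1 i k j l -> lsub i k j l (Phi x) = Phi x.

Lemma inv_BD1 : inv_det1 BD1.
Proof.
move=> i k j l d1; rewrite Phi_BD1 lsub_BD1 //; apply/eqP => d0.
by move: d1; rewrite /det1 d0 expr0n.
Qed.

Lemma inv_Bq2 : inv_det1 Bq2.
Proof.
by move=> i k j l d1; rewrite Phi_Bq2 lsubM lsubK lsubX lsub_YBv0 [(BK _ * _) ^+ 2]exprMn -[BK (_ - _) ^+ 2]BKX d1 BK1 mul1r.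
Qed.
Lemma inv_sub x y : inv_det1 x -> inv_det1 y -> inv_det1 (x - y).
Proof. by move=> hx hy i k j l d1; rewrite [Phi _](rmorphB Phi) lsubB hx ?hy. Qed.

Lemma inv_mul x y : inv_det1 x -> inv_det1 y -> inv_det1 (x * y).
Proof. by move=> hx hy i k j l d1; rewrite [Phi _](rmorphM Phi) lsubM hx ?hy. Qed.

Lemma inv_add x y : inv_det1 x -> inv_det1 y -> inv_det1 (x + y).
Proof. by move=> hx hy i k j l d1; rewrite [Phi _](rmorphD Phi) lsubD hx ?hy. Qed.

Lemma inv_K c : inv_det1 (BK c).
Proof. by move=> i k j l d1; rewrite PhiK lsubK. Qed.

Lemma inv_exp x n : inv_det1 x -> inv_det1 (x ^+ n).
Proof.
move=> hx; elim: n => [|n IHn]; first by rewrite expr0 -BK1; apply: inv_K.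
by rewrite exprS; apply: inv_mul.
Qed.

Lemma inv_sum I r (F : I -> BT) : (forall i, inv_det1 (F i)) -> inv_det1 (\sum_(i <- r) F i).
Proof.
move=> hF; elim/big_rec: _ => [|i x _ hx]; last exact: inv_add.
by rewrite -BK0; apply: inv_K.
Qed.

Lemma inv_diag x (i l : 'F_7) k j : inv_det1 x -> (i * l) ^+ 2 = 1 -> x`_k`_j != 0 -> i ^+ k * l ^+ j = 1.
Proof.
move=> hx il x0; have i0 : i != 0.
  by apply/eqP => i0; move: il; rewrite i0 mul0r expr0n.
have := hx i 0 0 l; rewrite /det1 mul0r subr0 => /(_ il); rewrite lsub_Phi // => /Phi_inj E.
by apply: (mulIf x0); rewrite mul1r -{2}E lsub_diag_coef.
Qed.

(** Read off from [diag(-1, 1)], of determinant -1, and from [diag(3, 5)], of determinant 15 = 1,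
    where 3 generates the units of [F_7]. *)
Lemma inv_coef x k j : inv_det1 x -> x`_k`_j != 0 -> ~~ odd k /\ k = j %[mod 6].
Proof.
move=> hx x0.
have h1 : (-1 : 'F_7) ^+ k * 1 ^+ j = 1 by apply: (inv_diag hx) x0; rewrite mulr1 sqrrN expr1n.
have h2 : (3 : 'F_7) ^+ k * 5 ^+ j = 1 by apply: (inv_diag hx) x0; apply/eqP.
split.
  by move: h1; rewrite expr1n mulr1 -signr_odd; case: (odd k).
have m6 (n : nat) : (3 : 'F_7) ^+ n = 3 ^+ (n %% 6).
  by rewrite {1}(divn_eq n 6) exprD mulnC exprM F7_pow6 // expr1n mul1r.
have m6' (n : nat) : (5 : 'F_7) ^+ n = 5 ^+ (n %% 6).
  by rewrite {1}(divn_eq n 6) exprD mulnC exprM F7_pow6 // expr1n mul1r.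
move: h2; rewrite m6 m6' => /eqP.
have : (k %% 6 < 6)%N by rewrite ltn_pmod. have : (j %% 6 < 6)%N by rewrite ltn_pmod.
move: (k %% 6)%N (j %% 6)%N => m n nlt mlt.
suff /implyP h : (3 ^+ m * 5 ^+ n == 1 :> 'F_7) ==> (m == n) by move=> /h/eqP.
by move: nlt mlt; case: n => [|[|[|[|[|[|//]]]]]] _; case: m => [|[|[|[|[|[|//]]]]]] _.
Qed.

(** The substitution [y] to [u], [u] to [-y] makes [Phi BU] divisible by [y]. Setting [y = 0] in the
    invariance equation therefore compares the part of [x] free of [v] with the part free of [y]. *)
Lemma inv_reflect x : inv_det1 x -> x`_0 = 0 -> forall k, x`_k`_0 = 0.
Proof.
move=> hx x0; have W : lsub 0 (-1) 1 0 (Phi x) = Phi x.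
  by apply: hx; rewrite /det1 mul0r sub0r mulrN1 opprK expr1n.
pose f : {rmorphism BT -> {poly 'F_7}} := horner_eval 0 \o (lsub 0 (-1) 1 0 \o Phi).
pose g : {rmorphism BT -> {poly 'F_7}} := comp_poly (al *: 'X) \o map_poly (horner_eval 0).
have fg : f =1 g.
  apply: BT_ext.
    change ((lsub 0 (-1) 1 0 (Phi BU)).[0] = (map_poly (horner_eval 0) BU) \Po (al *: 'X)).
    rewrite PhiU lsubM lsubK /Bv0 lsubB lsubX [lsub _ _ _ _ (_ * _)]lsubM lsubX lsubU BK0 mul0r addr0 map_BU comp_poly0.
    have E (u w p : BT) : u * ((w * BY) ^+ 7 - p * (w * BY)) = BY * (u * (w * (w * BY) ^+ 6 - p * w)).
      by ring.
    rewrite horner_coef0 E.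
    by rewrite coefYM.
  change ((lsub 0 (-1) 1 0 (Phi BY)).[0] = (map_poly (horner_eval 0) BY) \Po (al *: 'X)).
  rewrite PhiY lsubM lsubK lsubY BK0 mul0r add0r BK1 mul1r map_BY comp_polyX horner_coef0 mulrC.
  by rewrite coef0_BKM coef0_BU.
have : g x = 0.
  by rewrite -fg; change ((lsub 0 (-1) 1 0 (Phi x)).[0] = 0); rewrite W horner_coef0 Phi_coef0 x0 comp_poly0.
move=> /eqP; change (((map_poly (horner_eval 0) x) \Po (al *: 'X) == 0) -> forall k, x`_k`_0 = 0).
rewrite comp_poly_eq0 ?size_scale ?size_polyX // => /eqP E k.
by have := congr1 (fun p : {poly 'F_7} => p`_k) E; rewrite coef_map coef0 /= /horner_eval horner_coef0.
Qed.

Lemma Bq2_neq0 : Bq2 != 0.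
Proof. by rewrite expf_neq0 ?mulf_neq0 ?BU_neq0 ?BY_neq0. Qed.

(** All exponents are even, so once the parts free of [y] or of [v] are gone, [(y v)^2] divides. *)
Lemma inv_div x : inv_det1 x -> x`_0 = 0 -> exists2 g, inv_det1 g & x = Bq2 * g.
Proof.
move=> hx x0; pose g : BT := map_poly (drop_poly 2) (drop_poly 2 x).
have gE k j : g`_k`_j = x`_k.+2`_j.+2.
  by rewrite coef_map_id0 ?raddf0 // !coef_drop_poly !addn2.
have xE : x = Bq2 * g.
  apply/polyP => k; apply/polyP => j.
  have -> : Bq2 * g = BY * (BY * (BU * (BU * g))) by rewrite /Bq2; ring.
  have z k' j' : odd k' || odd j' -> x`_k'`_j' = 0.
    move=> od; apply/eqP/negPn/negP => /(inv_coef hx)[ek /(congr1 odd)].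
    rewrite !odd_mod // => kj; move: od; by rewrite -kj orbb (negPf ek).
  rewrite coefYM; case: k => [|[|k]]; rewrite ?coefYM ?x0 //.
    by rewrite coef0; apply: z.
  rewrite coefUM; case: j => [|[|j]]; rewrite ?coefUM ?gE //; first exact: inv_reflect.
  by apply: z; rewrite orbT.
exists g => // i k j l d1; have q0 : Phi Bq2 != 0.
  by rewrite -(rmorph0 Phi) (inj_eq Phi_inj) Bq2_neq0.
apply: (mulfI q0); have := hx i k j l d1; rewrite xE [Phi _](rmorphM Phi) lsubM.
by rewrite (inv_Bq2 d1).
Qed.

Lemma BD1_coef0 n : (BD1 ^+ n)`_0 = 'X^(6 * n).
Proof.
rewrite exprM -!horner_coef0 horner_exp; congr (_ ^+ n).
rewrite horner_coef0 /BD1 coefD [BY ^+ 42]exprS coefYM add0r.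
by rewrite -horner_coef0 horner_exp horner_coef0 coef0_BU.
Qed.

Lemma size_BD1 n k : (size ((BD1 ^+ n)`_k)%R <= (6 * n).+1)%N.
Proof.
elim: n k => [|n IHn] k.
  by rewrite expr0 coef1; case: (k == _); rewrite ?size_poly1 ?size_poly0.
rewrite exprS /BD1 mulrDl coefD (leq_trans (size_polyD _ _)) // geq_max; apply/andP; split.
  have -> : (BY ^+ 42 * BD1 ^+ n)`_k = if (k < 42)%N then 0 else (BD1 ^+ n)`_(k - 42).
    exact: coefXnM.
  by case: ifP => _; rewrite ?size_poly0 // (leq_trans (IHn _)) // ltnS leq_mul2l leqnSn orbT.
have -> : (BU ^+ 6 * BD1 ^+ n)`_k = 'X^6 * (BD1 ^+ n)`_k.
  apply/polyP => j; rewrite (_ : BU ^+ 6 * BD1 ^+ n = BU * (BU * (BU * (BU * (BU * (BU * BD1 ^+ n)))))); last ring.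
  rewrite coefXnM !coefUM; case: j => [|[|[|[|[|[|j]]]]]] //=; do 6!rewrite ?coefUM //=.
  by rewrite !subSS subn0.
rewrite (leq_trans (size_polyMleq _ _)) // size_polyXn addSn /=.
by rewrite (leq_trans (leq_add (leqnn 6) (IHn k))) // addnS mulnS.
Qed.

(** The part free of [y] has exponents divisible by 6 and is matched by powers of [BD1]. The
    remainder is divisible by [Bq2], and dividing lowers the degree in [v], on which the induction
    runs. *)
Lemma inv_sum_exist x : inv_det1 x ->
  exists l : seq ('F_7 * (nat * nat)), x = \sum_(w <- l) BK w.1 * BD1 ^+ w.2.1 * Bq2 ^+ w.2.2.
Proof.
move=> hx; have [N xN] : exists N, forall k, (size (x`_k)%R <= N)%N.
  exists (\max_(k < size x) size (x`_k)%R)%N => k.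
  case: (ltnP k (size x)) => [lk|gk]; last by rewrite nth_default ?size_poly0.
  exact: (leq_bigmax (Ordinal lk)).
elim: N x hx xN => [|N IHN] x hx xN.
  exists [::]; rewrite big_nil; apply/polyP => k.
  by rewrite coef0; apply/eqP; rewrite -size_poly_leq0.
have [M hM] : exists M, (size (x`_0)%R <= M)%N by exists (size (x`_0)%R).
pose h := \sum_(n < M) BK x`_0`_(6 * n) * BD1 ^+ n.
have inv_h : inv_det1 h.
  by apply: inv_sum => n; apply: inv_mul; [apply: inv_K | apply: inv_exp; apply: inv_BD1].
have h0 : h`_0 = x`_0.
  apply/polyP => j; rewrite /h !coef_sum.
  have [jM|jM] := leqP M j.
    rewrite big1 => [|n _]; first by rewrite nth_default // (leq_trans hM).
    rewrite coef_BK_mul BD1_coef0 coefXn; case: eqP => [jn|_]; rewrite ?mulr0 //.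
    by rewrite nth_default ?mul0r // -jn (leq_trans hM).
  have [/dvdnP[m jm]|n6] := boolP (6 %| j)%N.
    have mM : (m < M)%N by rewrite (leq_ltn_trans _ jM) // jm leq_pmulr.
    rewrite (bigD1 (Ordinal mM)) //= coef_BK_mul BD1_coef0 coefXn jm mulnC eqxx mulr1 big1 ?addr0 // => n ne.
    rewrite coef_BK_mul BD1_coef0 coefXn; case: eqP => [mn|_]; rewrite ?mulr0 //.
    by case/negP: ne; apply/eqP/val_inj => /=; lia.
  rewrite big1 => [|n _].
    apply/esym/eqP/negPn/negP => /(inv_coef hx)[_ /eqP]; rewrite mod0n eq_sym => j6.
    by rewrite /dvdn j6 in n6.
  rewrite coef_BK_mul BD1_coef0 coefXn; case: eqP => [jn|_]; rewrite ?mulr0 //.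
  by rewrite jn dvdn_mulr in n6.
have [g hg xg] : exists2 g, inv_det1 g & x - h = Bq2 * g.
  by apply: inv_div; [apply: inv_sub | rewrite coefB h0 subrr].
have hN k : (size (h`_k)%R <= N.+1)%N.
  rewrite /h coef_sum; apply: (leq_trans (size_sum _ _ _)); apply/bigmax_leqP => n _.
  rewrite coef_BK_mul' ; have [->|x0] := eqVneq (x`_0`_(6 * n)) 0; first by rewrite scale0r size_poly0.
  rewrite size_scale // (leq_trans (size_BD1 _ _)) //.
  rewrite (leq_trans _ (xN 0%N)) // ltnNge; apply: contraNN x0 => /leq_sizeP/(_ _ (leqnn _)) ->; exact: eqxx.
have gN k : (size (g`_k)%R <= N)%N.
  apply/leq_sizeP => j Nj; have : (x - h)`_k.+2`_j.+2 = 0.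
    have Nj2 : (N.+1 <= j.+2)%N by rewrite ltnS leqW.
    rewrite !coefB (nth_default 0 (leq_trans (xN _) Nj2)) (nth_default 0 (leq_trans (hN _) Nj2)).
    exact: subrr.
  have -> : x - h = BY * (BY * (BU * (BU * g))) by rewrite xg /Bq2; ring.
  by rewrite !coefYM !coefUM.
have [l gl] := IHN g hg gN.
exists ([seq (x`_0`_(6 * n), (val n, 0%N)) | n : 'I_M <- index_enum 'I_M] ++ [seq (w.1, (w.2.1, w.2.2.+1)) | w <- l]).
rewrite big_cat !big_map /= -[LHS](subrK h) xg [X in X = _]addrC; congr (_ + _).
  by rewrite /h; apply: eq_bigr => n _; rewrite expr0 mulr1.
by rewrite gl mulr_sumr; apply: eq_bigr => w _; rewrite exprS; ring.
Qed.
End Dickson.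

(** * Values of a class at the eight points, and their equivariance *)

Section Values.
Local Notation BT := {poly {poly 'F_7}}.
Variables (gT : finGroupType) (E : {group gT}) (e1 e2 c : gT).
Hypothesis hE : is_extraspecial_7 E e1 e2 c.
Variables y1 y2 C v : rcoh E.
Hypothesis hP : @is_HE_presentation gT E e1 e2 y1 y2 C v.
Variables al la : 'F_7.
Hypothesis hval : he_val hE y1 y2 C v al la.

Local Notation o := (of7 (rcoh7 E)).
Local Notation Ph := (Phi al la).

(** Homogeneous coordinates of the point of the projective line attached to [A_m]. *)
Definition st (m : option 'F_7) : 'F_7 * 'F_7 := if m is Some k then (1, k) else (0, 1).

(* The common form of all eight restrictions of [x]: [r m] is the value of [x]
   at [y1 = s y], [y2 = t y], [C = y^6], where [(s, t) = st m]; in it [BU] stands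
   for [v]. *)
Definition rho (x : rcoh E) (r : option 'F_7 -> BT) := forall m, es_sig hE m x = A0ev (Ph (r m)).

Let al0 : al != 0. Proof. by case: hval. Qed.
Let la0 : la != 0. Proof. by case: hval. Qed.

Let sD m x x' : es_sig hE m (x + x') = es_sig hE m x + es_sig hE m x'.
Proof. exact: rmorphD. Qed.
Let sB m x x' : es_sig hE m (x - x') = es_sig hE m x - es_sig hE m x'.
Proof. exact: rmorphB. Qed.
Let sM m x x' : es_sig hE m (x * x') = es_sig hE m x * es_sig hE m x'.
Proof. exact: rmorphM. Qed.
Let sX m x n : es_sig hE m (x ^+ n) = es_sig hE m x ^+ n.
Proof. exact: rmorphXn. Qed.
Let sMn m x n : es_sig hE m (x *+ n) = es_sig hE m x *+ n.
Proof. exact: rmorphMn. Qed.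

Lemma rho_inj x r r' : rho x r -> rho x r' -> r =1 r'.
Proof. by move=> h h' m; apply: (Phi_inj al0 la0); apply: A0ev_inj; rewrite -h -h'. Qed.

Lemma rho_eq x r r' : r =1 r' -> rho x r -> rho x r'.
Proof. by move=> rr h m; rewrite h rr. Qed.

Lemma rho_det x x' r : rho x r -> rho x' r -> x = x'.
Proof.
move=> h h'; apply/eqP; rewrite -subr_eq0; apply/eqP.
apply: (es_detection (he_es_rel hE hP)) => m.
by rewrite sB h h' subrr.
Qed.

Lemma rho0 : rho 0 (fun => 0).
Proof. by move=> m; rewrite [LHS](rmorph0 (es_sig hE m)) (rmorph0 Ph) (rmorph0 A0ev). Qed.

Lemma rhoD x x' r r' : rho x r -> rho x' r' -> rho (x + x') (fun m => r m + r' m).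
Proof.
move=> h h' m.
by rewrite sD h h' -(rmorphD A0ev) -(rmorphD Ph).
Qed.

Lemma rhoB x x' r r' : rho x r -> rho x' r' -> rho (x - x') (fun m => r m - r' m).
Proof.
move=> h h' m.
by rewrite sB h h' -(rmorphB A0ev) -(rmorphB Ph).
Qed.

Lemma rhoM x x' r r' : rho x r -> rho x' r' -> rho (x * x') (fun m => r m * r' m).
Proof.
move=> h h' m.
by rewrite sM h h' -(rmorphM A0ev) -(rmorphM Ph).
Qed.

Lemma rhoX x r n : rho x r -> rho (x ^+ n) (fun m => r m ^+ n).
Proof. by move=> h m; rewrite sX h -(rmorphXn A0ev) -(rmorphXn Ph). Qed.

Lemma rhoK k : rho (o k) (fun => BK k).
Proof.
move=> m; rewrite PhiK; transitivity (of7 (rcoh7 A0) k).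
  exact: (rmorph_of7 _ _ (es_sig hE m)).
by apply/esym; exact: (rmorph_of7 _ _ A0ev).
Qed.

Lemma rho1 : rho 1 (fun => 1).
Proof. by move=> m; rewrite [LHS](rmorph1 (es_sig hE m)) (rmorph1 Ph) (rmorph1 A0ev). Qed.

Lemma rhoMn x r n : rho x r -> rho (x *+ n) (fun m => r m *+ n).
Proof. by move=> h m; rewrite sMn h -(rmorphMn A0ev) -(rmorphMn Ph). Qed.

Lemma rho_sum I (l : seq I) (F : I -> rcoh E) (f : I -> option 'F_7 -> BT) :
  (forall i, rho (F i) (f i)) -> rho (\sum_(i <- l) F i) (fun m => \sum_(i <- l) f i m).
Proof.
move=> h; elim: l => [|i l IHl].
  by rewrite big_nil; apply: rho_eq rho0 => m; rewrite big_nil.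
by rewrite big_cons; apply: rho_eq (rhoD (h i) IHl) => m; rewrite big_cons.
Qed.

Lemma rho_prod I (l : seq I) (F : I -> rcoh E) (f : I -> option 'F_7 -> BT) :
  (forall i, rho (F i) (f i)) -> rho (\prod_(i <- l) F i) (fun m => \prod_(i <- l) f i m).
Proof.
move=> h; elim: l => [|i l IHl].
  by rewrite big_nil; apply: rho_eq rho1 => m; rewrite big_nil.
by rewrite big_cons; apply: rho_eq (rhoM (h i) IHl) => m; rewrite big_cons.
Qed.

Lemma rho_mpoly n (h : 'I_n -> rcoh E) (g : option 'F_7 -> 'I_n -> BT) (P : {mpoly 'F_7[n]}) :
  (forall i, rho (h i) (fun m => g m i)) ->
  rho (mpoly_at h P) (fun m => mpoly_at (g m) P).
Proof.
move=> hg; apply: rho_sum => mm; apply: rhoMn; apply: rho_prod => i; exact: rhoX.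
Qed.

Lemma rho_y1 : rho y1 (fun m => BK (st m).1 * BY).
Proof.
move=> m; have [_ _ /(_ m)[-> _ _ _]] := hval; congr (A0ev _).
rewrite [RHS](rmorphM Ph) [X in _ = X * _]PhiK PhiY.
by case: m => [k|] /=; rewrite BKM mulrCA mulrC.
Qed.

Lemma rho_y2 : rho y2 (fun m => BK (st m).2 * BY).
Proof.
move=> m; have [_ _ /(_ m)[_ -> _ _]] := hval; congr (A0ev _).
rewrite [RHS](rmorphM Ph) [X in _ = X * _]PhiK PhiY.
by case: m => [k|] /=; rewrite BKM mulrCA mulrC.
Qed.

Lemma rho_v : rho v (fun => BU).
Proof. by move=> m; have [_ _ /(_ m)[_ _ -> _]] := hval; rewrite PhiU. Qed.

Lemma rho_C : rho C (fun => BY ^+ 6).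
Proof.
move=> m; have [_ _ /(_ m)[_ _ _ ->]] := hval; congr (A0ev _).
by rewrite [RHS](rmorphXn Ph) PhiY exprMn -BKX (F7_pow6 al0) BK1 mulr1.
Qed.

Definition isform k (f : option 'F_7 -> 'F_7) :=
  exists p : nat -> 'F_7, forall m, f m = \sum_(i < k.+1) p i * ((st m).1 ^+ i * (st m).2 ^+ (k - i)).

Lemma isform0 k : isform k (fun => 0).
Proof. by exists (fun => 0) => m; rewrite big1 // => i _; rewrite mul0r. Qed.

Lemma isformD k f g : isform k f -> isform k g -> isform k (fun m => f m + g m).
Proof.
move=> [p hp] [q hq]; exists (fun i => p i + q i) => m.
by rewrite hp hq -big_split; apply: eq_bigr => i _; rewrite mulrDl.
Qed.

Lemma isform_eq k f g : f =1 g -> isform k f -> isform k g.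
Proof. by move=> fg [p hp]; exists p => m; rewrite -fg. Qed.

Lemma isform_sum k I (l : seq I) (f : I -> option 'F_7 -> 'F_7) :
  (forall i, isform k (f i)) -> isform k (fun m => \sum_(i <- l) f i m).
Proof.
move=> h; elim: l => [|i l IHl].
  by apply: isform_eq (isform0 k) => m; rewrite big_nil.
by apply: isform_eq (isformD (h i) IHl) => m; rewrite big_cons.
Qed.

Lemma isform_monomial k (x : 'F_7) a b : (a + b = k)%N ->
  isform k (fun m => x * ((st m).1 ^+ a * (st m).2 ^+ b)).
Proof.
move=> abk; exists (fun i => x *+ (i == a)) => m.
have ak : (a < k.+1)%N by rewrite -abk ltnS leq_addr.
have kb : (k - a = b)%N by rewrite -abk addKn.
rewrite (bigD1 (Ordinal ak)) //= eqxx mulr1n kb big1 ?addr0 // => i ne.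
rewrite (_ : (i == a :> nat) = false) ?mul0r //.
by apply: contra_neqF ne => /eqP ia; apply: val_inj.
Qed.

(** Below degree 6 in [y] the part involving [C] does not contribute, and a monomial of degree [k]
    in [y1, y2] takes the value [s^i t^(k-i) y^k]. These conditions tie the values at different
    [A_m] together. *)
Lemma rho_form x r k j : rho x r -> (k < 6)%N -> isform k (fun m => (r m)`_k`_j).
Proof.
move=> hr k6; have [P [Q xE]] := he_span hP x.
pose g (m : option 'F_7) := tnth [tuple BK (st m).1 * BY; BK (st m).2 * BY; BU].
have h1 : rho (mpoly_at (tnth [tuple y1; y2; v]) P) (fun m => mpoly_at (g m) P).
  apply: rho_mpoly => i; rewrite /g; case: i => -[|[|[|//]]] i3.
  - exact: rho_y1.
  - exact: rho_y2.
  - exact: rho_v.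
have h2 : rho (C * mpoly_at (fun=> v) Q) (fun m => BY ^+ 6 * mpoly_at (fun => BU) Q).
  by apply: (rhoM rho_C); apply: rho_mpoly => i; exact: rho_v.
have E1 := rho_inj hr; rewrite xE in E1; have {}E1 := E1 _ (rhoD h1 h2).
apply: isform_eq (_ : isform k (fun m => (mpoly_at (g m) P : BT)`_k`_j)) => [m|].
  rewrite E1 !coefD [X in _ + X](_ : _ = 0) ?addr0 //.
  set z := mpoly_at _ _; suff -> : (BY ^+ 6 * z)`_k = 0 by rewrite coef0.
  rewrite (_ : BY ^+ 6 * z = BY * (BY * (BY * (BY * (BY * (BY * z)))))); last ring.
  by case: k k6 => [|[|[|[|[|[|//]]]]]] _; do 6?rewrite coefYM //.
apply: isform_eq (_ : isform k (fun m => \sum_(mm <- msupp P)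
    (P@_mm *+ ((k == mm (inord 0) + mm (inord 1))%N && (j == mm (inord 2)))) *
    ((st m).1 ^+ mm (inord 0) * (st m).2 ^+ mm (inord 1)))).
  move=> m; rewrite /mpoly_at !coef_sum; apply: eq_bigr => mm _.
  have -> : (\prod_(i < 3) g m i ^+ mm i) *+ (P@_mm : 'F_7) =
      BK (P@_mm * ((st m).1 ^+ mm (inord 0) * (st m).2 ^+ mm (inord 1))) *
      BY ^+ (mm (inord 0) + mm (inord 1)) * BU ^+ mm (inord 2).
    rewrite (mulrn_of7 BT7) -/(BK _) !big_ord_recl big_ord0 mulr1 /g.
    have -> : inord 0 = ord0 :> 'I_3 by apply: val_inj; rewrite /= inordK.
    have -> : inord 1 = lift ord0 ord0 :> 'I_3 by apply: val_inj; rewrite /= inordK.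
    have -> : inord 2 = lift ord0 (lift ord0 ord0) :> 'I_3 by apply: val_inj; rewrite /= inordK.
    rewrite !(tnth_nth 0) /= !exprMn !BKM !BKX exprD; ring.
  rewrite coef_YU; set b := _ && _; case: b; rewrite ?mulr1n ?mulr0n ?mul0r //.
apply: isform_sum => mm; case: eqP => [kE|_]; last first.
  by apply: isform_eq (isform0 k) => m; rewrite /= mulr0n mul0r.
by case: (j == _); [apply: isform_monomial | apply: isform_eq (isform0 k) => m; rewrite /= mulr0n mul0r].
Qed.

Lemma form0 f : isform 0 f -> forall m m', f m = f m'.
Proof. by move=> [p hp] m m'; rewrite !hp !big_ord_recl !big_ord0 /= !expr0. Qed.

(** Zeros at [(1, 0)] and [(0, 1)] leave the multiples of [s t]. *)
Lemma form2 f : isform 2 f -> f (Some 0) = 0 -> f None = 0 -> exists x, forall k, f (Some k) = x * k.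
Proof.
move=> [p hp] f0 fN; exists (p 1%N) => k; move: f0 fN.
rewrite !hp !big_ord_recl !big_ord0 /= /bump /=.
move: (p 0%N) (p 1%N) (p 2%N) => p0 p1 p2 h0 hN.
have p20 : p2 = 0 by rewrite -[RHS]h0; ring.
have p00 : p0 = 0 by rewrite -[RHS]hN; ring.
rewrite p20 p00; ring.
Qed.

(** Zeros at 0, oo, 1 and -1 leave the multiples of [s t (s^2 - t^2)], which is odd in [t]. *)
Lemma form4 f : isform 4 f -> f (Some 0) = 0 -> f None = 0 -> f (Some 1) = 0 -> f (Some (-1)) = 0 ->
  f (Some (-2)) = - f (Some 2).
Proof.
move=> [p hp]; rewrite !hp !big_ord_recl !big_ord0 /= /bump /=.
move: (p 0%N) (p 1%N) (p 2%N) (p 3%N) (p 4%N) => p0 p1 p2 p3 p4 h0 hN h1 h6.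
have e4 : p4 = 0 by rewrite -[RHS]h0; ring.
have e0 : p0 = 0 by rewrite -[RHS]hN; ring.
have e13 : p1 + p2 + p3 = 0 by rewrite -[RHS]h1 e4 e0; ring.
have e13' : p2 - p1 - p3 = 0 by rewrite -[RHS]h6 e4 e0; ring.
have p20 : p2 = 0.
  have : p2 *+ 2 = 0 by rewrite -[RHS]addr0 -{1}e13 -e13'; ring.
  by rewrite -mulr_natr => /eqP; rewrite mulf_eq0 orbF => /eqP.
rewrite e0 p20 e4; have -> : p1 = - p3 by rewrite -[LHS](addrK (p2 + p3)) addrA e13 p20; ring.
ring.
Qed.

(** The 24 matrices of the group [3D_8], in explicit form. *)
Definition monomial22 (M : 'M['F_7]_2) : Prop :=
  (M 0 1 = 0 /\ M 1 0 = 0 /\ M 0 0 != 0 /\ M 0 0 ^+ 2 = M 1 1 ^+ 2) \/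
  (M 0 0 = 0 /\ M 1 1 = 0 /\ M 0 1 != 0 /\ M 0 1 ^+ 2 = M 1 0 ^+ 2).

(** Stability under [N_G(E)] in polynomial terms: [M] takes the point of [m] to [i] times that of
    [m'], and [v] is multiplied by the determinant. *)
Definition equi (r : option 'F_7 -> BT) := forall (M : 'M['F_7]_2) m m' (i : 'F_7),
  monomial22 M -> i != 0 ->
  i * (st m').1 = M 0 0 * (st m).1 + M 0 1 * (st m).2 ->
  i * (st m').2 = M 1 0 * (st m).1 + M 1 1 * (st m).2 ->
  r m = lsub i 0 0 (M 0 0 * M 1 1 - M 0 1 * M 1 0) (r m').

Lemma equiD r r' : equi r -> equi r' -> equi (fun m => r m + r' m).
Proof. by move=> h h' M m m' i hM i0 e1' e2'; rewrite lsubD -(h M m) // -(h' M m). Qed.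
Lemma equiB r r' : equi r -> equi r' -> equi (fun m => r m - r' m).
Proof. by move=> h h' M m m' i hM i0 e1' e2'; rewrite lsubB -(h M m) // -(h' M m). Qed.
Lemma equiM r r' : equi r -> equi r' -> equi (fun m => r m * r' m).
Proof. by move=> h h' M m m' i hM i0 e1' e2'; rewrite lsubM -(h M m) // -(h' M m). Qed.
Lemma equiX r n : equi r -> equi (fun m => r m ^+ n).
Proof. by move=> h M m m' i hM i0 e1' e2'; rewrite lsubX -(h M m). Qed.
Lemma equi0 : equi (fun => 0).
Proof. by move=> M m m' i _ _ _ _; rewrite [RHS](rmorph0 (lsub _ _ _ _)). Qed.
Lemma equiK k : equi (fun => BK k).
Proof. by move=> M m m' i _ _ _ _; rewrite lsubK. Qed.
Lemma equi_eq r r' : r =1 r' -> equi r -> equi r'.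
Proof. by move=> rr h M m m' i hM i0 e1' e2'; rewrite -!rr; apply: (h M). Qed.

Lemma equi_YU (x : option 'F_7 -> 'F_7) a b :
  (forall (p q s t s' t' i : 'F_7) m m', st m = (s, t) -> st m' = (s', t') ->
     p != 0 -> p ^+ 2 = q ^+ 2 -> i != 0 ->
     i * s' = p * s -> i * t' = q * t -> x m' * (i ^+ a * (p * q) ^+ b) = x m) ->
  (forall (p q s t s' t' i : 'F_7) m m', st m = (s, t) -> st m' = (s', t') ->
     p != 0 -> p ^+ 2 = q ^+ 2 -> i != 0 ->
     i * s' = p * t -> i * t' = q * s -> x m' * (i ^+ a * (- (p * q)) ^+ b) = x m) ->
  equi (fun m => BK (x m) * BY ^+ a * BU ^+ b).
Proof.
move=> h1 h2 M m m' i hM i0 e1' e2'.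
rewrite !lsubM lsubK !lsubX lsubY lsubU !BK0 mul0r addr0 mul0r add0r !exprMn -!BKX.
rewrite -(_ : x m' * (i ^+ a * (M 0 0 * M 1 1 - M 0 1 * M 1 0) ^+ b) = x m).
  by rewrite !BKM; ring.
case: hM => [[m1 [m2 [p0 pq]]]|[m1 [m2 [p0 pq]]]].
  rewrite m1 mul0r subr0; apply: (h1 _ _ (st m).1 (st m).2 (st m').1 (st m').2) => //; try exact: surjective_pairing.
    by rewrite e1' m1 mul0r addr0.
  by rewrite e2' m2 mul0r add0r.
rewrite m1 mul0r sub0r; apply: (h2 _ _ (st m).1 (st m).2 (st m').1 (st m').2) => //; try exact: surjective_pairing.
  by rewrite e1' m1 mul0r add0r.
by rewrite e2' m2 mul0r addr0.
Qed.

Definition vA m := (st m).1 ^+ 2 + (st m).2 ^+ 2.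
Definition vB m := (st m).1 ^+ 2 * (st m).2 ^+ 2.
Definition vD m := (st m).1 * (st m).2 ^+ 3 - (st m).1 ^+ 3 * (st m).2.

Lemma equi_Y6 : equi (fun => BY ^+ 6).
Proof.
apply: equi_eq (_ : equi (fun m => BK ((fun => 1) m) * BY ^+ 6 * BU ^+ 0)).
  by move=> m; rewrite BK1 mul1r expr0 mulr1.
by apply: equi_YU => *; rewrite F7_pow6 // expr0 !mulr1.
Qed.

Lemma equi_U6 : equi (fun => BU ^+ 6).
Proof.
have q0 (p q : 'F_7) : p != 0 -> p ^+ 2 = q ^+ 2 -> q != 0.
  by move=> p0 pq; apply: contra_neq p0 => q0; move: pq; rewrite q0 expr0n => /eqP; rewrite expf_eq0 => /eqP.
apply: equi_eq (_ : equi (fun m => BK ((fun => 1) m) * BY ^+ 0 * BU ^+ 6)).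
  by move=> m; rewrite BK1 mul1r expr0 mul1r.
apply: equi_YU => p q s t s' t' i m m' _ _ p0 pq _ _ _; rewrite F7_pow6 ?expr0 ?mulr1 //.
  by rewrite mulf_neq0 // (q0 p).
by rewrite oppr_eq0 mulf_neq0 // (q0 p).
Qed.

Lemma equi_a : equi (fun m => BK (vA m) * BY ^+ 2 * BU ^+ 2).
Proof.
apply: equi_YU => p q s t s' t' i m m' E1 E2 p0 pq _ es et; rewrite /vA E1 E2 /=.
  have -> : (s' ^+ 2 + t' ^+ 2) * (i ^+ 2 * (p * q) ^+ 2) = ((i * s') ^+ 2 + (i * t') ^+ 2) * (p ^+ 2 * q ^+ 2) by ring.
  rewrite es et exprMn [(q * t) ^+ 2]exprMn -pq.
  have -> : (p ^+ 2 * s ^+ 2 + p ^+ 2 * t ^+ 2) * (p ^+ 2 * p ^+ 2) = (s ^+ 2 + t ^+ 2) * p ^+ 6 by ring.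
  by rewrite F7_pow6 // mulr1.
have -> : (s' ^+ 2 + t' ^+ 2) * (i ^+ 2 * (- (p * q)) ^+ 2) = ((i * s') ^+ 2 + (i * t') ^+ 2) * (p ^+ 2 * q ^+ 2) by ring.
rewrite es et exprMn [(q * s) ^+ 2]exprMn -pq.
have -> : (p ^+ 2 * t ^+ 2 + p ^+ 2 * s ^+ 2) * (p ^+ 2 * p ^+ 2) = (s ^+ 2 + t ^+ 2) * p ^+ 6 by ring.
by rewrite F7_pow6 // mulr1.
Qed.

Lemma equi_b : equi (fun m => BK (vB m) * BY ^+ 4 * BU ^+ 4).
Proof.
apply: equi_YU => p q s t s' t' i m m' E1 E2 p0 pq _ es et; rewrite /vB E1 E2 /=.
  have -> : s' ^+ 2 * t' ^+ 2 * (i ^+ 4 * (p * q) ^+ 4) = (i * s') ^+ 2 * (i * t') ^+ 2 * ((p ^+ 2) ^+ 2 * (q ^+ 2) ^+ 2) by ring.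
  rewrite es et exprMn [(q * t) ^+ 2]exprMn -pq.
  have -> : p ^+ 2 * s ^+ 2 * (p ^+ 2 * t ^+ 2) * ((p ^+ 2) ^+ 2 * (p ^+ 2) ^+ 2) = s ^+ 2 * t ^+ 2 * (p ^+ 6) ^+ 2 by ring.
  by rewrite F7_pow6 // expr1n mulr1.
have -> : s' ^+ 2 * t' ^+ 2 * (i ^+ 4 * (- (p * q)) ^+ 4) = (i * s') ^+ 2 * (i * t') ^+ 2 * ((p ^+ 2) ^+ 2 * (q ^+ 2) ^+ 2) by ring.
rewrite es et exprMn [(q * s) ^+ 2]exprMn -pq.
have -> : p ^+ 2 * t ^+ 2 * (p ^+ 2 * s ^+ 2) * ((p ^+ 2) ^+ 2 * (p ^+ 2) ^+ 2) = s ^+ 2 * t ^+ 2 * (p ^+ 6) ^+ 2 by ring.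
by rewrite F7_pow6 // expr1n mulr1.
Qed.

Lemma equi_d : equi (fun m => BK (vD m) * BY ^+ 4 * BU ^+ 1).
Proof.
apply: equi_YU => p q s t s' t' i m m' E1 E2 p0 pq _ es et; rewrite /vD E1 E2 /=.
  have -> : (s' * t' ^+ 3 - s' ^+ 3 * t') * (i ^+ 4 * (p * q) ^+ 1) =
    ((i * s') * (i * t') ^+ 3 - (i * s') ^+ 3 * (i * t')) * (p * q) by ring.
  rewrite es et; have -> : (p * s * (q * t) ^+ 3 - (p * s) ^+ 3 * (q * t)) * (p * q) =
    (s * t ^+ 3 * q ^+ 2 - s ^+ 3 * t * p ^+ 2) * (p ^+ 2 * q ^+ 2) by ring.
  rewrite -pq; have -> : (s * t ^+ 3 * p ^+ 2 - s ^+ 3 * t * p ^+ 2) * (p ^+ 2 * p ^+ 2) = (s * t ^+ 3 - s ^+ 3 * t) * p ^+ 6 by ring.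
  by rewrite F7_pow6 // mulr1.
have -> : (s' * t' ^+ 3 - s' ^+ 3 * t') * (i ^+ 4 * (- (p * q)) ^+ 1) =
  ((i * s') ^+ 3 * (i * t') - (i * s') * (i * t') ^+ 3) * (p * q) by ring.
rewrite es et; have -> : ((p * t) ^+ 3 * (q * s) - (p * t) * (q * s) ^+ 3) * (p * q) =
  (s * t ^+ 3 * p ^+ 2 - s ^+ 3 * t * q ^+ 2) * (p ^+ 2 * q ^+ 2) by ring.
rewrite -pq; have -> : (s * t ^+ 3 * p ^+ 2 - s ^+ 3 * t * p ^+ 2) * (p ^+ 2 * p ^+ 2) = (s * t ^+ 3 - s ^+ 3 * t) * p ^+ 6 by ring.
by rewrite F7_pow6 // mulr1.
Qed.
End Values.

(** * Generators over [DA] and [CA], and uniqueness of the expansion *)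

Section MonomialFreeness.
Local Notation BT := {poly {poly 'F_7}}.

(** Terms with different exponents do not interfere; a zero weight marks a summand that vanishes at
    the point under consideration. *)
Lemma monomial_free N (e : 'I_N -> 'X_{1..2} -> nat * nat) (w : 'I_N -> 'F_7)
    (P : 'I_N -> {mpoly 'F_7[2]}) k0 m0 :
  \sum_k \sum_(m <- msupp (P k)) BK (w k * (P k)@_m) * BY ^+ (e k m).1 * BU ^+ (e k m).2 = 0 ->
  (forall k m, w k != 0 -> m \in msupp (P k) -> e k m = e k0 m0 -> k = k0 /\ m = m0) ->
  w k0 != 0 -> (P k0)@_m0 = 0.
Proof.
move=> E0 inj w0; apply/eqP/negPn/negP => Pm.
have m0P : m0 \in msupp (P k0) by rewrite mcoeff_msupp.
have := congr1 (fun z : BT => z`_(e k0 m0).1`_(e k0 m0).2) E0.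
rewrite coef_sum coef_sum (bigD1 k0) //= coef_sum coef_sum (bigD1_seq m0) ?msupp_uniq //=.
rewrite coef_YU !eqxx mulr1n !coef0 big1 => [|m ne].
  rewrite addr0 big1 => [|k ne]; first by rewrite addr0 => /eqP; rewrite mulf_eq0 (negPf w0) (negPf Pm).
  rewrite coef_sum coef_sum big_seq big1 // => m mP; rewrite coef_YU.
  have [wk|wk] := eqVneq (w k) 0; first by rewrite wk mul0r mul0rn.
  case: andP => // -[/eqP h1 /eqP h2]; have [|kk _] := inj k m wk mP.
    by rewrite [LHS]surjective_pairing -h1 -h2 -surjective_pairing.
  by rewrite kk eqxx in ne.
rewrite coef_YU; case: andP => // -[/eqP h1 /eqP h2].
have [mP|mP] := boolP (m \in msupp (P k0)); last first.
  by rewrite (memN_msupp_eq0 mP) mulr0 mul0rn.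
have [|_ mm] := inj k0 m w0 mP; last by rewrite mm eqxx in ne.
by rewrite [LHS]surjective_pairing -h1 -h2 -surjective_pairing.
Qed.

Lemma mpoly_at2 (a b : BT) (P : {mpoly 'F_7[2]}) :
  mpoly_at (tnth [tuple a; b]) P = \sum_(m <- msupp P) BK P@_m * a ^+ m ord0 * b ^+ m (lift ord0 ord0).
Proof.
apply: eq_bigr => m _; rewrite (mulrn_of7 BT7) -/(BK _) !big_ord_recl big_ord0 mulr1.
by rewrite !(tnth_nth 0) /= mulrA.
Qed.

Lemma expD6 (x : BT) n k : x ^+ (6 * n + k)%N = (x ^+ 6) ^+ n * x ^+ k.
Proof. by rewrite exprD exprM. Qed.

Lemma mnm2_eq (m m' : 'X_{1..2}) : m ord0 = m' ord0 -> m (lift ord0 ord0) = m' (lift ord0 ord0) -> m = m'.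
Proof.
move=> h0 h1; apply/mnmP; case=> -[|[|//]] i2.
  by rewrite (_ : Ordinal i2 = ord0) //; apply: val_inj.
by rewrite (_ : Ordinal i2 = lift ord0 ord0) //; apply: val_inj.
Qed.
End MonomialFreeness.

Section Realization.
Local Notation BT := {poly {poly 'F_7}}.
Variables (gT : finGroupType) (E : {group gT}) (e1 e2 c : gT).
Hypothesis hE : is_extraspecial_7 E e1 e2 c.
Variables y1 y2 C v : rcoh E.
Hypothesis hP : @is_HE_presentation gT E e1 e2 y1 y2 C v.
Variables al la : 'F_7.
Hypothesis hval : he_val hE y1 y2 C v al la.

Local Notation o := (of7 (rcoh7 E)).
Local Notation rho := (rho hE al la).
Local Notation inv1 := (inv_det1 al la).
Local Notation V := (v ^+ 6).
Local Notation D1 := (C ^+ 7 + V).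
Local Notation D2 := (C * V).
Local Notation a := ((y1 ^+ 2 + y2 ^+ 2) * v ^+ 2).
Local Notation b := (y1 ^+ 2 * y2 ^+ 2 * v ^+ 4).
Local Notation d := ((y1 * y2 ^+ 3 - y1 ^+ 3 * y2) * v).
Local Notation C' := (C - (y1 ^+ 2 + y2 ^+ 2) ^+ 3).
Local Notation xs := [:: 1; a; a ^+ 2; b; a * b; a ^+ 2 * b].
Local Notation zs := [:: d; a * d; a ^+ 2 * d; C'; C' * a; C' * a ^+ 2].
Local Notation comb := (DA_CA_comb D1 D2 C V xs zs).

Let al0 : al != 0. Proof. by case: hval. Qed.
Let la0 : la != 0. Proof. by case: hval. Qed.
Let rC := rho_C hval.
Let rv := rho_v hval.

Lemma rho_V : rho V (fun => BU ^+ 6).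
Proof. exact: rhoX rv. Qed.

Lemma rho_D1 : rho D1 (fun => BD1).
Proof. by apply: rho_eq (rhoD (rhoX 7 rC) rho_V) => m; rewrite /BD1 -exprM. Qed.

Lemma rho_D2 : rho D2 (fun => Bq2 ^+ 3).
Proof. by apply: rho_eq (rhoM rC rho_V) => m; rewrite /Bq2 -exprM exprMn. Qed.

Lemma rho_ss : rho (y1 ^+ 2 + y2 ^+ 2) (fun m => BK (vA m) * BY ^+ 2).
Proof.
apply: rho_eq (rhoD (rhoX 2 (rho_y1 hval)) (rhoX 2 (rho_y2 hval))) => m.
by rewrite /vA BKD !BKX; ring.
Qed.

Lemma rho_a : rho a (fun m => BK (vA m) * Bq2).
Proof. by apply: rho_eq (rhoM rho_ss (rhoX 2 rv)) => m; rewrite /Bq2; ring. Qed.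

Lemma rho_b : rho b (fun m => BK (vB m) * Bq2 ^+ 2).
Proof.
apply: rho_eq (rhoM (rhoM (rhoX 2 (rho_y1 hval)) (rhoX 2 (rho_y2 hval))) (rhoX 4 rv)) => m.
by rewrite /vB /Bq2 BKM !BKX; ring.
Qed.

Lemma rho_d : rho d (fun m => BK (vD m) * BY ^+ 4 * BU ^+ 1).
Proof.
apply: rho_eq (rhoM (rhoB (rhoM (rho_y1 hval) (rhoX 3 (rho_y2 hval)))
  (rhoM (rhoX 3 (rho_y1 hval)) (rho_y2 hval))) rv) => m.
by rewrite /vD BKB !BKM; ring.
Qed.

(** The coefficient of [y^6] in the value of [C']; it is zero where [s^2 + t^2] has cube 1, in
    particular at [A_0] and [A_1]. *)
Definition vC m := 1 - vA m ^+ 3.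

Lemma rho_C' : rho C' (fun m => BK (vC m) * BY ^+ 6).
Proof.
apply: rho_eq (rhoB rC (rhoX 3 rho_ss)) => m.
by rewrite /vC BKB BK1 BKX; ring.
Qed.

Definition xw m := [:: 1; vA m; vA m ^+ 2; vB m; vA m * vB m; vA m ^+ 2 * vB m].
Definition xe := [:: 0; 1; 2; 2; 3; 4]%N.
Definition zw m := [:: vD m; vA m * vD m; vA m ^+ 2 * vD m; vC m; vC m * vA m; vC m * vA m ^+ 2].
Definition zy := [:: 4; 6; 8; 6; 8; 10]%N.
Definition zu := [:: 1; 3; 5; 0; 2; 4]%N.

Lemma rho_xs k : (k < 6)%N -> rho xs`_k (fun m => BK (xw m)`_k * Bq2 ^+ nth 0%N xe k).
Proof.
case: k => [|[|[|[|[|[|//]]]]]] _.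
- by apply: rho_eq (rho1 hE al la) => m; rewrite /= BK1 expr0 mulr1.
- by apply: rho_eq rho_a => m.
- by apply: rho_eq (rhoX 2 rho_a) => m; rewrite /= BKX; ring.
- by apply: rho_eq rho_b => m.
- by apply: rho_eq (rhoM rho_a rho_b) => m; rewrite /= BKM; ring.
- by apply: rho_eq (rhoM (rhoX 2 rho_a) rho_b) => m; rewrite /= BKM BKX; ring.
Qed.

Lemma rho_zs k : (k < 6)%N ->
  rho zs`_k (fun m => BK (zw m)`_k * BY ^+ nth 0%N zy k * BU ^+ nth 0%N zu k).
Proof.
case: k => [|[|[|[|[|[|//]]]]]] _.
- by apply: rho_eq rho_d => m.
- by apply: rho_eq (rhoM rho_a rho_d) => m; rewrite /= /Bq2 BKM; ring.
- by apply: rho_eq (rhoM (rhoX 2 rho_a) rho_d) => m; rewrite /= /Bq2 BKM BKX; ring.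
- by apply: rho_eq rho_C' => m; rewrite /= expr0 mulr1.
- by apply: rho_eq (rhoM rho_C' rho_a) => m; rewrite /= /Bq2 BKM; ring.
- by apply: rho_eq (rhoM rho_C' (rhoX 2 rho_a)) => m; rewrite /= /Bq2 BKM BKX; ring.
Qed.

Definition rcomb (u : {ffun 'I_6 -> {mpoly 'F_7[2]}} * {ffun 'I_6 -> {mpoly 'F_7[2]}}) m : BT :=
  \sum_(k < 6) mpoly_at (tnth [tuple BD1; Bq2 ^+ 3]) (u.1 k) * (BK (xw m)`_k * Bq2 ^+ nth 0%N xe k) +
  \sum_(k < 6) mpoly_at (tnth [tuple BY ^+ 6; BU ^+ 6]) (u.2 k) *
     (BK (zw m)`_k * BY ^+ nth 0%N zy k * BU ^+ nth 0%N zu k).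

Lemma rho_comb u : rho (comb u) (rcomb u).
Proof.
apply: rhoD; apply: rho_sum => k; apply: rhoM; try exact: rho_xs; try exact: rho_zs.
  by apply: rho_mpoly => i; case: i => -[|[|//]] i2; [exact: rho_D1 | exact: rho_D2].
by apply: rho_mpoly => i; case: i => -[|[|//]] i2; [exact: rC | exact: rho_V].
Qed.

(** Equivariance links [A_oo] to [A_0] and [A_6] to [A_1], so invariance is demanded at one member
    of each radical class. *)
Definition stab (r : option 'F_7 -> BT) := [/\ inv1 (r (Some 0)), inv1 (r (Some 1)) & equi r].

Lemma stab_eq r r' : r =1 r' -> stab r -> stab r'.
Proof. by move=> rr [h0 h1 h]; split; rewrite -?rr //; apply: equi_eq h. Qed.

Lemma stabM r r' : stab r -> stab r' -> stab (fun m => r m * r' m).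
Proof.
by move=> [h0 h1 h] [h0' h1' h']; split; [exact: inv_mul | exact: inv_mul | exact: equiM].
Qed.

Lemma stab0 : stab (fun => 0).
Proof. by split; [rewrite -BK0; exact: inv_K | rewrite -BK0; exact: inv_K | exact: equi0]. Qed.

Lemma stabD r r' : stab r -> stab r' -> stab (fun m => r m + r' m).
Proof.
by move=> [h0 h1 h] [h0' h1' h']; split; [exact: inv_add | exact: inv_add | exact: equiD].
Qed.

Lemma stab_sum I (l : seq I) (f : I -> option 'F_7 -> BT) :
  (forall i, stab (f i)) -> stab (fun m => \sum_(i <- l) f i m).
Proof.
move=> h; elim: l => [|i l IHl].
  by apply: stab_eq stab0 => m; rewrite big_nil.
by apply: stab_eq (stabD (h i) IHl) => m; rewrite big_cons.
Qed.

Lemma stabK k : stab (fun => BK k).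
Proof. by split; [exact: inv_K | exact: inv_K | exact: equiK]. Qed.

Lemma stab_vanish r : equi r -> r (Some 0) = 0 -> r (Some 1) = 0 -> stab r.
Proof. by move=> h h0 h1; split=> //; rewrite ?h0 ?h1 -BK0; exact: inv_K. Qed.

Lemma equi_xs k : (k < 6)%N -> equi (fun m => BK (xw m)`_k * Bq2 ^+ nth 0%N xe k).
Proof.
have ea : equi (fun m => BK (vA m) * Bq2).
  by apply: equi_eq equi_a => m; rewrite /Bq2; ring.
have eb : equi (fun m => BK (vB m) * Bq2 ^+ 2).
  by apply: equi_eq equi_b => m; rewrite /Bq2; ring.
case: k => [|[|[|[|[|[|//]]]]]] _.
- by apply: equi_eq (equiK 1) => m; rewrite /= expr0 mulr1.
- by apply: equi_eq ea => m.
- by apply: equi_eq (equiX 2 ea) => m; rewrite /= BKX; ring.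
- by apply: equi_eq eb => m.
- by apply: equi_eq (equiM ea eb) => m; rewrite /= BKM; ring.
- by apply: equi_eq (equiM (equiX 2 ea) eb) => m; rewrite /= BKM BKX; ring.
Qed.

Lemma equi_zs k : (k < 6)%N ->
  equi (fun m => BK (zw m)`_k * BY ^+ nth 0%N zy k * BU ^+ nth 0%N zu k).
Proof.
have ea := equi_a; have ed := equi_d.
have e3 : equi (fun m => BK (vA m ^+ 3) * BY ^+ 6 * BU ^+ 6).
  by apply: equi_eq (equiX 3 ea) => m; rewrite BKX; ring.
have eC : equi (fun m => BK (vC m) * BY ^+ 6).
  (* The cube in [C'] is equivariant only as [a^3 / V]: the identity is proved after multiplication
     by [v^6], which is then cancelled. *)
  move=> M m m' i hM i0 e1' e2'; apply: (mulIf (x := BU ^+ 6)); first by rewrite expf_neq0 ?BU_neq0.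
  have := equiB (equiM equi_Y6 equi_U6) e3 hM i0 e1' e2'.
  rewrite [in X in _ = _ * X](equi_U6 (m := m) (m' := m') hM i0 e1' e2') -lsubM.
  have KE m'' : BY ^+ 6 * BU ^+ 6 - BK (vA m'' ^+ 3) * BY ^+ 6 * BU ^+ 6 = BK (vC m'') * BY ^+ 6 * BU ^+ 6.
    by rewrite /vC BKB BK1; ring.
  by rewrite !KE.
case: k => [|[|[|[|[|[|//]]]]]] _.
- by apply: equi_eq ed => m.
- by apply: equi_eq (equiM ea ed) => m; rewrite /= BKM; ring.
- by apply: equi_eq (equiM (equiX 2 ea) ed) => m; rewrite /= BKM BKX; ring.
- by apply: equi_eq eC => m; rewrite /= expr0 mulr1.
- by apply: equi_eq (equiM eC ea) => m; rewrite /= BKM; ring.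
- by apply: equi_eq (equiM eC (equiX 2 ea)) => m; rewrite /= BKM BKX; ring.
Qed.

(** [s t^3 - s^3 t] and [1 - (s^2 + t^2)^3] vanish at [(1, 0)], and likewise at [(1, 1)]: the
    summand over [CA] is invisible on [A_0] and [A_1]. *)
Lemma zw0 k : (zw (Some 0))`_k = 0.
Proof.
have -> : zw (Some 0) = nseq 6 0 by apply/eqP.
by rewrite nth_nseq if_same.
Qed.

Lemma zw1 k : (zw (Some 1))`_k = 0.
Proof.
have -> : zw (Some 1) = nseq 6 0 by apply/eqP.
by rewrite nth_nseq if_same.
Qed.

Lemma stab_comb u : stab (rcomb u).
Proof.
apply: stabD; apply: stab_sum => k.
  apply: stabM; last first.
    split; last exact: equi_xs.
      by apply: inv_mul; [exact: inv_K | apply: inv_exp; exact: inv_Bq2].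
    by apply: inv_mul; [exact: inv_K | apply: inv_exp; exact: inv_Bq2].
  apply: stab_eq (_ : stab (fun m => \sum_(mm <- msupp (u.1 k))
      BK (u.1 k)@_mm * BD1 ^+ mm ord0 * (Bq2 ^+ 3) ^+ mm (lift ord0 ord0))).
    by move=> m; rewrite mpoly_at2.
  apply: stab_sum => mm.
  have q3 : stab (fun => (Bq2 ^+ 3) ^+ mm (lift ord0 ord0)).
    split; try by do 2!apply: inv_exp; exact: inv_Bq2.
    apply: equiX.
    by apply: equi_eq (equiM equi_Y6 equi_U6) => m; rewrite /Bq2; ring.
  have d1 : stab (fun => BD1 ^+ mm ord0).
    split; try by apply: inv_exp; apply: inv_BD1.
    apply: equiX; apply: equi_eq (equiD (equiX 7 equi_Y6) equi_U6) => m.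
    by rewrite /BD1 -exprM.
  exact: stabM (stabM (stabK _) d1) q3.
apply: stab_vanish; last 2 first.
- by rewrite zw0 BK0 !mul0r mulr0.
- by rewrite zw1 BK0 !mul0r mulr0.
apply: equiM; last exact: equi_zs.
apply: equi_eq (_ : equi (fun m => \sum_(mm <- msupp (u.2 k))
      BK (u.2 k)@_mm * (BY ^+ 6) ^+ mm ord0 * (BU ^+ 6) ^+ mm (lift ord0 ord0))).
  by move=> m; rewrite mpoly_at2.
elim: (msupp _ : seq _) => [|mm l IHl].
  by apply: equi_eq equi0 => m; rewrite big_nil.
apply: equi_eq (equiD (equiM (equiM (equiK (u.2 k)@_mm) (equiX (mm ord0) equi_Y6))
  (equiX (mm (lift ord0 ord0)) equi_U6)) IHl) => m; rewrite big_cons //.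
Qed.

Lemma size_BD1_0 : (1 < size ((BD1 : BT)`_0)%R)%N.
Proof. by have := BD1_coef0 1; rewrite expr1 muln1 => ->; rewrite size_polyXn. Qed.

(** Its injectivity is the algebraic independence of [BD1] and [Bq2]; the latter is written as a
    multiple of [BY] to fit [ev2_inj]. *)
Definition Psi : {rmorphism BT -> BT} := ev2 BT7 BD1 (BY * (BY * BU ^+ 2)).

Lemma Psi_inj : injective Psi.
Proof. by apply: ev2_inj size_BD1_0 _; rewrite mulf_neq0 ?expf_neq0 ?BU_neq0 ?BY_neq0. Qed.

Lemma Psi_YU x n k : Psi (BK x * BY ^+ n * BU ^+ k) = BK x * Bq2 ^+ n * BD1 ^+ k.
Proof.
have PU : Psi BU = BD1 by rewrite [LHS]ev2C ev1X.
have PY : Psi BY = Bq2 by rewrite [LHS]ev2X /Bq2; ring.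
have PK : Psi (BK x) = BK x by exact: rmorph_of7.
by rewrite [LHS](rmorphM Psi) [Psi (_ * _)](rmorphM Psi) PK [Psi (BY ^+ n)](rmorphXn Psi) PY
  [Psi (BU ^+ k)](rmorphXn Psi) PU.
Qed.

Lemma rcomb_DA u m0 : (forall k, (zw m0)`_k = 0) -> rcomb u m0 = 0 ->
  \sum_(k < 6) \sum_(mm <- msupp (u.1 k)) BK ((xw m0)`_k * (u.1 k)@_mm) *
    BY ^+ (3 * mm (lift ord0 ord0) + nth 0%N xe k) * BU ^+ mm ord0 = 0.
Proof.
move=> z0 E0; apply: Psi_inj; rewrite [RHS](rmorph0 Psi) -[RHS]E0 /rcomb.
rewrite [X in _ = _ + X]big1 ?addr0 => [|k _]; last by rewrite z0 BK0 !mul0r mulr0.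
rewrite [LHS](rmorph_sum Psi); apply: eq_bigr => k _.
rewrite [LHS](rmorph_sum Psi) mpoly_at2 mulr_suml; apply: eq_bigr => mm _.
by rewrite [LHS]Psi_YU BKM exprD exprM; ring.
Qed.

(** At [A_0] the element [b] vanishes and [1, a, a^2] carry exponents of [Bq2] distinct modulo 3; at
    [A_1] the same then holds for [b, ab, a^2 b]. At [A_2] the six generators over [CA] are
    non-zero, with exponents of [v] distinct modulo 6. *)
Lemma comb_free u : comb u = 0 -> u = ([ffun => 0], [ffun => 0]).
Proof.
move=> u0; have E0 m : rcomb u m = 0.
  by apply: (rho_inj hval (rho_comb u)); rewrite u0; exact: rho0.
have h0 (k : 'I_6) : (k < 3)%N -> u.1 k = 0.
  move=> k3; apply/mpolyP => m; rewrite mcoeff0.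
  apply: (monomial_free (e := fun k mm => (3 * mm (lift ord0 ord0) + nth 0%N xe k, mm ord0)%N)
     (w := fun k => (xw (Some 0))`_k) (P := fun k => u.1 k) (k0 := k)) => [|k' m' w' _ [h1 h2]|].
  - exact: (rcomb_DA zw0 (E0 _)).
  - have k3' : (k' < 3)%N.
      move: w'; rewrite /xw /vB /= expr0n /= mulr0 !mulr0; case: k' h1 h2 => -[|[|[|[|[|[|//]]]]]] // ? _ _ /=;
      by rewrite eqxx.
    have kx (j : 'I_6) : (j < 3)%N -> nth 0%N xe j = j by case: j => -[|[|[|//]]].
    move: h1; rewrite !kx // => h1; split; first by apply: val_inj => /=; lia.
    apply: mnm2_eq => //; lia.
  - by rewrite /xw /vA /= expr0n /= addr0 expr1n; case: k k3 => -[|[|[|//]]].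
have h1 (k : 'I_6) : u.1 k = 0.
  have [/h0 //|k3] := ltnP k 3; apply/mpolyP => m; rewrite mcoeff0.
  apply: (monomial_free (e := fun k mm => (3 * mm (lift ord0 ord0) + nth 0%N xe k, mm ord0)%N)
     (w := fun k => (xw (Some 1))`_k) (P := fun k => u.1 k) (k0 := k)) => [|k' m' w' mP [h1 h2]|].
  - exact: (rcomb_DA zw1 (E0 _)).
  - have k3' : (3 <= k')%N by rewrite leqNgt; apply/negP => /h0 uk; rewrite uk msupp0 in mP.
    have kx (j : 'I_6) : (3 <= j)%N -> nth 0%N xe j = (j - 1)%N by case: j => -[|[|[|[|[|[|//]]]]]].
    move: h1; rewrite !kx // => h1; split; first by apply: val_inj => /=; have := ltn_ord k; have := ltn_ord k'; lia.
    apply: mnm2_eq => //; have := ltn_ord k; have := ltn_ord k'; lia.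
  - by rewrite /xw /vA /vB /= !expr1n; case: k k3 => -[|[|[|[|[|[|//]]]]]].
have zw2 : zw (Some 2) = [:: 6; 2; 3; 2; 3; 1] by apply/eqP.
have h2 (k : 'I_6) : u.2 k = 0.
  apply/mpolyP => m; rewrite mcoeff0.
  apply: (monomial_free (e := fun k mm => (6 * mm ord0 + nth 0%N zy k, 6 * mm (lift ord0 ord0) + nth 0%N zu k)%N)
     (w := fun k => (zw (Some 2))`_k) (P := fun k => u.2 k) (k0 := k)).
  - rewrite -[RHS](E0 (Some 2)) /rcomb [X in _ = X + _]big1 ?add0r => [|j _]; last first.
      by rewrite h1 /mpoly_at msupp0 big_nil mul0r.
    apply: eq_bigr => j _; rewrite mpoly_at2 mulr_suml; apply: eq_bigr => mm _ /=.
    by rewrite BKM (expD6 BY) (expD6 BU); ring.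
  - move=> j mm _ _ [h3 h4].
    have jk : j = k.
      have zl (i : 'I_6) : (nth 0%N zu i < 6)%N by case: i => -[|[|[|[|[|[|//]]]]]].
      have zz : nth 0%N zu j = nth 0%N zu k by have := zl j; have := zl k; lia.
      have lj : (j < size zu)%N := ltn_ord j; have lk : (k < size zu)%N := ltn_ord k.
      by apply: val_inj; apply/eqP; rewrite -(nth_uniq 0%N lj lk) ?zz.
    by split=> //; move: h3 h4; rewrite jk => h3 h4; apply: mnm2_eq; lia.
  - by rewrite zw2; case: k => -[|[|[|[|[|[|//]]]]]].
rewrite [u]surjective_pairing; congr (_, _); apply/ffunP => k; rewrite ffunE; [exact: h1 | exact: h2].
Qed.

Lemma combB u u' : comb u - comb u' = comb ([ffun k => u.1 k - u'.1 k], [ffun k => u.2 k - u'.2 k]).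
Proof.
rewrite /DA_CA_comb opprD addrACA -!sumrB; congr (_ + _); apply: eq_bigr => k _; rewrite /= ffunE -mulrBl;
  congr (_ * _); rewrite !(mpoly_atE (rcoh7 E)); exact/esym/mmapB.
Qed.

Lemma comb_inj : injective comb.
Proof.
move=> u u' uu; have := combB u u'; rewrite uu subrr => /esym/comb_free[/ffunP h1 /ffunP h2].
rewrite [u]surjective_pairing [u']surjective_pairing; congr (_, _); apply/ffunP => k; apply/eqP; rewrite -subr_eq0.
  by have := h1 k; rewrite !ffunE => ->.
by have := h2 k; rewrite !ffunE => ->.
Qed.

Definition S x := exists u, x = comb u.

Lemma S0 : S 0.
Proof.
exists ([ffun => 0], [ffun => 0]); rewrite /DA_CA_comb !big1 ?addr0 // => k _;
  by rewrite /= ffunE /mpoly_at msupp0 big_nil mul0r.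
Qed.

Lemma SB x y : S x -> S y -> S (x - y).
Proof. by move=> [u ->] [u' ->]; rewrite combB; eexists. Qed.

Lemma SD x y : S x -> S y -> S (x + y).
Proof. by move=> hx hy; rewrite -[y]opprK; apply: SB => //; rewrite -[- y]add0r; apply: SB => //; exact: S0. Qed.

Lemma S_sum I (l : seq I) (F : I -> rcoh E) : (forall i, S (F i)) -> S (\sum_(i <- l) F i).
Proof. by move=> h; elim/big_rec: _ => [|i x _ hx]; [exact: S0 | exact: SD]. Qed.

Lemma mpoly_at_monomial (h : 'I_2 -> rcoh E) (x : 'F_7) i j :
  mpoly_at h (x *: 'X_[[multinom tnth [tuple i; j] k | k < 2]]) =
  o x * (h ord0 ^+ i * h (lift ord0 ord0) ^+ j).
Proof.
rewrite (mpoly_atE (rcoh7 E)) mmapZ mmapX /mmap1 !big_ord_recl big_ord0 mulr1 !mnmE !(tnth_nth 0%N) /=.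
by [].
Qed.

Lemma mulr4A (R : pzRingType) (p q r s : R) : p * q * r * s = p * (q * r) * s.
Proof. by rewrite mulrA. Qed.

Lemma mpoly_at_monomial2 p q (x : 'F_7) i j :
  mpoly_at (tnth [tuple p; q]) (x *: 'X_[[multinom tnth [tuple i; j] k | k < 2]]) =
  o x * (p ^+ i * q ^+ j) :> rcoh E.
Proof. exact: (mpoly_at_monomial (tnth [tuple p; q])). Qed.

Lemma S_DA (k : 'I_6) x i j : S (o x * D1 ^+ i * D2 ^+ j * xs`_k).
Proof.
exists ([ffun k' => if k' == k then x *: 'X_[[multinom tnth [tuple i; j] k | k < 2]] else 0], [ffun => 0]).
rewrite /DA_CA_comb [X in _ = _ + X]big1 ?addr0 => [|k' _]; last first.
  by rewrite /= ffunE /mpoly_at msupp0 big_nil mul0r.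
rewrite (bigD1 k) //= big1 ?addr0 => [|k' ne]; last first.
  by rewrite ffunE (negPf ne) /mpoly_at msupp0 big_nil mul0r.
by rewrite ffunE (eqxx k) mpoly_at_monomial2; exact: mulr4A.
Qed.

Lemma S_CA (k : 'I_6) x i j : S (o x * C ^+ i * V ^+ j * zs`_k).
Proof.
exists ([ffun => 0], [ffun k' => if k' == k then x *: 'X_[[multinom tnth [tuple i; j] k | k < 2]] else 0]).
rewrite /DA_CA_comb [X in _ = X + _]big1 ?add0r => [|k' _]; last first.
  by rewrite /= ffunE /mpoly_at msupp0 big_nil mul0r.
rewrite (bigD1 k) //= big1 ?addr0 => [|k' ne]; last first.
  by rewrite ffunE (negPf ne) /mpoly_at msupp0 big_nil mul0r.
by rewrite ffunE (eqxx k) mpoly_at_monomial2; exact: mulr4A.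
Qed.

End Realization.

(** * Expansion of stable classes *)

Section StableElements.
Local Notation BT := {poly {poly 'F_7}}.
Variables (gT : finGroupType) (E : {group gT}) (e1 e2 c : gT).
Hypothesis hE : is_extraspecial_7 E e1 e2 c.
Variables y1 y2 C v : rcoh E.
Hypothesis hP : @is_HE_presentation gT E e1 e2 y1 y2 C v.
Variables al la : 'F_7.
Hypothesis hval : he_val hE y1 y2 C v al la.

Local Notation o := (of7 (rcoh7 E)).
Local Notation rho := (rho hE al la).
Local Notation V := (v ^+ 6).
Local Notation D1 := (C ^+ 7 + V).
Local Notation D2 := (C * V).
Local Notation a := ((y1 ^+ 2 + y2 ^+ 2) * v ^+ 2).
Local Notation b := (y1 ^+ 2 * y2 ^+ 2 * v ^+ 4).
Local Notation d := ((y1 * y2 ^+ 3 - y1 ^+ 3 * y2) * v).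
Local Notation C' := (C - (y1 ^+ 2 + y2 ^+ 2) ^+ 3).
Local Notation xs := [:: 1; a; a ^+ 2; b; a * b; a ^+ 2 * b].
Local Notation zs := [:: d; a * d; a ^+ 2 * d; C'; C' * a; C' * a ^+ 2].
Local Notation stab := (stab al la).
Local Notation S := (S y1 y2 C v).

Let al0 : al != 0. Proof. by case: hval. Qed.
Let la0 : la != 0. Proof. by case: hval. Qed.
Let rC := rho_C hval.
Let rv := rho_v hval.

Lemma rho_ex x : exists r, rho x r.
Proof.
have [P [Q ->]] := he_span hP x.
exists (fun m => mpoly_at (tnth [tuple BK (st m).1 * BY; BK (st m).2 * BY; BU]) P
  + BY ^+ 6 * mpoly_at (fun => BU) Q).
apply: rhoD; last by apply: (rhoM rC); apply: rho_mpoly => i; exact: rv.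
apply: (@rho_mpoly _ _ _ _ _ hE al la _ _
  (fun m => tnth [tuple BK (st m).1 * BY; BK (st m).2 * BY; BU])) => i.
case: i => -[|[|[|//]]] i3.
- exact: (rho_y1 hval).
- exact: (rho_y2 hval).
- exact: rv.
Qed.

Lemma S_stab x r : rho x r -> S x -> stab r.
Proof.
move=> hr [u xu]; apply: stab_eq (stab_comb hval u) => m.
by apply: (rho_inj hval _ hr); rewrite xu; exact: (rho_comb hval).
Qed.

Lemma equi_diag r (p q i : 'F_7) m m' : equi r -> p != 0 -> p ^+ 2 = q ^+ 2 -> i != 0 ->
  i * (st m').1 = p * (st m).1 -> i * (st m').2 = q * (st m).2 -> r m = lsub i 0 0 (p * q) (r m').
Proof.
move=> hr p0 pq i0 es et.
have [M00 M01 M10 M11] : [/\ (mx22 p 0 0 q) 0 0 = p, (mx22 p 0 0 q) 0 1 = 0, (mx22 p 0 0 q) 1 0 = 0 &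
    (mx22 p 0 0 q) 1 1 = q] by rewrite !mxE.
have h := hr (mx22 p 0 0 q) m m' i.
rewrite /monomial22 M00 M01 M10 M11 !mul0r ?subr0 ?sub0r ?addr0 ?add0r in h.
by apply: h => //; left.
Qed.

Lemma equi_anti r (p q i : 'F_7) m m' : equi r -> p != 0 -> p ^+ 2 = q ^+ 2 -> i != 0 ->
  i * (st m').1 = p * (st m).2 -> i * (st m').2 = q * (st m).1 -> r m = lsub i 0 0 (- (p * q)) (r m').
Proof.
move=> hr p0 pq i0 es et.
have [M00 M01 M10 M11] : [/\ (mx22 0 p q 0) 0 0 = 0, (mx22 0 p q 0) 0 1 = p, (mx22 0 p q 0) 1 0 = q &
    (mx22 0 p q 0) 1 1 = 0] by rewrite !mxE.
have h := hr (mx22 0 p q 0) m m' i.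
rewrite /monomial22 M00 M01 M10 M11 !mul0r ?subr0 ?sub0r ?addr0 ?add0r in h.
by apply: h => //; right.
Qed.

Section Equivariant.
Variable r : option 'F_7 -> BT.
Hypothesis hr : equi r.

Lemma equi_neg k : r (Some k) = lsub (-1) 0 0 (-1) (r (Some (- k))).
Proof.
rewrite (equi_diag (p := -1) (q := 1) (i := -1) (m' := Some (- k)) hr) ?mulr1 //= ?mulNr ?mul1r ?opprK //.
by rewrite sqrrN.
Qed.

Lemma equi_two : r (Some 2) = lsub 2 0 0 4 (r (Some 2)).
Proof.
by rewrite {1}(equi_diag (p := 2) (q := 2) (i := 2) (m' := Some 2) hr).
Qed.

(** The matrix with rows [(0, 1)] and [(-1, 0)] maps [(1, 2)] to [(2, -1) = 2 (1, 3)]. *)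
Lemma equi_23 : r (Some 2) = lsub 2 0 0 1 (r (Some 3)).
Proof.
rewrite (equi_anti (p := 1) (q := -1) (i := 2) (m' := Some 3) hr) //; by apply/eqP.
Qed.

Lemma equi_32 : r (Some 3) = lsub 3 0 0 1 (r (Some 2)).
Proof.
rewrite (equi_anti (p := 1) (q := -1) (i := 3) (m' := Some 2) hr) //; by apply/eqP.
Qed.

Lemma equi_inf : r None = lsub 1 0 0 1 (r (Some 0)).
Proof.
rewrite (equi_anti (p := 1) (q := -1) (i := 1) (m' := Some 0) hr) //; by apply/eqP.
Qed.

End Equivariant.

(** The consequences of [equi] on which the expansion rests. They involve only the three given
    generators of [W_G(E)], and so can be read off directly for a class restricted from [G]. *)
Definition equi5 (r : option 'F_7 -> BT) := [/\ forall k, r (Some k) = lsub (-1) 0 0 (-1) (r (Some (- k))),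
  r (Some 2) = lsub 2 0 0 4 (r (Some 2)), r (Some 2) = lsub 2 0 0 1 (r (Some 3)),
  r (Some 3) = lsub 3 0 0 1 (r (Some 2)) & r None = lsub 1 0 0 1 (r (Some 0))].

Lemma equi_equi5 r : equi r -> equi5 r.
Proof.
move=> h; split; [exact: equi_neg | exact: equi_two | exact: equi_23 | exact: equi_32 | exact: equi_inf].
Qed.

Lemma equi5B r r' : equi5 r -> equi5 r' -> equi5 (fun m => r m - r' m).
Proof.
move=> [h1 h2 h3 h4 h5] [g1 g2 g3 g4 g5]; split=> [k||||]; rewrite lsubB.
- by rewrite -h1 -g1.
- by rewrite -h2 -g2.
- by rewrite -h3 -g3.
- by rewrite -h4 -g4.
- by rewrite -h5 -g5.
Qed.

Section Equivariant5.
Variable r : option 'F_7 -> BT.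
Hypothesis hr : equi5 r.
Let equi_neg : forall k, r (Some k) = lsub (-1) 0 0 (-1) (r (Some (- k))). Proof. by case: hr. Qed.
Let equi_two : r (Some 2) = lsub 2 0 0 4 (r (Some 2)). Proof. by case: hr. Qed.
Let equi_23 : r (Some 2) = lsub 2 0 0 1 (r (Some 3)). Proof. by case: hr. Qed.
Let equi_32 : r (Some 3) = lsub 3 0 0 1 (r (Some 2)). Proof. by case: hr. Qed.
Let equi_inf : r None = lsub 1 0 0 1 (r (Some 0)). Proof. by case: hr. Qed.

Lemma equi_zero : r (Some 0) = 0 -> r (Some 1) = 0 -> r (Some 2) = 0 -> forall m, r m = 0.
Proof.
move=> r0 r1 r2; have L i l : lsub i 0 0 l 0 = 0 by exact: rmorph0.
have neg k : r (Some (- k)) = 0 -> r (Some k) = 0 by move=> rk; rewrite equi_neg rk L.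
have r3 : r (Some 3) = 0 by rewrite equi_32 r2 L.
case=> [k|]; last by rewrite equi_inf r0 L.
have [] : [\/ k = 0 \/ k = - 0, k = 1 \/ k = - (1), k = 2 \/ k = - (2) | k = 3 \/ k = - (3)].
  case: k => -[|[|[|[|[|[|[|//]]]]]]] k7.
  - by constructor 1; left; apply/eqP.
  - by constructor 2; left; apply/eqP.
  - by constructor 3; left; apply/eqP.
  - by constructor 4; left; apply/eqP.
  - by constructor 4; right; apply/eqP.
  - by constructor 3; right; apply/eqP.
  - by constructor 2; right; apply/eqP.
all: by case=> -> //; apply: neg; rewrite opprK.
Qed.

(** [diag(2, 2)] fixes the point of [A_2] and gives the congruence, as 2 has order 3. The quarter
    turn applied twice scales [y] by 2 * 3 = -1 and gives the parity. *)
Lemma equi_coef2 k j : (r (Some 2))`_k`_j != 0 -> ~~ odd k /\ ((k + 2 * j) %% 3)%N = 0%N.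
Proof.
move=> c0.
have h1 : (2 : 'F_7) ^+ k * 4 ^+ j = 1.
  by apply: (mulIf c0); rewrite mul1r -lsub_diag_coef -equi_two.
have h2 : (2 : 'F_7) ^+ k * 3 ^+ k = 1.
  apply: (mulIf c0); rewrite mul1r {2}equi_23 lsub_diag_coef equi_32 lsub_diag_coef !expr1n; ring.
split.
  move: h2; rewrite -exprMn (_ : 2 * 3 = -1 :> 'F_7); last by apply/eqP.
  by rewrite -signr_odd; case: (odd k).
move: h1; rewrite (_ : 4 = 2 ^+ 2 :> 'F_7); last by apply/eqP.
rewrite -exprM -exprD; set n := (k + 2 * j)%N.
have -> : (2 : 'F_7) ^+ n = 2 ^+ (n %% 3).
  rewrite {1}(divn_eq n 3) exprD mulnC exprM (_ : 2 ^+ 3 = 1 :> 'F_7); last by apply/eqP.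
  by rewrite expr1n mul1r.
have : (n %% 3 < 3)%N by rewrite ltn_pmod.
by case: (n %% 3)%N => [|[|[|//]]] // _ /eqP.
Qed.
End Equivariant5.

Definition stab5 (r : option 'F_7 -> BT) :=
  [/\ inv_det1 al la (r (Some 0)), inv_det1 al la (r (Some 1)) & equi5 r].

Lemma S_stab5 x r : rho x r -> S x -> stab5 r.
Proof. by move=> hr /(S_stab hr)[i0 i1 /equi_equi5 he]. Qed.

(** The values at [A_2] that can be removed without disturbing [A_0] and [A_1]. *)
Definition liftable z := exists s rs, [/\ S s, rho s rs, rs (Some 0) = 0, rs (Some 1) = 0 & rs (Some 2) = z].

Lemma liftable_sum I (l : seq I) (F : I -> BT) : (forall i, liftable (F i)) -> liftable (\sum_(i <- l) F i).
Proof.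
move=> h; elim: l => [|i l [s [rs [h1 h2 h3 h4 h5]]]].
  by rewrite big_nil; exists 0, (fun => 0); split=> //; [exact: S0 | exact: rho0].
have [s' [rs' [h1' h2' h3' h4' h5']]] := h i.
exists (s' + s), (fun m => rs' m + rs m); rewrite h3 h3' h4 h4' h5 h5' !addr0 big_cons.
by split=> //; [exact: SD | exact: rhoD].
Qed.

(** The residue of [j] modulo 6 selects one generator over [CA]; parity and the congruence modulo 3
    then fix [k] modulo 6. The excluded small [k] are those below the exponent of [y] in that
    generator. *)
Lemma liftable_monomial x k j : ~~ odd k -> ((k + 2 * j) %% 3)%N = 0%N -> k != 0%N -> k != 2 ->
  (k == 4 -> odd j) -> liftable (BK x * BY ^+ k * BU ^+ j).
Proof.
move=> ek kj k0 k2 k4.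
have [idx [n0 [n1 [kE jE]]]] : exists (idx : 'I_6) n0 n1,
    k = (6 * n0 + nth 0%N zy idx)%N /\ j = (6 * n1 + nth 0%N zu idx)%N.
  have j6 : (j %% 6 < 6)%N by rewrite ltn_pmod.
  have jd := divn_eq j 6; have kd := divn_eq k 6.
  have k6 : (k %% 6 < 6)%N by rewrite ltn_pmod.
  move: (j %/ 6)%N (k %/ 6)%N jd kd => n1 q; move: (j %% 6)%N (k %% 6)%N j6 k6.
  case=> [|[|[|[|[|[|//]]]]]] r6 _ r6' jd kd.
  - exists (inord 3), (q - 1)%N, n1; rewrite inordK //=; lia.
  - exists (inord 0), q, n1; rewrite inordK //=; lia.
  - exists (inord 4), (q - 1)%N, n1; rewrite inordK //=; lia.
  - exists (inord 1), (q - 1)%N, n1; rewrite inordK //=; lia.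
  - exists (inord 5), (q - 1)%N, n1; rewrite inordK //=; lia.
  - exists (inord 2), (q - 1)%N, n1; rewrite inordK //=; lia.
have zn : (zw (Some 2))`_idx != 0.
  rewrite (_ : zw (Some 2) = [:: 6; 2; 3; 2; 3; 1]); last by apply/eqP.
  by case: (idx) => -[|[|[|[|[|[|//]]]]]].
exists (o (x / (zw (Some 2))`_idx) * C ^+ n0 * V ^+ n1 * zs`_idx),
  (fun m => BK (x / (zw (Some 2))`_idx) * (BY ^+ 6) ^+ n0 * (BU ^+ 6) ^+ n1 *
    (BK (zw m)`_idx * BY ^+ nth 0%N zy idx * BU ^+ nth 0%N zu idx)).
split.
- exact: S_CA.
- apply: rhoM; last exact: (rho_zs hval).
  apply: rhoM; last by apply: rhoX; exact: (rho_V hval).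
  by apply: rhoM; [exact: rhoK | apply: rhoX; exact: rC].
- by rewrite zw0 BK0 !mul0r mulr0.
- by rewrite zw1 BK0 !mul0r mulr0.
- rewrite -[in RHS](divfK zn x) BKM kE jE (expD6 BY) (expD6 BU); ring.
Qed.

(** At [A_0] the element [a] takes the value [Bq2], so [1, a, a^2] over [DA] supply every power of
    it. *)
Lemma S_lift0 l : exists s rs, [/\ S s, rho s rs &
  rs (Some 0) = \sum_(w <- l) BK w.1 * BD1 ^+ w.2.1 * Bq2 ^+ w.2.2].
Proof.
exists (\sum_(w <- l) o w.1 * D1 ^+ w.2.1 * D2 ^+ (w.2.2 %/ 3) * xs`_(w.2.2 %% 3)),
  (fun m => \sum_(w <- l) BK w.1 * BD1 ^+ w.2.1 * (Bq2 ^+ 3) ^+ (w.2.2 %/ 3) *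
     (BK (xw m)`_(w.2.2 %% 3) * Bq2 ^+ nth 0%N xe (w.2.2 %% 3))).
have m6 (w : 'F_7 * (nat * nat)) : (w.2.2 %% 3 < 6)%N by apply: ltn_trans (_ : 3 < 6)%N; rewrite ?ltn_pmod.
split.
- by apply: S_sum => w; exact: (S_DA y1 y2 C v (Ordinal (m6 w))).
- apply: rho_sum => w; apply: rhoM; last exact: (rho_xs hval).
  apply: rhoM; last by apply: rhoX; exact: (rho_D2 hval).
  by apply: rhoM; [exact: rhoK | apply: rhoX; exact: (rho_D1 hval)].
- apply: eq_bigr => w _; rewrite -[LHS]mulrA -[RHS]mulrA; rewrite -!mulrA; do 2!congr (_ * _).
  have -> : Bq2 ^+ w.2.2 = (Bq2 ^+ 3) ^+ (w.2.2 %/ 3) * Bq2 ^+ (w.2.2 %% 3).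
    by rewrite -exprM -exprD mulnC -divn_eq.
  congr (_ * _).
  have : (w.2.2 %% 3 < 3)%N by rewrite ltn_pmod.
  have A1 : vA (Some 0) = 1 by apply/eqP.
  case: (w.2.2 %% 3)%N => [|[|[|//]]] _; rewrite /= ?A1 ?expr1n BK1 mul1r //.
Qed.

(** At [A_1] one has [s^2 + t^2 = 2], whence the division by a power of 2; the factor [Bq2^2] is the
    value of [b]. *)
Lemma S_lift1 l : exists s rs, [/\ S s, rho s rs, rs (Some 0) = 0 &
  rs (Some 1) = Bq2 ^+ 2 * \sum_(w <- l) BK w.1 * BD1 ^+ w.2.1 * Bq2 ^+ w.2.2].
Proof.
exists (\sum_(w <- l) o (w.1 / 2 ^+ (w.2.2 %% 3)) * D1 ^+ w.2.1 * D2 ^+ (w.2.2 %/ 3) * xs`_(3 + w.2.2 %% 3)),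
  (fun m => \sum_(w <- l) BK (w.1 / 2 ^+ (w.2.2 %% 3)) * BD1 ^+ w.2.1 * (Bq2 ^+ 3) ^+ (w.2.2 %/ 3) *
     (BK (xw m)`_(3 + w.2.2 %% 3) * Bq2 ^+ nth 0%N xe (3 + w.2.2 %% 3))).
have m3 (w : 'F_7 * (nat * nat)) : (w.2.2 %% 3 < 3)%N by rewrite ltn_pmod.
have m6 (w : 'F_7 * (nat * nat)) : (3 + w.2.2 %% 3 < 6)%N by rewrite (ltn_add2l 3 _ 3).
split.
- by apply: S_sum => w; exact: (S_DA y1 y2 C v (Ordinal (m6 w))).
- apply: rho_sum => w; apply: rhoM; last exact: (rho_xs hval).
  apply: rhoM; last by apply: rhoX; exact: (rho_D2 hval).
  by apply: rhoM; [exact: rhoK | apply: rhoX; exact: (rho_D1 hval)].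
- rewrite big1 // => w _.
  have B0 : vB (Some 0) = 0 by apply/eqP.
  suff -> : (xw (Some 0))`_(3 + w.2.2 %% 3) = 0 by rewrite BK0 mul0r mulr0.
  by case: (w.2.2 %% 3)%N (m3 w) => [|[|[|//]]] _; rewrite /= B0 ?mulr0.
- rewrite mulr_sumr; apply: eq_bigr => w _.
  have A2 : vA (Some 1) = 2 by apply/eqP.
  have B1 : vB (Some 1) = 1 by apply/eqP.
  have two0 : (2 ^+ (w.2.2 %% 3) : 'F_7) != 0 by rewrite expf_neq0.
  have -> : (xw (Some 1))`_(3 + w.2.2 %% 3) = 2 ^+ (w.2.2 %% 3).
    by case: (w.2.2 %% 3)%N (m3 w) => [|[|[|//]]] _; rewrite /= B1 ?A2 ?mulr1.
  have -> : nth 0%N xe (3 + w.2.2 %% 3) = (2 + w.2.2 %% 3)%N.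
    by case: (w.2.2 %% 3)%N (m3 w) => [|[|[|//]]].
  have -> : Bq2 ^+ w.2.2 = (Bq2 ^+ 3) ^+ (w.2.2 %/ 3) * Bq2 ^+ (w.2.2 %% 3).
    by rewrite -exprM -exprD mulnC -divn_eq.
  rewrite -[in RHS](divfK two0 w.1) BKM exprD; ring.
Qed.

(** The forms of degree 0, 2 and 4 vanish at 0, oo, 1 and -1, which excludes the monomials at [A_2]
    that no generator over [CA] reaches. *)
Lemma vanish01_S x r : rho x r -> equi5 r -> r (Some 0) = 0 -> r (Some 1) = 0 -> S x.
Proof.
move=> hr he r0 r1.
have rN : r None = 0 by case: (he) => _ _ _ _ ->; rewrite r0; exact: rmorph0.
have r6 : r (Some (- (1))) = 0 by have [he1 _ _ _ _] := he; rewrite he1 opprK r1; exact: rmorph0.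
have [s [rs [Ss hs s0 s1 s2]]] : liftable (r (Some 2)).
  rewrite [r (Some 2)]BT_expand; apply: liftable_sum => -[k kr] /=; apply: liftable_sum => -[j jr] /=.
  have [->|c0] := eqVneq (r (Some 2))`_k`_j 0.
    rewrite BK0 !mul0r; exists 0, (fun => 0); split=> //; [exact: S0 | exact: rho0].
  have [ek kj] := equi_coef2 he c0.
  have form n : (n < 6)%N -> isform n (fun m => (r m)`_n`_j) := fun n6 => rho_form hP hval j hr n6.
  apply: liftable_monomial => //.
  - apply: contraNneq c0 => k0; rewrite k0 (form0 (form 0%N isT) _ (Some 0)) r0 !coef0; exact: eqxx.
  - apply: contraNneq c0 => k2; rewrite k2.
    have [|| z hz] := form2 (form 2 isT); rewrite ?r0 ?rN ?coef0 //.
    by have := hz 1; rewrite r1 !coef0 mulr1 => z0; rewrite hz -z0 mul0r.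
  (* The quartic form is odd in [t], while [diag(-1, 1)] gives the sign [(-1)^j]; hence [j] is
     odd. *)
  - move=> /eqP k4; have := form4 (form 4 isT).
    rewrite r0 rN r1 r6 !coef0 => /(_ erefl erefl erefl erefl) E4.
    have [he1 _ _ _ _] := he; have := he1 2; move=> /(congr1 (fun z : BT => z`_4`_j)).
    rewrite lsub_diag_coef E4 -[in LHS](mul1r (r (Some 2))`_4`_j) mulrN -mulNr.
    rewrite k4 in c0 => /(mulIf c0) /eqP; rewrite (_ : (-1) ^+ 4 = 1 :> 'F_7) ?mul1r; last by apply/eqP.
    by rewrite -signr_odd; case: (odd j).
suff -> : x = s by [].
have hxs := rhoB hr hs; have h0 : forall m, r m - rs m = 0.
  apply: equi_zero; rewrite ?r0 ?r1 ?s0 ?s1 ?s2 ?subrr //.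
  by apply: equi5B => //; have [] := S_stab5 hs Ss.
apply: (rho_det hP hr); apply: rho_eq hs => m.
by apply/esym/eqP; rewrite -subr_eq0 h0.
Qed.

(** The available corrections take at [A_1] multiples of [Bq2^2], the value of [b]. Divisibility by
    this square comes from the forms of degree 0 and 2: the latter is odd in [t], whereas invariance
    together with [diag(-1, 1)] makes it even. *)
Lemma vanish0_S x r : rho x r -> stab5 r -> r (Some 0) = 0 -> S x.
Proof.
move=> hr hst r0; have [_ i1 he] := hst.
have rN : r None = 0 by case: (he) => _ _ _ _ ->; rewrite r0; exact: rmorph0.
have form n j : (n < 6)%N -> isform n (fun m => (r m)`_n`_j) := fun n6 => rho_form hP hval j hr n6.
have c0 : (r (Some 1))`_0 = 0.
  by apply/polyP => j; rewrite (form0 (form 0%N j isT) _ (Some 0)) r0 !coef0.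
have [g ig gE] := inv_div al0 la0 i1 c0.
have g0 : g`_0 = 0.
  apply/polyP => j.
  have -> : g`_0`_j = (r (Some 1))`_2`_j.+2.
    rewrite gE (_ : Bq2 * g = BY * (BY * (BU * (BU * g)))); last by rewrite /Bq2; ring.
    by rewrite !coefYM !coefUM.
  have [|| z hz] := form2 (form 2 j.+2 isT); rewrite ?r0 ?rN ?coef0 //.
  apply/eqP/negPn/negP => n0; have [_ /(congr1 odd)] := inv_coef al0 la0 i1 n0.
  rewrite !odd_mod //= negbK => /esym/negbT ej.
  have [he1 _ _ _ _] := he; have := he1 1; move=> /(congr1 (fun z : BT => z`_2`_j.+2)).
  rewrite lsub_diag_coef !hz -signr_odd -[in X in _ * X * _]signr_odd /= negbK (negbTE ej) !expr0 !mul1r.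
  move: n0; rewrite hz mulr1 => z0 E0; have : z *+ 2 = 0 by rewrite mulr2n {1}E0; ring.
  by rewrite -mulr_natr => /eqP; rewrite mulf_eq0 (negPf z0).
have [g' ig' gE'] := inv_div al0 la0 ig g0.
have [l lE] := inv_sum_exist al0 la0 ig'.
have [s [rs [Ss hs s0 s1]]] := S_lift1 l.
rewrite -[x](subrK s); apply: SD => //; apply: vanish01_S (rhoB hr hs) _ _ _.
- by apply: equi5B => //; have [] := S_stab5 hs Ss.
- by rewrite r0 s0 subrr.
- by rewrite s1 gE gE' lE mulrA -expr2 subrr.
Qed.

Lemma stab_S x r : rho x r -> stab5 r -> S x.
Proof.
move=> hr hst; have [i0 _ _] := hst; have [l lE] := inv_sum_exist al0 la0 i0.
have [s [rs [Ss hs s0]]] := S_lift0 l.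
rewrite -[x](subrK s); apply: SD => //; apply: vanish0_S (rhoB hr hs) _ _.
  have [j0 j1 he'] := S_stab5 hs Ss; have [_ i1 he] := hst.
  by split; [exact: inv_sub | exact: inv_sub | exact: equi5B].
by rewrite s0 lE subrr.
Qed.
End StableElements.

(** * The subgroups [A_m] of [E], and conjugation in [G] *)

Section ExtraspecialSubgroups.
Variables (gT : finGroupType) (E : {group gT}) (e1 e2 c : gT).
Hypothesis hE : is_extraspecial_7 E e1 e2 c.
Local Notation gen := (gen_A e1 e2).
Local Notation pi1 := (es_pi1 e1 e2 c).
Local Notation pi2 := (es_pi2 e1 e2 c).
Local Notation phi m := (phi2 (gen m) c).
Local Notation A m := (sub_A e1 e2 c m).

Let e1E : e1 \in E. Proof. by case: (es_mem hE). Qed.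
Let e2E : e2 \in E. Proof. by case: (es_mem hE). Qed.
Let cE : c \in E. Proof. by case: (es_mem hE). Qed.
Let genE m : gen m \in E. Proof. by case: (es_cp hE m). Qed.

Lemma phi10 m : phi m (1, 0) = gen m.
Proof. by rewrite /phi2 /= expg1 expg0 mulg1. Qed.

Lemma phi01 m : phi m (0, 1) = c.
Proof. by rewrite /phi2 /= expg1 expg0 mul1g. Qed.

Lemma phi_in_A m p : phi m p \in A m.
Proof. by rewrite /phi2 groupM // groupX // mem_gen // !inE eqxx ?orbT. Qed.

Lemma sub_AE m : A m = es_ker hE m.
Proof.
apply/eqP; rewrite eqEsubset; apply/andP; split.
  rewrite gen_subG subUset !sub1set -{1}(phi01 m) -{2}(phi10 m).
  by apply/andP; split; exact: es_phi_ker.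
by apply/subsetP => x /(es_phi_surj (hE := hE))[p ->]; exact: phi_in_A.
Qed.

Lemma mem_AP m x : x \in A m -> exists p, x = phi m p.
Proof. by rewrite sub_AE => /(es_phi_surj (hE := hE)). Qed.

Lemma A_sub m : A m \subset E.
Proof. by rewrite gen_subG subUset !sub1set cE genE. Qed.

Lemma mem_A m x : (x \in A m) = (x \in E) && (es_chi e1 e2 c m x == 0).
Proof. by rewrite sub_AE inE. Qed.

Lemma pi1_gen m : pi1 (gen m) = (st m).1.
Proof. by rewrite (es_genE e1 e2 c) (es_pi1E hE); case: m. Qed.

Lemma pi2_gen m : pi2 (gen m) = (st m).2.
Proof. by rewrite (es_genE e1 e2 c) (es_pi2E hE); case: m. Qed.

Lemma pi1_c : pi1 c = 0.
Proof. by have := es_pi1E hE 0 0 1; rewrite nf001. Qed.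

Lemma pi2_c : pi2 c = 0.
Proof. by have := es_pi2E hE 0 0 1; rewrite nf001. Qed.

Lemma pi1X x (i : 'F_7) : x \in E -> pi1 (x ^+ i)%g = pi1 x * i.
Proof.
move=> xE; rewrite -[RHS]F7_mulrn; elim: (nat_of_ord i) => [|n IHn].
  by rewrite expg0 -(nf000 e1 e2 c) (es_pi1E hE) mulr0n.
by rewrite expgS (es_pi1M hE) ?groupX // IHn mulrS.
Qed.

Lemma pi2X x (i : 'F_7) : x \in E -> pi2 (x ^+ i)%g = pi2 x * i.
Proof.
move=> xE; rewrite -[RHS]F7_mulrn; elim: (nat_of_ord i) => [|n IHn].
  by rewrite expg0 -(nf000 e1 e2 c) (es_pi2E hE) mulr0n.
by rewrite expgS (es_pi2M hE) ?groupX // IHn mulrS.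
Qed.

Lemma pi1_phi m p : pi1 (phi m p) = (st m).1 * p.1.
Proof. by rewrite (es_pi1M hE) ?groupX // !pi1X // pi1_c mul0r addr0 pi1_gen. Qed.

Lemma pi2_phi m p : pi2 (phi m p) = (st m).2 * p.1.
Proof. by rewrite (es_pi2M hE) ?groupX // !pi2X // pi2_c mul0r addr0 pi2_gen. Qed.

Lemma on_line m x i : x \in E -> pi1 x = i * (st m).1 -> pi2 x = i * (st m).2 ->
  exists k, x = phi m (i, k).
Proof.
move=> xE h1 h2; have : x \in A m.
  by rewrite mem_A xE /es_chi; case: m h1 h2 => [k|] /= -> h2; rewrite ?h2 ?mulr1 ?mulr0 // mulrC subrr.
move=> /mem_AP[[i' k] xp]; exists k; rewrite xp; congr (phi2 _ _ (_, _)).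
move: h1 h2; rewrite xp pi1_phi pi2_phi; case: m {xp} => [k'|] /=; first by rewrite mul1r mulr1.
by move=> _; rewrite mul1r mulr1.
Qed.

Lemma line_ex x : exists m i, pi1 x = i * (st m).1 /\ pi2 x = i * (st m).2.
Proof.
have [p0|p0] := eqVneq (pi1 x) 0; first by exists None, (pi2 x); rewrite /= p0 mulr0 mulr1.
by exists (Some (pi2 x / pi1 x)), (pi1 x); rewrite /= mulr1 mulrC divfK.
Qed.

Lemma es_commutator x y : x \in E -> y \in E ->
  [~ x, y]%g = (c ^+ (pi1 x * pi2 y - pi2 x * pi1 y)%R)%g.
Proof.
move=> xE yE; apply: (mulgI (y * x)%g); rewrite -commgC.
have [[[i j] k] ->] := es_nfP hE xE; have [[[i' j'] k'] ->] := es_nfP hE yE.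
rewrite /= !(es_pi1E hE) !(es_pi2E hE) !(nfM (es_heis hE)).
have -> : (c ^+ (i * j' - j * i')%R)%g = nf e1 e2 c 0 0 (i * j' - j * i').
  by rewrite /nf !expg0 !mul1g.
rewrite (nfM (es_heis hE)); congr nf; ring.
Qed.

Lemma c_order (x : 'F_7) : (c ^+ x)%g = 1%g -> x = 0.
Proof.
move=> cx; have : nf e1 e2 c 0 0 x = nf e1 e2 c 0 0 0 by rewrite /nf cx !expg0.
by move=> /(congr1 (es_co e1 e2 c)); rewrite !(es_coK hE) => -[].
Qed.

(** The commutator is [c] to the determinant of the images in [F_7^2], so commuting elements have
    proportional images. *)
Lemma commute_line x y : x \in E -> y \in E -> commute x y -> exists m, x \in A m /\ y \in A m.
Proof.
move=> xE yE xy.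
have d0 : pi1 x * pi2 y - pi2 x * pi1 y = 0.
  by apply: c_order; rewrite -es_commutator //; apply/eqP/commgP.
have [m [i [h1 h2]]] := line_ex x; have [m' [i' [h1' h2']]] := line_ex y.
have [i0|i0] := eqVneq i 0.
  have [k ->] := on_line yE h1' h2'; exists m'; rewrite phi_in_A.
  have [k' ->] : exists k', x = phi m' (0, k') by apply: on_line => //; rewrite ?h1 ?h2 i0 !mul0r.
  by split=> //; exact: phi_in_A.
have [k ->] := on_line xE h1 h2; exists m; split; first exact: phi_in_A.
rewrite mem_A yE /es_chi; move: d0; rewrite h1 h2; case: m {h1 h2} => [k'|] /=.
  rewrite mulr1 -mulrA -mulrBr => /eqP; rewrite mulf_eq0 (negPf i0) /= subr_eq0 => /eqP ->.
  by rewrite ?subrr.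
by rewrite mulr0 mul0r sub0r mulr1 => /eqP; rewrite oppr_eq0 mulf_eq0 (negPf i0).
Qed.

Lemma phi_inj m : injective (phi m).
Proof. exact: es_phi_inj hE m. Qed.

Lemma card_A m m' : #|A m| = #|A m'|.
Proof.
have card m'' : #|A m''| = #|[set: 'F_7 * 'F_7]|.
  rewrite -(card_imset _ (@phi_inj m'')); apply: eq_card => x; apply/idP/imsetP.
    by move=> /mem_AP[p ->]; exists p; rewrite ?inE.
  by case=> p _ ->; exact: phi_in_A.
by rewrite !card.
Qed.
End ExtraspecialSubgroups.

Section Restriction.
Variables (gT : finGroupType) (G E : {group gT}).
Hypothesis EG : E \subset G.

(** For a class restricted from [G], conjugation by [g] is an inner automorphism. *)
Lemma sig_conj (z : rcoh G) a b g (cp : cpair E a b) (cp' : cpair E (a ^ g)%g (b ^ g)%g) : g \in G ->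
  sig cp' (rres EG z) = sig cp (rres EG z).
Proof.
move=> gG.
have up a' b' : cpair E a' b' -> cpair G a' b'.
  by move=> [aE bE ab a7 b7]; split=> //; exact: (subsetP EG).
have res a' b' (q : cpair E a' b') : sig (up _ _ q) z = sig q (rres EG z).
  by apply: rpull_comp.
rewrite -!res; apply: (@rpull_inner _ _ G A0 _ _ (phi2M (up _ _ cp)) (phi2D (up _ _ cp))
  (phi2M (up _ _ cp')) (phi2D (up _ _ cp')) z g gG) => p _.
by rewrite /phi2 conjMg !conjXg.
Qed.
End Restriction.

Lemma GL2_ex (M : 'M['F_7]_2) : \det M != 0 -> exists g : {'GL_2['F_7]}, GLval g = M.
Proof.
move=> d0; have Mu : M \is a GRing.unit by rewrite -/(M \in unitmx) unitmxE unitfE.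
by exists (FinRing.unit 'M['F_7]_2 Mu).
Qed.

Section MonomialMatrices.
Let W : {set {'GL_2['F_7]}} := [set g : {'GL_2['F_7]} | `[< monomial22 (GLval g) >]].

Lemma mulmx22 (M N : 'M['F_7]_2) i j : (M *m N) i j = M i 0 * N 0 j + M i 1 * N 1 j.
Proof.
rewrite mxE !big_ord_recl big_ord0 addr0.
by rewrite (_ : lift ord0 ord0 = 1) //; apply: val_inj.
Qed.

Lemma monomial22M M N : monomial22 M -> monomial22 N -> monomial22 (M *m N).
Proof.
have nz (p q : 'F_7) : p != 0 -> p ^+ 2 = q ^+ 2 -> q != 0.
  by move=> p0 pq; apply: contra_neq p0 => q0; move: pq; rewrite q0 expr0n => /eqP; rewrite expf_eq0 => /eqP.
move=> [[a1 [a2 [a3 a4]]]|[a1 [a2 [a3 a4]]]] [[b1 [b2 [b3 b4]]]|[b1 [b2 [b3 b4]]]];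
  rewrite /monomial22 !mulmx22 a1 a2 b1 b2 ?mul0r ?mulr0 ?addr0 ?add0r ?mul0r ?mulr0 ?addr0.
- by left; split=> //; split=> //; split; [exact: mulf_neq0 | rewrite !exprMn a4 b4].
- by right; split=> //; split=> //; split; [exact: mulf_neq0 | rewrite !exprMn a4 b4].
- right; split=> //; split=> //; split; first by rewrite mulf_neq0 // (nz _ _ b3 b4).
  by rewrite !exprMn a4 b4.
- left; split=> //; split=> //; split; first by rewrite mulf_neq0 // (nz _ _ b3 b4).
  by rewrite !exprMn a4 b4.
Qed.

Fact monomial_group : group_set W.
Proof.
apply/group_setP; split.
  rewrite inE; apply/asboolP; left.
  have -> : GLval (1%g : {'GL_2['F_7]}) = 1%:M by [].
  by rewrite !mxE /=; split=> //; split=> //; split.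
move=> g h; rewrite !inE => /asboolP gW /asboolP hW; apply/asboolP.
have -> : GLval (g * h)%g = GLval g *m GLval h by [].
exact: monomial22M.
Qed.

Lemma generated_monomial (g : {'GL_2['F_7]}) :
  g \in <<[set g : {'GL_2['F_7]} | GLval g \in
             [:: mx22 (-1) 0 0 1; mx22 2 0 0 2; mx22 0 1 (-1) 0]%R]>>%g ->
  monomial22 (GLval g).
Proof.
suff sub : <<[set g : {'GL_2['F_7]} | GLval g \in
             [:: mx22 (-1) 0 0 1; mx22 2 0 0 2; mx22 0 1 (-1) 0]%R]>>%g \subset Group monomial_group.
  by move=> /(subsetP sub); rewrite inE => /asboolP.
rewrite gen_subG; apply/subsetP => h; rewrite !inE => /or3P[] /eqP ->; apply/asboolP.
- by left; rewrite !mxE /=; split=> //; split=> //; split=> //; rewrite sqrrN.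
- by left; rewrite !mxE /=.
- by right; rewrite !mxE /=; split=> //; split=> //; split=> //; rewrite sqrrN.
Qed.
End MonomialMatrices.

(** * Stability conditions for classes restricted from [G] *)

Section Local.
Variables (gT : finGroupType) (G E : {group gT}) (e1 e2 c : gT).
Hypothesis hloc : ONan_7local G E e1 e2 c.
Let hE : is_extraspecial_7 E e1 e2 c := on_E hloc.
Variables y1 y2 C v : rcoh E.
Hypothesis hP : @is_HE_presentation gT E e1 e2 y1 y2 C v.
Variables al la : 'F_7.
Hypothesis hval : he_val hE y1 y2 C v al la.

Local Notation Ph := (Phi al la).
Local Notation rho := (rho hE al la).
Local Notation gen := (gen_A e1 e2).
Local Notation pi1 := (es_pi1 e1 e2 c).
Local Notation pi2 := (es_pi2 e1 e2 c).
Local Notation phi m := (phi2 (gen m) c).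

Let EG : E \subset G := pHall_sub (on_sylow hloc).
Let al0 : al != 0. Proof. by case: hval. Qed.
Let la0 : la != 0. Proof. by case: hval. Qed.
Let e1E : e1 \in E. Proof. by case: (es_mem hE). Qed.
Let e2E : e2 \in E. Proof. by case: (es_mem hE). Qed.
Let cE : c \in E. Proof. by case: (es_mem hE). Qed.
Let genE m : gen m \in E. Proof. by case: (es_cp hE m). Qed.

Lemma cpair_conj a b g : cpair E a b -> (a ^ g)%g \in E -> (b ^ g)%g \in E -> cpair E (a ^ g)%g (b ^ g)%g.
Proof.
move=> [_ _ ab a7 b7] aE bE; split=> //; rewrite -?conjXg ?a7 ?b7 ?conj1g //.
by rewrite /commute -!conjMg ab.
Qed.

Lemma stable_value z r m m' g p q : rho (rres EG z) r -> g \in G ->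
  (gen m ^ g)%g = phi m' p -> (c ^ g)%g = phi m' q ->
  Ph (r m) = lsub p.1 p.2 q.1 q.2 (Ph (r m')).
Proof.
move=> hr gG hp hq.
have cp' : cpair E (gen m ^ g)%g (c ^ g)%g.
  by apply: cpair_conj (es_cp hE m) _ _; rewrite ?hp ?hq /phi2 groupM ?groupX.
apply: A0ev_inj; rewrite -(hr m) /es_sig -(sig_conj EG z (es_cp hE m) cp' gG).
exact: (sig_lin cp' hp hq (hr m')).
Qed.

Lemma norm_action n (M : 'M['F_7]_2) m m' i : n \in 'N(E)%g ->
  pi1 (e1 ^ n)%g = M 0 0 -> pi2 (e1 ^ n)%g = M 1 0 -> pi1 (e2 ^ n)%g = M 0 1 -> pi2 (e2 ^ n)%g = M 1 1 ->
  i * (st m').1 = M 0 0 * (st m).1 + M 0 1 * (st m).2 ->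
  i * (st m').2 = M 1 0 * (st m).1 + M 1 1 * (st m).2 ->
  exists k, (gen m ^ n)%g = phi m' (i, k) /\ (c ^ n)%g = phi m' (0, M 0 0 * M 1 1 - M 1 0 * M 0 1).
Proof.
move=> nE a1 a2 b1 b2 h1 h2.
have nm x : x \in E -> (x ^ n)%g \in E by move=> xE; rewrite memJ_norm.
have g1 : pi1 (gen m ^ n)%g = i * (st m').1.
  rewrite h1; case: (m) => [k|] /=; rewrite ?mulr1 ?mulr0 ?add0r ?b1 //.
  by rewrite conjMg conjXg (es_pi1M hE) ?groupX ?nm // (pi1X hE) ?nm // a1 b1.
have g2 : pi2 (gen m ^ n)%g = i * (st m').2.
  rewrite h2; case: (m) => [k|] /=; rewrite ?mulr1 ?mulr0 ?add0r ?b2 //.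
  by rewrite conjMg conjXg (es_pi2M hE) ?groupX ?nm // (pi2X hE) ?nm // a2 b2.
have [k kE] := on_line hE (nm _ (genE m)) g1 g2; exists k; split=> //.
rewrite -{1}(es_comm hE) conjRg (es_commutator hE) ?nm // a1 a2 b1 b2.
by rewrite /phi2 /= expg0 mul1g.
Qed.

Lemma W_E_pi n (M : 'M['F_7]_2) : n \in 'N(E)%g ->
  (e1 ^ n \in e1 ^+ (M 0 0)%R * e2 ^+ (M 1 0)%R *: <[c]>)%g ->
  (e2 ^ n \in e1 ^+ (M 0 1)%R * e2 ^+ (M 1 1)%R *: <[c]>)%g ->
  [/\ pi1 (e1 ^ n)%g = M 0 0, pi2 (e1 ^ n)%g = M 1 0, pi1 (e2 ^ n)%g = M 0 1 & pi2 (e2 ^ n)%g = M 1 1].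
Proof.
move=> nE.
have pow k : exists x : 'F_7, (c ^+ k)%g = (c ^+ x)%g.
  exists (k%:R); rewrite val_Fp_nat // [in LHS](divn_eq k 7) expgD mulnC expgM (es_c hE) expg1n mul1g.
  by [].
have cos (a b : 'F_7) x : x \in (e1 ^+ a * e2 ^+ b *: <[c]>)%g -> pi1 x = a /\ pi2 x = b.
  move=> /lcosetP[_ /cycleP[k ->] ->]; have [x' ->] := pow k.
  by rewrite -[(_ * _)%g]/(nf e1 e2 c a b x') (es_pi1E hE) (es_pi2E hE).
by move=> /cos[-> ->] /cos[-> ->].
Qed.

Lemma W_E_intro n (M : 'M['F_7]_2) : n \in 'N_G(E)%g ->
  pi1 (e1 ^ n)%g = M 0 0 -> pi2 (e1 ^ n)%g = M 1 0 -> pi1 (e2 ^ n)%g = M 0 1 -> pi2 (e2 ^ n)%g = M 1 1 ->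
  W_E G E e1 e2 c M.
Proof.
move=> nN a1 a2 b1 b2; exists n => //; have /setIP[_ nE] := nN.
have cos x : x \in E -> x \in (e1 ^+ (pi1 x) * e2 ^+ (pi2 x) *: <[c]>)%g.
  move=> xE; rewrite -{1}(es_nfK hE xE); apply/lcosetP; exists (c ^+ (es_co e1 e2 c x).2)%g => //.
  exact: mem_cycle.
by rewrite -a1 -a2 -b1 -b2; split; apply: cos; rewrite memJ_norm.
Qed.

(** The matrix of [n] belongs to [W_G(E)], hence is monomial, and equivariance applies; the power of
    [c] in the image of [gen m] is absorbed by [lsub_Phi]. *)
Lemma normal_stable x r n m (cp' : cpair E (gen m ^ n)%g (c ^ n)%g) : rho x r -> equi r ->
  n \in 'N_G(E)%g -> sig cp' x = A0ev (Ph (r m)).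
Proof.
move=> hr he nN; have /setIP[nG nE] := nN.
pose M : 'M['F_7]_2 := mx22 (pi1 (e1 ^ n)%g) (pi1 (e2 ^ n)%g) (pi2 (e1 ^ n)%g) (pi2 (e2 ^ n)%g).
have [M00 M01 M10 M11] : [/\ pi1 (e1 ^ n)%g = M 0 0, pi1 (e2 ^ n)%g = M 0 1,
  pi2 (e1 ^ n)%g = M 1 0 & pi2 (e2 ^ n)%g = M 1 1] by rewrite !mxE.
have [m' [i [l1 l2]]] := line_ex e1 e2 c (gen m ^ n)%g.
have nm x' : x' \in E -> (x' ^ n)%g \in E by move=> xE; rewrite memJ_norm.
have h1 : i * (st m').1 = M 0 0 * (st m).1 + M 0 1 * (st m).2.
  rewrite -l1; case: (m) => [k|] /=; rewrite ?mulr1 ?mulr0 ?add0r -?M01 //.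
  by rewrite conjMg conjXg (es_pi1M hE) ?groupX ?nm // (pi1X hE) ?nm // M00 M01.
have h2 : i * (st m').2 = M 1 0 * (st m).1 + M 1 1 * (st m).2.
  rewrite -l2; case: (m) => [k|] /=; rewrite ?mulr1 ?mulr0 ?add0r -?M11 //.
  by rewrite conjMg conjXg (es_pi2M hE) ?groupX ?nm // (pi2X hE) ?nm // M10 M11.
have [k [gk ck]] := norm_action nE M00 M10 M01 M11 h1 h2.
have d0 : M 0 0 * M 1 1 - M 1 0 * M 0 1 != 0.
  apply/eqP => d0; move: ck; rewrite d0 /phi2 /= !expg0 mulg1 => cn1.
  have c1 : c = 1%g by rewrite -[c](conjgK n) cn1 conj1g.
  have := @c_order _ _ _ _ _ hE 1; rewrite c1 expg1n => /(_ erefl) /eqP.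
  by [].
have [g gM] : exists g : {'GL_2['F_7]}, GLval g = M.
  by apply: GL2_ex; rewrite det_mx22 [M 0 1 * _]mulrC.
have mono : monomial22 M.
  rewrite -gM; apply: generated_monomial; apply/(on_WE hloc); rewrite gM.
  exact: W_E_intro nN M00 M10 M01 M11.
have i0 : i != 0.
  apply/eqP => i0; move: h1 h2; rewrite i0 !mul0r => h1 h2.
  have s0 : (M 0 0 * M 1 1 - M 1 0 * M 0 1) * (st m).1 = 0.
    rewrite [LHS](_ : _ = M 1 1 * (M 0 0 * (st m).1 + M 0 1 * (st m).2) - M 0 1 * (M 1 0 * (st m).1 + M 1 1 * (st m).2)).
      by rewrite -h1 -h2 !mulr0 subrr.
    ring.
  have t0 : (M 0 0 * M 1 1 - M 1 0 * M 0 1) * (st m).2 = 0.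
    rewrite [LHS](_ : _ = M 0 0 * (M 1 0 * (st m).1 + M 1 1 * (st m).2) - M 1 0 * (M 0 0 * (st m).1 + M 0 1 * (st m).2)).
      by rewrite -h1 -h2 !mulr0 subrr.
    ring.
  move/eqP: s0; move/eqP: t0; rewrite !mulf_eq0 (negPf d0) /=.
  by case: (m) => [k'|] /=; rewrite oner_eq0.
rewrite (he M m m' i mono i0 h1 h2) -(lsub_Phi al la k _ _ i0) [M 0 1 * M 1 0]mulrC.
exact: (sig_lin cp' gk ck (hr m')).
Qed.

Lemma image_stab5 z r : rho (rres EG z) r -> stab5 al la r.
Proof.
move=> hr.
have rad m : m \in [:: Some 0; None; Some 1; Some 6] -> inv_det1 al la (r m).
  move=> mr i k j l d1.
  (* [W_A] refers to the basis [(c, gen m)] and [lsub] to [(gen m, c)], so the entries appear in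
     reverse order. *)
  have [|x xN] := (on_radical hloc mr (mx22 l k j i)).2 _.
    rewrite det_mx22E (_ : l * i - k * j = i * l - j * k); last ring.
    have : (i * l - j * k) ^+ 2 == 1 ^+ 2 by rewrite d1 expr1n.
    by rewrite eqf_sqr => /orP[] /eqP->; [left | right].
  rewrite !mxE /= => -[cx gx]; have /setIP[xG _] := xN.
  have cc : commute (gen m) c by case: (es_cp hE m).
  apply/esym; apply: (stable_value (p := (i, k)) (q := (j, l)) hr xG); rewrite /phi2 /=.
    by rewrite gx; apply: commuteX2; apply: commute_sym.
  by rewrite cx; apply: commuteX2; apply: commute_sym.
have gens (p q s t : 'F_7) m m' i x : mx22 p q s t \in [:: mx22 (-1) 0 0 1; mx22 2 0 0 2; mx22 0 1 (-1) 0] ->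
    p * t - q * s != 0 -> i != 0 ->
    i * (st m').1 = p * (st m).1 + q * (st m).2 ->
    i * (st m').2 = s * (st m).1 + t * (st m).2 -> p * t - s * q = x ->
    r m = lsub i 0 0 x (r m').
  pose M := mx22 p q s t; move=> Mg dM i0 h1 h2 <-.
  have [M00 M01 M10 M11] : [/\ M 0 0 = p, M 0 1 = q, M 1 0 = s & M 1 1 = t] by rewrite !mxE.
  have [g gM] : exists g : {'GL_2['F_7]}, GLval g = M by apply: GL2_ex; rewrite det_mx22E.
  have : W_E G E e1 e2 c (GLval g) by apply/(on_WE hloc); rewrite mem_gen // inE gM.
  rewrite gM => -[n nN [w1 w2]]; have /setIP[nG nE] := nN.
  have [a1 a2 b1 b2] := W_E_pi nE w1 w2.
  have := norm_action (M := M) (m := m) (m' := m') (i := i) nE a1 a2 b1 b2.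
  rewrite M00 M01 M10 M11 => /(_ h1 h2)[k [gk ck]].
  apply: (Phi_inj al0 la0); rewrite -(lsub_Phi al la k) //.
  exact: (stable_value hr nG gk ck).
split; [exact: rad | exact: rad |]; split=> [k||||].
- apply: (gens (-1) 0 0 1) => //.
  + by rewrite !inE eqxx.
  + by rewrite /st mul0r addr0.
  + by rewrite /st mulrN mulNr opprK mul0r add0r.
  + by apply/eqP.
- by apply: (gens 2 0 0 2); rewrite ?inE ?eqxx ?orbT //; apply/eqP.
- by apply: (gens 0 1 (-1) 0); rewrite ?inE ?eqxx ?orbT //; apply/eqP.
- by apply: (gens 0 1 (-1) 0); rewrite ?inE ?eqxx ?orbT //; apply/eqP.
- by apply: (gens 0 1 (-1) 0); rewrite ?inE ?eqxx ?orbT //; apply/eqP.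
Qed.
End Local.

(** * Normalisers of the [A_m] *)

Section Fusion.
Variables (gT : finGroupType) (G E : {group gT}) (e1 e2 c : gT).
Hypothesis hloc : ONan_7local G E e1 e2 c.
Let hE : is_extraspecial_7 E e1 e2 c := on_E hloc.
Local Notation gen := (gen_A e1 e2).
Local Notation pi1 := (es_pi1 e1 e2 c).
Local Notation pi2 := (es_pi2 e1 e2 c).
Local Notation phi m := (phi2 (gen m) c).
Local Notation A m := (sub_A e1 e2 c m).

Let EG : E \subset G := pHall_sub (on_sylow hloc).
Let e1E : e1 \in E. Proof. by case: (es_mem hE). Qed.
Let e2E : e2 \in E. Proof. by case: (es_mem hE). Qed.
Let cE : c \in E. Proof. by case: (es_mem hE). Qed.
Let genE m : gen m \in E. Proof. by case: (es_cp hE m). Qed.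
Let genc m : commute (gen m) c. Proof. by case: (es_cp hE m). Qed.
Let cAm m : c \in A m. Proof. by have := phi_in_A e1 e2 c m (0, 1); rewrite (phi01 e1 e2 c). Qed.
Let genAm m : gen m \in A m. Proof. by rewrite -(phi10 e1 e2 c m) phi_in_A. Qed.

(** Coordinates are row vectors, and [p'], [q'] are the rows of the acting matrix. *)
Definition row_mul (p p' q' : 'F_7 * 'F_7) : 'F_7 * 'F_7 :=
  (p.1 * p'.1 + p.2 * q'.1, p.1 * p'.2 + p.2 * q'.2).

Lemma row_mulE i j i1 j1 i2 j2 :
  row_mul (i, j) (i1, j1) (i2, j2) = (i * i1 + j * i2, i * j1 + j * j2).
Proof. by []. Qed.

Lemma phi2E m i j : phi m (i, j) = (gen m ^+ i * c ^+ j)%g.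
Proof. by []. Qed.

Lemma phiJ m p p' q' g : (gen m ^ g)%g = phi m p' -> (c ^ g)%g = phi m q' ->
  (phi m p ^ g)%g = phi m (row_mul p p' q').
Proof.
move: p p' q' => [i j] [i1 j1] [i2 j2] hp hq.
have g7 := es_exp7 hE (genE m); have c7 := es_exp7 hE cE.
have X (u w k : 'F_7) : ((gen m ^+ u * c ^+ w) ^+ k = gen m ^+ (k * u)%R * c ^+ (k * w)%R)%g.
  rewrite expgMn; last exact: commuteX2.
  by rewrite ![(k * _)%R]mulrC !expg_F7M.
rewrite row_mulE {1}phi2E conjMg !conjXg hp hq !phi2E !X !(expg_F7D _ _ g7) !(expg_F7D _ _ c7).
rewrite -!mulgA; congr (_ * _)%g; rewrite !mulgA; congr (_ * _)%g.
by apply: commuteX2; apply: commute_sym.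
Qed.

Lemma A_eq m m' g : (gen m ^ g)%g \in A m' -> (c ^ g)%g \in A m' -> (A m :^ g)%g = A m'.
Proof.
move=> gA cA; apply/eqP; rewrite eqEcard cardJg (card_A hE m m') leqnn andbT.
by rewrite -genJ gen_subG conjUg !conjg_set1 subUset !sub1set cA gA.
Qed.

Lemma norm_A_phi m g : (A m :^ g)%g = A m ->
  exists p q, (gen m ^ g)%g = phi m p /\ (c ^ g)%g = phi m q.
Proof.
move=> Ag; have mem x : x \in A m -> (x ^ g)%g \in A m by move=> xA; rewrite -Ag memJ_conjg.
have [p pE] := mem_AP hE (mem _ (genAm m)); have [q qE] := mem_AP hE (mem _ (cAm m)).
by exists p, q.
Qed.

Definition acts_by m (p q : 'F_7 * 'F_7) :=
  exists2 x, x \in 'N_G(A m)%g & (gen m ^ x)%g = phi m p /\ (c ^ x)%g = phi m q.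

Lemma acts_byM m p q p' q' : acts_by m p q -> acts_by m p' q' ->
  acts_by m (row_mul p p' q') (row_mul q p' q').
Proof.
move=> [x xN [xp xq]] [y yN [yp yq]]; exists (x * y)%g; first exact: groupM.
by rewrite !conjgM xp xq !(phiJ _ yp yq).
Qed.

Lemma acts_byV m p q : acts_by m p q -> exists p' q', [/\ acts_by m p' q',
  row_mul p p' q' = (1, 0) & row_mul q p' q' = (0, 1)].
Proof.
move=> [x xN [xp xq]]; have xV : (x^-1)%g \in 'N_G(A m)%g by rewrite groupV.
have /setIP[_ /normP Ax] := xV; have [p' [q' [hp hq]]] := norm_A_phi Ax.
exists p', q'; split; first by exists (x^-1)%g.
  apply: (@phi_inj _ _ _ _ _ hE m); rewrite (phi10 e1 e2 c m).
  by rewrite -[LHS](phiJ p hp hq) -xp conjgK.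
apply: (@phi_inj _ _ _ _ _ hE m); rewrite (phi01 e1 e2 c m).
by rewrite -[LHS](phiJ q hp hq) -xq conjgK.
Qed.

Lemma E_norm_A m : E \subset 'N(A m)%g.
Proof.
apply/subsetP => e eE; apply/normP; apply: A_eq.
  have -> : (gen m ^ e = gen m * c ^+ (pi1 (gen m) * pi2 e - pi2 (gen m) * pi1 e)%R)%g.
    by rewrite -(es_commutator hE) // conjg_mulR.
  set x := (_ - _); have := phi_in_A e1 e2 c m (1, x).
  by rewrite phi2E expg1.
by rewrite conjgE (centP (es_central hE) _ eE) mulKg.
Qed.

(** The commutator with [gen m] is a non-zero linear form on [E] modulo its centre, so every power
    of [c] occurs. *)
Lemma shear_in_E m x : exists2 y, y \in E & (gen m ^ y)%g = (gen m * c ^+ (x : 'F_7))%g.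
Proof.
have [y [yE yx]] : exists y, y \in E /\ pi1 (gen m) * pi2 y - pi2 (gen m) * pi1 y = x.
  rewrite (pi1_gen hE) (pi2_gen hE); case: m => [k|]; rewrite /st.
    exists (e2 ^+ x)%g; rewrite groupX // (pi1X hE) // (pi2X hE) //.
    have -> : pi1 e2 = 0 by have := es_pi1E hE 0 1 0; rewrite nf010.
    have -> : pi2 e2 = 1 by have := es_pi2E hE 0 1 0; rewrite nf010.
    by split=> //; rewrite mul1r mul0r mulr0 subr0; exact: mul1r.
  exists (e1 ^+ (- x)%R)%g; rewrite groupX // (pi1X hE) // (pi2X hE) //.
  have -> : pi1 e1 = 1 by have := es_pi1E hE 1 0 0; rewrite nf100.
  have -> : pi2 e1 = 0 by have := es_pi2E hE 1 0 0; rewrite nf100.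
  by split=> //; rewrite mul0r sub0r mul1r mulrN opprK; exact: mul1r.
by exists y => //; rewrite conjg_mulR (es_commutator hE) // yx.
Qed.

Lemma acts_by_shear m x : acts_by m (1, x) (0, 1).
Proof.
have [y yE gy] := shear_in_E m x.
exists y; first by rewrite inE (subsetP EG) // (subsetP (E_norm_A m)).
split; last by rewrite conjgE (centP (es_central hE) _ yE) mulKg (phi01 e1 e2 c m).
by rewrite gy phi2E expg1.
Qed.

(* The shears fixing [c], together with their conjugates by an element moving
   [<c>], are all elementary matrices and hence generate [SL_2]. *)
Lemma acts_by_SL2 m u0 w0 j k : acts_by m (u0, w0) (j, k) -> j != 0 ->
  forall i i' l l', i * l' - i' * l = 1 -> acts_by m (i, i') (l, l').
Proof.
move=> h j0; pose x0 := - k / j; pose w := u0 * x0 + w0.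
(* The shear by [x0 = -k/j] makes the image of [c] a power of [gen m]. *)
have h1 : acts_by m (u0, w) (j, 0).
  have := acts_byM h (acts_by_shear m x0); rewrite !row_mulE !mulr1 !mulr0 !addr0.
  by rewrite [j * x0]mulrC divfK // addNr.
have [[p1 p2] [[q1 q2] [hV]]] := acts_byV h1; rewrite !row_mulE !mul0r !addr0 => E1 E2.
have a1 : u0 * p1 + w * q1 = 1 := congr1 fst E1.
have a2 : u0 * p2 + w * q2 = 0 := congr1 snd E1.
have b1 : j * p1 = 0 := congr1 fst E2.
have b2 : j * p2 = 1 := congr1 snd E2.
have p10 : p1 = 0 by move/eqP: b1; rewrite mulf_eq0 (negPf j0) => /eqP.
have ww : w * q1 = 1 by rewrite -[RHS]a1 p10 mulr0 add0r.
have q10 : q1 != 0 by apply/eqP => q10; move/eqP: ww; rewrite q10 mulr0 eq_sym oner_eq0.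
(* Conjugating a shear by the element of [h1] gives the opposite shear. *)
have low y : acts_by m (1, 0) (y, 1).
  have jq : q1 * j != 0 by rewrite mulf_neq0.
  have := acts_byM (acts_byM hV (acts_by_shear m (y / (q1 * j)))) h1.
  rewrite !row_mulE !mulr1 !mulr0 !addr0 p10 !mul0r !add0r => H.
  have a2' : q2 * j = - (u0 * q1).
    have := congr1 (fun z => z * (q1 * j)) a2; rewrite mul0r mulrDl.
    have -> : u0 * p2 * (q1 * j) = u0 * q1 * (j * p2) by ring.
    have -> : w * q2 * (q1 * j) = (w * q1) * (q2 * j) by ring.
    by rewrite b2 ww mulr1 mul1r addrC => /eqP; rewrite addr_eq0 => /eqP.
  have e2V : q1 * u0 + (q1 * (y / (q1 * j)) + q2) * j = y.
    rewrite mulrDl a2' (_ : q1 * (y / (q1 * j)) * j = y / (q1 * j) * (q1 * j)); last ring.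
    rewrite divfK //; ring.
  by move: H; rewrite e2V [q1 * w]mulrC ww [p2 * j]mulrC b2.
(* Factorisation into upper, lower and upper elementary matrices, possible when [l] is non-zero. *)
have big i i' l l' : l != 0 -> i * l' - i' * l = 1 -> acts_by m (i, i') (l, l').
  move=> l0 d1; pose al := (i - 1) / l; pose be := (l' - 1) / l.
  have := acts_byM (acts_byM (acts_by_shear m al) (low l)) (acts_by_shear m be).
  have alq : al * l = i - 1 by rewrite /al divfK.
  have beq : l * be = l' - 1 by rewrite /be mulrC divfK.
  rewrite !row_mulE !mulr1 !mulr0 ?mul0r ?mul1r ?addr0 ?add0r ?alq ?beq.
  have -> : 1 + (i - 1) = i by ring.
  have -> : l' - 1 + 1 = l' by ring.
  have -> : i * be + al = i'; last by [].
  apply: (mulfI l0); rewrite mulrDr (_ : l * (i * be) = i * (l * be)); last ring.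
  rewrite beq [l * al]mulrC alq -[RHS]addr0 -(subrr 1) -{2}d1; ring.
move=> i i' l l' d1; have [l0|] := eqVneq l 0; last by move=> l0; exact: big.
have i0 : i != 0.
  by apply/eqP => i0; move/eqP: d1; rewrite i0 l0 mul0r mulr0 subr0 eq_sym oner_eq0.
(* For [l = 0] the first row is added to the second, and this is undone afterwards. *)
have H : acts_by m (i, i') (i + l, i' + l').
  by apply: big; [rewrite l0 addr0 | rewrite -[RHS]d1; ring].
by have := acts_byM (low (-1)) H; rewrite !row_mulE !mul1r !mul0r !addr0 !mulN1r !addKr.
Qed.

(** An element moving [<c>] would, together with the shears from [E], generate all of [SL_2]. *)
Lemma nonradical_c m h : m \in [:: Some 2; Some 3; Some 4; Some 5] -> h \in G -> (A m :^ h)%g = A m ->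
  exists l, (c ^ h)%g = (c ^+ (l : 'F_7))%g.
Proof.
move=> mr hG Ah; have [[u w] [[j k] [hp hq]]] := norm_A_phi Ah; exists k; rewrite hq.
have [j0|j0] := eqVneq j 0; first by rewrite phi2E j0 expg0 mul1g.
have hN : h \in 'N_G(A m)%g by rewrite inE hG; apply/normP.
case: (on_nonradical hloc mr) => M d1.
have ah : acts_by m (u, w) (j, k) by exists h.
have d1' : M 1 1 * M 0 0 - M 0 1 * M 1 0 = 1 by rewrite -[RHS]d1 det_mx22; ring.
have [x xN [xp xq]] := acts_by_SL2 ah j0 d1'.
exists x => //; split.
  by rewrite xq phi2E; apply: commuteX2.
by rewrite xp phi2E; apply: commuteX2.
Qed.

(* Frattini argument: [E] is a Sylow subgroup of [E C_G(A)], which contains [E^h]. *)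
Lemma nonradical_frattini m h : m \in [:: Some 2; Some 3; Some 4; Some 5] -> h \in G ->
  (A m :^ h)%g = A m ->
  exists2 n, n \in 'N_G(E)%g & (gen m ^ h)%g = (gen m ^ n)%g /\ (c ^ h)%g = (c ^ n)%g.
Proof.
move=> mr hG Ah; have [l cl] := nonradical_c mr hG Ah.
have AhV : (A m :^ h^-1)%g = A m by rewrite -{1}Ah conjsgK.
have [l' cl'] := nonradical_c mr (groupVr hG) AhV.
pose K := (E <*> 'C_G(A m))%G.
have AG : A m \subset G := subset_trans (A_sub hE m) EG.
have EN : E \subset 'N('C_G(A m))%g.
  by rewrite normsI ?norms_cent ?E_norm_A ?(subset_trans EG (normG G)).
have cent z : z \in G -> (gen m ^ z)%g = gen m -> (c ^ z)%g = c -> z \in 'C_G(A m)%g.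
  move=> zG gz cz; rewrite inE zG /= cent_gen; apply/centP => y; rewrite !inE => /orP[] /eqP->.
    by apply/commute_sym/commgP/conjg_fixP.
  by apply/commute_sym/commgP/conjg_fixP.
(* As [h] preserves [<c>], conjugates of elements of [E] by [h] still act on [A m] as shears; these
   are induced by [E], up to the centraliser. *)
have EhK : (E :^ h \subset K)%g.
  apply/subsetP => _ /imsetP[e eE ->].
  have [p [q [gV _]]] := norm_A_phi AhV.
  have [k ek] : exists k : 'F_7, (gen m ^ (e ^ h))%g = (gen m * c ^+ k)%g.
    exists (l * (pi1 (phi m p) * pi2 e - pi2 (phi m p) * pi1 e)).
    have -> : (gen m ^ (e ^ h) = ((gen m ^ h^-1) ^ e) ^ h)%g by rewrite -!conjgM [(e ^ h)%g]conjgE mulgA.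
    have phE : phi m p \in E := subsetP (A_sub hE m) _ (phi_in_A e1 e2 c m p).
    rewrite gV [(phi m p ^ e)%g]conjg_mulR (es_commutator hE phE eE).
    rewrite conjMg -gV conjgKV conjXg cl; congr (_ * _)%g.
    by rewrite expg_F7M // (es_exp7 hE).
  have ec : (c ^ (e ^ h))%g = c.
    have -> : (c ^ (e ^ h) = ((c ^ h^-1) ^ e) ^ h)%g by rewrite -!conjgM [(e ^ h)%g]conjgE mulgA.
    have ce : commute (c ^ h^-1)%g e.
      by rewrite cl'; apply: commute_sym; apply: commuteX; apply: commute_sym; exact: (centP (es_central hE)).
    by rewrite [(_ ^ e)%g]conjgE ce mulKg conjgKV.
  have [y' y'E gy'] := shear_in_E m k.
  have cy' : (c ^ y')%g = c by rewrite conjgE (centP (es_central hE) _ y'E) mulKg.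
  have zC : ((e ^ h) * y'^-1)%g \in 'C_G(A m)%g.
    apply: cent.
    - by rewrite groupM ?groupV ?groupJ ?(subsetP EG _ eE) ?(subsetP EG _ y'E).
    - by rewrite conjgM ek -gy' conjgK.
    - by rewrite conjgM ec -{1}cy' conjgK.
  rewrite -[(e ^ h)%g](mulgKV y'); apply: groupM.
    by rewrite (subsetP (joing_subr _ _)).
  by rewrite (subsetP (joing_subl _ _)).
have KG : K \subset G by rewrite join_subG EG subsetIl.
have sylE : (7.-Sylow(K) E)%g := pHall_subl (joing_subl _ _) KG (on_sylow hloc).
have sylEh : (7.-Sylow(K) (E :^ h))%g.
  by rewrite pHallE EhK cardJg /= (card_Hall sylE).
have [k kK Ehk] := Sylow_trans sylE sylEh.
have : k \in (E * 'C_G(A m))%g by rewrite -norm_joinEl.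
move=> /mulsgP[e z eE zC kez].
have /setIP[zG zCA] := zC.
have Ehz : (E :^ h = E :^ z)%g by rewrite Ehk kez conjsgM conjGid.
exists (h * z^-1)%g.
  rewrite inE groupM ?groupV //=; apply/normP; by rewrite conjsgM Ehz conjsgK.
have fixh x : x \in A m -> (x ^ h)%g = (x ^ (h * z^-1))%g.
  move=> xA; rewrite conjgM [RHS]conjgE invgK.
  have xh : (x ^ h)%g \in A m by rewrite -Ah memJ_conjg.
  by rewrite mulgA (centP zCA _ xh) mulgK.
by split; apply: fixh.
Qed.
End Fusion.

Lemma mulrn_cancel7 (R : comNzRingType) n : 7%:R = 0 :> R -> ~~ (7 %| n)%N ->
  exists k, forall w : R, w *+ n *+ k = w.
Proof.
move=> R7 n7; pose u : 'F_7 := n%:R.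
have u0 : u != 0.
  apply: contraNneq n7 => u0; have := val_Fp_nat (isT : prime 7) n; rewrite -/u u0 => /esym/eqP.
  exact.
exists (u^-1 : 'F_7) => w; rewrite (mulrn_of7 R7) -[w *+ n]mulr_natl mulrA.
have -> : n%:R = of7 R7 u by rewrite rmorph_nat.
by rewrite -rmorphM mulVf // rmorph1 mul1r.
Qed.

(** * Stable classes are restrictions from [G] *)

Section StableClasses.
Local Notation BT := {poly {poly 'F_7}}.
Variables (gT : finGroupType) (G E : {group gT}) (e1 e2 c : gT).
Hypothesis hloc : ONan_7local G E e1 e2 c.
Let hE : is_extraspecial_7 E e1 e2 c := on_E hloc.
Variables y1 y2 C v : rcoh E.
Hypothesis hP : @is_HE_presentation gT E e1 e2 y1 y2 C v.
Variables al la : 'F_7.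
Hypothesis hval : he_val hE y1 y2 C v al la.

Local Notation Ph := (Phi al la).
Local Notation rho := (rho hE al la).
Local Notation gen := (gen_A e1 e2).
Local Notation A m := (sub_A e1 e2 c m).

Let EG : E \subset G := pHall_sub (on_sylow hloc).
Let al0 : al != 0. Proof. by case: hval. Qed.
Let la0 : la != 0. Proof. by case: hval. Qed.
Let genE m : gen m \in E. Proof. by case: (es_cp hE m). Qed.
Let cE : c \in E. Proof. by case: (es_mem hE). Qed.

Lemma sylow_index : ~~ (7 %| #|G : E|%g)%N.
Proof.
have /and3P[_ _] := on_sylow hloc; rewrite p'natE; first by [].
exact: (isT : prime 7).
Qed.

Definition fused m m' := exists2 n, n \in 'N_G(E)%g & (A m :^ n)%g = A m'.

Lemma fused_refl m : fused m m.
Proof. by exists 1%g; rewrite ?group1 ?conjsg1. Qed.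

Lemma fused_sym m m' : fused m m' -> fused m' m.
Proof. by move=> [n nN An]; exists (n^-1)%g; rewrite ?groupV // -An conjsgK. Qed.

Lemma fused_trans m m' m'' : fused m m' -> fused m' m'' -> fused m m''.
Proof. by move=> [n nN An] [n' nN' An']; exists (n * n')%g; rewrite ?groupM // conjsgM An. Qed.

Lemma fused_gens (p q s t : 'F_7) m m' i :
  mx22 p q s t \in [:: mx22 (-1) 0 0 1; mx22 2 0 0 2; mx22 0 1 (-1) 0] -> p * t - q * s != 0 ->
  i * (st m').1 = p * (st m).1 + q * (st m).2 -> i * (st m').2 = s * (st m).1 + t * (st m).2 ->
  fused m m'.
Proof.
pose M := mx22 p q s t; move=> Mg dM h1 h2.
have [M00 M01 M10 M11] : [/\ M 0 0 = p, M 0 1 = q, M 1 0 = s & M 1 1 = t] by rewrite !mxE.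
have [g gM] : exists g : {'GL_2['F_7]}, GLval g = M by apply: GL2_ex; rewrite det_mx22E.
have : W_E G E e1 e2 c (GLval g) by apply/(on_WE hloc); rewrite mem_gen // inE gM.
rewrite gM => -[n nN [w1 w2]]; have /setIP[nG nE] := nN.
have [a1 a2 b1 b2] := W_E_pi hloc nE w1 w2.
have := norm_action hloc (M := M) (m := m) (m' := m') (i := i) nE a1 a2 b1 b2.
rewrite M00 M01 M10 M11 => /(_ h1 h2)[k [gk ck]].
by exists n => //; apply: (A_eq hloc); rewrite ?gk ?ck; exact: phi_in_A.
Qed.

(** Each of the three [G]-classes of the [A_m] is a single orbit of [W_G(E)]: its members are
    already linked by the given generators. *)
Lemma fused_conj m m' g : g \in G -> (A m :^ g)%g = A m' -> fused m m'.
Proof.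
move=> gG Ag; have : has (fun cl => (m \in cl) && (m' \in cl)) ONan_classes.
  by apply/(on_conj hloc); exists g.
have f0 : fused (Some 0) None.
  by apply: (fused_gens (p := 0) (q := 1) (s := -1) (t := 0) (i := -1)); rewrite ?inE ?eqxx ?orbT //; apply/eqP.
have f16 : fused (Some 1) (Some 6).
  by apply: (fused_gens (p := -1) (q := 0) (s := 0) (t := 1) (i := -1)); rewrite ?inE ?eqxx ?orbT //; apply/eqP.
have f25 : fused (Some 2) (Some 5).
  by apply: (fused_gens (p := -1) (q := 0) (s := 0) (t := 1) (i := -1)); rewrite ?inE ?eqxx ?orbT //; apply/eqP.
have f34 : fused (Some 3) (Some 4).
  by apply: (fused_gens (p := -1) (q := 0) (s := 0) (t := 1) (i := -1)); rewrite ?inE ?eqxx ?orbT //; apply/eqP.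
have f23 : fused (Some 2) (Some 3).
  by apply: (fused_gens (p := 0) (q := 1) (s := -1) (t := 0) (i := 2)); rewrite ?inE ?eqxx ?orbT //; apply/eqP.
have two x : x \in [:: Some 2; Some 3; Some 4; Some 5] -> fused (Some 2) x.
  rewrite !inE => /or4P[] /eqP->; [exact: fused_refl | exact: f23 | exact: fused_trans f23 f34 | exact: f25].
rewrite /ONan_classes /= orbF => /or3P[] /andP[].
- rewrite !inE => /orP[] /eqP-> /orP[] /eqP->; try exact: fused_refl; [exact: f0 | exact: fused_sym f0].
- rewrite !inE => /orP[] /eqP-> /orP[] /eqP->; try exact: fused_refl; [exact: f16 | exact: fused_sym f16].
- by move=> /two h /two h'; apply: fused_trans h'; exact: fused_sym.
Qed.

(** One writes [g = h n] with [n] in [N_G(E)] and [h] normalising [A m]. At a radical [A m]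
    invariance absorbs [h]; at the others [h] acts on [A m] like an element of [N_G(E)]. *)
Lemma fused_stable x r g m (cp' : cpair E (gen m ^ g)%g (c ^ g)%g) :
  rho x r -> stab al la r -> g \in G -> sig cp' x = A0ev (Ph (r m)).
Proof.
move=> hr [i0 i1 he] gG; have [gE' cE' gc _ _] := cp'.
have [m' [gA cA]] := commute_line hE gE' cE' gc.
have Ag := A_eq hloc gA cA; have [n nN An] := fused_conj gG Ag.
have /setIP[nG nE] := nN.
pose h := (g * n^-1)%g; have hG : h \in G by rewrite groupM ?groupV.
have Ah : (A m :^ h)%g = A m by rewrite conjsgM Ag -An conjsgK.
have ghn x' : (x' ^ g)%g = ((x' ^ h) ^ n)%g by rewrite -conjgM mulgKV.
have [he1 _ _ _ heN] := equi_equi5 he.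
have red i l (z z' : BT) : (i * l) ^+ 2 = 1 -> i != 0 -> inv_det1 al la z' -> z = lsub i 0 0 l z' -> z = z'.
  move=> il i00 iz zE; apply: (Phi_inj al0 la0); rewrite zE -(lsub_Phi al la 0 l z' i00).
  by apply: iz; rewrite /det1 mul0r subr0.
(* The substitutions linking [A_oo] to [A_0] and [A_6] to [A_1] have determinant 1, so invariance
   makes the values equal. *)
have rN : r None = r (Some 0).
  by apply: red heN => //; rewrite mulr1 expr1n.
have r6 : r (Some 6) = r (Some 1).
  have h6 : r (Some 6) = lsub (-1) 0 0 (-1) (r (Some 1)).
    by rewrite {1}(he1 6); congr (lsub _ _ _ _ (r (Some _))); apply/eqP.
  by apply: red h6 => //; rewrite mulrNN mulr1 expr1n.
have [mr|mr] : m \in [:: Some 0; None; Some 1; Some 6] \/ m \in [:: Some 2; Some 3; Some 4; Some 5].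
- by case: (m) => [-[[|[|[|[|[|[|[|//]]]]]]] k7]|]; [left|left|right|right|right|right|left|left].
- have [p [q [hp hq]]] := norm_A_phi hloc Ah.
  have im : inv_det1 al la (r m).
    by move: mr; rewrite !inE => /or4P[] /eqP->; rewrite ?rN ?r6.
  have d1 : det1 p.1 p.2 q.1 q.2.
    have gc' : commute (gen m) c by case: (es_cp hE m).
    have W : W_A G c (gen m) (mx22 q.2 p.2 q.1 p.1).
      exists h; first by rewrite inE hG; apply/normP.
      rewrite !mxE hq hp; split; rewrite /phi2; exact: commuteX2.
    have := (on_radical hloc mr _).1 W; rewrite det_mx22E /det1.
    have -> : q.2 * p.1 - p.2 * q.1 = p.1 * q.2 - q.1 * p.2 by ring.
    by case=> ->; rewrite ?sqrrN expr1n.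
  have cpn : cpair E (gen m ^ n)%g (c ^ n)%g.
    by apply: cpair_conj (es_cp hE m) _ _; rewrite memJ_norm.
  have ga : (gen m ^ g)%g = ((gen m ^ n) ^+ p.1 * (c ^ n) ^+ p.2)%g.
    by rewrite ghn hp /phi2 conjMg !conjXg.
  have ca : (c ^ g)%g = ((gen m ^ n) ^+ q.1 * (c ^ n) ^+ q.2)%g.
    by rewrite ghn hq /phi2 conjMg !conjXg.
  have sn := normal_stable cpn hr he nN.
  by rewrite -(im _ _ _ _ d1); exact: (sig_lin cp' ga ca sn).
have [n' nN' [hg hc]] := nonradical_frattini hloc mr hG Ah.
have eg : (gen m ^ g)%g = (gen m ^ (n' * n))%g by rewrite ghn hg conjgM.
have ec : (c ^ g)%g = (c ^ (n' * n))%g by rewrite ghn hc conjgM.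
move: cp' {gE' cE' gc gA cA}; rewrite eg ec => cp'.
by apply: (normal_stable cp' hr he); rewrite groupM.
Qed.

Lemma A0_abelem : (7.-abelem A0)%g.
Proof.
apply/(abelemP (p := 7) isT); split.
  apply/centsP => x _ y _; change ((x.1 + y.1, x.2 + y.2) = (y.1 + x.1, y.2 + x.2)).
  by rewrite [x.1 + _]addrC [x.2 + _]addrC.
move=> x _; have X n : (x ^+ n)%g = (x.1 *+ n, x.2 *+ n).
  elim: n => [|n IHn]; first by rewrite expg0 !mulr0n.
  by rewrite expgS IHn !mulrS.
have z (t : 'F_7) : t *+ 7 = 0.
  by rewrite -[LHS]mulr_natr (_ : 7%:R = 0 :> 'F_7) ?mulr0 //; apply/eqP.
by rewrite X !z.
Qed.

(** All conjugates that contribute to the restriction of the transfer to [A_m] give the value of [x]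
    there, so the transfer restricts to the index times [x]; the index is invertible modulo 7. *)
Lemma stable_in_image x r : rho x r -> stab al la r -> exists z, rres EG z = x.
Proof.
move=> hr hst; have [f fE _] := red_even_rep x.
pose z : rcoh G := rcl (transfer EG f); pose n := #|G : E|%g.
have zE : rres EG z = x *+ n.
  suff h1 : rho (rres EG z) (fun m => r m *+ n) by exact: (rho_det hP h1 (rhoMn n hr)).
  move=> m; rewrite (rmorphMn Ph) (rmorphMn A0ev) -hr.
  have aG : gen m \in G := subsetP EG _ (genE m); have cG : c \in G := subsetP EG _ cE.
  have cpG : cpair G (gen m) c by case: (es_cp hE m).
  have -> : es_sig hE m (rres EG z) = sig cpG z by apply/esym; apply: rpull_comp.
  apply: (transfer_abelem EG (phi2M cpG) (phi2D cpG)); first exact: A0_abelem.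
  move=> g gG pM pE.
  have gE' : (gen m ^ g)%g \in E by have := pE (1, 0); rewrite (phi10 e1 e2 c m); apply; rewrite inE.
  have cE' : (c ^ g)%g \in E by have := pE (0, 1); rewrite (phi01 e1 e2 c m); apply; rewrite inE.
  have cp' := cpair_conj (es_cp hE m) gE' cE'.
  rewrite hr -(fused_stable cp' hr hst gG) fE; apply: eq_rpull => p _.
  by rewrite /phi2 conjMg !conjXg.
have [k kn] := mulrn_cancel7 (rcoh7 E) sylow_index.
exists (z *+ k); have -> : rres EG (z *+ k) = rres EG z *+ k by exact: rmorphMn.
by rewrite zE kn.
Qed.
End StableClasses.

(** * The decomposition of [H^*(BO'N)] *)

Section Decomposition.
Variables (gT : finGroupType) (G E : {group gT}) (e1 e2 c : gT).
Hypothesis hloc : ONan_7local G E e1 e2 c.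
Let hE : is_extraspecial_7 E e1 e2 c := on_E hloc.
Variables y1 y2 C v : rcoh E.
Hypothesis hP : @is_HE_presentation gT E e1 e2 y1 y2 C v.
Let EG : E \subset G := pHall_sub (on_sylow hloc).

(** On each [A_m] the factor [v^6] is a non-zero polynomial and cancels; the [A_m] detect
    equality. *)
Lemma he_v6_regular (z w : rcoh E) : v ^+ 6 * z = v ^+ 6 * w -> z = w.
Proof.
have [al [la hval]] := he_values hE hP.
have [r hr] := rho_ex hP hval z; have [s hs] := rho_ex hP hval w; move=> zw.
have h1 := rhoM (rhoX 6 (rho_v hval)) hr; have h2 := rhoM (rhoX 6 (rho_v hval)) hs.
rewrite zw in h1; apply: (rho_det hP hr); apply: rho_eq hs => m.
have /esym := rho_inj hval h1 h2 m; apply: mulfI; by rewrite expf_neq0 ?BU_neq0.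
Qed.

Lemma ONan_decomposition :
  [/\ forall z, v ^+ 6 * z = ((y1 ^+ 2 + y2 ^+ 2) * v ^+ 2) ^+ 3 <-> z = (y1 ^+ 2 + y2 ^+ 2) ^+ 3,
      injective (rres EG)
    & exists f : {ffun 'I_6 -> {mpoly 'F_7[2]}} *
                 {ffun 'I_6 -> {mpoly 'F_7[2]}} -> rcoh G,
        bijective f /\
        forall u, rres EG (f u) =
          DA_CA_comb (C ^+ 7 + v ^+ 6) (C * v ^+ 6) C (v ^+ 6)
            [:: 1; (y1 ^+ 2 + y2 ^+ 2) * v ^+ 2; ((y1 ^+ 2 + y2 ^+ 2) * v ^+ 2) ^+ 2;
              y1 ^+ 2 * y2 ^+ 2 * v ^+ 4; (y1 ^+ 2 + y2 ^+ 2) * v ^+ 2 * (y1 ^+ 2 * y2 ^+ 2 * v ^+ 4);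
              ((y1 ^+ 2 + y2 ^+ 2) * v ^+ 2) ^+ 2 * (y1 ^+ 2 * y2 ^+ 2 * v ^+ 4)]
            [:: (y1 * y2 ^+ 3 - y1 ^+ 3 * y2) * v;
              (y1 ^+ 2 + y2 ^+ 2) * v ^+ 2 * ((y1 * y2 ^+ 3 - y1 ^+ 3 * y2) * v);
              ((y1 ^+ 2 + y2 ^+ 2) * v ^+ 2) ^+ 2 * ((y1 * y2 ^+ 3 - y1 ^+ 3 * y2) * v);
              C - (y1 ^+ 2 + y2 ^+ 2) ^+ 3;
              (C - (y1 ^+ 2 + y2 ^+ 2) ^+ 3) * ((y1 ^+ 2 + y2 ^+ 2) * v ^+ 2);
              (C - (y1 ^+ 2 + y2 ^+ 2) ^+ 3) * ((y1 ^+ 2 + y2 ^+ 2) * v ^+ 2) ^+ 2] u].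
Proof.
have [al [la hval]] := he_values hE hP.
have cop : coprime #|G : E|%g 7.
  by rewrite coprime_sym (prime_coprime _ (isT : prime 7)) (sylow_index hloc).
have res_inj := rres_inj (EG := EG) cop.
split=> //.
  move=> z; have -> : ((y1 ^+ 2 + y2 ^+ 2) * v ^+ 2) ^+ 3 = v ^+ 6 * (y1 ^+ 2 + y2 ^+ 2) ^+ 3 by ring.
  by split=> [/he_v6_regular|->].
have im u := stable_in_image hP hval (rho_comb hval u) (stab_comb hval u).
have pre w := let: ex_intro r hr := rho_ex hP hval (rres EG w) in
  stab_S hP hval hr (image_stab5 hval hr).
(* Both directions are existence statements, from which witnesses are chosen; injectivity of
   restriction and uniqueness of the expansion make the two choices mutually inverse. *)
pose f u := projT1 (cid (im u)); have fE u : rres EG (f u) = _ := projT2 (cid (im u)).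
pose g w := projT1 (cid (pre w)); have gE w : rres EG w = _ := projT2 (cid (pre w)).
exists f; split; last exact: fE.
exists g => [u|w]; last by apply: res_inj; rewrite fE -gE.
by apply: (comb_inj hval); rewrite -gE fE.
Qed.
End Decomposition.

Theorem theorem7p4 (gT : finGroupType) (G E : {group gT}) (e1 e2 c : gT)
    (hG : is_ONan G) (hloc : ONan_7local G E e1 e2 c)
    (y1 y2 C v : redcohom E 7) (hE : is_HE_presentation e1 e2 y1 y2 C v) :
  let V := v ^+ 6 in
  let D1 := C ^+ 7 + V in
  let D2 := C * V in
  let a := (y1 ^+ 2 + y2 ^+ 2) * v ^+ 2 in
  let b := y1 ^+ 2 * y2 ^+ 2 * v ^+ 4 in
  let d := (y1 * y2 ^+ 3 - y1 ^+ 3 * y2) * v in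
  let a3V := (y1 ^+ 2 + y2 ^+ 2) ^+ 3 in
  let C' := C - a3V in
  let res := redcohom_res (pHall_sub (on_sylow hloc)) (p := 7) in
  [/\ forall z, V * z = a ^+ 3 <-> z = a3V,
      injective res
    & exists f : {ffun 'I_6 -> {mpoly 'F_7[2]}} *
                 {ffun 'I_6 -> {mpoly 'F_7[2]}} -> redcohom G 7,
        bijective f /\
        forall u, res (f u) =
          DA_CA_comb D1 D2 C V
            [:: 1; a; a ^+ 2; b; a * b; a ^+ 2 * b]
            [:: d; a * d; a ^+ 2 * d; C'; C' * a; C' * a ^+ 2] u].
Proof. exact: (ONan_decomposition hloc hE). Qed.
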